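(* Let $\Omega\subset\mathbb{R}^n$ be an open convex set that does not contain affine lines. Then every Hilbert–Schmidt Hankel operator on $\mathrm{PW}(\Omega)$ is generated by a bounded symbol; that is, if $\mathrm{H}_\phi:\mathrm{PW}(\Omega)\to\mathrm{PW}(\Omega)$ is a Hankel operator that is Hilbert–Schmidt, then there exists $\psi\in L^\infty(\mathbb{R}^n)$ such that $\mathrm{H}_\phi=\mathrm{H}_\psi$ (equivalently, $\widehat\phi=\widehat\psi$ on $2\Omega$).
   Context: The Fourier transform is $\hat f(x)=\int_{\mathbb{R}^n}f(y)e^{-2\pi i\langle x,y\rangle}\,dy$ (extended to $L^2$ and to tempered distributions). $\mathrm{PW}(\Omega)=\{f\in L^2(\mathbb{R}^n):\operatorname{supp}\hat f\subset\Omega\}$ with the $L^2$ norm, where $\operatorname{supp}\hat f\subset\Omega$ means $\hat f=0$ almost everywhere outside $\Omega$. Write $2\Omega=\{2x:x\in\Omega\}=\Omega+\Omega$, and $\mathcal{F}^{-1}C_c^\infty(\Omega)$ for the functions whose Fourier transform is smooth with compact support in $\Omega$; these are dense in $\mathrm{PW}(\Omega)$. For a distribution $\widehat\phi$ on $2\Omega$, the Hankel operator $\mathrm{H}_\phi$ with symbol $\phi$ is defined, initially on $\mathcal{F}^{-1}C_c^\infty(\Omega)$, by $$\widehat{\mathrm{H}_\phi f}(x)=\int_\Omega\widehat\phi(x+y)\hat f(y)\,dy,\qquad x\in\Omega$$ (in the distributional sense), and is said to be bounded or Hilbert–Schmidt if it extends to such an operator on $\mathrm{PW}(\Omega)$.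 Only the restriction of $\widehat\phi$ to $2\Omega$ matters. *)

(* Defs.v *)
From HB Require Import structures.
From mathcomp Require Import all_boot all_order all_algebra.
From mathcomp Require Import all_classical all_reals all_analysis.
From mathcomp Require Import complex.

Set Implicit Arguments.
Unset Strict Implicit.
Unset Printing Implicit Defensive.

Import Order.TTheory GRing.Theory Num.Theory.
Import numFieldNormedType.Exports.

Local Open Scope classical_set_scope.
Local Open Scope ring_scope.
Local Open Scope complex_scope.

(* 'rV[R]_n carries the sigma-algebra generated by the coordinates, i.e. the
   Borel sigma-algebra of its topology. *)

Definition rV_display : measure_display -> measure_display.
Proof. exact. Qed.

Section rV_measurable.
Context (R : realType) (n : nat).

Definition rV_coord (i : 'I_n) (x : 'rV[R]_n) : measurableTypeR R := x ord0 i.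

Let rV_set0 : g_sigma_preimage rV_coord set0.
Proof. exact: sigma_algebra0. Qed.

Let rV_setC A : g_sigma_preimage rV_coord A -> g_sigma_preimage rV_coord (~` A).
Proof. exact: sigma_algebraC. Qed.

Let rV_bigcup (F : (set 'rV[R]_n)^nat) :
  (forall i, g_sigma_preimage rV_coord (F i)) ->
  g_sigma_preimage rV_coord (\bigcup_i (F i)).
Proof. exact: sigma_algebra_bigcup. Qed.

HB.instance Definition _ :=
  @isMeasurable.Build (rV_display default_measure_display)
    'rV[R]_n (g_sigma_preimage rV_coord) rV_set0 rV_setC rV_bigcup.
End rV_measurable.

Section rV_measurable_fun.
Context (R : realType) (n : nat).

Lemma measurable_rV_coord (i : 'I_n) : measurable_fun setT (@rV_coord R n i).
Proof.
move=> _ Y mY; rewrite setTI; apply: sub_sigma_algebra => /=.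
rewrite -bigcup_seq/=; exists i => /=; first by rewrite mem_index_enum.
by exists Y => //; rewrite setTI.
Qed.

Lemma measurable_fun_rV d (T : measurableType d) (f : T -> 'rV[R]_n) :
  (forall i, measurable_fun setT (@rV_coord R n i \o f)) ->
  measurable_fun setT f.
Proof.
move=> mf _ Y mY; rewrite setTI.
suff: g_sigma_preimage (fun i => @rV_coord R n i \o f) `<=` measurable.
  by apply; rewrite g_sigma_preimage_comp; exists Y; rewrite ?setTI.
apply: smallest_sub; first exact: sigma_algebra_measurable.
rewrite -bigcup_seq/=; apply: bigcup_sub => i _ A [B mB <-].
exact: mf.
Qed.
End rV_measurable_fun.

Section rV_cons.
Context (R : realType) (n : nat).

Definition rV_cons (p : measurableTypeR R * 'rV[R]_n) : 'rV[R]_n.+1 :=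
  \row_i if unlift ord0 i is Some j then p.2 ord0 j else p.1.

Definition rV_uncons (x : 'rV[R]_n.+1) : measurableTypeR R * 'rV[R]_n :=
  (x ord0 ord0, \row_j x ord0 (lift ord0 j)).

Lemma rV_consK : cancel rV_cons rV_uncons.
Proof.
case=> a x; rewrite /rV_uncons !mxE unlift_none/=; congr (_, _).
by apply/rowP => j; rewrite !mxE liftK.
Qed.

Lemma measurable_rV_cons : measurable_fun setT rV_cons.
Proof.
apply: measurable_fun_rV => i.
case: (unliftP ord0 i) => [j ->|->].
- rewrite (_ : _ \o _ = @rV_coord R n j \o snd).
    by apply: measurableT_comp => //; exact: measurable_rV_coord.
  by apply/funext => p; rewrite /rV_coord/= mxE liftK.
- rewrite (_ : _ \o _ = fst) //.
  by apply/funext => p; rewrite /rV_coord/= mxE unlift_none.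
Qed.

Lemma measurable_rV_uncons : measurable_fun setT rV_uncons.
Proof.
apply: measurable_fun_pair => /=; first exact: (measurable_rV_coord ord0).
apply: measurable_fun_rV => i.
rewrite (_ : _ \o _ = @rV_coord R n.+1 (lift ord0 i)).
  exact: measurable_rV_coord.
by apply/funext => x; rewrite /rV_coord/= mxE.
Qed.

Context (mu : {sigma_finite_measure set 'rV[R]_n -> \bar R}).

Definition lebesgue_rVS : set 'rV[R]_n.+1 -> \bar R :=
  pushforward (@lebesgue_measure R \x mu)%E rV_cons.

Let lebesgue_rVS0 : lebesgue_rVS set0 = 0%E.
Proof. by rewrite /lebesgue_rVS /pushforward preimage_set0 measure0. Qed.

Let lebesgue_rVS_ge0 A : (0 <= lebesgue_rVS A)%E.
Proof. exact: (measure_ge0 (@lebesgue_measure R \x mu)%E). Qed.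

Let lebesgue_rVS_sigma_additive : semi_sigma_additive lebesgue_rVS.
Proof.
rewrite /lebesgue_rVS; apply: measure_semi_sigma_additive.
exact: measurable_rV_cons.
Qed.

HB.instance Definition _ := isMeasure.Build _ _ _ lebesgue_rVS
  lebesgue_rVS0 lebesgue_rVS_ge0 lebesgue_rVS_sigma_additive.

Let lebesgue_rVS_sigma_finite : sigma_finite setT lebesgue_rVS.
Proof.
have /sigma_finiteP[F [TF ndF Foo]] := sigma_finiteT (@lebesgue_measure R).
have /sigma_finiteP[G [TG ndG Goo]] := sigma_finiteT mu.
exists (fun k => rV_uncons @^-1` (F k `*` G k)).
  rewrite -preimage_bigcup (_ : \bigcup_k _ = setT) ?preimage_setT//.
  apply/seteqP; split=> // -[x y] _.
  have : [set: measurableTypeR R] x by []; rewrite TF => -[k _ Fkx].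
  have : [set: 'rV[R]_n] y by []; rewrite TG => -[l _ Gly].
  exists (maxn k l) => //; split => /=.
    by move: x Fkx; exact/subsetPset/ndF/leq_maxl.
  by move: y Gly; exact/subsetPset/ndG/leq_maxr.
move=> k; have [mF Fk] := Foo k; have [mG Gk] := Goo k.
split.
  rewrite -[X in measurable X]setTI; apply: measurable_rV_uncons => //.
  exact: measurableX.
rewrite /lebesgue_rVS /pushforward -comp_preimage.
rewrite (_ : _ \o _ = idfun); last by apply/funext => p /=; rewrite rV_consK.
by rewrite product_measure1E// lte_mul_pinfty// ge0_fin_numE.
Qed.

HB.instance Definition _ := Measure_isSigmaFinite.Build _ _ _ lebesgue_rVS
  lebesgue_rVS_sigma_finite.

End rV_cons.

Fixpoint lebesgue_rV (R : realType) (n : nat) :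
    {sigma_finite_measure set 'rV[R]_n -> \bar R} :=
  if n is m.+1 then lebesgue_rVS (lebesgue_rV R m) else \d_(0 : 'rV[R]_0).

Section complex_functions.
Context (R : realType) (n : nat).
Local Notation V := 'rV[R]_n.
Local Notation mu := (lebesgue_rV R n).
Implicit Types (f g h : V -> R[i]) (U K : set V).

Definition cmeasurable f :=
  measurable_fun setT (fun x => complex.Re (f x)) /\
  measurable_fun setT (fun x => complex.Im (f x)).

Definition cLnorm (p : \bar R) f : \bar R :=
  Lnorm mu p (fun x => (Normc.normc (f x))%:E).

Definition Lp (p : \bar R) f := cmeasurable f /\ (cLnorm p f < +oo)%E.

Definition cintegral f : R[i] :=
  (\int[mu]_x complex.Re (f x)) +i* (\int[mu]_x complex.Im (f x)).

Definition L2dot f g : R[i] := cintegral (fun x => f x * conjc (g x)).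

Definition dotv (x y : V) : R := \sum_i x ord0 i * y ord0 i.

Definition expi (t : R) : R[i] := cos t +i* sin t.

Definition fourier f : V -> R[i] :=
  fun x => cintegral (fun y => f y * expi (- (2 * pi * dotv x y))).

(* The Fourier transform on L^2 is the continuous extension of [fourier] from
   the dense subspace L^1 `&` L^2; it is determined only up to null sets, hence
   the relation "g is a representative of the Fourier transform of f". *)
Definition fourierL2 f g :=
  [/\ Lp 2%:E f, Lp 2%:E g &
      exists F : nat -> V -> R[i],
        [/\ forall k, Lp 1%:E (F k) /\ Lp 2%:E (F k),
            cLnorm 2%:E (F k \- f) @[k --> \oo] --> 0%E &
            cLnorm 2%:E (fourier (F k) \- g) @[k --> \oo] --> 0%E]].

Definition PW U f :=
  exists2 g, fourierL2 f g & \forall x \ae mu, ~ U x -> g x = 0.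

Definition partial (s : seq 'I_n) (f : V -> R) : V -> R :=
  foldr (fun i (g : V -> R) => fun x => 'D_(delta_mx ord0 i) g x) f s.

Definition smooth (f : V -> R) := forall s : seq 'I_n,
  continuous (partial s f) /\
  forall x i, derivable (partial s f) x (delta_mx ord0 i).

Definition csupport h : set V := closure [set x | h x != 0].

(* C_c^oo(U); the functions are extended by 0 to the whole space. *)
Definition test_function U h :=
  [/\ smooth (fun x => complex.Re (h x)), smooth (fun x => complex.Im (h x)),
      compact (csupport h) & csupport h `<=` U].

Definition cpartial (s : seq 'I_n) h (x : V) : R[i] :=
  partial s (fun y => complex.Re (h y)) x +i*
  partial s (fun y => complex.Im (h y)) x.

Definition Ck_norm (k : nat) h : \bar R :=
  ereal_sup [set y | exists s x,
    (size s <= k)%N /\ y = (Normc.normc (cpartial s h x))%:E].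

(* Only the values of a distribution on U at test functions on U matter. *)
Definition distribution_on U (u : (V -> R[i]) -> R[i]) :=
  (forall (a : R[i]) h1 h2, test_function U h1 -> test_function U h2 ->
     u (fun x => a * h1 x + h2 x) = a * u h1 + u h2) /\
  (forall K, compact K -> K `<=` U -> exists (c : R) (k : nat),
     forall h, test_function U h -> csupport h `<=` K ->
       ((Normc.normc (u h))%:E <= c%:E * Ck_norm k h)%E).

(* The Fourier transform of psi as a tempered distribution. *)
Definition fourier_distribution (psi : V -> R[i]) (h : V -> R[i]) : R[i] :=
  cintegral (fun x => psi x * fourier h x).

Definition contains_affine_line U :=
  exists p v : V, v != 0 /\ forall t : R, U (p + t *: v).

Definition dilate2 U : set V := (fun x => 2 *: x) @` U.

(* An operator on PW U acts on representatives and respects almost everywhere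
   equality. *)
Definition PW_operator U (T : (V -> R[i]) -> V -> R[i]) :=
  [/\ forall f, PW U f -> PW U (T f),
      forall f g, PW U f -> PW U g ->
        (\forall x \ae mu, f x = g x) -> \forall x \ae mu, T f x = T g x &
      forall (a : R[i]) f g, PW U f -> PW U g ->
        \forall x \ae mu, T (fun y => a * f y + g y) x = a * T f x + T g x].

Definition bounded_PW_operator U T :=
  PW_operator U T /\
  exists c : R, forall f, PW U f ->
    (cLnorm 2%:E (T f) <= c%:E * cLnorm 2%:E f)%E.

Definition PW_orthonormal_basis U (I : choiceType) (e : I -> V -> R[i]) :=
  [/\ forall i, PW U (e i),
      forall i j, L2dot (e i) (e j) = (i == j)%:R &
      forall f, PW U f -> (forall i, L2dot f (e i) = 0) ->
        \forall x \ae mu, f x = 0].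

Definition hilbert_schmidt U T :=
  bounded_PW_operator U T /\
  exists (I : choiceType) (e : I -> V -> R[i]),
    PW_orthonormal_basis U e /\
    (\esum_(i in [set: I]) (cLnorm 2%:E (T (e i)) ^+ 2) < +oo)%E.

(* T extends the Hankel operator whose symbol has Fourier transform u (a
   distribution on [dilate2 U]). With g the Fourier transform of f,
   "\int_U u(x + y) g(y) dy" is the pairing of u with the test function
   z |-> g(z - x), supported in x + U `<=` dilate2 U. *)
Definition hankel_operator U (u : (V -> R[i]) -> R[i])
    (T : (V -> R[i]) -> V -> R[i]) :=
  forall f g, fourierL2 f g -> test_function U g ->
    exists2 k, fourierL2 (T f) k &
      \forall x \ae mu, U x -> k x = u (fun z : V => g (z - x)).

End complex_functions.

(* Main.v *)
(* Write K = 2 Omega, and let q(z) be the integral of exp(-2 pi b_z) over the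
   domain of the support function of K, where b_z(x) = sup_(w in K) <w - z, x>.
   Carleman's inequality bounds the integral of |h|^2 q by a constant times
   ||fourier h||_1^2 for h in C_c^oo(K): rotating the contour in polar coordinates
   turns the Fourier transform of the unimodular kernel exp(-2 pi i s_K), with s_K
   the support function of K, into i^n q up to regularization. Because Omega
   contains no line, a Mahler type inequality gives q(z) w(z) >= c_n, where w(z)
   is the measure of Omega `&` (z - Omega). On the other hand the Hilbert-Schmidt
   norm of H dominates the integral of |phihat|^2 w, up to mollifying phihat. By
   Cauchy-Schwarz, |phihat h| <= C ||fourier h||_1 on C_c^oo(2 Omega), and the
   Hahn-Banach theorem with the duality of L^1 and L^oo yields psi. *)

Require Import Defs.
From HB Require Import structures.
From mathcomp Require Import all_boot all_order all_algebra.
From mathcomp Require Import all_classical all_reals all_analysis.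
From mathcomp Require Import measurable_realfun ess_sup_inf complex ring lra.

Set Implicit Arguments.
Unset Strict Implicit.
Unset Printing Implicit Defensive.

Import Order.TTheory GRing.Theory Num.Theory.
Import numFieldNormedType.Exports HBNNSimple.

Local Open Scope classical_set_scope.
Local Open Scope ring_scope.
Local Open Scope complex_scope.

Local Notation Re := complex.Re.
Local Notation Im := complex.Im.
Local Notation normc := Normc.normc.

(** * Complex-valued integrals *)

Section complex_modulus.
Context {R : realType}.
Implicit Types x y z : R[i].

(** The symbol is a distribution without values, and the weight [w] degenerates at the boundary of 2
    Omega. Both obstacles are met at one scale [r]: phihat is averaged against bumps of radius [r],
    and Omega is replaced by the convex set [inset Omega r], whose points keep such bumps inside. No
    constant depends on [r], so the bound on test functions survives r -> 0. The Hilbert-Schmidt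
    norm is given by a basis, not by a kernel. The kernel is recovered by applying H to wave
    packets, the inverse transforms of translated bumps: the packet at y goes to a function whose
    transform at x is the averaged phihat at x + y, and Plancherel in y plays the part of a
    resolution of the identity. The rotation uses no contour integral: along each ray both sides are
    gamma integrals, equal to multiples of sigma^-n and (i sigma)^-n. Constants are not optimized:
    Plancherel is used as an inequality, squared norms obey a triangle inequality with factor 2, and
    a near-Auerbach basis of the polar set stands in for sharp volume products. *)

Lemma cReD x y : Re (x + y) = Re x + Re y. Proof. by case: x y => a b [c d]. Qed.
Lemma cImD x y : Im (x + y) = Im x + Im y. Proof. by case: x y => a b [c d]. Qed.
Lemma cReN x : Re (- x) = - Re x. Proof. by case: x. Qed.
Lemma cImN x : Im (- x) = - Im x. Proof. by case: x. Qed.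
Lemma cReM x y : Re (x * y) = Re x * Re y - Im x * Im y.
Proof. by case: x y => a b [c d]. Qed.
Lemma cImM x y : Im (x * y) = Re x * Im y + Im x * Re y.
Proof. by case: x y => a b [c d]. Qed.
Lemma cReJ x : Re (conjc x) = Re x. Proof. by case: x. Qed.
Lemma cImJ x : Im (conjc x) = - Im x. Proof. by case: x. Qed.
Lemma complex_ext x y : Re x = Re y -> Im x = Im y -> x = y.
Proof. by case: x y => a b [c d] /= -> ->. Qed.

Lemma normcE z : normc z = Num.sqrt (Re z ^+ 2 + Im z ^+ 2).
Proof. by case: z. Qed.

Lemma normc_ge0 z : 0 <= normc z. Proof. by rewrite normcE sqrtr_ge0. Qed.

Lemma normc_sqr z : normc z ^+ 2 = Re z ^+ 2 + Im z ^+ 2.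
Proof. by rewrite normcE sqr_sqrtr// addr_ge0 ?sqr_ge0. Qed.

Lemma ler_Re_normc z : `|Re z| <= normc z.
Proof.
rewrite -(ler_pXn2r (n:=2)) ?nnegrE ?normc_ge0// normc_sqr real_normK ?num_real//.
by rewrite lerDl sqr_ge0.
Qed.

Lemma ler_Im_normc z : `|Im z| <= normc z.
Proof.
rewrite -(ler_pXn2r (n:=2)) ?nnegrE ?normc_ge0// normc_sqr real_normK ?num_real//.
by rewrite lerDr sqr_ge0.
Qed.

Lemma normc_le_ReIm z : normc z <= `|Re z| + `|Im z|.
Proof.
rewrite -(ler_pXn2r (n:=2)) ?nnegrE ?normc_ge0// ?addr_ge0// normc_sqr.
rewrite sqrrD !real_normK ?num_real// addrAC lerDl.
by rewrite mulrn_wge0// mulr_ge0.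
Qed.

Lemma normcMl x y : normc (x * y) = normc x * normc y.
Proof. exact: Normc.normcM. Qed.

Lemma ler_normcD x y : normc (x + y) <= normc x + normc y.
Proof. exact: (@le_normcD R x y). Qed.

Lemma normc_conj x : normc (conjc x) = normc x.
Proof. by rewrite !normcE cReJ cImJ sqrrN. Qed.

Lemma normcNl x : normc (- x) = normc x.
Proof. by rewrite !normcE cReN cImN !sqrrN. Qed.

Lemma normc_real (r : R) : normc r%:C = `|r|.
Proof. by rewrite normcE /= expr0n addr0 sqrtr_sqr. Qed.

Lemma normc_eq0 x : (normc x == 0) = (x == 0).
Proof.
apply/eqP/eqP => [|->]; last by rewrite Normc.normc0.
exact: Normc.eq0_normc.
Qed.

Lemma mulJc x : x * conjc x = (normc x ^+ 2)%:C.
Proof.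
rewrite normc_sqr; apply: complex_ext; rewrite ?cReM ?cImM cReJ cImJ/=; ring.
Qed.

Lemma normc_sqrD x y : normc (x + y) ^+ 2 <= 2 * normc x ^+ 2 + 2 * normc y ^+ 2.
Proof.
rewrite !normc_sqr cReD cImD.
have := sqr_ge0 (Re x - Re y); have := sqr_ge0 (Im x - Im y); rewrite !expr2; nra.
Qed.

Lemma normc_sum (I : Type) (s : seq I) (P : pred I) (F : I -> R[i]) :
  normc (\sum_(i <- s | P i) F i) <= \sum_(i <- s | P i) normc (F i).
Proof.
elim/big_ind2 : _ => [|x a y b xa yb|//]; first by rewrite Normc.normc0.
exact: (le_trans (ler_normcD _ _) (lerD xa yb)).
Qed.

Lemma normc_expi (t : R) : normc (expi t) = 1.
Proof. by rewrite normcE/= cos2Dsin2 sqrtr1. Qed.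

Lemma expiD (s t : R) : expi (s + t) = expi s * expi t.
Proof.
by rewrite /expi; apply: complex_ext; rewrite ?cReM ?cImM/= ?cosD ?sinD//; ring.
Qed.

Lemma expi0 : expi (0 : R) = 1.
Proof. by rewrite /expi cos0 sin0. Qed.

Lemma expiN (t : R) : expi (- t) = conjc (expi t).
Proof. by rewrite /expi cosN sinN. Qed.

End complex_modulus.

Section complex_integral.
Context d (T : measurableType d) (R : realType).
Variable mu : {measure set T -> \bar R}.
Implicit Types f g : T -> R[i].

Definition cmeas f := measurable_fun setT (fun x => Re (f x)) /\
  measurable_fun setT (fun x => Im (f x)).

Definition cintble f := mu.-integrable setT (fun x => (Re (f x))%:E) /\
  mu.-integrable setT (fun x => (Im (f x))%:E).

(** The analogue of [cintegral] over an arbitrary measure, since integrals over the line and over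
    products are needed besides those over R^n. *)
Definition cI f : R[i] := (\int[mu]_x Re (f x)) +i* (\int[mu]_x Im (f x)).

Lemma cintble_meas f : cintble f -> cmeas f.
Proof.
by move=> [/measurable_int/measurable_EFinP ? /measurable_int/measurable_EFinP].
Qed.

Lemma cmeasD f g : cmeas f -> cmeas g -> cmeas (fun x => f x + g x).
Proof.
move=> [f1 f2] [g1 g2]; split.
  under eq_fun do rewrite cReD; exact: measurable_funD.
under eq_fun do rewrite cImD; exact: measurable_funD.
Qed.

Lemma cmeasM f g : cmeas f -> cmeas g -> cmeas (fun x => f x * g x).
Proof.
move=> [f1 f2] [g1 g2]; split.
  under eq_fun do rewrite cReM.
  by apply: measurable_funB; apply: measurable_funM.
under eq_fun do rewrite cImM.
by apply: measurable_funD; apply: measurable_funM.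
Qed.

Lemma cmeasJ f : cmeas f -> cmeas (fun x => conjc (f x)).
Proof.
move=> [f1 f2]; split.
  by under eq_fun do rewrite cReJ.
by under eq_fun do rewrite cImJ; exact: measurable_funN.
Qed.

Lemma cmeas_cst (a : R[i]) : cmeas (fun=> a).
Proof. by split; exact: measurable_cst. Qed.

Lemma cmeas_real (f : T -> R) : measurable_fun setT f -> cmeas (fun x => (f x)%:C).
Proof. by move=> mf; split => //; exact: measurable_cst. Qed.

Lemma cmeas_expi (f : T -> R) : measurable_fun setT f -> cmeas (fun x => expi (f x)).
Proof.
move=> mf; split => /=.
  apply: measurableT_comp => //; apply: continuous_measurable_fun.
  exact: continuous_cos.
apply: measurableT_comp => //; apply: continuous_measurable_fun.
exact: continuous_sin.
Qed.

Lemma cmeas_normc f : cmeas f -> measurable_fun setT (fun x => normc (f x)).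
Proof.
move=> [f1 f2]; under eq_fun do rewrite normcE.
apply: measurableT_comp.
  apply: continuous_measurable_fun; exact: sqrt_continuous.
by apply: measurable_funD; exact: measurable_funX.
Qed.

Lemma cmeas_sum (I : Type) (s : seq I) (F : I -> T -> R[i]) :
  (forall i, cmeas (F i)) -> cmeas (fun x => \sum_(i <- s) F i x).
Proof.
move=> mF; elim: s => [|i s IH].
  by under eq_fun do rewrite big_nil; exact: cmeas_cst.
by under eq_fun do rewrite big_cons; exact: cmeasD.
Qed.

Lemma emeas_normc f : cmeas f -> measurable_fun setT (fun x => (normc (f x))%:E).
Proof. by move=> mf; apply/measurable_EFinP; exact: cmeas_normc. Qed.

Lemma le_cintble f (g : T -> \bar R) : cmeas f -> mu.-integrable setT g ->
  (forall x, ((normc (f x))%:E <= g x)%E) -> cintble f.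
Proof.
move=> [m1 m2] ig fg; split; apply: (le_integrable _ _ _ ig) => //;
  try by apply/measurable_EFinP.
- move=> x _; rewrite abse_EFin (le_trans _ (lee_abs _))// (le_trans _ (fg x))//.
  by rewrite lee_fin ler_Re_normc.
- move=> x _; rewrite abse_EFin (le_trans _ (lee_abs _))// (le_trans _ (fg x))//.
  by rewrite lee_fin ler_Im_normc.
Qed.

Lemma cintbleP f : cintble f <->
  cmeas f /\ mu.-integrable setT (fun x => (normc (f x))%:E).
Proof.
split=> [cf|[mf] nf]; last exact: (le_cintble mf nf).
have mf := cintble_meas cf; split => //.
case: cf => i1 i2.
apply: (le_integrable _ _ _ (integrableD _ (integrable_abse i1) (integrable_abse i2))) => //.
  exact: emeas_normc.
move=> x _; rewrite /= lee_fin (ger0_norm (normc_ge0 _)).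
by rewrite (le_trans (normc_le_ReIm _))// ler_norm.
Qed.

Lemma cintble_lty f : cmeas f -> (\int[mu]_x (normc (f x))%:E < +oo)%E -> cintble f.
Proof.
move=> mf fy; apply/cintbleP; split => //; apply/integrableP; split.
  exact: emeas_normc.
by under eq_integral do rewrite abse_EFin (ger0_norm (normc_ge0 _)).
Qed.

Lemma cintble_fin f : cintble f -> (\int[mu]_x (normc (f x))%:E < +oo)%E.
Proof.
move=> /cintbleP[_ /integrableP[_]].
by under eq_integral do rewrite abse_EFin (ger0_norm (normc_ge0 _)).
Qed.

Lemma cintbleD f g : cintble f -> cintble g -> cintble (fun x => f x + g x).
Proof.
move=> [f1 f2] [g1 g2]; split.
  under eq_fun do rewrite cReD EFinD; exact: integrableD.
under eq_fun do rewrite cImD EFinD; exact: integrableD.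
Qed.

Lemma cintbleZ a f : cintble f -> cintble (fun x => a * f x).
Proof.
move=> cf; apply/cintbleP; split.
  by apply: cmeasM; [exact: cmeas_cst|exact: cintble_meas].
under eq_fun do rewrite normcMl EFinM.
by apply: integrableZl => //; have /cintbleP[] := cf.
Qed.

Lemma cintbleJ f : cintble f -> cintble (fun x => conjc (f x)).
Proof.
move=> [f1 f2]; split; first by under eq_fun do rewrite cReJ.
by under eq_fun do rewrite cImJ EFinN; exact: integrableN.
Qed.

Lemma cintbleMb f (b : R) g : cintble f -> cmeas g ->
  (forall x, normc (g x) <= b) -> cintble (fun x => g x * f x).
Proof.
move=> cf mg gb; apply: (@le_cintble _ (fun x => b%:E * (normc (f x))%:E)%E).
- by apply: cmeasM => //; exact: cintble_meas.
- by apply: integrableZl => //; have /cintbleP[] := cf.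
- by move=> x; rewrite normcMl -EFinM lee_fin ler_wpM2r// normc_ge0.
Qed.

Lemma cID f g : cintble f -> cintble g -> cI (fun x => f x + g x) = cI f + cI g.
Proof.
move=> [f1 f2] [g1 g2]; apply: complex_ext => /=.
  by under eq_Rintegral do rewrite cReD; rewrite RintegralD.
by under eq_Rintegral do rewrite cImD; rewrite RintegralD.
Qed.

Lemma cIZ a f : cintble f -> cI (fun x => a * f x) = a * cI f.
Proof.
move=> [f1 f2]; apply: complex_ext.
  rewrite cReM /=; under eq_Rintegral do rewrite cReM.
  rewrite RintegralB//; first by rewrite !RintegralZl.
  - by under [X in _.-integrable _ X]eq_fun do rewrite /= EFinM; exact: integrableZl.
  - by under [X in _.-integrable _ X]eq_fun do rewrite /= EFinM; exact: integrableZl.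
rewrite cImM /=; under eq_Rintegral do rewrite cImM.
rewrite RintegralD//; first by rewrite !RintegralZl.
- by under [X in _.-integrable _ X]eq_fun do rewrite /= EFinM; exact: integrableZl.
- by under [X in _.-integrable _ X]eq_fun do rewrite /= EFinM; exact: integrableZl.
Qed.

Lemma cIJ f : cintble f -> cI (fun x => conjc (f x)) = conjc (cI f).
Proof.
move=> [f1 f2]; apply: complex_ext; rewrite ?cReJ ?cImJ/=.
  by under eq_Rintegral do rewrite cReJ.
under eq_Rintegral do rewrite cImJ -mulN1r.
by rewrite RintegralZl// mulN1r.
Qed.

Lemma eq_cI f g : f =1 g -> cI f = cI g.
Proof. by move=> fg; congr cI; apply/funext. Qed.

Lemma cI_real (f : T -> R) : cI (fun x => (f x)%:C) = (\int[mu]_x f x)%:C.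
Proof.
apply: complex_ext => //=; rewrite /Rintegral.
by under eq_integral do rewrite /=; rewrite integral0.
Qed.

Lemma cI_sum (I : Type) (s : seq I) (F : I -> T -> R[i]) :
  (forall i, cintble (F i)) ->
  cintble (fun x => \sum_(i <- s) F i x) /\
  cI (fun x => \sum_(i <- s) F i x) = \sum_(i <- s) cI (F i).
Proof.
move=> mF; elim: s => [|i s [IH1 IH2]].
  under eq_fun do rewrite big_nil; rewrite big_nil; split.
    by split; exact: integrable0.
  by rewrite cI_real /Rintegral integral0.
under eq_fun do rewrite big_cons; rewrite big_cons -IH2; split.
  exact: cintbleD.
by rewrite -cID.
Qed.

Lemma EFin_Rintegral (f : T -> R) : mu.-integrable setT (EFin \o f) ->
  (\int[mu]_x f x)%:E = (\int[mu]_x (f x)%:E)%E.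
Proof. by move=> i; rewrite fineK//; exact: integrable_fin_num. Qed.

Lemma normc_cI f : cintble f -> ((normc (cI f))%:E <= \int[mu]_x (normc (f x))%:E)%E.
Proof.
move=> cf; have [->|I0] := eqVneq (cI f) 0.
  by rewrite Normc.normc0 integral_ge0// => x _; rewrite lee_fin normc_ge0.
set I := cI f in I0 *.
have nI : normc I != 0 by rewrite normc_eq0.
(* Multiplication by the unit [u] makes the integral real and nonnegative; then Re (u f) <= |f|
   suffices. *)
pose u := conjc I * ((normc I)^-1)%:C.
have nu : normc u = 1.
  rewrite normcMl normc_conj normc_real ger0_norm ?invr_ge0 ?normc_ge0//.
  by rewrite divff.
have -> : normc I = Re (u * I).
  rewrite /u mulrAC [conjc I * I]mulrC mulJc -rmorphM/= expr2 -mulrA mulfV// mulr1 //.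
rewrite -cIZ//= EFin_Rintegral; last first.
  by have [] := cintbleZ u cf.
have [cr ci] := cintbleZ u cf.
have /cintbleP[_ cn] := cf.
apply: le_integral => // x _; rewrite lee_fin.
by rewrite (le_trans (ler_norm _))// (le_trans (ler_Re_normc _))// normcMl nu mul1r.
Qed.

End complex_integral.

Section complex_convergence.
Context d (T : measurableType d) (R : realType).
Variable mu : {measure set T -> \bar R}.
Implicit Types f g : T -> R[i].

Lemma integral_normc_cvg0 (G : nat -> T -> R[i]) (g : T -> \bar R) :
  (forall k, cmeas (G k)) ->
  (forall x, (fun k => normc (G k x)) @ \oo --> (0 : R)) ->
  mu.-integrable setT g -> (forall k x, ((normc (G k x))%:E <= g x)%E) ->
  (fun k => \int[mu]_x (normc (G k x))%:E)%E @ \oo --> 0%E.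
Proof.
move=> mG G0 ig Gg.
have [|||||_ _] := @dominated_convergence _ T R mu setT measurableT
  (fun k x => (normc (G k x))%:E) (cst 0%E) g.
- by move=> k; exact: emeas_normc.
- exact: measurable_cst.
- by apply/nearW => x _; apply: cvg_EFin; [exact: nearW|exact: G0].
- exact: ig.
- apply/nearW => x k _; rewrite gee0_abs ?lee_fin ?normc_ge0//.
by rewrite integral0.
Qed.

(** Dominated convergence. Convergence in R[i] is phrased as the modulus of a difference tending to
    0, so that only real limits occur; the bound on [f] is inherited from the bounds on [F k]. *)
Lemma cI_cvg (F : nat -> T -> R[i]) f (g : T -> \bar R) :
  (forall k, cmeas (F k)) -> cmeas f ->
  (forall x, (fun k => normc (F k x - f x)) @ \oo --> (0 : R)) ->
  mu.-integrable setT g -> (forall k x, ((normc (F k x))%:E <= g x)%E) ->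
  (fun k => normc (cI mu (F k) - cI mu f)) @ \oo --> (0 : R).
Proof.
move=> mF mf Ff ig Fg.
have fg x : ((normc (f x))%:E <= g x)%E.
  apply/lee_addgt0Pr => e e0.
  have /cvgrPdist_lt /(_ e e0) [N _ /(_ N (leqnn N))] := Ff x.
  rewrite /= sub0r normrN ger0_norm ?normc_ge0// => Nf.
  have : normc (f x) <= normc (F N x) + e.
    rewrite (_ : f x = F N x + - (F N x - f x)); last by rewrite opprB addrC subrK.
    by rewrite (le_trans (ler_normcD _ _))// normcNl lerD2l ltW.
  rewrite -lee_fin EFinD => /le_trans; apply.
  by rewrite leeD2r.
have iF k : cintble mu (F k) by exact: (le_cintble (mF k) ig (Fg k)).
have if_ : cintble mu f by exact: (le_cintble mf ig fg).
have key : (fun k => \int[mu]_x (normc (F k x - f x))%:E)%E @ \oo --> 0%E.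
  apply: (@integral_normc_cvg0 _ (fun x => g x + g x)%E) => //.
  - move=> k; apply: cmeasD => //; under eq_fun do rewrite -mulN1r.
    by apply: cmeasM => //; exact: cmeas_cst.
  - exact: integrableD.
  - move=> k x; apply: (@le_trans _ _ ((normc (F k x))%:E + (normc (f x))%:E)%E).
      by rewrite -EFinD lee_fin -(normcNl (f x)) ler_normcD.
    by rewrite leeD.
apply/cvgrPdist_le => e e0.
have /fine_cvgP[_ /cvgrPdist_le /(_ e e0)] := key.
move=> ke; have /fine_cvgP[kf _] := key.
near=> k.
rewrite sub0r normrN ger0_norm ?normc_ge0//.
have ifk : cintble mu (fun x => F k x + (-1) * f x) by apply: cintbleD => //; exact: cintbleZ.
have -> : cI mu (F k) - cI mu f = cI mu (fun x => F k x + (-1) * f x).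
  by rewrite cID// ?cIZ ?mulN1r//; exact: cintbleZ.
rewrite -lee_fin (le_trans (normc_cI ifk))//.
under eq_integral do rewrite mulN1r.
have kfin : (\int[mu]_x (normc (F k x - f x))%:E)%E \is a fin_num by near: k.
rewrite -(fineK kfin) lee_fin.
have : `|0 - fine (\int[mu]_x (normc (F k x - f x))%:E)%E| <= e by near: k.
by rewrite sub0r normrN => /(le_trans (ler_norm _)).
Unshelve. all: by end_near. Qed.

End complex_convergence.

Section real_fubini.
Context d1 d2 (T1 : measurableType d1) (T2 : measurableType d2) (R : realType).
Variables (m1 : {sigma_finite_measure set T1 -> \bar R})
          (m2 : {sigma_finite_measure set T2 -> \bar R}).

(** The inner integral can be infinite on a null set, where its real-valued version is 0 by the
    convention of [fine]; the two agree almost everywhere, which is all that the outer integral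
    sees. *)
Lemma Rfubini_integrable (f : T1 * T2 -> R) :
  (m1 \x m2)%E.-integrable setT (EFin \o f) ->
  m1.-integrable setT (fun x => (\int[m2]_y f (x, y))%:E) /\
  (\int[m1]_x (\int[m2]_y f (x, y))%:E)%E = (\int[m1]_x \int[m2]_y (f (x, y))%:E)%E.
Proof.
move=> fi; have iF := integrable_fubini_F fi.
have mF := measurable_int _ iF.
have mf : measurable_fun setT (fun x => (\int[m2]_y f (x, y))%:E).
  by apply/measurable_EFinP; apply: measurableT_comp => //; exact: fine_measurable.
have ae : ae_eq m1 setT (fubini_F m2 (EFin \o f)) (fun x => (\int[m2]_y f (x, y))%:E).
  by apply: filterS (integrable_ae measurableT iF) => x /(_ I) xf _; rewrite /Rintegral fineK.
split; last by apply: ae_eq_integral => //; exact: ae_eq_sym.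
apply/integrableP; split => //.
have /integrableP[_] := iF; apply: le_lt_trans.
rewrite le_eqVlt; apply/orP; left; apply/eqP; apply: ae_eq_integral => //.
- exact: measurableT_comp.
- exact: measurableT_comp.
- by apply: filterS ae => x /(_ I) <-.
Qed.

Lemma integrable_prod_swap (f : T1 * T2 -> \bar R) :
  (m1 \x m2)%E.-integrable setT f -> (m2 \x m1)%E.-integrable setT (fun z => f (z.2, z.1)).
Proof.
move=> fi; have mf := measurable_int _ fi.
apply/integrable12ltyP.
  by apply: measurableT_comp => //; apply: measurable_fun_pair; [exact: measurable_snd|exact: measurable_fst].
by move/integrable21ltyP : fi; apply.
Qed.

End real_fubini.

Section complex_fubini.
Context d1 d2 (T1 : measurableType d1) (T2 : measurableType d2) (R : realType).
Variables (m1 : {sigma_finite_measure set T1 -> \bar R})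
          (m2 : {sigma_finite_measure set T2 -> \bar R}).
Implicit Types f : T1 * T2 -> R[i].

Lemma cI_fubini f : cintble (m1 \x m2)%E f ->
  [/\ cintble m1 (fun x => cI m2 (fun y => f (x, y))),
      cintble m2 (fun y => cI m1 (fun x => f (x, y))) &
      cI m1 (fun x => cI m2 (fun y => f (x, y))) =
      cI m2 (fun y => cI m1 (fun x => f (x, y)))].
Proof.
move=> [f1 f2].
have [a1 e1] := Rfubini_integrable f1; have [a2 e2] := Rfubini_integrable f2.
have [b1 c1] := Rfubini_integrable (f := fun z => Re (f (z.2, z.1))) (integrable_prod_swap f1).
have [b2 c2] := Rfubini_integrable (f := fun z => Im (f (z.2, z.1))) (integrable_prod_swap f2).
split; [by split|by split|].
apply: complex_ext => /=; rewrite [LHS]/Rintegral [RHS]/Rintegral.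
- by rewrite e1 c1 (Fubini f1).
- by rewrite e2 c2 (Fubini f2).
Qed.

Lemma cintble_prod (f : T1 -> R[i]) (g : T2 -> R[i]) : cintble m1 f -> cintble m2 g ->
  cintble (m1 \x m2)%E (fun z => f z.1 * g z.2).
Proof.
move=> fi gi.
have mfg : cmeas (fun z : T1 * T2 => f z.1 * g z.2).
  have [mf1 mf2] := cintble_meas fi; have [mg1 mg2] := cintble_meas gi.
  apply: cmeasM; split.
  - exact: (measurableT_comp mf1 measurable_fst).
  - exact: (measurableT_comp mf2 measurable_fst).
  - exact: (measurableT_comp mg1 measurable_snd).
  - exact: (measurableT_comp mg2 measurable_snd).
apply/cintbleP; split => //; apply/integrable12ltyP; first exact: emeas_normc.
rewrite (_ : (\int[m1]_x _)%E =
    (\int[m1]_x ((normc (f x))%:E * \int[m2]_y (normc (g y))%:E))%E); last first.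
  apply: eq_integral => x _; rewrite -ge0_integralZl//.
  - by apply: eq_integral => y _; rewrite /= -EFinM -normcMl ger0_norm ?normc_ge0.
  - by apply: emeas_normc; exact: cintble_meas gi.
  - by move=> y _; rewrite lee_fin normc_ge0.
  - by rewrite lee_fin normc_ge0.
rewrite ge0_integralZr//.
- have f0 : (0 <= \int[m1]_x (normc (f x))%:E)%E.
    by apply: integral_ge0 => x _; rewrite lee_fin normc_ge0.
  by rewrite lte_mul_pinfty ?cintble_fin// ge0_fin_numE// cintble_fin.
- by apply: emeas_normc; exact: cintble_meas fi.
- by move=> x _; rewrite lee_fin normc_ge0.
- by apply: integral_ge0 => x _; rewrite lee_fin normc_ge0.
Qed.

End complex_fubini.

(** * Squared L^2 norms and the Cauchy-Schwarz inequality *)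

Section square_norm.
Context d (T : measurableType d) (R : realType).
Variable mu : {measure set T -> \bar R}.
Implicit Types f g : T -> R[i].

(** The square of the L^2 norm, kept squared so that no roots are taken; the price is the factor 2
    in [N2D] in place of the triangle inequality. *)
Definition N2 f : \bar R := (\int[mu]_x (normc (f x) ^+ 2)%:E)%E.

Lemma N2_ge0 f : (0 <= N2 f)%E.
Proof. by apply: integral_ge0 => x _; rewrite lee_fin sqr_ge0. Qed.

Lemma cmeas_sqr f : cmeas f -> measurable_fun setT (fun x => (normc (f x) ^+ 2)%:E).
Proof. by move=> mf; apply/measurable_EFinP/measurable_funX; exact: cmeas_normc. Qed.

Lemma N2D f g : cmeas f -> cmeas g ->
  (N2 (fun x => (f x + g x)%R) <= 2%:E * N2 f + 2%:E * N2 g)%E.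
Proof.
move=> mf mg; rewrite /N2 -!ge0_integralZl//; last 4 first.
- exact: cmeas_sqr.
- by move=> x _; rewrite lee_fin sqr_ge0.
- exact: cmeas_sqr.
- by move=> x _; rewrite lee_fin sqr_ge0.
rewrite -ge0_integralD//.
- apply: ge0_le_integral => //.
  + by move=> x _; rewrite lee_fin sqr_ge0.
  + by apply: cmeas_sqr; exact: cmeasD.
  + by apply: emeasurable_funD; apply: measurable_funeM; exact: cmeas_sqr.
  + by move=> x _; rewrite -!EFinM -EFinD lee_fin normc_sqrD.
- by move=> x _; rewrite -!EFinM lee_fin mulr_ge0// sqr_ge0.
- by apply: measurable_funeM; exact: cmeas_sqr.
- by move=> x _; rewrite -!EFinM lee_fin mulr_ge0// sqr_ge0.
- by apply: measurable_funeM; exact: cmeas_sqr.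
Qed.

Lemma N2Z a f : cmeas f -> N2 (fun x => a * f x) = ((normc a ^+ 2)%:E * N2 f)%E.
Proof.
move=> mf; rewrite /N2 -ge0_integralZl//.
- by apply: eq_integral => x _; rewrite normcMl exprMn EFinM.
- exact: cmeas_sqr.
- by move=> x _; rewrite lee_fin sqr_ge0.
- by rewrite lee_fin sqr_ge0.
Qed.

Lemma cintbleM2 f g : cmeas f -> cmeas g -> (N2 f < +oo)%E -> (N2 g < +oo)%E ->
  cintble mu (fun x => f x * g x).
Proof.
move=> mf mg f2 g2; apply: (@le_cintble _ _ _ _ _ (fun x => (normc (f x) ^+ 2)%:E + (normc (g x) ^+ 2)%:E)%E).
- exact: cmeasM.
- apply: integrableD => //; apply/integrableP; split; try exact: cmeas_sqr.
  + by under eq_integral do rewrite abse_EFin ger0_norm ?sqr_ge0//.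
  + by under eq_integral do rewrite abse_EFin ger0_norm ?sqr_ge0//.
- move=> x; rewrite -EFinD lee_fin normcMl.
  have := sqr_ge0 (normc (f x) - normc (g x)).
  have := normc_ge0 (f x); have := normc_ge0 (g x); rewrite !expr2; nra.
Qed.

(** Integration of 2 |f g| <= s |f|^2 + s^-1 |g|^2, followed by a choice of s. The form with upper
    bounds [A] and [B] is the one in which estimates of the two norms are fed in. *)
Lemma normc_cI_sqr f g (A B : R) : cmeas f -> cmeas g -> (N2 f <= A%:E)%E -> (N2 g <= B%:E)%E ->
  normc (cI mu (fun x => f x * g x)) ^+ 2 <= A * B.
Proof.
move=> mf mg fA gB.
have A0 : 0 <= A by rewrite -lee_fin (le_trans _ fA)// N2_ge0.
have B0 : 0 <= B by rewrite -lee_fin (le_trans _ gB)// N2_ge0.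
have ifg : cintble mu (fun x => f x * g x).
  by apply: cintbleM2 => //; [apply: le_lt_trans fA _|apply: le_lt_trans gB _]; rewrite ltry.
set I := normc _.
have I0 : 0 <= I by exact: normc_ge0.
have key s : 0 < s -> 2 * I <= s * A + s^-1 * B.
  move=> s0.
  have : ((2 * I)%:E <= \int[mu]_x ((s * normc (f x) ^+ 2)%:E + (s^-1 * normc (g x) ^+ 2)%:E))%E.
    rewrite EFinM (@le_trans _ _ (2%:E * \int[mu]_x (normc (f x * g x))%:E)%E)//.
      by rewrite lee_pmul2l// normc_cI.
    rewrite -ge0_integralZl//.
    - apply: ge0_le_integral => //.
      + by move=> x _; rewrite -EFinM lee_fin mulr_ge0// normc_ge0.
      + by apply: measurable_funeM; apply: emeas_normc; exact: cmeasM.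
      + by apply: emeasurable_funD; apply/measurable_EFinP; apply: measurable_funM => //; apply/measurable_EFinP; exact: cmeas_sqr.
      + move=> x _; rewrite -EFinM -EFinD lee_fin normcMl.
        have := sqr_ge0 (s * normc (f x) - normc (g x)).
        have si : 0 <= s^-1 by rewrite invr_ge0 ltW.
        move=> /(mulr_ge0 si).
        set u := normc (f x); set v := normc (g x).
        have -> : s^-1 * (s * u - v) ^+ 2 = s * u ^+ 2 + s^-1 * v ^+ 2 - 2 * (u * v).
          by field; rewrite gt_eqF.
        by rewrite subr_ge0.
    - by apply: emeas_normc; exact: cmeasM.
    - by move=> x _; rewrite lee_fin normc_ge0.
  move=> /le_trans h; rewrite -lee_fin; apply: h.
  have mfs := cmeas_sqr mf; have mgs := cmeas_sqr mg.
  rewrite ge0_integralD//; last 4 first.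
  - by move=> x _; rewrite lee_fin mulr_ge0 ?sqr_ge0 ?ltW.
  - by under eq_fun do rewrite EFinM; exact: measurable_funeM.
  - by move=> x _; rewrite lee_fin mulr_ge0 ?sqr_ge0 ?invr_ge0 ?ltW.
  - by under eq_fun do rewrite EFinM; exact: measurable_funeM.
  under eq_integral do rewrite EFinM.
  under [X in (_ + X <= _)%E]eq_integral do rewrite EFinM.
  rewrite !ge0_integralZl//; last 4 first.
  - by move=> x _; rewrite lee_fin sqr_ge0.
  - by rewrite lee_fin invr_ge0 ltW.
  - by move=> x _; rewrite lee_fin sqr_ge0.
  - by rewrite lee_fin ltW.
  rewrite EFinD !EFinM leeD// lee_pmul2l ?lte_fin ?invr_gt0//.
rewrite leNgt; apply/negP => h.
have I1 : 0 < I by rewrite lt_neqAle I0 andbT; apply/eqP => I00; move: h; rewrite -I00 expr0n /= ltNge mulr_ge0.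
have [A00|A00] := eqVneq A 0.
  (* When A = 0, this value of s gives 2 I <= I B / (B + 1) <= I, absurd for I > 0. *)
  have s0 : 0 < (B + 1) / I by rewrite divr_gt0// ltr_wpDl.
  have := key _ s0; rewrite A00 mulr0 add0r invf_div.
  have : I / (B + 1) * B <= I by rewrite mulrAC ler_pdivrMr ?ltr_wpDl// ler_wpM2l// lerDl.
  by move=> h1 h2; have := le_trans h2 h1; lra.
have A1 : 0 < A by rewrite lt_neqAle eq_sym A00.
(* The choice s = I / A turns the bound into 2 I <= I + A B / I, while A B < I^2 is assumed for
   contradiction. *)
have := key (I / A) (divr_gt0 I1 A1); rewrite divfK// invf_div.
have : A / I * B < I by rewrite mulrAC ltr_pdivrMr// -expr2.
lra.
Qed.

End square_norm.

Section L2_rV.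
Context (R : realType) (n : nat).
Local Notation mu := (lebesgue_rV R n).
Implicit Types f : 'rV[R]_n -> R[i].

Lemma poweR2 (x : \bar R) : (0 <= x)%E -> (x `^ 2 = x ^+ 2)%E.
Proof.
case: x => [r|_|//]; last by rewrite /poweR ?gt_eqF// mulyy.
by rewrite lee_fin => r0; rewrite poweR_EFin powR_mulrn// -EFin_expe.
Qed.

Lemma cLnorm_ge0 p f : (0 <= cLnorm p f)%E.
Proof. exact: Lnorm_ge0. Qed.

Lemma cLnorm2 f : (cLnorm 2%:E f ^+ 2)%E = N2 mu f.
Proof.
rewrite -poweR2 ?cLnorm_ge0// /cLnorm poweR_Lnorm//.
by apply: eq_integral => x _; rewrite poweR2 ?abse_ge0// abse_EFin -EFin_expe real_normK ?num_real.
Qed.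

Lemma cLnorm1 f : cLnorm 1%:E f = (\int[mu]_x (normc (f x))%:E)%E.
Proof.
rewrite /cLnorm Lnorm1.
by apply: eq_integral => x _; rewrite abse_EFin ger0_norm ?normc_ge0.
Qed.

Lemma cLnorm2_lty f : (cLnorm 2%:E f < +oo)%E <-> (N2 mu f < +oo)%E.
Proof.
rewrite -cLnorm2; have := cLnorm_ge0 2%:E f; case: (cLnorm _ _) => // r r0.
by rewrite -EFin_expe !ltry.
Qed.

Lemma cLnorm2_cvg0 (F : nat -> 'rV[R]_n -> R[i]) :
  cLnorm 2%:E (F k) @[k --> \oo] --> 0%E -> N2 mu (F k) @[k --> \oo] --> 0%E.
Proof.
move=> F0.
have h : (cLnorm 2%:E (F k) * cLnorm 2%:E (F k))%E @[k --> \oo] --> (0 * 0)%E.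
  by apply: cvgeM => //; rewrite mule_def_fin.
rewrite mule0 in h; move: h.
by under [X in X @ _ --> _ -> _]eq_fun do rewrite -expe2 cLnorm2.
Qed.

Lemma N2_cvg0 (F : nat -> 'rV[R]_n -> R[i]) :
  N2 mu (F k) @[k --> \oo] --> 0%E -> cLnorm 2%:E (F k) @[k --> \oo] --> 0%E.
Proof.
move=> F0.
have key (e : R) : 0 < e -> \forall k \near \oo, (cLnorm 2%:E (F k) < e%:E)%E.
  move=> e0; have /fine_cvgP[h1 /cvgrPdist_lt /(_ (e ^+ 2) (exprn_gt0 _ e0)) h2] := F0.
  near=> k.
  rewrite -lte_sqr ?cLnorm_ge0 ?lee_fin ?ltW// cLnorm2 -EFin_expe.
  have kf : N2 mu (F k) \is a fin_num by near: k.
  rewrite -(fineK kf) lte_fin.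
  have : `|0 - fine (N2 mu (F k))| < e ^+ 2 by near: k.
  by rewrite sub0r normrN; apply: le_lt_trans; rewrite ler_norm.
apply/fine_cvgP; split.
  near=> k; rewrite ge0_fin_numE ?cLnorm_ge0//.
  have : (cLnorm 2%:E (F k) < 1%:E)%E by near: k; exact: key.
  by move=> /lt_trans; apply; rewrite ltry.
apply/cvgrPdist_lt => e e0; near=> k.
have ke : (cLnorm 2%:E (F k) < e%:E)%E by near: k; exact: key.
rewrite sub0r normrN ger0_norm ?fine_ge0 ?cLnorm_ge0//.
by rewrite -lte_fin fineK// ge0_fin_numE ?cLnorm_ge0// (lt_trans ke)// ltry.
Unshelve. all: by end_near. Qed.

Lemma Lp2P f : Lp 2%:E f <-> cmeas f /\ (N2 mu f < +oo)%E.
Proof. by split=> -[mf] /cLnorm2_lty. Qed.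

Lemma Lp1P f : Lp 1%:E f <-> cintble mu f.
Proof.
rewrite /Lp cLnorm1; split; first by case=> mf; exact: cintble_lty.
by move=> cf; split; [exact: cintble_meas cf|exact: cintble_fin].
Qed.

End L2_rV.

(** * Lebesgue measure on R^n *)

Section rV_borel.
Context (R : realType).
Implicit Types n : nat.

Lemma measurable_coord n (i : 'I_n) : measurable_fun setT (fun x : 'rV[R]_n => x ord0 i).
Proof. exact: measurable_rV_coord. Qed.

(** An open set is the union of the countably many rational cubes that it contains, so the
    coordinate sigma-algebra contains the Borel sets. *)
Lemma open_measurable_rV n (A : set 'rV[R]_n) : open A -> measurable A.
Proof.
move=> oA.
pose box (p : 'rV[rat]_n * nat) : set 'rV[R]_n :=
  [set x | forall i, `|x ord0 i - ratr (p.1 ord0 i)| < (p.2.+1%:R^-1 : R)].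
have mbox p : measurable (box p).
  rewrite (_ : box p = \bigcap_(i in [set` enum 'I_n])
      ((fun x : 'rV[R]_n => x ord0 i) @^-1` (ball (ratr (p.1 ord0 i) : R) (p.2.+1%:R^-1 : R)))).
    apply: fin_bigcap_measurable; first exact: finite_seq.
    move=> i _; rewrite -[X in measurable X]setTI; apply: measurable_coord => //.
    exact: measurable_ball.
  apply/seteqP; split=> x /= h.
    by move=> i _ /=; rewrite /ball/= distrC.
  by move=> i; have := h i; rewrite /= mem_enum /ball /= distrC; apply.
rewrite (_ : A = \bigcup_p (if `[< box p `<=` A >] then box p else set0)).
  apply: countable_bigcupT_measurable; first exact: countableP.
  by move=> p; case: ifP => // _; exact: mbox.
apply/seteqP; split=> [x Ax|x [p _]]; last by case: asboolP => // h; exact: h.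
have /nbhs_ballP[e /= e0 xe] : nbhs x A by exact: open_nbhs_nbhs.
have [N _ Nk] := near_infty_natSinv_lt (PosNum (divr_gt0 e0 (ltr0n _ 2))).
have {Nk} Ne : N.+1%:R^-1 < e / 2 by exact: (Nk N (leqnn N)).
have [q qx] : exists q : 'rV[rat]_n, forall i, `|x ord0 i - ratr (q ord0 i)| < N.+1%:R^-1.
  have h i : exists r : rat, `|x ord0 i - ratr r| < N.+1%:R^-1.
    have [r] : exists r : rat, ratr r \in `](x ord0 i - N.+1%:R^-1), (x ord0 i + N.+1%:R^-1)[.
      by apply: rat_in_itvoo; rewrite ltrBlDr -addrA ltrDl addr_gt0 ?invr_gt0.
    by rewrite in_itv/= => ?; exists r; rewrite ltr_distlC.
  have [f fP] := choice h; exists (\row_i f i) => i; by rewrite mxE.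
exists (q, N) => //.
have sub : box (q, N) `<=` A.
  move=> y /= yq; apply: xe; split=> // i j; rewrite (ord1 i) /ball/=.
  rewrite (_ : x ord0 j - y ord0 j = (x ord0 j - ratr (q ord0 j)) - (y ord0 j - ratr (q ord0 j))); last by ring.
  by rewrite (le_lt_trans (ler_normB _ _))// (splitr e) ltrD// (lt_trans _ Ne).
by case: asboolP.
Qed.

Lemma closed_measurable_rV n (A : set 'rV[R]_n) : closed A -> measurable A.
Proof. by move=> /closed_openC/open_measurable_rV/measurableC; rewrite setCK. Qed.

Lemma continuous_measurable_rV n (f : 'rV[R]_n -> R) : continuous f -> measurable_fun setT f.
Proof.
move=> cf; apply: (measurability _ (RGenOpens.measurableE R)) => _ [_ [a [b ->] <-]].
rewrite setTI; apply: open_measurable_rV; move/continuousP : cf; apply.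
exact: interval_open.
Qed.

Lemma measurable_rV_add n : measurable_fun setT (fun p : 'rV[R]_n * 'rV[R]_n => p.1 + p.2).
Proof.
apply: measurable_fun_rV => i.
rewrite (_ : _ \o _ = (fun p : 'rV[R]_n * 'rV[R]_n => p.1 ord0 i + p.2 ord0 i)).
  apply: measurable_funD.
  - by apply: (measurableT_comp (measurable_coord i)); exact: measurable_fst.
  - by apply: (measurableT_comp (measurable_coord i)); exact: measurable_snd.
by apply/funext => p; rewrite /rV_coord/= mxE.
Qed.

Lemma measurable_rV_scale n (c : R) : measurable_fun setT (fun x : 'rV[R]_n => c *: x).
Proof.
apply: measurable_fun_rV => i.
rewrite (_ : _ \o _ = (fun p : 'rV[R]_n => c * p ord0 i)).
  by apply: measurable_funM => //; exact: measurable_coord.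
by apply/funext => p; rewrite /rV_coord/= mxE.
Qed.

Lemma measurable_rVN n : measurable_fun setT (fun x : 'rV[R]_n => - x).
Proof. by under eq_fun do rewrite -scaleN1r; exact: measurable_rV_scale. Qed.

Lemma measurable_rV_shift n (a : 'rV[R]_n) : measurable_fun setT (fun x : 'rV[R]_n => x + a).
Proof.
apply: measurable_fun_rV => i.
rewrite (_ : _ \o _ = (fun p : 'rV[R]_n => p ord0 i + a ord0 i)).
  by apply: measurable_funD => //; exact: measurable_coord.
by apply/funext => p; rewrite /rV_coord/= mxE.
Qed.

Lemma measurable_rVD d (T : measurableType d) n (f g : T -> 'rV[R]_n) :
  measurable_fun setT f -> measurable_fun setT g -> measurable_fun setT (fun x => f x + g x).
Proof.
move=> mf mg; apply: measurable_fun_rV => i.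
rewrite (_ : _ \o _ = (fun x => f x ord0 i + g x ord0 i)).
  by apply: measurable_funD; apply: (measurableT_comp (measurable_coord i)).
by apply/funext => p; rewrite /rV_coord/= mxE.
Qed.

Lemma measurable_dotv n : measurable_fun setT (fun p : 'rV[R]_n * 'rV[R]_n => dotv p.1 p.2).
Proof.
apply: measurable_sum => j; apply: measurable_funM.
- by apply: (measurableT_comp (measurable_coord j)); exact: measurable_fst.
- by apply: (measurableT_comp (measurable_coord j)); exact: measurable_snd.
Qed.

Lemma measurable_dotvl n (a : 'rV[R]_n) : measurable_fun setT (dotv a).
Proof.
by apply: measurable_sum => j; apply: measurable_funM => //; exact: measurable_coord.
Qed.

Lemma measurable_dotvr n (a : 'rV[R]_n) : measurable_fun setT (fun x : 'rV[R]_n => dotv x a).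
Proof.
by apply: measurable_sum => j; apply: measurable_funM => //; exact: measurable_coord.
Qed.

End rV_borel.

(** * Affine substitutions on the line *)

Section affine_line.
Context (R : realType).
Local Notation leb := (@lebesgue_measure R).
Local Open Scope ereal_scope.

(** By uniqueness of Lebesgue measure it suffices to compare the two sides on half-open
    intervals. *)
Lemma leb_affine_measure (c a : R) (A : set R) : (0 < c)%R -> measurable A ->
  leb A = (c%:E * leb ((fun x => c * x + a)%R @^-1` A)).
Proof.
move=> c0 mA.
have mf : measurable_fun setT ((fun x => c * x + a)%R : measurableTypeR R -> measurableTypeR R).
  by apply: measurable_funD => //; apply: measurable_funM.
pose k : {nonneg R} := NngNum (ltW c0).
have : mscale k (pushforward leb ((fun x => c * x + a)%R : R -> measurableTypeR R)) A = leb A.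
  move=> m; apply/esym/lebesgue_measure_unique => //= _ [[u v] _ <-].
  rewrite /mscale /= /pushforward.
  rewrite (_ : (fun x : R => (c * x + a)%R) @^-1` `]u, v]%classic =
      `]((u - a) / c)%R, ((v - a) / c)%R]%classic); last first.
    apply/seteqP; split=> x /=; rewrite !in_itv/= ltr_pdivrMr// ler_pdivlMr// => /andP[h1 h2];
     apply/andP; split; lra.
  rewrite !lebesgue_measure_itv/= !lte_fin ltr_pM2r ?invr_gt0// ltrD2r.
  case: ifP => _; last by rewrite mule0.
  by rewrite -!EFinB -EFinM -mulrBl mulrC divfK ?gt_eqF// opprB addrA subrK.
by move=> /(_ mf) <-.
Qed.

Lemma leb_affine_pos (c a : R) (F : R -> \bar R) : (0 < c)%R -> measurable_fun setT F ->
  (forall x, 0 <= F x) -> c%:E * (\int[leb]_x F (c * x + a)%R) = \int[leb]_x F x.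
Proof.
move=> c0 mF F0.
have mf : measurable_fun setT ((fun x => c * x + a)%R : measurableTypeR R -> measurableTypeR R).
  by apply: measurable_funD => //; apply: measurable_funM.
pose k : {nonneg R} := NngNum (ltW c0).
transitivity (c%:E * \int[pushforward leb ((fun x => c * x + a)%R : R -> measurableTypeR R)]_x F x).
  by rewrite ge0_integral_pushforward.
rewrite -(ge0_integral_mscale _ measurableT k)//.
by apply: eq_measure_integral => A mA _; exact/esym/leb_affine_measure.
Qed.

Lemma leb_opp (F : R -> \bar R) : measurable_fun setT F ->
  (forall x, 0 <= F x) -> (\int[leb]_x F (- x)%R) = \int[leb]_x F x.
Proof.
move=> mF F0.
transitivity (\int[pushforward leb (-%R : R -> measurableTypeR R)]_x F x).
  by rewrite ge0_integral_pushforward.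
by apply: eq_measure_integral => A mA _; exact: lebesgue_measureN.
Qed.

Lemma leb_affine (c a : R) (F : R -> \bar R) : c != 0%R -> measurable_fun setT F ->
  (forall x, 0 <= F x) -> `|c|%:E * (\int[leb]_x F (c * x + a)%R) = \int[leb]_x F x.
Proof.
move=> c0 mF F0.
have [cp|cn|c00] := ltrgt0P c; last by rewrite c00 eqxx in c0.
  exact: leb_affine_pos.
have mG : measurable_fun setT (fun x : R => F (- c * x + a)%R).
  by apply: measurableT_comp => //; apply: measurable_funD => //; apply: measurable_funM.
rewrite -(leb_affine_pos a _ mF F0 (c := - c)%R) ?oppr_gt0//; congr (_ * _).
rewrite -[RHS]leb_opp//.
by apply: eq_integral => x _; rewrite mulrNN.
Qed.
End affine_line.

(** * Tonelli in coordinates and linear substitutions on R^n *)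

Section rV_tonelli.
Context (R : realType).
Local Notation leb := (@lebesgue_measure R).
Local Notation mu n := (lebesgue_rV R n).
Local Open Scope ereal_scope.

Lemma integral_rV0 (F : 'rV[R]_0 -> \bar R) : measurable_fun setT F ->
  \int[mu 0]_x F x = F 0%R.
Proof. by move=> mF; rewrite integral_dirac// diracT mul1e. Qed.

Lemma measurable_comp_rV_cons n (F : 'rV[R]_n.+1 -> \bar R) : measurable_fun setT F ->
  measurable_fun setT (fun p : measurableTypeR R * 'rV[R]_n => F (rV_cons p)).
Proof. by move=> mF; apply: measurableT_comp => //; exact: measurable_rV_cons. Qed.

Lemma integral_rVS n (F : 'rV[R]_n.+1 -> \bar R) : measurable_fun setT F ->
  (forall x, 0 <= F x) ->
  \int[mu n.+1]_x F x = \int[leb]_t \int[mu n]_x F (rV_cons (t, x)).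
Proof.
move=> mF F0.
transitivity (\int[pushforward (leb \x mu n) (@rV_cons R n)]_x F x) => //.
rewrite (ge0_integral_pushforward (@measurable_rV_cons R n))// preimage_setT.
by rewrite (fubini_tonelli1 (F \o @rV_cons R n)); [by []|exact: measurable_comp_rV_cons|move=> p; exact: F0].
Qed.

Lemma integral_rVS' n (F : 'rV[R]_n.+1 -> \bar R) : measurable_fun setT F ->
  (forall x, 0 <= F x) ->
  \int[mu n.+1]_x F x = \int[mu n]_x \int[leb]_t F (rV_cons (t, x)).
Proof.
move=> mF F0; rewrite integral_rVS//.
rewrite (@fubini_tonelli _ _ _ _ _ leb (mu n) (fun p => F (rV_cons p)))//.
exact: measurable_comp_rV_cons.
Qed.

Lemma rV_cons0 n (t : R) (x : 'rV[R]_n) : rV_cons (t, x) ord0 ord0 = t.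
Proof. by rewrite mxE unlift_none. Qed.

Lemma rV_consS n (t : R) (x : 'rV[R]_n) i : rV_cons (t, x) ord0 (lift ord0 i) = x ord0 i.
Proof. by rewrite mxE liftK. Qed.

Lemma rV_cons_uncons n (x : 'rV[R]_n.+1) : rV_cons (rV_uncons x) = x.
Proof.
apply/rowP => i; case: (unliftP ord0 i) => [j ->|->]; rewrite mxE ?liftK ?unlift_none//=.
by rewrite mxE.
Qed.

Lemma rV_consD n (s t : R) (x y : 'rV[R]_n) :
  (rV_cons (s, x) + rV_cons (t, y) = rV_cons ((s + t)%R : R, x + y) :> 'rV[R]_n.+1)%R.
Proof.
apply/rowP => i; rewrite mxE; case: (unliftP ord0 i) => [j ->|->].
  by rewrite !rV_consS mxE.
by rewrite !rV_cons0.
Qed.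

Lemma integral_shift n (a : 'rV[R]_n) (F : 'rV[R]_n -> \bar R) : measurable_fun setT F ->
  (forall x, 0 <= F x) -> \int[mu n]_x F (x + a)%R = \int[mu n]_x F x.
Proof.
elim: n => [|n IH] in a F *.
  move=> mF F0; rewrite !integral_rV0//; first by congr F; apply/rowP => -[].
  by apply: measurableT_comp => //; exact: measurable_rV_shift.
move=> mF F0.
have mFa : measurable_fun setT (fun x : 'rV[R]_n.+1 => F (x + a)%R).
  by apply: measurableT_comp => //; exact: measurable_rV_shift.
rewrite integral_rVS//; rewrite -(rV_cons_uncons a); case: (rV_uncons a) => a0 a'.
under eq_integral => t _.
  under eq_integral => x _ do rewrite rV_consD.
  rewrite (IH a' (fun x => F (rV_cons (t + a0, x)%R)))//; last first.
    by apply: (measurableT_comp (measurable_comp_rV_cons mF)); exact: pair1_measurable.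
  over.
rewrite (integral_rVS mF F0).
pose J (t : R) := \int[mu n]_x F (rV_cons (t, x)).
have mJ : measurable_fun setT J.
  exact: (measurable_fun_fubini_tonelli_F (m2 := mu n) _ (measurable_comp_rV_cons mF)).
have J0 t : 0 <= J t by apply: integral_ge0.
have := leb_affine_pos a0 ltr01 mJ J0; rewrite mul1e => <-.
by apply: eq_integral => t _; rewrite mul1r.
Qed.

(** With the tail frozen the head undergoes an affine map of slope [d]; then the tail is transformed
    by [phi], which scales the measure by [c]. Together with its upper triangular companion this
    replaces determinants: the linear substitutions below are built from such maps. *)
Lemma integral_block_lower n (d : R) (l : 'rV[R]_n -> R) (phi : 'rV[R]_n -> 'rV[R]_n)
    (c : R) (F : 'rV[R]_n.+1 -> \bar R) : d != 0%R ->
  measurable_fun setT l -> measurable_fun setT phi ->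
  (forall G, measurable_fun setT G -> (forall x, 0 <= G x) ->
    c%:E * (\int[mu n]_x G (phi x)) = \int[mu n]_x G x) -> (0 <= c)%R ->
  measurable_fun setT F -> (forall x, 0 <= F x) ->
  (`|d| * c)%:E * (\int[mu n.+1]_x F (rV_cons ((rV_uncons x).1 * d + l (rV_uncons x).2, phi (rV_uncons x).2)%R))
  = \int[mu n.+1]_x F x.
Proof.
move=> d0 ml mphi H c0 mF F0.
have mG : measurable_fun setT (fun x : 'rV[R]_n.+1 =>
    F (rV_cons ((rV_uncons x).1 * d + l (rV_uncons x).2, phi (rV_uncons x).2)%R)).
  apply: (measurableT_comp (measurable_comp_rV_cons mF)) => /=.
  have m1 : measurable_fun setT (fun x : 'rV[R]_n.+1 => (rV_uncons x).1).
    by apply: (measurableT_comp measurable_fst); exact: measurable_rV_uncons.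
  have m2 : measurable_fun setT (fun x : 'rV[R]_n.+1 => (rV_uncons x).2).
    by apply: (measurableT_comp measurable_snd); exact: measurable_rV_uncons.
  apply: measurable_fun_pair => /=.
    apply: (@measurable_funD _ _ R); last exact: (measurableT_comp ml).
    by apply: (@measurable_funM _ _ R).
  exact: (measurableT_comp mphi).
rewrite [in LHS]integral_rVS'// mulrC EFinM -muleA.
under eq_integral => x _.
  under eq_integral => t _ do rewrite rV_consK /=.
  over.
rewrite [RHS]integral_rVS'//.
have mI : measurable_fun setT (fun x : 'rV[R]_n => \int[leb]_t F (rV_cons (t, x))).
  exact: (measurable_fun_fubini_tonelli_G (m1 := leb) _ (measurable_comp_rV_cons mF)).
rewrite -(H _ mI) => [|x]; last exact: integral_ge0.
congr (_ * _).
rewrite -ge0_integralZl//; last 2 first.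
  apply: (measurable_fun_fubini_tonelli_G (m1 := leb) (fun p => F (rV_cons (p.1 * d + l p.2, phi p.2)%R))).
    apply: (measurableT_comp (measurable_comp_rV_cons mF)); apply: measurable_fun_pair => /=.
      apply: (@measurable_funD _ _ R); first by apply: (@measurable_funM _ _ R).
      exact: (measurableT_comp ml measurable_snd).
    exact: (measurableT_comp mphi measurable_snd).
  by move=> p; exact: F0.
  by move=> x _; apply: integral_ge0.
apply: eq_integral => x _.
rewrite -(leb_affine (l x) d0 (F := fun t => F (rV_cons (t, phi x))))//.
  by congr (_ * _); apply: eq_integral => t _; rewrite mulrC.
by apply: (measurableT_comp (measurable_comp_rV_cons mF)); exact: pair2_measurable.
Qed.

(** Here the tail is integrated first: for a fixed head its extra term is a translation, which
    translation invariance removes. *)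
Lemma integral_block_upper n (d : R) (u : 'rV[R]_n) (phi : 'rV[R]_n -> 'rV[R]_n)
    (c : R) (F : 'rV[R]_n.+1 -> \bar R) : d != 0%R ->
  measurable_fun setT phi ->
  (forall G, measurable_fun setT G -> (forall x, 0 <= G x) ->
    c%:E * (\int[mu n]_x G (phi x)) = \int[mu n]_x G x) -> (0 <= c)%R ->
  measurable_fun setT F -> (forall x, 0 <= F x) ->
  (`|d| * c)%:E * (\int[mu n.+1]_x F (rV_cons ((rV_uncons x).1 * d, phi (rV_uncons x).2 + (rV_uncons x).1 *: u)%R))
  = \int[mu n.+1]_x F x.
Proof.
move=> d0 mphi H c0 mF F0.
have mK : measurable_fun setT (fun p : measurableTypeR R * 'rV[R]_n => F (rV_cons (p.1 * d, phi p.2 + p.1 *: u)%R)).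
  apply: (measurableT_comp (measurable_comp_rV_cons mF)); apply: measurable_fun_pair => /=.
    by apply: (@measurable_funM _ _ R).
  apply: measurable_rVD.
    exact: (measurableT_comp mphi measurable_snd).
  apply: measurable_fun_rV => i.
  rewrite (_ : _ \o _ = (fun p : measurableTypeR R * 'rV[R]_n => (p.1 : R) * u ord0 i)%R).
    by apply: (@measurable_funM _ _ R).
  by apply/funext => p; rewrite /rV_coord /= mxE.
have mG : measurable_fun setT (fun x : 'rV[R]_n.+1 =>
    F (rV_cons ((rV_uncons x).1 * d, phi (rV_uncons x).2 + (rV_uncons x).1 *: u)%R)).
  exact: (measurableT_comp mK (@measurable_rV_uncons R n)).
have mJ : measurable_fun setT (fun t => \int[mu n]_x F (rV_cons (t, x))).
  exact: (measurable_fun_fubini_tonelli_F (m2 := mu n) _ (measurable_comp_rV_cons mF)).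
rewrite [in LHS]integral_rVS// [RHS]integral_rVS//.
under eq_integral => t _.
  under eq_integral => x _ do rewrite rV_consK /=.
  over.
rewrite -(leb_affine 0 d0 mJ); last by move=> t; apply: integral_ge0.
rewrite EFinM -muleA; congr (_ * _).
rewrite -ge0_integralZl//; last 2 first.
  exact: (measurable_fun_fubini_tonelli_F (m2 := mu n) _ mK).
  by move=> x _; apply: integral_ge0.
apply: eq_integral => t _; rewrite addr0 (mulrC d).
have mFt : measurable_fun setT (fun x => F (rV_cons ((t * d)%R, x))).
  by apply: (measurableT_comp (measurable_comp_rV_cons mF)); exact: pair1_measurable.
rewrite (H (fun x => F (rV_cons (t * d, x + t *: u)%R))) ?(integral_shift (t *: u) mFt)//.
by apply: (measurableT_comp mFt); exact: measurable_rV_shift.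
Qed.

Lemma integral_scale n (c : R) (F : 'rV[R]_n -> \bar R) : c != 0%R -> measurable_fun setT F ->
  (forall x, 0 <= F x) -> (`|c| ^+ n)%:E * (\int[mu n]_x F (c *: x)%R) = \int[mu n]_x F x.
Proof.
move=> c0; elim: n F => [|n IH] F mF F0.
  rewrite expr0 mul1e !integral_rV0//; first by congr F; apply/rowP => -[].
  by apply: measurableT_comp => //; exact: measurable_rV_scale.
rewrite exprS -[RHS](integral_block_lower (l := cst 0%R) (phi := fun x => c *: x) c0 _ _ IH)//; last first.
  exact: measurable_rV_scale.
congr (_ * _); apply: eq_integral => x _; congr F.
rewrite -{1}(rV_cons_uncons x); case: (rV_uncons x) => t y /=.
apply/rowP => i; rewrite mxE; case: (unliftP ord0 i) => [j ->|->].
  by rewrite !rV_consS mxE.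
by rewrite !rV_cons0 addr0 mulrC.
Qed.

Lemma integral_rVN n (F : 'rV[R]_n -> \bar R) : measurable_fun setT F ->
  (forall x, 0 <= F x) -> \int[mu n]_x F (- x)%R = \int[mu n]_x F x.
Proof.
move=> mF F0; have c0 : (-1)%R != 0%R :> R by rewrite oppr_eq0 oner_eq0.
rewrite -(integral_scale c0 mF F0).
rewrite normrN1 expr1n mul1e; by under [RHS]eq_integral do rewrite scaleN1r.
Qed.

End rV_tonelli.

Section signed_change_of_variables.
Context d (T : measurableType d) (R : realType) (mu : {measure set T -> \bar R}).
Variables (phi : T -> T) (c : R).
Hypotheses (c0 : 0 < c) (mphi : measurable_fun setT phi).
Hypothesis H : forall G : T -> \bar R, measurable_fun setT G -> (forall x, (0 <= G x)%E) ->
  (c%:E * (\int[mu]_x G (phi x)) = \int[mu]_x G x)%E.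

(** A substitution rule for nonnegative functions passes to integrable ones through positive and
    negative parts. *)
Lemma cov_integrable (g : T -> R) : mu.-integrable setT (EFin \o g) ->
  mu.-integrable setT (EFin \o (g \o phi)) /\
  c * (\int[mu]_x g (phi x)) = \int[mu]_x g x.
Proof.
move=> ig.
have mg := measurable_int _ ig.
have mgp : measurable_fun setT (EFin \o (g \o phi)).
  exact: (measurableT_comp mg mphi).
have ci : mu.-integrable setT (EFin \o (g \o phi)).
  apply/integrableP; split => //.
  have := H (G := fun x => `|(g x)%:E|%E) (measurableT_comp (@abse_measurable R setT) mg) (fun x => abse_ge0 _).
  have /integrableP[_] := ig => /= + h; rewrite -h.
  have : (0 <= \int[mu]_x `|g (phi x)|%:E)%E by apply: integral_ge0 => x _; rewrite lee_fin.
  case: (integral _ _ _) => [r _ _|_|//]; first exact: ltry.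
  by rewrite gt0_muley// lte_fin.
split=> //; apply: EFin_inj; rewrite EFinM !EFin_Rintegral//.
have p1 := H (measurable_funepos mg) (fun x => funepos_ge0 _ x).
have p2 := H (measurable_funeneg mg) (fun x => funeneg_ge0 _ x).
rewrite [in RHS]integralE -p1 -p2 [in LHS]integralE muleBr//.
  by congr (_ * _ - _ * _)%E; apply: eq_integral => x _; rewrite ?funeposE ?funenegE.
by apply: fin_num_adde_defl; rewrite fin_numN; exact: integrable_neg_fin_num.
Qed.

Lemma cov_cI (f : T -> R[i]) : cintble mu f ->
  cintble mu (fun x => f (phi x)) /\ c%:C * cI mu (fun x => f (phi x)) = cI mu f.
Proof.
move=> [/cov_integrable [i1 e1] /cov_integrable [i2 e2]]; split; first by split.
by apply: complex_ext; rewrite ?cReM ?cImM/= mul0r ?subr0 ?addr0.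
Qed.

End signed_change_of_variables.

(** * Explicit integrals on the half-line and the line *)

Section half_line.
Context (R : realType).
Local Notation leb := (@lebesgue_measure R).
Local Notation Rpos := (`[(0%R : R), +oo[%classic : set R).

(** The integrand may change sign, as the damped oscillations of the gamma integrals do;
    integrability is therefore assumed, and the truncations to [0, k + 1] pass to the limit by
    dominated convergence. *)
Lemma FTC2y_integrable (f F : R -> R) :
  (forall x : R, is_derive x (1 : R) F (f x)) -> continuous f ->
  leb.-integrable Rpos (EFin \o f) ->
  F x @[x --> +oo] --> 0 ->
  (\int[leb]_(x in Rpos) (f x)%:E = (- F 0)%:E)%E.
Proof.
move=> dF cf fi F0.
have cF : continuous F.
  by move=> x; apply: differentiable_continuous; apply/derivable1_diffP; have [] := dF x.
pose I (k : nat) : set R := `[0, k.+1%:R]%classic.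
have mI k : measurable (I k) by exact: measurable_itv.
have mf : measurable_fun setT (EFin \o f).
  by apply/measurable_EFinP; exact: continuous_measurable_fun.
have IE k : (\int[leb]_x ((EFin \o f) \_ (I k)) x = (F k.+1%:R - F 0)%:E)%E.
  rewrite -integral_mkcond EFinB (@continuous_FTC2 _ f F 0 k.+1%:R)//.
  - exact: continuous_subspaceT.
  - split; first by move=> x _; have [] := dF x.
    + exact: cvg_at_right_filter (cF _).
    + exact: cvg_at_left_filter (cF _).
  - by move=> x _; rewrite derive1E; apply: derive_val.
rewrite integral_mkcond.
have [|||||_ _] := @dominated_convergence _ _ R leb setT measurableT
  (fun k => (EFin \o f) \_ (I k)) ((EFin \o f) \_ Rpos)
  (abse \o ((EFin \o f) \_ Rpos)).
- by move=> k; apply/(measurable_restrictT _ (mI k)); apply: (measurable_funS measurableT _ mf).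
- by apply/(measurable_restrictT _ (measurable_itv _)); apply: (measurable_funS measurableT _ mf).
- apply/nearW => x _; apply: cvg_near_cst.
  
  exists (Num.truncn `|x|).+1 => // k /= Nk; rewrite /patch !mem_setE !in_itv/= andbT.
  case: ifPn => [/andP[-> _]//|]; rewrite negb_and => /orP[/negbTE -> //|].
  rewrite -ltNge => kx; case: ifP => // x0; exfalso; move: kx; apply/negP; rewrite -leNgt.
  have := truncnS_gt `|x|; move=> /ltW /(le_trans (ler_norm _)) /le_trans; apply.
  by rewrite ler_nat leqW.
- apply: integrable_abse; apply/(integrable_mkcond _ _).1 => //.
- apply/nearW => x k _; rewrite /= /patch !mem_setE !in_itv/= andbT.
  case: ifPn => [/andP[-> _]//|_].
  by rewrite (_ : (point : \bar R) = 0%E)// abse0 abse_ge0.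
move=> h.
have h2 : (fun k => (F k.+1%:R - F 0)%:E) @ \oo --> (- F 0)%:E.
  apply: cvg_EFin; first exact: nearW.
  rewrite -[X in _ --> X]add0r; apply: cvgB; last exact: cvg_cst.
  rewrite (cvg_shiftS (fun k => F k%:R)).
  exact: (cvg_comp _ _ (@cvgr_idn R)).
apply: (cvg_unique _ h) => //.
by move: h2; under eq_fun do rewrite -IE.
Qed.

Lemma is_derive_cvg (F : R -> R) (x l : R) : is_derive x (1 : R) F l -> F y @[y --> x] --> F x.
Proof.
by move=> dF; apply: differentiable_continuous; apply/derivable1_diffP; have [] := dF.
Qed.

Lemma is_derive_expRN (x : R) : is_derive x (1 : R) (fun x => expR (- x)) (- expR (- x)).
Proof.
have := is_derive1_comp (is_derive_expR (- x)) (is_deriveN (is_derive_id x (1 : R))).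
by rewrite mulrN1.
Qed.

Lemma integral_expRN : (\int[leb]_(x in Rpos) (expR (- x))%:E = 1)%E.
Proof.
have dE x : is_derive x (1 : R) (fun x => - expR (- x)) (expR (- x)).
  by have := is_deriveN (is_derive_expRN x); rewrite opprK.
rewrite (@ge0_continuous_FTC2y _ (fun x => expR (- x)) (fun x => - expR (- x)) 0 0).
- by rewrite oppr0 expR0 sub0e EFinN oppeK.
- by move=> x _; exact: expR_ge0.
- apply: continuous_subspaceT => x.
  exact: (is_derive_cvg (is_derive_expRN x)).
- by rewrite -[X in _ --> X]oppr0; apply: cvgN; exact: cvgr_expR.
- by move=> x _; have [] := dE x.
- apply: cvg_at_right_filter.
  exact: (is_derive_cvg (dE 0)).
- by move=> x _; rewrite derive1E; apply: derive_val.
Qed.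

Lemma continuous_expRNabs : continuous (fun x : R => expR (- `|x|)).
Proof.
move=> x; apply: (@continuous_comp _ _ _ (fun x : R => - `|x|) (@expR R)).
  by apply: cvgN; exact: norm_continuous.
exact: continuous_expR.
Qed.

Lemma integral_expRNabs : (\int[leb]_x (expR (- `|x|))%:E = 2%:E)%E.
Proof.
rewrite ge0_symfun_integralT//.
- rewrite -[RHS]mule1 -integral_expRN; congr (_ * _)%E.
  rewrite set_itvcy; apply: eq_integral => x; rewrite inE/= => x0.
  by rewrite ger0_norm.
- exact: continuous_expRNabs.
- by move=> x; rewrite /= normrN.
Qed.

Lemma integral_cauchy : (\int[leb]_x ((1 + x ^+ 2)^-1)%:E = pi%:E)%E.
Proof.
have c0 (x : R) : 0 <= (1 + x ^+ 2)^-1 by rewrite invr_ge0 addr_ge0// sqr_ge0.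
have cc : continuous (fun x : R => (1 + x ^+ 2)^-1).
  move=> x; apply: cvgV; first by rewrite gt_eqF// ltr_wpDr// sqr_ge0.
  apply: cvgD; first exact: cvg_cst.
  exact: exprn_continuous.
rewrite ge0_symfun_integralT//; last by move=> x /=; rewrite sqrrN.
rewrite -set_itvcy.
rewrite (@ge0_continuous_FTC2y _ (fun x => (1 + x ^+ 2)^-1) atan 0 (pi / 2)).
- by rewrite -EFinB atan0 subr0 -EFinM; congr EFin; field.
- by [].
- exact: continuous_subspaceT.
- exact: cvgy_atan.
- by move=> x _; have [] := is_derive1_atan x.
- by apply: cvg_at_right_filter; exact: continuous_atan.
- by move=> x _; rewrite derive1_atan.
Qed.

(** The summand 1 makes the integrand nonnegative, as the fundamental theorem used here on a
    half-line requires; its contribution is subtracted afterwards. *)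
Lemma integral_expRN_cos (a : R) :
  (\int[leb]_(x in Rpos) (expR (- x) * (1 + cos (a * x)))%:E = (1 + (1 + a ^+ 2)^-1)%:E)%E.
Proof.
pose F x := - expR (- x) + (1 + a ^+ 2)^-1 * (expR (- x) * (a * sin (a * x) - cos (a * x))).
have d0 : 1 + a ^+ 2 != 0 by rewrite gt_eqF// ltr_wpDr// sqr_ge0.
have dax (x : R) : is_derive x (1 : R) (fun x => a * x) a.
  by have := is_deriveZ a (is_derive_id x (1 : R)); rewrite /GRing.scale/= mulr1.
have ds (x : R) : is_derive x (1 : R) (fun x => sin (a * x)) (cos (a * x) * a).
  exact: (is_derive1_comp (is_derive_sin (a * x)) (dax x)).
have dc (x : R) : is_derive x (1 : R) (fun x => cos (a * x)) (- sin (a * x) * a).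
  exact: (is_derive1_comp (is_derive_cos (a * x)) (dax x)).
have dF x : is_derive x (1 : R) F (expR (- x) * (1 + cos (a * x))).
  have h1 := is_deriveD (is_deriveN (is_derive_expRN x))
    (is_deriveZ (1 + a ^+ 2)^-1 (is_deriveM (is_derive_expRN x)
       (is_deriveB (is_deriveZ a (ds x)) (dc x)))).
  apply: (is_derive_eq h1); rewrite !fctE /GRing.scale/= /GRing.scale/=.
  by field.
have cE (x : R) : expR (- y) @[y --> x] --> expR (- x).
  exact: (is_derive_cvg (is_derive_expRN x)).
have cC (x : R) : cos (a * y) @[y --> x] --> cos (a * x).
  exact: (is_derive_cvg (dc x)).
rewrite (@ge0_continuous_FTC2y _ (fun x => expR (- x) * (1 + cos (a * x))) F 0 0).
- rewrite -EFinB /F oppr0 expR0 mulr0 cos0 sin0 mulr0; congr EFin; ring.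
- move=> x _; apply: mulr_ge0; first exact: expR_ge0.
  by have := cos_max (a * x); rewrite ler_norml => /andP[? _]; lra.
- apply: continuous_subspaceT => x; apply: cvgM; first exact: cE.
  by apply: cvgD; [exact: cvg_cst|exact: cC].
- rewrite (_ : 0 = - 0 + (1 + a ^+ 2)^-1 * 0 :> R); last by rewrite oppr0 mulr0 addr0.
  apply: cvgD; first by apply: cvgN; exact: cvgr_expR.
  apply: cvgM; first exact: cvg_cst.
  apply/cvgr0Pnorm_le => e e0.
  have e1 : 0 < e / (`|a| + 1) by rewrite divr_gt0// ltr_wpDl.
  have := @cvgr_expR R => /cvgr0Pnorm_le /(_ _ e1); apply: filterS => x /=.
  rewrite normrM => h.
  have b : `|a * sin (a * x) - cos (a * x)| <= `|a| + 1.
    rewrite (le_trans (ler_normB _ _))// lerD ?cos_max// normrM ler_piMr// sin_max//.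
  rewrite (le_trans (ler_pM _ _ h b))//.
  by rewrite divfK// gt_eqF// ltr_wpDl.
- by move=> x _; have [] := dF x.
- apply: cvg_at_right_filter.
  exact: (is_derive_cvg (dF 0)).
- by move=> x _; rewrite derive1E; apply: derive_val.
Qed.

(** The real part comes from the half-line integral by evenness, after subtraction of the integral
    of exp (- |x|); the imaginary part vanishes because its integrand is odd. *)
Lemma fourier_expRNabs (a : R) :
  cI leb (fun x => (expR (- `|x|))%:C * expi (a * x)) = (2 / (1 + a ^+ 2))%:C.
Proof.
have me : measurable_fun setT (fun x : R => expR (- `|x|)).
  by apply: continuous_measurable_fun; exact: continuous_expRNabs.
have ma : measurable_fun setT (fun x : R => a * x) by exact: measurable_funM.
have ci : cintble leb (fun x => (expR (- `|x|))%:C * expi (a * x)).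
  apply: cintble_lty; first by apply: cmeasM; [exact: cmeas_real|exact: cmeas_expi].
  under eq_integral do rewrite normcMl normc_expi mulr1 normc_real ger0_norm ?expR_ge0//.
  by rewrite integral_expRNabs ltry.
have ie : leb.-integrable setT (fun x => (expR (- `|x|))%:E).
  apply/integrableP; split; first exact/measurable_EFinP.
  under eq_integral do rewrite abse_EFin ger0_norm ?expR_ge0//.
  by rewrite integral_expRNabs ltry.
apply: complex_ext => /=.
- have cC : continuous (fun x : R => cos (a * x)).
    move=> x; apply: (@continuous_comp _ _ _ (fun x : R => a * x) (@cos R)); last exact: continuous_cos.
    by apply: cvgM; [exact: cvg_cst|exact: cvg_id].
  have h : (\int[leb]_x (expR (- `|x|) * (1 + cos (a * x)))%:E = (2 * (1 + (1 + a ^+ 2)^-1))%:E)%E.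
    rewrite ge0_symfun_integralT.
    + rewrite EFinM -integral_expRN_cos set_itvcy; congr (_ * _)%E.
      apply: eq_integral => x; rewrite inE/= => x0.
      by rewrite ger0_norm.
    + move=> x; apply: mulr_ge0; first exact: expR_ge0.
      by have := cos_max (a * x); rewrite ler_norml => /andP[? _]; lra.
    + move=> x; apply: cvgM; first exact: continuous_expRNabs.
      by apply: cvgD; [exact: cvg_cst|exact: cC].
    + by move=> x; rewrite /= normrN mulrN cosN.
  have [c1 _] := ci.
  have : ((2 * (1 + (1 + a ^+ 2)^-1))%:E =
     2%:E + \int[leb]_x (Re ((expR (- `|x|))%:C * expi (a * x)))%:E)%E.
    rewrite -h -integral_expRNabs -integralD//.
    by apply: eq_integral => x _; rewrite cReM /= mul0r subr0 mulrDr mulr1.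
  rewrite -EFin_Rintegral// -EFinD => -[] e.
  apply: (addrI 2); apply: etrans (esym e) _; ring.
- have [c1 c2] := ci.
  set I := \int[leb]_x _.
  suff : I = - I by move=> /eqP; rewrite -addr_eq0 -mulr2n mulrn_eq0 /= => /eqP.
  have [_ +] := @cov_integrable _ _ R leb (fun x : R => - x) 1 ltr01
    (@oppr_measurable R setT) (fun G mG G0 => etrans (mul1e _) (leb_opp mG G0)) _ c2.
  rewrite mul1r => e; apply: etrans (esym e) _.
  rewrite /I -mulN1r -RintegralZl//.
  by apply: eq_Rintegral => x _; rewrite !cImM /= normrN mulrN sinN !mul0r !addr0; ring.
Qed.

End half_line.

Section rV_complex_integral.
Context (R : realType).
Local Notation leb := (@lebesgue_measure R).
Local Notation mu n := (lebesgue_rV R n).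

Lemma cI_shift n (a : 'rV[R]_n) f : cintble (mu n) f ->
  cintble (mu n) (fun x => f (x + a)) /\ cI (mu n) (fun x => f (x + a)) = cI (mu n) f.
Proof.
move=> fi.
have [i1 e] := @cov_cI _ _ R (mu n) (fun x => x + a) 1 ltr01 (measurable_rV_shift a)
  (fun G mG G0 => etrans (mul1e _) (integral_shift a mG G0)) f fi.
by split => //; rewrite -e mul1r.
Qed.

Lemma cI_opp n f : cintble (mu n) f ->
  cintble (mu n) (fun x => f (- x)) /\ cI (mu n) (fun x => f (- x)) = cI (mu n) f.
Proof.
move=> fi.
have mo := @measurable_rVN R n.
have [i1 e] := @cov_cI _ _ R (mu n) (fun x => - x) 1 ltr01 mo
  (fun G mG G0 => etrans (mul1e _) (integral_rVN mG G0)) f fi.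
by split => //; rewrite -e mul1r.
Qed.

Lemma cI_scale n (c : R) f : c != 0 -> cintble (mu n) f ->
  cintble (mu n) (fun x => f (c *: x)) /\
  (`|c| ^+ n)%:C * cI (mu n) (fun x => f (c *: x)) = cI (mu n) f.
Proof.
move=> c0 fi; have cn : 0 < `|c| ^+ n by rewrite exprn_gt0// normr_gt0.
exact: (@cov_cI _ _ R (mu n) (fun x => c *: x) _ cn (measurable_rV_scale c)
  (fun G mG G0 => integral_scale c0 mG G0) f fi).
Qed.

Lemma integrable_rVS n (g : 'rV[R]_n.+1 -> R) : (mu n.+1).-integrable setT (EFin \o g) ->
  (leb \x mu n)%E.-integrable setT (fun p => (g (rV_cons p))%:E) /\
  (\int[mu n.+1]_x (g x)%:E = \int[leb \x mu n]_p (g (rV_cons p))%:E)%E.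
Proof.
move=> ig.
have mg := measurable_int _ ig.
have mc := measurable_comp_rV_cons mg.
have i2 : (leb \x mu n)%E.-integrable setT (fun p => (g (rV_cons p))%:E).
  apply/integrableP; split; first exact: mc.
  have /integrableP[_] := ig.
  rewrite integral_rVS//; last exact: measurableT_comp.
  rewrite (fubini_tonelli1 (fun p => `|(g (rV_cons p))%:E|%E))//.
  exact: (measurableT_comp (@abse_measurable R setT) mc).
split => //.
transitivity (\int[pushforward (leb \x mu n)%E (@rV_cons R n)]_x (g x)%:E)%E => //.
by rewrite (integral_pushforward (@measurable_rV_cons R n)).
Qed.

Lemma cI_rVS n (F : 'rV[R]_n.+1 -> R[i]) : cintble (mu n.+1) F ->
  cI (mu n.+1) F = cI leb (fun t => cI (mu n) (fun x => F (rV_cons (t, x)))).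
Proof.
move=> [/integrable_rVS[i1 e1] /integrable_rVS[i2 e2]].
have [a1 b1] := Rfubini_integrable i1; have [a2 b2] := Rfubini_integrable i2.
apply: complex_ext => /=; rewrite [LHS]/Rintegral [RHS]/Rintegral.
- by rewrite e1 b1 -(integral12_prod_meas1 i1).
- by rewrite e2 b2 -(integral12_prod_meas1 i2).
Qed.

Lemma measurable_prod_coord n (f : 'I_n -> R -> R) : (forall i, measurable_fun setT (f i)) ->
  measurable_fun setT (fun x : 'rV[R]_n => \prod_i f i (x ord0 i)).
Proof.
move=> mf.
have h (s : seq 'I_n) : measurable_fun setT (fun x : 'rV[R]_n => \prod_(i <- s) f i (x ord0 i)).
  elim: s => [|i s IH]; first by under eq_fun do rewrite big_nil; exact: measurable_cst.
  under eq_fun do rewrite big_cons; apply: measurable_funM => //.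
  by apply: measurableT_comp => //; exact: measurable_coord.
exact: h.
Qed.

Lemma integral_prod n (f : 'I_n -> R -> R) : (forall i, measurable_fun setT (f i)) ->
  (forall i x, 0 <= f i x) ->
  (\int[mu n]_x (\prod_i f i (x ord0 i))%:E = \prod_i \int[leb]_t (f i t)%:E)%E.
Proof.
elim: n f => [|n IH] f mf f0.
  rewrite integral_rV0; first by rewrite !big_ord0.
  by apply/measurable_EFinP; exact: measurable_prod_coord.
rewrite integral_rVS; last 2 first.
- by apply/measurable_EFinP; exact: measurable_prod_coord.
- by move=> x; rewrite lee_fin prodr_ge0.
rewrite big_ord_recl -IH//.
have p0 : (0 <= \int[mu n]_x (\prod_i f (lift ord0 i) (x ord0 i))%:E)%E.
  by apply: integral_ge0 => x _; rewrite lee_fin prodr_ge0.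
rewrite -ge0_integralZr//; last 2 first.
- by apply/measurable_EFinP; exact: mf.
- by move=> t _; rewrite lee_fin.
apply: eq_integral => t _.
rewrite -ge0_integralZl//.
- apply: eq_integral => x _; rewrite big_ord_recl rV_cons0 EFinM; congr (_ * _%:E)%E.
  by apply: eq_bigr => i _; rewrite rV_consS.
- by apply/measurable_EFinP; apply: (measurable_prod_coord (f := fun i => f (lift ord0 i))).
- by move=> x _; rewrite lee_fin prodr_ge0.
- by rewrite lee_fin.
Qed.

Lemma normc_prod (I : Type) (s : seq I) (F : I -> R[i]) :
  normc (\prod_(i <- s) F i) = \prod_(i <- s) normc (F i).
Proof. by apply: (big_morph _ (@normcMl R)); exact: Normc.normc1. Qed.

Lemma cmeas_prod_coord n (f : 'I_n -> R -> R[i]) : (forall i, cmeas (f i)) ->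
  cmeas (fun x : 'rV[R]_n => \prod_i f i (x ord0 i)).
Proof.
move=> mf.
have h (s : seq 'I_n) : cmeas (fun x : 'rV[R]_n => \prod_(i <- s) f i (x ord0 i)).
  elim: s => [|i s IH]; first by under eq_fun do rewrite big_nil; exact: cmeas_cst.
  under eq_fun do rewrite big_cons; apply: cmeasM => //.
  have [m1 m2] := mf i.
  by split; [apply: (measurableT_comp m1)|apply: (measurableT_comp m2)]; exact: measurable_coord.
exact: h.
Qed.

Lemma cI_prod n (f : 'I_n -> R -> R[i]) : (forall i, cintble leb (f i)) ->
  cintble (mu n) (fun x => \prod_i f i (x ord0 i)) /\
  cI (mu n) (fun x => \prod_i f i (x ord0 i)) = \prod_i cI leb (f i).
Proof.
move=> fi.
have fcm m (h : 'I_m -> R -> R[i]) : (forall i, cintble leb (h i)) ->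
    cintble (mu m) (fun x => \prod_i h i (x ord0 i)).
  move=> hi; apply: cintble_lty.
    by apply: cmeas_prod_coord => i; exact: cintble_meas (hi i).
  under eq_integral do rewrite normc_prod.
  rewrite (integral_prod (f := fun i t => normc (h i t))); last 2 first.
  - by move=> i; apply: cmeas_normc; exact: cintble_meas (hi i).
  - by move=> i x; exact: normc_ge0.
  rewrite ltey_eq; apply/orP; left; apply: prode_fin_num => i _.
  rewrite ge0_fin_numE ?cintble_fin//.
  by apply: integral_ge0 => x _; rewrite lee_fin normc_ge0.
split; first exact: fcm.
elim: n f fi => [|n IH] f fi.
  have [i1 i2] := fcm _ _ fi.
  apply: complex_ext; rewrite !big_ord0 /=.
    rewrite /Rintegral integral_rV0 ?big_ord0//.
    by have [] := cintble_meas (fcm _ _ fi) => h _; apply/measurable_EFinP.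
  rewrite /Rintegral integral_rV0 ?big_ord0//.
  by have [] := cintble_meas (fcm _ _ fi) => _ h; apply/measurable_EFinP.
rewrite cI_rVS; last exact: fcm.
rewrite big_ord_recl -IH//.
have pi := fcm _ _ (fun i => fi (lift ord0 i)).
set c := cI (mu n) _.
rewrite mulrC -cIZ//; apply: eq_cI => t.
rewrite mulrC /c -cIZ//; apply: eq_cI => x.
by rewrite big_ord_recl rV_cons0; congr (_ * _); apply: eq_bigr => i _; rewrite rV_consS.
Qed.

End rV_complex_integral.

Lemma cintegralE (R : realType) n (f : 'rV[R]_n -> R[i]) : cintegral f = cI (lebesgue_rV R n) f.
Proof. by []. Qed.

(** * A damping function with an explicit Fourier transform *)

Section envelopes.
Context (R : realType) (n : nat).
Local Notation leb := (@lebesgue_measure R).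
Local Notation mu := (lebesgue_rV R n).
Local Notation V := 'rV[R]_n.

(** The pair [gam], [khat] plays the part of a Gaussian. Both are products over the coordinates, so
    their integrals and the transform reduce to exp (- |t|) and 1 / (1 + t^2) on the line. Besides
    damping, they supply integrable majorants and a positive integrable weight. *)
Definition gam (x : V) : R := \prod_i expR (- `|x ord0 i|).
Definition khat (x : V) : R := \prod_i (2 / (1 + (2 * pi * x ord0 i) ^+ 2)).

Lemma gam_gt0 x : 0 < gam x. Proof. by apply: prodr_gt0 => i _; exact: expR_gt0. Qed.

Lemma gam_le1 x : gam x <= 1.
Proof.
by apply: prodr_ile1 => i _; rewrite expR_ge0/= -[leRHS]expR0 ler_expR oppr_le0.
Qed.

Lemma measurable_gam : measurable_fun setT gam.
Proof.
apply: (measurable_prod_coord (f := fun=> fun t => expR (- `|t|))) => i.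
by apply: continuous_measurable_fun; exact: continuous_expRNabs.
Qed.

Lemma measurable_inv1D2 (c : R) : measurable_fun setT (fun x : R => (1 + (c * x) ^+ 2)^-1).
Proof.
apply: continuous_measurable_fun => x; apply: cvgV.
  by rewrite gt_eqF// ltr_wpDr// sqr_ge0.
apply: cvgD; first exact: cvg_cst.
apply: (@continuous_comp _ _ _ (fun x : R => c * x) (fun x : R => x ^+ 2)).
  by apply: cvgM; [exact: cvg_cst|exact: cvg_id].
exact: exprn_continuous.
Qed.

Lemma measurable_khat : measurable_fun setT khat.
Proof.
apply: (measurable_prod_coord (f := fun=> fun t => 2 / (1 + (2 * pi * t) ^+ 2))) => i.
by apply: measurable_funM => //; exact: measurable_inv1D2.
Qed.

Lemma khat_ge0 x : 0 <= khat x.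
Proof.
by apply: prodr_ge0 => i _; rewrite divr_ge0// addr_ge0// sqr_ge0.
Qed.

Lemma integrable_gam : mu.-integrable setT (EFin \o gam).
Proof.
apply/integrableP; split; first by apply/measurable_EFinP; exact: measurable_gam.
under eq_integral do rewrite /= ger0_norm ?(ltW (gam_gt0 _))//.
rewrite (integral_prod (n := n) (f := fun=> fun t => expR (- `|t|))); last 2 first.
- by move=> i; apply: continuous_measurable_fun; exact: continuous_expRNabs.
- by move=> i x; exact: expR_ge0.
rewrite ltey_eq; apply/orP; left; apply: prode_fin_num => i _.
by rewrite integral_expRNabs.
Qed.

Lemma integral_khat : (\int[mu]_x (khat x)%:E = 1)%E.
Proof.
rewrite (integral_prod (n := n) (f := fun=> fun t => 2 / (1 + (2 * pi * t) ^+ 2))); last 2 first.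
- by move=> i; apply: measurable_funM => //; exact: measurable_inv1D2.
- by move=> i x; rewrite divr_ge0// addr_ge0// sqr_ge0.
rewrite (_ : (\int[leb]_t _)%E = 1%E); first by rewrite big1_eq.
have pi0 : 0 < 2 * pi :> R by rewrite mulr_gt0// pi_gt0.
have mF : measurable_fun setT (fun t : R => ((1 + t ^+ 2)^-1)%:E).
  by apply/measurable_EFinP; have := measurable_inv1D2 1; under eq_fun do rewrite mul1r.
have F0 (t : R) : (0 <= ((1 + t ^+ 2)^-1)%:E)%E.
  by rewrite lee_fin invr_ge0 addr_ge0// sqr_ge0.
have := leb_affine_pos 0 pi0 mF F0; rewrite integral_cauchy.
under eq_integral do rewrite addr0.
under [in X in _ -> X]eq_integral do rewrite EFinM.
rewrite ge0_integralZl//; last first.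
  by apply/measurable_EFinP; exact: measurable_inv1D2.
have : (0 <= \int[leb]_x ((1 + (2 * pi * x) ^+ 2)^-1)%:E)%E.
  by apply: integral_ge0 => t _; rewrite lee_fin invr_ge0 addr_ge0// sqr_ge0.
case: (integral _ _ _) => [r _|_|//].
  rewrite -!EFinM => -[] e; congr EFin.
  have p0 : (pi : R) != 0 by rewrite gt_eqF ?pi_gt0.
  by apply: (mulfI p0); rewrite mulr1 -[RHS]e; ring.
by rewrite gt0_muley ?lte_fin.
Qed.

Lemma integrable_khat : mu.-integrable setT (EFin \o khat).
Proof.
apply/integrableP; split; first by apply/measurable_EFinP; exact: measurable_khat.
under eq_integral do rewrite /= ger0_norm ?khat_ge0//.
by rewrite integral_khat ltry.
Qed.

Lemma dotvC (x y : V) : dotv x y = dotv y x.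
Proof. by apply: eq_bigr => i _; rewrite mulrC. Qed.

Lemma dotvDl (x y z : V) : dotv (x + y) z = dotv x z + dotv y z.
Proof. by rewrite /dotv -big_split; apply: eq_bigr => i _; rewrite mxE mulrDl. Qed.

Lemma dotvZl (c : R) (x z : V) : dotv (c *: x) z = c * dotv x z.
Proof. by rewrite /dotv mulr_sumr; apply: eq_bigr => i _; rewrite mxE mulrA. Qed.

Lemma dotvNl (x z : V) : dotv (- x) z = - dotv x z.
Proof. by rewrite -scaleN1r dotvZl mulN1r. Qed.

Lemma dotvDr (x y z : V) : dotv z (x + y) = dotv z x + dotv z y.
Proof. by rewrite dotvC dotvDl !(dotvC z). Qed.

Lemma dotvZr (c : R) (x z : V) : dotv z (c *: x) = c * dotv z x.
Proof. by rewrite dotvC dotvZl dotvC. Qed.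

Lemma dotvNr (x z : V) : dotv z (- x) = - dotv z x.
Proof. by rewrite dotvC dotvNl dotvC. Qed.

Lemma expi_sum (I : Type) (s : seq I) (f : I -> R) :
  expi (\sum_(i <- s) f i) = \prod_(i <- s) expi (f i).
Proof. by apply: (big_morph _ (@expiD R)); exact: expi0. Qed.

Lemma fourier_gam (z : V) : fourier (fun x => (gam x)%:C) z = (khat z)%:C.
Proof.
rewrite /fourier cintegralE.
have fi (i : 'I_n) : cintble leb (fun t => (expR (- `|t|))%:C * expi (- (2 * pi * z ord0 i) * t)).
  apply: cintble_lty.
    apply: cmeasM.
      by apply: cmeas_real; apply: continuous_measurable_fun; exact: continuous_expRNabs.
    by apply: cmeas_expi; exact: measurable_funM.
  under eq_integral do rewrite normcMl normc_expi mulr1 normc_real ger0_norm ?expR_ge0//.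
  by rewrite integral_expRNabs ltry.
have [_ h] := cI_prod fi.
rewrite (@eq_cI _ _ _ mu _ (fun x => \prod_i ((expR (- `|x ord0 i|))%:C * expi (- (2 * pi * z ord0 i) * x ord0 i)))).
  rewrite h /khat rmorph_prod; apply: eq_bigr => i _.
  by rewrite fourier_expRNabs sqrrN.
move=> x; rewrite big_split/= /gam rmorph_prod; congr (_ * _).
rewrite -expi_sum; congr expi; rewrite /dotv mulr_sumr -sumrN.
by apply: eq_bigr => i _; ring.
Qed.

End envelopes.

Arguments fourier : simpl never.

(** * The Fourier transform on L^1 *)

Section fourier_transform.
Context (R : realType) (n : nat).
Local Notation mu := (lebesgue_rV R n).
Local Notation V := 'rV[R]_n.
Implicit Types f g h : V -> R[i].

Definition kern (x y : V) : R[i] := expi (- (2 * pi * dotv x y)).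

Lemma kernC x y : kern x y = kern y x. Proof. by rewrite /kern dotvC. Qed.

Lemma kernDl x y z : kern (x + y) z = kern x z * kern y z.
Proof. by rewrite /kern dotvDl mulrDr opprD expiD. Qed.

Lemma kernNl x z : kern (- x) z = conjc (kern x z).
Proof. by rewrite /kern dotvNl mulrN expiN. Qed.

Lemma kernNr x z : kern x (- z) = conjc (kern x z).
Proof. by rewrite kernC kernNl kernC. Qed.

Lemma kernZl (c : R) x z : kern (c *: x) z = kern x (c *: z).
Proof. by rewrite /kern dotvZl dotvZr. Qed.

Lemma normc_kern x y : normc (kern x y) = 1.
Proof. exact: normc_expi. Qed.

Lemma cmeas_kern x : cmeas (kern x).
Proof.
apply: cmeas_expi; apply: measurable_funN; apply: measurable_funM => //.
exact: measurable_dotvl.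
Qed.

Lemma cmeas_kern2 : cmeas (fun p : V * V => kern p.1 p.2).
Proof.
apply: cmeas_expi; apply: measurable_funN; apply: measurable_funM => //.
exact: measurable_dotv.
Qed.

Lemma conjcM (a b : R[i]) : conjc (a * b) = conjc a * conjc b.
Proof. by apply: complex_ext; rewrite ?cReM ?cImM ?cReJ ?cImJ ?cReM ?cImM; ring. Qed.

Lemma fourierE f x : fourier f x = cI mu (fun y => f y * kern x y).
Proof. by []. Qed.

Lemma cintble_kern f x : cintble mu f -> cintble mu (fun y => f y * kern x y).
Proof.
move=> fi; under eq_fun do rewrite mulrC.
apply: (cintbleMb (b := 1) fi (cmeas_kern x)) => y; by rewrite normc_kern.
Qed.

Lemma normc_fourier f x : cintble mu f ->
  ((normc (fourier f x))%:E <= \int[mu]_y (normc (f y))%:E)%E.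
Proof.
move=> fi; apply: le_trans (normc_cI (cintble_kern x fi)) _.
by under eq_integral do rewrite normcMl normc_kern mulr1.
Qed.

Lemma cintble_gam : cintble mu (fun x => (gam x)%:C).
Proof. by split; [exact: integrable_gam|exact: integrable0]. Qed.

Lemma cintble_khat : cintble mu (fun x => (khat x)%:C).
Proof. by split; [exact: integrable_khat|exact: integrable0]. Qed.

Lemma cintble_prod_kern f g : cintble mu f -> cintble mu g ->
  cintble (mu \x mu)%E (fun p => kern p.1 p.2 * (f p.1 * g p.2)).
Proof.
move=> fi gi; apply: (cintbleMb (b := 1)); first exact: cintble_prod.
  exact: cmeas_kern2.
by move=> p; rewrite normc_kern.
Qed.

(** Measurability comes from Fubini, which needs integrability in both variables: the factor [gam x]
    provides it in x and is divided out again. *)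
Lemma cmeas_fourier f : cintble mu f -> cmeas (fourier f).
Proof.
move=> fi.
have [i1 _ _] := cI_fubini (cintble_prod_kern cintble_gam fi).
have e x : fourier f x = (gam x)^-1%:C *
    cI mu (fun y => kern (x, y).1 (x, y).2 * ((gam (x, y).1)%:C * f (x, y).2)).
  rewrite -cIZ; last first.
    apply: (cintbleMb (b := 1)); last by move=> y; rewrite normc_kern.
      exact: (cintbleZ (gam x)%:C fi).
    exact: cmeas_kern.
  apply: eq_cI => y /=; have gx : (gam x)%:C != 0 by rewrite fmorph_eq0 gt_eqF ?gam_gt0.
  by rewrite -/(kern x y) fmorphV; field.
rewrite (_ : fourier f = fun x => (gam x)^-1%:C *
    cI mu (fun y => kern (x, y).1 (x, y).2 * ((gam (x, y).1)%:C * f (x, y).2))); last exact/funext.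
apply: cmeasM; last exact: cintble_meas i1.
apply: cmeas_real; under eq_fun do rewrite /gam -prodfV.
apply: (measurable_prod_coord (f := fun=> fun t : R => (expR (- `|t|))^-1)) => i.
under eq_fun do rewrite -expRN opprK.
apply: (measurableT_comp (@measurable_expR R)); exact: normr_measurable.
Qed.

(** Fubini and the symmetry of the kernel. This multiplication formula carries the inversion
    theorem, Plancherel's inequality and Carleman's inequality. *)
Lemma fourier_mult f g : cintble mu f -> cintble mu g ->
  cI mu (fun x => f x * fourier g x) = cI mu (fun y => g y * fourier f y).
Proof.
move=> fi gi.
have [_ _ h] := cI_fubini (cintble_prod_kern fi gi).
transitivity (cI mu (fun x => cI mu (fun y => kern (x, y).1 (x, y).2 * (f (x, y).1 * g (x, y).2)))).
  apply: eq_cI => x; rewrite fourierE -cIZ; last exact: cintble_kern.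
  by apply: eq_cI => y /=; rewrite mulrCA mulrA mulrAC -mulrA mulrC -mulrA mulrCA.
rewrite h; apply: eq_cI => y; rewrite fourierE -cIZ; last exact: cintble_kern.
by apply: eq_cI => x /=; rewrite kernC; ring.
Qed.

Lemma fourier_kern f x y : fourier (fun z => f z * kern x z) y = fourier f (x + y).
Proof. by apply: eq_cI => z; rewrite -mulrA -kernDl. Qed.

Lemma fourier_conj f x : cintble mu f -> fourier (fun z => conjc (f z)) x = conjc (fourier f (- x)).
Proof.
move=> fi; rewrite !fourierE -cIJ; last exact: cintble_kern.
by apply: eq_cI => z; rewrite conjcM kernNl conjcK.
Qed.

(** [gamk k] increases to 1, while its transform [khatk k] is a nonnegative approximate identity of
    mass 1. *)
Definition gamk (k : nat) (x : V) : R := gam (k.+1%:R^-1 *: x).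
Definition khatk (k : nat) (x : V) : R := k.+1%:R ^+ n * khat (k.+1%:R *: x).

Lemma kinv0 (k : nat) : k.+1%:R^-1 != 0 :> R.
Proof. by rewrite invr_eq0 pnatr_eq0. Qed.

Lemma cintble_gamk k : cintble mu (fun x => (gamk k x)%:C).
Proof. exact: (cI_scale (kinv0 k) cintble_gam).1. Qed.

Lemma fourier_gamk k z : fourier (fun x => (gamk k x)%:C) z = (khatk k z)%:C.
Proof.
have i0 := cintble_kern (k.+1%:R *: z) cintble_gam.
have [_ h] := cI_scale (kinv0 k) i0.
have kp : 0 < k.+1%:R :> R by [].
rewrite /khatk rmorphM/= -fourier_gam [in RHS]fourierE -h mulrA -rmorphM/=.
rewrite normfV ger0_norm ?ltW// exprVn mulfV ?expf_neq0 ?gt_eqF// mul1r fourierE.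
by apply: eq_cI => x; rewrite kernZl scalerA mulfV ?scale1r// gt_eqF.
Qed.

Lemma khatk_ge0 k x : 0 <= khatk k x.
Proof. by rewrite mulr_ge0 ?exprn_ge0 ?khat_ge0. Qed.

Lemma measurable_khatk k : measurable_fun setT (khatk k).
Proof.
apply: measurable_funM => //; apply: measurableT_comp; first exact: measurable_khat.
exact: measurable_rV_scale.
Qed.

Lemma integral_khatk k : (\int[mu]_x (khatk k x)%:E = 1)%E.
Proof.
have mk : measurable_fun setT (fun x : V => (khat x)%:E).
  by apply/measurable_EFinP; exact: measurable_khat.
have k0 : k.+1%:R != 0 :> R by rewrite pnatr_eq0.
rewrite -(integral_khat R n) -(integral_scale k0 mk); last by move=> x; rewrite lee_fin khat_ge0.
rewrite -ge0_integralZl//.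
- by apply: eq_integral => x _; rewrite -EFinM ger0_norm.
- by apply: (measurableT_comp mk); exact: measurable_rV_scale.
- by move=> x _; rewrite lee_fin khat_ge0.
Qed.

Lemma cintble_khatk k : cintble mu (fun x => (khatk k x)%:C).
Proof.
apply: cintble_lty; first by apply: cmeas_real; exact: measurable_khatk.
under eq_integral do rewrite normc_real ger0_norm ?khatk_ge0//.
by rewrite integral_khatk ltry.
Qed.

Lemma gamk_dist k x : normc ((gamk k x)%:C - 1) <= k.+1%:R^-1 * \sum_i `|x ord0 i|.
Proof.
have -> : (gamk k x)%:C - 1 = (gamk k x - 1)%:C by rewrite rmorphB rmorph1.
rewrite normc_real distrC ger0_norm; last first.
  by rewrite subr_ge0 gam_le1.
have -> : gamk k x = expR (- (k.+1%:R^-1 * \sum_i `|x ord0 i|)).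
  rewrite /gamk /gam mulr_sumr -sumrN expR_sum; apply: eq_bigr => i _.
  by rewrite mxE normrM ger0_norm.
rewrite lerBlDr -lerBlDl; exact: expR_ge1Dx.
Qed.

Lemma cvg_invnM (c : R) : (fun k => k.+1%:R^-1 * c) @ \oo --> (0 : R).
Proof.
rewrite -[X in _ --> X](mul0r c); apply: cvgMl; exact: cvg_harmonic.
Qed.

Lemma squeeze0 (u v : nat -> R) : (forall k, 0 <= u k) -> (forall k, u k <= v k) ->
  v @ \oo --> (0 : R) -> u @ \oo --> (0 : R).
Proof.
move=> u0 uv v0; apply: (@squeeze_cvgr _ _ _ _ (fun=> 0) v) => //.
  by apply: nearW => k; rewrite u0 uv.
exact: cvg_cst.
Qed.

Lemma normc_cvg_unique (u : nat -> R[i]) (a b : R[i]) :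
  (fun k => normc (u k - a)) @ \oo --> (0 : R) ->
  (fun k => normc (u k - b)) @ \oo --> (0 : R) -> a = b.
Proof.
move=> ua ub; apply/eqP; rewrite -subr_eq0 -normc_eq0; apply/eqP.
have h : (fun k => normc (u k - a) + normc (u k - b)) @ \oo --> (0 : R).
  by rewrite -[X in _ --> X]addr0; apply: cvgD.
apply/le_anti; rewrite normc_ge0 andbT.
apply: (cvgr_to_ge h); apply: nearW => k.
have -> : a - b = (- (u k - a)) + (u k - b) by rewrite opprB addrA subrK.
by rewrite (le_trans (ler_normcD _ _))// normcNl.
Qed.

Definition ccont f := forall x, (fun y => normc (f y - f x)) @ x --> (0 : R).

Lemma cvg_shift_scale (z u : V) : (fun k => z + k.+1%:R^-1 *: u) @ \oo --> z.
Proof.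
rewrite -[X in _ --> X]addr0; apply: cvgD; first exact: cvg_cst.
rewrite -[X in _ --> X](scale0r u); apply: cvgZl; exact: cvg_harmonic.
Qed.

(** The damped integrals [u k] converge to the double transform because [gamk k] tends to 1, and to
    [g z] because, by the multiplication formula, they are averages of [g] against [khatk k] centred
    at z. *)
Lemma fourier_inversion g (M : R) : cintble mu g -> ccont g -> (forall x, normc (g x) <= M) ->
  cintble mu (fourier g) -> forall z, fourier (fourier g) (- z) = g z.
Proof.
move=> gi gc gM Gi z.
have mg := cintble_meas gi.
pose u k := cI mu (fun x => ((gamk k x)%:C * kern (- z) x) * fourier g x).
have ai k : cintble mu (fun x => (gamk k x)%:C * kern (- z) x).
  exact/cintble_kern/cintble_gamk.
apply: (@normc_cvg_unique u).
- apply: (@cI_cvg _ _ _ mu _ _ (fun x => (normc (fourier g x))%:E)).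
  + move=> k; apply: cmeasM; last exact: cmeas_fourier.
    exact: cintble_meas (ai k).
  + by apply: cmeasM; [exact: cmeas_fourier|exact: cmeas_kern].
  + move=> x; apply: (squeeze0 (v := fun k => k.+1%:R^-1 * ((\sum_i `|x ord0 i|) * normc (fourier g x)))).
    * by move=> k; exact: normc_ge0.
    * move=> k; rewrite mulrA.
      have -> : (gamk k x)%:C * kern (- z) x * fourier g x - fourier g x * kern (- z) x =
         ((gamk k x)%:C - 1) * (kern (- z) x * fourier g x) by ring.
      by rewrite !normcMl normc_kern mul1r ler_wpM2r ?normc_ge0// gamk_dist.
    * exact: cvg_invnM.
  + by have /cintbleP[] := Gi.
  + move=> k x; rewrite lee_fin !normcMl normc_kern mulr1 normc_real.
    by rewrite ler_piMl ?normc_ge0// ger0_norm ?(ltW (gam_gt0 _))// gam_le1.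
have uE k : u k = cI mu (fun y => (khat y)%:C * g (z + k.+1%:R^-1 *: y)).
  rewrite /u fourier_mult//.
  rewrite (@eq_cI _ _ _ mu _ (fun y => g y * (khatk k (y - z))%:C)); last first.
    move=> y; congr (_ * _).
    rewrite -fourier_gamk -(addrC (- z)) -fourier_kern; exact: eq_cI.
  have gki : cintble mu (fun y => g y * (khatk k (y - z))%:C).
    apply: (cintbleMb (b := M) _ mg gM).
    exact: (cI_shift (- z) (cintble_khatk k)).1.
  rewrite -(cI_shift z gki).2.
  have k0 : k.+1%:R != 0 :> R by rewrite pnatr_eq0.
  have mgs : cmeas (fun y : V => g (z + k.+1%:R^-1 *: y)).
    have ms : measurable_fun setT (fun y : V => z + k.+1%:R^-1 *: y).
      under eq_fun do rewrite addrC.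
      apply: (measurableT_comp (measurable_rV_shift z)); exact: measurable_rV_scale.
    by have [m1 m2] := mg; split; [apply: (measurableT_comp m1)|apply: (measurableT_comp m2)].
  have gsi : cintble mu (fun y => (khat y)%:C * g (z + k.+1%:R^-1 *: y)).
    under eq_fun do rewrite mulrC.
    by apply: (cintbleMb (b := M) cintble_khat mgs).
  rewrite -(cI_scale k0 gsi).2 -cIZ; last exact: (cI_scale k0 gsi).1.
  apply: eq_cI => y; rewrite addrK scalerA mulVf// scale1r (addrC y z).
  by rewrite /khatk ger0_norm// rmorphM/=; ring.
have -> : g z = cI mu (fun y => (khat y)%:C * g z).
  under [in RHS]eq_fun do rewrite mulrC.
  have -> := cIZ (g z) cintble_khat.
  by rewrite cI_real /Rintegral integral_khat mulr1.
rewrite (_ : (fun k => normc (u k - _)) = fun k => normc (cI mu (fun y => (khat y)%:C * g (z + k.+1%:R^-1 *: y)) - cI mu (fun y => (khat y)%:C * g z))); last first.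
  by apply/funext => k; rewrite uE.
have mkh : cmeas (fun y : V => (khat y)%:C) by apply: cmeas_real; exact: measurable_khat.
apply: (@cI_cvg _ _ _ mu _ _ (fun x => (M * khat x)%:E)).
- move=> k; apply: cmeasM => //.
  have ms : measurable_fun setT (fun y : V => z + k.+1%:R^-1 *: y).
    under eq_fun do rewrite addrC.
    apply: (measurableT_comp (measurable_rV_shift z)); exact: measurable_rV_scale.
  by have [m1 m2] := mg; split; [apply: (measurableT_comp m1)|apply: (measurableT_comp m2)].
- by apply: cmeasM => //; exact: cmeas_cst.
- move=> y.
  have h : (fun k => normc (g (z + k.+1%:R^-1 *: y) - g z)) @ \oo --> (0 : R).
    apply: (cvg_comp (fun k : nat => z + k.+1%:R^-1 *: y) (fun w => normc (g w - g z))); last exact: gc.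
    exact: cvg_shift_scale.
  rewrite -[X in _ --> X](mulr0 (normc (khat y)%:C)).
  under eq_fun do rewrite -mulrBr normcMl.
  by apply: cvgM => //; exact: cvg_cst.
- by under eq_fun do rewrite EFinM; apply: integrableZl => //; exact: integrable_khat.
- move=> k y; rewrite lee_fin normcMl normc_real ger0_norm ?khat_ge0// mulrC.
  by rewrite ler_wpM2r ?khat_ge0.
Qed.

Lemma limn_einf_le (u : nat -> \bar R) (c : \bar R) : (forall k, (u k <= c)%E) -> (limn_einf u <= c)%E.
Proof.
move=> uc; rewrite limn_einf_lim; apply: lime_le; first exact: is_cvg_einfs.
apply: nearW => k; apply: le_trans (uc k); apply: ereal_inf_lbound.
by exists k => /=.
Qed.

(* Plancherel, as an inequality; the damping factors [gamk k] make Fubini legitimate. *)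
Lemma N2_fourier f : cintble mu f -> (N2 mu (fourier f) <= N2 mu f)%E.
Proof.
move=> fi; have mf := cintble_meas fi; have mF := cmeas_fourier fi.
have cfi := cintbleJ fi.
have nm := cmeas_normc mf.
have mK k : measurable_fun setT (fun p : V * V => khatk k (p.1 - p.2)).
  apply: (measurableT_comp (measurable_khatk k)).
  apply: measurable_rVD; first exact: measurable_fst.
  under eq_fun do rewrite -scaleN1r.
  by apply: (measurableT_comp (measurable_rV_scale (-1))); exact: measurable_snd.
have mKu k u : measurable_fun setT (fun v : V => khatk k (u - v)).
  exact: (measurableT_comp (mK k) (pair1_measurable u)).
have mKv k v : measurable_fun setT (fun u : V => khatk k (u - v)).
  exact: (measurableT_comp (mK k) (pair2_measurable v)).
have bnd k : (\int[mu]_x (gamk k x * normc (fourier f x) ^+ 2)%:E <= N2 mu f)%E.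
  have ai x0 : cintble mu (fun x => (gamk k x)%:C * kern x0 x).
    exact/cintble_kern/cintble_gamk.
  have gFi : cintble mu (fun x => (gamk k x)%:C * conjc (fourier f x)).
    under eq_fun do rewrite mulrC.
    apply: (cintbleMb (b := fine (\int[mu]_y (normc (f y))%:E)%E) (cintble_gamk k)).
      exact: cmeasJ.
    move=> x; rewrite normc_conj -lee_fin fineK ?normc_fourier//.
    by rewrite ge0_fin_numE ?cintble_fin// integral_ge0// => y _; rewrite lee_fin normc_ge0.
  (* Damping makes this transform a convolution of conj f with [khatk k], so the damped norm becomes
     a double integral of f(u) conj f(v) against khatk(u - v). *)
  have inner u : fourier (fun x => (gamk k x)%:C * conjc (fourier f x)) u =
      cI mu (fun v => conjc (f v) * (khatk k (u - v))%:C).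
    rewrite fourierE.
    rewrite (@eq_cI _ _ _ mu _ (fun x => ((gamk k x)%:C * kern u x) * fourier (fun z => conjc (f z)) (- x))); last first.
      by move=> x; rewrite fourier_conj// opprK; ring.
    have i1 : cintble mu (fun x => ((gamk k x)%:C * kern u x) * fourier (fun z => conjc (f z)) (- x)).
      under eq_fun do rewrite fourier_conj// opprK mulrAC.
      exact: cintble_kern.
    rewrite -(cI_opp i1).2 (@eq_cI _ _ _ mu _ (fun x => ((gamk k x)%:C * kern (- u) x) * fourier (fun z => conjc (f z)) x)); last first.
      move=> x; rewrite opprK kernNr kernNl /gamk scalerN /gam; congr (_%:C * _ * _).
      by apply: eq_bigr => i _; rewrite mxE normrN.
    rewrite fourier_mult//; apply: eq_cI => v; congr (_ * _).
    rewrite fourier_kern fourier_gamk /khatk /khat; congr (_ * _)%:C.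
    by apply: eq_bigr => i _; rewrite !mxE; congr (2 / (1 + _)); ring.
  have K1 u : (\int[mu]_v (khatk k (u - v))%:E = 1)%E.
    have mk1 : measurable_fun setT (fun v : V => (khatk k (v + u))%:E).
      by apply/measurable_EFinP; apply: (measurableT_comp (measurable_khatk k)); exact: measurable_rV_shift.
    under eq_integral do rewrite addrC.
    rewrite (integral_rVN (F := fun v => (khatk k (v + u))%:E))//; last by move=> x; rewrite lee_fin khatk_ge0.
    rewrite (integral_shift u (F := fun v => (khatk k v)%:E)) ?integral_khatk//.
      by apply/measurable_EFinP; exact: measurable_khatk.
    by move=> x; rewrite lee_fin khatk_ge0.
  have K2 v : (\int[mu]_u (khatk k (u - v))%:E = 1)%E.
    rewrite (integral_shift (- v) (F := fun v => (khatk k v)%:E)) ?integral_khatk//.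
      by apply/measurable_EFinP; exact: measurable_khatk.
    by move=> x; rewrite lee_fin khatk_ge0.
  have e1 : (\int[mu]_x (gamk k x * normc (fourier f x) ^+ 2)%:E =
      (normc (cI mu (fun u => f u * fourier (fun x => (gamk k x)%:C * conjc (fourier f x)) u)))%:E)%E.
    rewrite -fourier_mult//.
    have i2 : cintble mu (fun x => ((gamk k x)%:C * conjc (fourier f x)) * fourier f x).
      under eq_fun do rewrite mulrC.
      apply: (cintbleMb (b := fine (\int[mu]_y (normc (f y))%:E)%E) gFi) => //.
      move=> x; rewrite -lee_fin fineK ?normc_fourier//.
      by rewrite ge0_fin_numE ?cintble_fin// integral_ge0// => y _; rewrite lee_fin normc_ge0.
    have e2 x : ((gamk k x)%:C * conjc (fourier f x)) * fourier f x = (gamk k x * normc (fourier f x) ^+ 2)%:C.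
      by rewrite -mulrA (mulrC (conjc _)) mulJc -rmorphM.
    under [in RHS]eq_cI do rewrite e2.
    rewrite cI_real normc_real ger0_norm; last first.
      by apply: Rintegral_ge0 => x _; rewrite mulr_ge0 ?sqr_ge0 ?(ltW (gam_gt0 _)).
    rewrite EFin_Rintegral//.
    by have [+ _] := i2; under eq_fun do rewrite e2.
  rewrite e1.
  have m2 : measurable_fun setT (fun p : V * V => (normc (f p.1) * (normc (f p.2) * khatk k (p.1 - p.2)))%:E).
    apply/measurable_EFinP; apply: measurable_funM.
      exact: (measurableT_comp nm measurable_fst).
    apply: measurable_funM => //; exact: (measurableT_comp nm measurable_snd).
  have m20 (p : V * V) : (0 <= (normc (f p.1) * (normc (f p.2) * khatk k (p.1 - p.2)))%:E)%E.
    rewrite lee_fin; apply: mulr_ge0; first exact: normc_ge0.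
    by apply: mulr_ge0; [exact: normc_ge0|exact: khatk_ge0].
  have gi3 : cintble mu (fun u => f u * fourier (fun x => (gamk k x)%:C * conjc (fourier f x)) u).
    under eq_fun do rewrite mulrC.
    apply: (cintbleMb (b := fine (\int[mu]_y (normc ((gamk k y)%:C * conjc (fourier f y)))%:E)%E) fi).
      exact: cmeas_fourier.
    move=> x; rewrite -lee_fin fineK ?normc_fourier//.
    by rewrite ge0_fin_numE ?cintble_fin// integral_ge0// => y _; rewrite lee_fin normc_ge0.
  apply: (le_trans (normc_cI gi3)).
  apply: (@le_trans _ _ (\int[mu]_u \int[mu]_v (normc (f u) * (normc (f v) * khatk k (u - v)))%:E)%E).
    apply: ge0_le_integral => //.
    - by move=> x _; rewrite lee_fin normc_ge0.
    - by apply: emeas_normc; exact: cintble_meas gi3.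
    - exact: (measurable_fun_fubini_tonelli_F (m2 := mu) _ m2 m20).
    - move=> u _; rewrite normcMl inner EFinM.
      under eq_integral do rewrite EFinM.
      have cki : cintble mu (fun v => conjc (f v) * (khatk k (u - v))%:C).
        under eq_fun do rewrite mulrC.
        apply: (cintbleMb (b := k.+1%:R ^+ n * 2 ^+ n) cfi).
          by apply: cmeas_real; exact: mKu.
        move=> v; rewrite normc_real ger0_norm ?khatk_ge0// /khatk ler_wpM2l//.
        have -> : 2 ^+ n = \prod_(i < n) (2 : R) by rewrite prodr_const card_ord.
        rewrite /khat; apply: ler_prod => i _.
        have h1 : 1 <= 1 + (2 * pi * (k.+1%:R *: (u - v)) ord0 i) ^+ 2 by rewrite lerDl sqr_ge0.
        rewrite divr_ge0//= ?(le_trans ler01 h1)// ler_pdivrMr ?(lt_le_trans ltr01 h1)//.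
        by rewrite ler_peMr.
      have mfk : measurable_fun setT (fun v => (normc (f v) * khatk k (u - v))%:E).
        apply/measurable_EFinP; apply: measurable_funM => //.
              have fk0 v : (0 <= (normc (f v) * khatk k (u - v))%:E)%E.
        by rewrite lee_fin mulr_ge0 ?normc_ge0 ?khatk_ge0.
      rewrite ge0_integralZl//; last by rewrite lee_fin normc_ge0.
      rewrite lee_wpmul2l ?lee_fin ?normc_ge0//.
      apply: (le_trans (normc_cI cki)).
      rewrite le_eqVlt; apply/orP; left; apply/eqP; apply: eq_integral => v _.
      by rewrite normcMl normc_conj normc_real ger0_norm ?khatk_ge0.
  (* Schur test: |f(u)| |f(v)| is at most half the sum of the squares, and khatk(u - v) has integral
     1 in either variable. *)
  pose H1 (p : V * V) : \bar R := (2^-1 * normc (f p.1) ^+ 2 * khatk k (p.1 - p.2))%:E.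
  pose H2 (p : V * V) : \bar R := (2^-1 * normc (f p.2) ^+ 2 * khatk k (p.1 - p.2))%:E.
  have mH1 : measurable_fun setT H1.
    apply/measurable_EFinP; apply: measurable_funM => //; apply: measurable_funM => //.
    by apply: measurable_funX; exact: (measurableT_comp nm measurable_fst).
  have mH2 : measurable_fun setT H2.
    apply/measurable_EFinP; apply: measurable_funM => //; apply: measurable_funM => //.
    by apply: measurable_funX; exact: (measurableT_comp nm measurable_snd).
  have H10 p : (0 <= H1 p)%E.
    by rewrite lee_fin; apply: mulr_ge0; last exact: khatk_ge0; apply: mulr_ge0; [rewrite invr_ge0|exact: sqr_ge0].
  have H20 p : (0 <= H2 p)%E.
    by rewrite lee_fin; apply: mulr_ge0; last exact: khatk_ge0; apply: mulr_ge0; [rewrite invr_ge0|exact: sqr_ge0].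
  have c2 (x : R) : (0 <= (2^-1 * x ^+ 2)%:E)%E by rewrite lee_fin mulr_ge0// sqr_ge0.
  have mhalf : measurable_fun setT (fun u => (2^-1 * normc (f u) ^+ 2)%:E).
    by apply/measurable_EFinP; apply: measurable_funM => //; exact: measurable_funX.
  have halfN : (\int[mu]_u (2^-1 * normc (f u) ^+ 2)%:E = 2^-1%:E * N2 mu f)%E.
    rewrite -ge0_integralZl//; [exact: cmeas_sqr|by move=> x _; rewrite lee_fin sqr_ge0].
  have I1 : (\int[mu]_u \int[mu]_v H1 (u, v) = 2^-1%:E * N2 mu f)%E.
    rewrite -halfN; apply: eq_integral => u _; rewrite /H1 /=.
    under eq_integral do rewrite EFinM.
    rewrite ge0_integralZl ?K1 ?mule1//.
    - by apply/measurable_EFinP; exact: mKu.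
    - by move=> v _; rewrite lee_fin khatk_ge0.
  have I2 : (\int[mu]_u \int[mu]_v H2 (u, v) = 2^-1%:E * N2 mu f)%E.
    rewrite (fubini_tonelli (m1 := mu) (m2 := mu) _ mH2 H20).
    rewrite -halfN; apply: eq_integral => v _; rewrite /H2 /=.
    under eq_integral do rewrite EFinM.
    rewrite ge0_integralZl ?K2 ?mule1//.
    - by apply/measurable_EFinP; exact: mKv.
    - by move=> u _; rewrite lee_fin khatk_ge0.
  have mF1 := measurable_fun_fubini_tonelli_F (m2 := mu) H1 mH1 H10.
  have mF2 := measurable_fun_fubini_tonelli_F (m2 := mu) H2 mH2 H20.
  apply: (@le_trans _ _ (\int[mu]_u (\int[mu]_v H1 (u, v) + \int[mu]_v H2 (u, v)))%E).
    apply: ge0_le_integral => //.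
    - by move=> u _; apply: integral_ge0 => v _; exact: (m20 (u, v)).
    - exact: (measurable_fun_fubini_tonelli_F (m2 := mu) _ m2 m20).
    - exact: emeasurable_funD.
    - move=> u _; rewrite -ge0_integralD//; last 2 first.
      + exact: (measurableT_comp mH1 (pair1_measurable u)).
      + exact: (measurableT_comp mH2 (pair1_measurable u)).
      apply: ge0_le_integral => //.
      + by move=> v _; exact: (m20 (u, v)).
      + exact: (measurableT_comp m2 (pair1_measurable u)).
      + apply: emeasurable_funD.
          exact: (measurableT_comp mH1 (pair1_measurable u)).
        exact: (measurableT_comp mH2 (pair1_measurable u)).
      + move=> v _; rewrite /H1 /H2 /= -EFinD lee_fin mulrA -mulrDl ler_wpM2r ?khatk_ge0//.
        have := sqr_ge0 (normc (f u) - normc (f v)); rewrite !expr2; nra.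
  rewrite ge0_integralD//; last 2 first.
  - by move=> u _; apply: integral_ge0.
  - by move=> u _; apply: integral_ge0.
  rewrite I1 I2 -ge0_muleDl ?lee_fin ?invr_ge0// -EFinD.
  by rewrite (_ : 2^-1 + 2^-1 = 1 :> R) ?mul1e//; lra.
have mk k : measurable_fun setT (fun x => (gamk k x * normc (fourier f x) ^+ 2)%:E).
  apply/measurable_EFinP; apply: measurable_funM; last exact/measurable_funX/cmeas_normc.
  by apply: (measurableT_comp (@measurable_gam R n)); exact: measurable_rV_scale.
have k0 k x : (0 <= (gamk k x * normc (fourier f x) ^+ 2)%:E)%E.
  by rewrite lee_fin mulr_ge0 ?sqr_ge0// ltW// gam_gt0.
have lims x : limn_einf (fun k => (gamk k x * normc (fourier f x) ^+ 2)%:E) = (normc (fourier f x) ^+ 2)%:E.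
  apply: (cvg_limn_einf_sup _).1; apply: cvg_EFin; first exact: nearW.
  rewrite -[X in _ --> X]mul1r; apply: cvgMl; apply/cvgrPdist_le => e e0.
  have /cvgrPdist_le /(_ e e0) := cvg_invnM (\sum_i `|x ord0 i|).
  apply: filterS => k; rewrite sub0r normrN => /(le_trans (ler_norm _)).
  apply: le_trans; apply: le_trans (gamk_dist k x).
  have -> : (gamk k x)%:C - 1 = (gamk k x - 1)%:C by rewrite rmorphB rmorph1.
  by rewrite normc_real distrC.
(* The damped bounds do not depend on [k], so Fatou's lemma removes the damping. *)
apply: (@le_trans _ _ (\int[mu]_x limn_einf (fun k => (gamk k x * normc (fourier f x) ^+ 2)%:E))%E).
  by rewrite le_eqVlt; apply/orP; left; apply/eqP; apply: eq_integral => x _; rewrite lims.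
apply: (le_trans (fatou mu measurableT mk (fun k x _ => k0 k x))).
exact: limn_einf_le.
Qed.

(** The multiplication formula moves the transform onto |h|^2, whose transform is the
    autocorrelation of [fourier h]; the L^1 norm of the latter is at most the square of that of
    [fourier h]. In Carleman's inequality [g] is a damped unimodular kernel. *)
Lemma normc_cI_fourier h g : cintble mu h -> cintble mu (fourier h) ->
  (forall z, h z = fourier (fourier h) (- z)) -> (exists M, forall z, normc (h z) <= M) ->
  cintble mu g -> (forall x, normc (g x) <= 1) ->
  ((normc (cI mu (fun z => h z * conjc (h z) * fourier g z)))%:E <=
   (\int[mu]_x (normc (fourier h x))%:E) * (\int[mu]_x (normc (fourier h x))%:E))%E.
Proof.
move=> hi Hi inv [M hM] gi g1.
have mh := cintble_meas hi; have mH := cintble_meas Hi.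
have nH := cmeas_normc mH.
have hhi : cintble mu (fun z => h z * conjc (h z)).
  by apply: (cintbleMb (b := M) (cintbleJ hi)).
have ggi : cintble mu (fun x => g x * fourier (fun z => h z * conjc (h z)) x).
  under eq_fun do rewrite mulrC.
  apply: (cintbleMb (b := fine (\int[mu]_y (normc (h y * conjc (h y)))%:E)%E) gi).
    exact: cmeas_fourier.
  move=> x; rewrite -lee_fin fineK ?normc_fourier//.
  by rewrite ge0_fin_numE ?cintble_fin// integral_ge0// => y _; rewrite lee_fin normc_ge0.
have inner x : fourier (fun z => h z * conjc (h z)) x = cI mu (fun y => conjc (fourier h y) * fourier h (x + y)).
  have hki := cintble_kern x hi.
  rewrite fourierE (@eq_cI _ _ _ mu _ (fun z => (h z * kern x z) * fourier (fun y => conjc (fourier h y)) z)); last first.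
    by move=> z; rewrite fourier_conj// -inv; ring.
  rewrite (fourier_mult hki (cintbleJ Hi)).
  by apply: eq_cI => y; rewrite fourier_kern.
rewrite (fourier_mult hhi gi); apply: (le_trans (normc_cI ggi)).
have m2 : measurable_fun setT (fun p : V * V => (normc (fourier h p.2) * normc (fourier h (p.1 + p.2)))%:E).
  apply/measurable_EFinP; apply: measurable_funM; first exact: (measurableT_comp nH measurable_snd).
  by apply: (measurableT_comp nH); exact: measurable_rV_add.
have m20 (p : V * V) : (0 <= (normc (fourier h p.2) * normc (fourier h (p.1 + p.2)))%:E)%E.
  by rewrite lee_fin !mulr_ge0 ?normc_ge0.
apply: (@le_trans _ _ (\int[mu]_x \int[mu]_y (normc (fourier h y) * normc (fourier h (x + y)))%:E)%E).
  apply: ge0_le_integral => //.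
  - by move=> x _; rewrite lee_fin normc_ge0.
  - by apply: emeas_normc; exact: cintble_meas ggi.
  - exact: (measurable_fun_fubini_tonelli_F (m2 := mu) _ m2 m20).
  - move=> x _; rewrite normcMl inner.
    apply: (@le_trans _ _ (normc (cI mu (fun y => conjc (fourier h y) * fourier h (x + y))))%:E).
      by rewrite lee_fin ler_piMl ?normc_ge0.
    have Hs := (cI_shift x Hi).1.
    have i4 : cintble mu (fun y => conjc (fourier h y) * fourier h (x + y)).
      under eq_fun do rewrite (addrC x).
      apply: (cintbleMb (b := fine (\int[mu]_y (normc (h y))%:E)%E) Hs); first exact: cmeasJ.
      move=> y; rewrite normc_conj -lee_fin fineK ?normc_fourier//.
      by rewrite ge0_fin_numE ?cintble_fin// integral_ge0// => z _; rewrite lee_fin normc_ge0.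
    apply: (le_trans (normc_cI i4)); rewrite le_eqVlt; apply/orP; left; apply/eqP.
    by apply: eq_integral => y _; rewrite normcMl normc_conj.
have -> : (\int[mu]_x \int[mu]_y (normc (fourier h y) * normc (fourier h (x + y)))%:E =
  \int[mu]_y \int[mu]_x (normc (fourier h y) * normc (fourier h (x + y)))%:E)%E.
  exact: (fubini_tonelli (m1 := mu) (m2 := mu) _ m2 m20).
have e0 : (0 <= \int[mu]_x (normc (fourier h x))%:E)%E.
  by apply: integral_ge0 => x _; rewrite lee_fin normc_ge0.
rewrite -ge0_integralZr//; last 2 first.
- by apply/measurable_EFinP; exact: nH.
- by move=> x _; rewrite lee_fin normc_ge0.
rewrite le_eqVlt; apply/orP; left; apply/eqP; apply: eq_integral => y _.
under eq_integral do rewrite EFinM.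
have mHs : measurable_fun setT (fun x : V => (normc (fourier h (x + y)))%:E).
  apply/measurable_EFinP; apply: (measurableT_comp nH); exact: measurable_rV_shift.
have Eint : (\int[mu]_x (normc (fourier h (x + y)))%:E = \int[mu]_x (normc (fourier h x))%:E)%E.
  apply: (integral_shift y (F := fun x : V => (normc (fourier h x))%:E)).
    by apply/measurable_EFinP; exact: nH.
  by move=> x; rewrite lee_fin; exact: normc_ge0.
rewrite (@ge0_integralZl _ _ R mu setT measurableT (fun x : V => (normc (fourier h (x + y)))%:E) mHs); last 2 first.
- by move=> x _; rewrite lee_fin; exact: normc_ge0.
- by rewrite lee_fin; exact: normc_ge0.
by rewrite Eint.
Qed.

End fourier_transform.

(** * Hahn-Banach, convex separation and the Mahler type bound *)

Section hahn_banach.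
Context (R : realType) (E : lmodType R) (D F : set E) (p f : E -> R).
Hypotheses (D0 : D 0) (DL : forall (t : R) x y, D x -> D y -> D (t *: x + y)).
Hypotheses (pD : forall x y, D x -> D y -> p (x + y) <= p x + p y)
  (pZ : forall (t : R) x, 0 < t -> D x -> p (t *: x) = t * p x).
Hypotheses (FD : F `<=` D) (F0 : F 0)
  (FL : forall (t : R) x y, F x -> F y -> F (t *: x + y))
  (fL : forall (t : R) x y, F x -> F y -> f (t *: x + y) = t * f x + f y)
  (fp : forall x, F x -> f x <= p x).

(** A partial extension is encoded by its graph, a linear set of pairs; single-valuedness follows
    from domination by [p]. The domain [D] is a subspace of [E], so that integrable functions can be
    treated inside the space of all functions. *)
Let dominated_graph (G : set (E * R)) :=
  [/\ forall x, F x -> G (x, f x), forall q, G q -> D q.1 /\ q.2 <= p q.1 &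
      forall (t : R) x a y b, G (x, a) -> G (y, b) -> G (t *: x + y, t * a + b)].

Let p0 : p 0 = 0.
Proof.
have h : p ((2 : R) *: 0) = 2 * p 0 by exact: pZ.
by move: h; rewrite scaler0 => h; lra.
Qed.

Let dominated_graph_f : dominated_graph [set q | F q.1 /\ q.2 = f q.1].
Proof.
split=> //.
- by move=> [x a] /= [Fx ->]; split; [exact: FD|exact: fp].
- by move=> t x a y b /= [Fx ->] [Fy ->]; rewrite fL//; split => //; exact: FL.
Qed.

Let dominated_graph0 G : dominated_graph G -> G (0, 0).
Proof.
case=> h _ _; have := h _ F0.
have := @fL 1 0 0 F0 F0; rewrite scale1r addr0 mul1r => e.
by rewrite (_ : f 0 = 0)//; lra.
Qed.

Let dominated_graph_fun G x a b : dominated_graph G -> G (x, a) -> G (x, b) -> a = b.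
Proof.
move=> [h hp hL] Ga Gb; apply/le_anti/andP; split.
- have /hp[_ /=] := hL (-1) _ _ _ _ Gb Ga.
  by rewrite scaleN1r addNr p0; lra.
- have /hp[_ /=] := hL (-1) _ _ _ _ Ga Gb.
  by rewrite scaleN1r addNr p0; lra.
Qed.

Let dominated_graph_extend G x0 : dominated_graph G -> D x0 -> (forall a, ~ G (x0, a)) ->
  exists2 B, G `<` B & dominated_graph B.
Proof.
move=> GG Dx0 Gx0; have [h hp hL] := GG; have G0 := dominated_graph0 GG.
have DN x : D x -> D (- x).
  by move=> Dx; have := DL (-1) Dx D0; rewrite scaleN1r addr0.
have DA x y : D x -> D y -> D (x + y).
  by move=> Dx Dy; have := DL 1 Dx Dy; rewrite scale1r.
(* A value c at [x0] must satisfy a - p (x0' ) <= c <= p (x + x0) - a with x0' = x - x0 in the lower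
   bound, for all pairs of the graph. Subadditivity puts every lower bound below every upper bound;
   c is the supremum of the lower ones. *)
pose S := [set q.2 - p (q.1 - x0) | q in G].
have Sub x a : G (x, a) -> ubound S (p (x + x0) - a).
  move=> Ga _ [[y b] Gb <-] /=.
  have /hp[_ /=] := hL 1 _ _ _ _ Ga Gb; rewrite scale1r mul1r.
  have [Dx _] := hp _ Ga; have [Dy _] := hp _ Gb; simpl in Dx, Dy.
  have := pD (DA _ _ Dx Dx0) (DA _ _ Dy (DN _ Dx0)).
  by rewrite addrACA subrr addr0; lra.
have S0 : S !=set0 by exists (0 - p (0 - x0)), (0, 0).
pose c := sup S.
have c1 x a : G (x, a) -> a + c <= p (x + x0).
  by move=> Ga; rewrite addrC -lerBrDr; apply: ge_sup => //; exact: Sub Ga.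
have c2 x a : G (x, a) -> a - c <= p (x - x0).
  move=> Ga; rewrite lerBlDr -lerBlDl; apply: ub_le_sup; last by exists (x, a).
  by exists (p (x + x0) - a); exact: Sub.
exists [set q | exists x a t, G (x, a) /\ q = (x + t *: x0, a + t * c)].
  split; last first.
    move=> /(_ (x0, c)); have h2 : G (x0, c) -> False by exact: Gx0.
    move=> h1; apply/h2/h1; exists 0, 0, 1; split => //.
    by rewrite !add0r scale1r mul1r.
  by move=> [x a] Ga /=; exists x, a, 0; rewrite scale0r mul0r !addr0.
split.
- by move=> x Fx; exists x, (f x), 0; rewrite scale0r mul0r !addr0; split => //; exact: h.
- move=> _ /= [x [a [t [Ga ->]]]] /=; have [Dx /= ap] := hp _ Ga; simpl in Dx.
  split; first by rewrite addrC; exact: DL.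
  have [t0|t0|<-] := ltgtP 0 t; last by rewrite scale0r mul0r !addr0.
  + have Gt : G (t^-1 *: x, t^-1 * a).
      by have := hL t^-1 _ _ _ _ Ga G0; rewrite !addr0.
    have := c1 _ _ Gt; rewrite -(ler_pM2l t0) -pZ//; last first.
      by apply: DA => //; have [] := hp _ Gt.
    by rewrite scalerDr scalerA mulrDr mulrA divff ?gt_eqF// scale1r mul1r.
  + have t0' : 0 < - t by rewrite oppr_gt0.
    have Gt : G ((- t)^-1 *: x, (- t)^-1 * a).
      by have := hL (- t)^-1 _ _ _ _ Ga G0; rewrite !addr0.
    have := c2 _ _ Gt; rewrite -(ler_pM2l t0') -pZ//; last first.
      by apply: DA; [have [] := hp _ Gt|exact: DN].
    rewrite scalerBr scalerA mulrBr mulrA divff ?gt_eqF// scale1r mul1r.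
    by rewrite scaleNr opprK mulNr opprK.
- move=> s x a y b /= [x1 [a1 [t1 [Ga1 [-> ->]]]]] [x2 [a2 [t2 [Ga2 [-> ->]]]]].
  exists (s *: x1 + x2), (s * a1 + a2), (s * t1 + t2); split; first exact: hL.
  congr (_, _); last by ring.
  by rewrite scalerDr scalerA scalerDl addrACA.
Qed.

Theorem hahn_banach : exists g : E -> R,
  [/\ forall x, F x -> g x = f x, forall x, D x -> g x <= p x &
      forall (t : R) x y, D x -> D y -> g (t *: x + y) = t * g x + g y].
Proof.
pose P := [set G | G = set0 \/ dominated_graph G].
have [C CP Ctot|A [PA Amax]] := @Zorn_bigcup _ P.
  have [h0|/existsNP[G /not_implyP[CG G0]]] := pselect (forall G, C G -> G = set0).
    left; apply/seteqP; split => // q [G CG]; rewrite (h0 _ CG)//.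
  right; have GG : dominated_graph G by have [] := CP _ CG.
  split.
  - by move=> x Fx; exists G => //; have [h _ _] := GG; exact: h.
  - move=> q [G' CG' Gq]; have [G0'|[_ h _]] := CP _ CG'; last exact: h.
    by move: Gq; rewrite G0'.
  - move=> t x a y b [G1 C1 g1] [G2 C2 g2].
    have ne X q : C X -> X q -> dominated_graph X.
      by move=> CX Xq; have [X0|//] := CP _ CX; move: Xq; rewrite X0.
    have [h|h] := Ctot _ _ C1 C2.
    + exists G2 => //; have [_ _ hL] := ne _ _ C2 g2; apply: hL => //; exact: h.
    + exists G1 => //; have [_ _ hL] := ne _ _ C1 g1; apply: hL => //; exact: h.
have {PA}GA : dominated_graph A.
  case: PA => // A0; exfalso; apply: (Amax _ _ (or_intror dominated_graph_f)).
  rewrite A0; split => // /(_ (0, f 0)); exact.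
have dom x : D x -> exists a, A (x, a).
  move=> Dx; apply: contrapT => /forallNP Ax.
  have [B AB BB] := dominated_graph_extend GA Dx Ax.
  by apply: (Amax _ AB); right.
have /choice[g gA] : forall x, exists a, D x -> A (x, a).
  move=> x; have [Dx|nDx] := pselect (D x); last by exists 0.
  by have [a Aa] := dom _ Dx; exists a.
exists g; have [h hp hL] := GA; split.
- by move=> x Fx; apply: (dominated_graph_fun GA (gA _ (FD Fx))); exact: h.
- by move=> x /gA /hp[].
- move=> t x y Dx Dy; apply: (dominated_graph_fun GA (gA _ (DL t Dx Dy))).
  by apply: hL; exact: gA.
Qed.

End hahn_banach.

(** * Separation of a point from an open convex set *)

Section separation.
Context (R : realType) (n : nat).
Local Notation V := 'rV[R]_n.
Implicit Types (K : set V) (x y z : V).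

Lemma rV_nbhs_ball K z : open K -> K z ->
  exists2 r : R, 0 < r & forall x, (forall i, `|x ord0 i| < r) -> K (z + x).
Proof.
move=> oK Kz.
have /nbhs_ballP[r /= r0 hr] : nbhs z K by exact: open_nbhs_nbhs.
exists r => // x xr; apply: hr; split => // i j /=; rewrite ord1 !mxE/=.
by rewrite /ball/= opprD addrA subrr sub0r normrN.
Qed.

Definition rVconvex K := forall x y (t : R), K x -> K y -> 0 <= t -> t <= 1 ->
  K (t *: x + (1 - t) *: y).

Lemma convex_setP K : convex_set (K : set (convex_lmodType V)) -> rVconvex K.
Proof.
move=> cK x y t Kx Ky t0 t1.
have := cK x y (Itv01 t0 t1); rewrite !inE => /(_ Kx Ky).
by rewrite /conv /=.
Qed.

Lemma dotv_delta x i : dotv x (delta_mx ord0 i) = x ord0 i.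
Proof.
rewrite /dotv (bigD1 i)//= mxE !eqxx mulr1 big1 ?addr0// => j ji.
by rewrite mxE (negbTE ji) mulr0.
Qed.

Lemma dotv0r x : dotv x 0 = 0.
Proof. by rewrite /dotv big1// => i _; rewrite mxE mulr0. Qed.

Lemma linear_dotv (g : V -> R) : (forall (t : R) x y, g (t *: x + y) = t * g x + g y) ->
  exists x, forall v, g v = dotv v x.
Proof.
move=> gL.
have g0 : g 0 = 0 by have := gL 1 0 0; rewrite scale1r addr0 mul1r; lra.
exists (\row_i g (delta_mx ord0 i)) => v.
rewrite {1}(row_sum_delta v) /dotv.
elim: (index_enum 'I_n) => [|i s IH]; first by rewrite !big_nil.
by rewrite !big_cons gL IH mxE.
Qed.

(* The gauge of [K - z] is a sublinear majorant of the functional sending [p - z] to 1. *)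
Lemma open_convex_separation K z p : open K -> rVconvex K -> K z -> ~ K p ->
  exists x, forall w, K w -> dotv w x < dotv p x.
Proof.
move=> oK cK Kz nKp.
have [r r0 hr] := rV_nbhs_ball oK Kz.
pose T (v : V) := [set t : R | 0 < t /\ K (z + t^-1 *: v)].
pose g (v : V) := inf (T v).
have T0 v : T v !=set0.
  have s0 : 0 <= \sum_i `|v ord0 i| by apply: sumr_ge0.
  exists ((1 + \sum_i `|v ord0 i|) / r); split.
    by apply: divr_gt0 => //; lra.
  apply: hr => i; rewrite mxE normrM invfM invrK.
  have si : `|v ord0 i| <= \sum_i `|v ord0 i|.
    by rewrite (bigD1 i)//= lerDl; apply: sumr_ge0.
  rewrite ger0_norm; last by rewrite mulr_ge0 ?invr_ge0//; lra.
  rewrite mulrAC gtr_pMl// ltr_pdivrMl; lra.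
have Tlb v : has_lbound (T v) by exists 0 => t [/ltW].
have gge0 v : 0 <= g v by apply: lb_le_inf => // t [/ltW].
have gle v t : T v t -> g v <= t by move=> vt; exact: ge_inf.
have gZ c v : 0 < c -> g (c *: v) <= c * g v.
  move=> c0; rewrite -ler_pdivrMl//; apply: lb_le_inf => // t [t0 Kt].
  rewrite ler_pdivrMl//; apply: gle; split; first exact: mulr_gt0.
  by rewrite scalerA invfM mulrAC mulVf ?gt_eqF// mul1r.
have gD v w : setT v -> setT w -> g (v + w) <= g v + g w.
  move=> _ _; rewrite -lerBlDr; apply: lb_le_inf => // t [t0 Kt].
  rewrite lerBlDr -lerBlDl; apply: lb_le_inf => // s [s0 Ks].
  rewrite lerBlDl; apply: gle; split; first exact: addr_gt0.
  have ts0 : 0 < t + s by exact: addr_gt0.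
  (* Subadditivity of the gauge: the point is the convex combination of the two given ones with
     weights proportional to t and s. *)
  have -> : z + (t + s)^-1 *: (v + w) =
      (t / (t + s)) *: (z + t^-1 *: v) + (1 - t / (t + s)) *: (z + s^-1 *: w).
    have -> : 1 - t / (t + s) = s / (t + s) by field; rewrite gt_eqF.
    rewrite !scalerDr !scalerA addrACA -scalerDl -mulrDl divff ?gt_eqF// scale1r.
    by rewrite !(mulrAC _ (t + s)^-1) !divff ?gt_eqF// mul1r.
  apply: cK => //; first by rewrite divr_ge0// ltW.
  by rewrite ler_pdivrMr// mul1r lerDl ltW.
pose v0 := p - z.
have [i v0i] : exists i, v0 ord0 i != 0.
  apply: contrapT => /forallNP h; apply: nKp.
  suff : v0 = 0 by move=> /eqP; rewrite subr_eq0 => /eqP ->.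
  by apply/rowP => i; rewrite [RHS]mxE; apply/eqP/negPn/negP/h.
pose F := [set s *: v0 | s in [set: R]].
pose f (v : V) := v ord0 i / v0 ord0 i.
have fE s : f (s *: v0) = s by rewrite /f mxE mulfK.
have pZ (t : R) v : 0 < t -> setT v -> g (t *: v) = t * g v.
  move=> t0 _; apply/le_anti; rewrite gZ//=.
  rewrite -ler_pdivlMl//; apply: le_trans (gZ t^-1 _ _); last by rewrite invr_gt0.
  by rewrite scalerA mulVf ?gt_eqF// scale1r.
have F0 : F 0 by exists 0 => //; rewrite scale0r.
have FL (t : R) v w : F v -> F w -> F (t *: v + w).
  move=> [c _ <-] [e _ <-]; exists (t * c + e) => //.
  by rewrite scalerDl scalerA.
have fL (t : R) v w : F v -> F w -> f (t *: v + w) = t * f v + f w.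
  by move=> [c _ <-] [e _ <-]; rewrite scalerA -scalerDl !fE.
have fg v : F v -> f v <= g v.
  move=> [s _ <-]; rewrite fE.
  have [s0|s0] := leP s 0; first exact: le_trans s0 (gge0 _).
  apply: lb_le_inf => // t [t0 Kt]; rewrite leNgt; apply/negP => ts.
  apply: nKp; have := cK _ _ (t / s) Kt Kz.
  have ts0 : 0 <= t / s by rewrite divr_ge0// ltW.
  have ts1 : t / s <= 1 by rewrite ler_pdivrMr// mul1r ltW.
  move=> /(_ ts0 ts1).
  rewrite scalerDr addrAC -scalerDl (addrC (t / s)) subrK scale1r !scalerA.
  have -> : t / s / t * s = 1 by field; rewrite !gt_eqF.
  by rewrite scale1r addrC subrK.
have [G [GF Gg GL]] := @hahn_banach R V setT F g f I (fun _ _ _ _ _ => I) gD pZ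
  (fun _ _ => I) F0 FL fL fg.
have [x xG] : exists x, forall v, G v = dotv v x.
  by apply: linear_dotv => t v w; exact: GL.
exists x => w Kw.
have Gp : G v0 = 1.
  rewrite GF; first by rewrite -(scale1r v0) fE.
  by exists 1 => //; rewrite scale1r.
(* Openness makes the inequality strict: [w] can be pushed away from [z] by a factor 1 + d inside
   [K], so the gauge of w - z is at most the inverse of 1 + d. *)
have [r' r'0 hr'] := rV_nbhs_ball oK Kw.
have s0 : 0 <= \sum_i `|(w - z) ord0 i| by apply: sumr_ge0.
pose d := r' / (1 + \sum_i `|(w - z) ord0 i|).
have d0 : 0 < d by apply: divr_gt0 => //; lra.
have : T (w - z) (1 + d)^-1.
  have d1 : 0 < 1 + d by lra.
  split; first by rewrite invr_gt0.
  rewrite invrK scalerDl scale1r addrA (addrC z) subrK.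
  apply: hr' => j; rewrite mxE normrM ger0_norm ?ltW//.
  have sj : `|(w - z) ord0 j| <= \sum_i `|(w - z) ord0 i|.
    by rewrite (bigD1 j)//= lerDl; apply: sumr_ge0.
  rewrite /d -mulrA gtr_pMr// ltr_pdivrMl; lra.
move=> /gle /(le_trans (Gg _ I)) h.
have d1 : (1 + d)^-1 < 1 by rewrite invf_lt1; lra.
have := le_lt_trans h d1; rewrite -Gp !xG /v0 !dotvDl !dotvNl; lra.
Qed.

End separation.

(** * Near-Auerbach bases *)

Section auerbach.
Context (R : realType).
Local Notation V n := 'rV[R]_n.
Local Notation mu n := (lebesgue_rV R n).

Definition row_comb n (a : 'I_n -> V n) (c : V n) : V n := \sum_i c ord0 i *: a i.
Definition row_dot n (a : 'I_n -> V n) (v : V n) : V n := \row_i dotv v (a i).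

(** [d] stands for the modulus of a determinant. The same value serves [row_comb a] and [row_dot a],
    which are given by a matrix and its transpose. *)
Definition scales_lebesgue n (d : R) (phi : V n -> V n) :=
  measurable_fun setT phi /\ forall F : V n -> \bar R, measurable_fun setT F ->
    (forall x, 0 <= F x)%E -> (d%:E * (\int[mu n]_x F (phi x)) = \int[mu n]_x F x)%E.

(** When the first vector is maximal up to a factor 2, its coefficient is at most 2 plus, for each
    of the [m] other vectors, twice the bound on their coefficients. The last summand makes the
    constant dominate that of the previous dimension. *)
Fixpoint auerbach_const (n : nat) : R :=
  if n is m.+1 then 2 + 2 * m%:R * auerbach_const m + auerbach_const m else 0.

Lemma auerbach_const_ge0 n : 0 <= auerbach_const n.
Proof. by elim: n => //= n IH; rewrite addr_ge0// addr_ge0// !mulr_ge0. Qed.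

Lemma measurable_rV_cons2 d (T : measurableType d) n (f : T -> R) (g : T -> V n) :
  measurable_fun setT f -> measurable_fun setT g ->
  measurable_fun setT (fun x => rV_cons (f x, g x)).
Proof.
move=> mf mg; apply: (measurableT_comp (@measurable_rV_cons R n)).
exact: measurable_fun_pair.
Qed.

Lemma measurable_tail n : measurable_fun setT (fun z : V n.+1 => (rV_uncons z).2).
Proof. exact: (measurableT_comp measurable_snd (@measurable_rV_uncons R n)). Qed.

Lemma measurable_rVZ d (T : measurableType d) n (f : T -> R) (s : V n) :
  measurable_fun setT f -> measurable_fun setT (fun x => f x *: s).
Proof.
move=> mf; apply: measurable_fun_rV => i.
rewrite (_ : _ \o _ = fun x => f x * s ord0 i); first exact: measurable_funM.
by apply/funext => x; rewrite /rV_coord/= mxE.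
Qed.

Lemma row0_eq (x y : V 0) : x = y.
Proof. by apply/rowP => -[]. Qed.

(* Greedy choice: each vector nearly maximizes the first coordinate left after
   eliminating the previous ones, so both maps are products of block triangular
   ones. *)
Lemma near_auerbach_basis n (A : set (V n)) (M : R) :
  (forall x i, A x -> `|x ord0 i| <= M) ->
  (forall u : V n, u != 0 -> exists2 x, A x & dotv u x != 0) ->
  exists (a : 'I_n -> V n) (d : R), [/\ forall i, A (a i), 0 < d,
    scales_lebesgue d (row_comb a), scales_lebesgue d (row_dot a) &
    forall x, A x -> exists2 c, x = row_comb a c & forall i, `|c ord0 i| <= auerbach_const n].
Proof.
elim: n A M => [|n IH] A M AM Asp.
  exists (fun=> 0), 1; split => //.
  - by case.
  - split; first by apply: measurable_fun_rV; case.
    by move=> F _ _; rewrite mul1e; apply: eq_integral => x _; congr F; exact: row0_eq.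
  - split; first by apply: measurable_fun_rV; case.
    by move=> F _ _; rewrite mul1e; apply: eq_integral => x _; congr F; exact: row0_eq.
  - by move=> x _; exists 0 => [|[]//]; exact: row0_eq.
pose S := [set `|x ord0 ord0| | x in A].
have Sub : has_ubound S by exists M => _ [x Ax <-]; exact: AM.
have [x0 Ax0 x00] : exists2 x, A x & x ord0 ord0 != 0.
  have [|x Ax] := Asp (delta_mx ord0 ord0).
    by apply/eqP => /rowP /(_ ord0); rewrite !mxE !eqxx => /eqP; rewrite oner_eq0.
  by rewrite dotvC dotv_delta => ?; exists x.
have S0 : 0 < sup S.
  apply: (@lt_le_trans _ _ `|x0 ord0 ord0|); first by rewrite normr_gt0.
  by apply: ub_le_sup => //; exists x0.
have [a Aa ha] : exists2 a, A a & sup S / 2 < `|a ord0 ord0|.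
  have [||_ [a Aa <-] h] := @sup_adherent _ S (sup S / 2); first by lra.
    by split=> //; exists `|x0 ord0 ord0|, x0.
  by exists a => //; lra.
have a0 : a ord0 ord0 != 0 by rewrite -normr_gt0; lra.
have Aa2 x : A x -> `|x ord0 ord0| <= 2 * `|a ord0 ord0|.
  move=> Ax; have : `|x ord0 ord0| <= sup S by apply: ub_le_sup => //; exists x.
  lra.
pose s := (a ord0 ord0)^-1 *: (rV_uncons a).2.
(* [y x] is the tail of [x] after subtraction of the multiple of [a] that cancels the head; the
   induction hypothesis is applied to these tails. *)
pose y (x : V n.+1) := (rV_uncons x).2 - x ord0 ord0 *: s.
have yE x i : y x ord0 i = x ord0 (lift ord0 i) - x ord0 ord0 * s ord0 i.
  by rewrite !mxE.
have sE i : s ord0 i * a ord0 ord0 = a ord0 (lift ord0 i).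
  by rewrite !mxE mulrC mulrA divff// mul1r.
have dotE (u : V n) x : dotv u (y x) = dotv (rV_cons (- dotv u s : R, u)) x.
  rewrite {2}/dotv big_ord_recl rV_cons0.
  under eq_bigr do rewrite rV_consS.
  rewrite /y dotvDr dotvNr dotvZr mulNr mulrC addrC; congr (_ + _).
  by apply: eq_bigr => i _; rewrite mxE.
clearbody y s.
have [|u u0|b [d [Ab d0 [mrc rc] [mrd rd] bspan]]] := IH (y @` A) (M + M * \sum_i `|s ord0 i|).
- move=> _ i [x Ax <-]; rewrite yE; apply: (le_trans (ler_normB _ _)).
  apply: lerD; first exact: AM.
  rewrite normrM; apply: ler_pM => //; first exact: AM.
  by rewrite (bigD1 i)//= lerDl; apply: sumr_ge0.
- have [|x Ax h] := Asp (rV_cons (- dotv u s : R, u)).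
    apply: contra u0 => /eqP /rowP h; apply/eqP/rowP => i.
    by have := h (lift ord0 i); rewrite rV_consS !mxE.
  by exists (y x); [exists x|rewrite dotE].
have /choice[xs hxs] : forall i, exists x, A x /\ y x = b i.
  by move=> i; have [x Ax h] := Ab i; exists x.
pose a' (i : 'I_n.+1) := if unlift ord0 i is Some j then xs j else a.
have a'0 : a' ord0 = a by rewrite /a' unlift_none.
have a'S j : a' (lift ord0 j) = xs j by rewrite /a' liftK.
pose t : V n := \row_i xs i ord0 ord0.
have tE i : t ord0 i = xs i ord0 ord0 by rewrite mxE.
clearbody t.
have xsS i j : xs i ord0 (lift ord0 j) = b i ord0 j + t ord0 i * s ord0 j.
  by rewrite -(hxs i).2 yE tE subrK.
have one1 : (1 : R) != 0 := oner_neq0 R.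
have idP G : measurable_fun setT G -> (forall x : V n, 0 <= G x)%E ->
    (1%:E * (\int[mu n]_x G (id x)) = \int[mu n]_x G x)%E by move=> *; rewrite mul1e.
(* The linear map is a block triangular map followed by a shear. Its transpose, treated next, uses
   the transposed factors in reverse order, hence scales the measure by the same [d]. *)
have rcE c : row_comb a' c = (fun z : V n.+1 =>
    rV_cons ((rV_uncons z).1 * 1 : R, (rV_uncons z).2 + (rV_uncons z).1 *: s))
    (rV_cons ((rV_uncons c).1 * a ord0 ord0 + dotv (rV_uncons c).2 t : R, row_comb b (rV_uncons c).2)).
  apply/rowP => i; rewrite /row_comb summxE big_ord_recl a'0 mxE.
  under eq_bigr do rewrite a'S mxE.
  rewrite rV_consK /=; have [j ->|->] := unliftP ord0 i.
    rewrite rV_consS !mxE summxE mulrDl addrCA; congr (_ + _).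
      by rewrite -mulrA (mulrC (a _ _)) sE.
    rewrite /dotv mulr_suml -big_split/=; apply: eq_bigr => k _.
    by rewrite !mxE xsS mulrDr mulrA.
  rewrite rV_cons0 mulr1; congr (_ + _).
  by apply: eq_bigr => k _; rewrite !mxE tE.
have rdE v : row_dot a' v = (fun z : V n.+1 =>
    rV_cons ((rV_uncons z).1 * a ord0 ord0 : R, row_dot b (rV_uncons z).2 + (rV_uncons z).1 *: t))
    (rV_cons ((rV_uncons v).1 * 1 + dotv s (rV_uncons v).2 : R, id (rV_uncons v).2)).
  apply/rowP => i; rewrite rV_consK /= mxE; have [j ->|->] := unliftP ord0 i.
    rewrite a'S rV_consS !mxE /dotv big_ord_recl mulr1 mulrDl addrCA; congr (_ + _).
      by rewrite tE.
    rewrite mulr_suml -big_split/=; apply: eq_bigr => k _.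
    by rewrite !mxE xsS; ring.
  rewrite a'0 rV_cons0 mulr1 mulrDl /dotv big_ord_recl; congr (_ + _).
  rewrite mulr_suml; apply: eq_bigr => k _.
  by rewrite -sE !mxE; ring.
exists a', (`|a ord0 ord0| * d); split.
- by move=> i; rewrite /a'; case: unliftP => [j _|_]; [have [] := hxs j|].
- by rewrite mulr_gt0// normr_gt0.
- split.
    apply: measurable_fun_rV => i; rewrite /comp /rV_coord /row_comb.
    under eq_fun do (rewrite summxE; under eq_bigr do rewrite mxE).
    by apply: measurable_sum => j; apply: measurable_funM => //; exact: measurable_coord.
  move=> F mF F0; rewrite (eq_integral _ _ (fun c _ => congr1 F (rcE c))).
  have msh : measurable_fun setT (fun z : V n.+1 =>
    rV_cons ((rV_uncons z).1 * 1 : R, (rV_uncons z).2 + (rV_uncons z).1 *: s) : V n.+1).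
    apply: measurable_rV_cons2.
      by apply: measurable_funM => //; exact: measurable_coord.
    apply: measurable_rVD; first exact: measurable_tail.
    by apply: measurable_rVZ; exact: measurable_coord.
  have ml : measurable_fun setT (fun x : V n => dotv x t) by exact: measurable_dotvr.
  pose Sh (z : V n.+1) : V n.+1 :=
    rV_cons ((rV_uncons z).1 * 1 : R, (rV_uncons z).2 + (rV_uncons z).1 *: s).
  transitivity (\int[mu n.+1]_x F (Sh x))%E.
    apply: (integral_block_lower (F := F \o Sh) a0 ml mrc rc (ltW d0)) => //.
      exact: (measurableT_comp mF msh).
    by move=> x; exact: F0.
  rewrite -[RHS](integral_block_upper (F := F) s (phi := id) (c := 1) one1 _ idP)//.
  by rewrite normr1 mulr1 mul1e.
- split.
    apply: measurable_fun_rV => i.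
    rewrite (_ : _ \o _ = fun v => dotv v (a' i)); first exact: measurable_dotvr.
    by apply/funext => v; rewrite /rV_coord/= mxE.
  move=> F mF F0; rewrite (eq_integral _ _ (fun c _ => congr1 F (rdE c))).
  have msh : measurable_fun setT (fun z : V n.+1 =>
    rV_cons ((rV_uncons z).1 * a ord0 ord0 : R, row_dot b (rV_uncons z).2 + (rV_uncons z).1 *: t) : V n.+1).
    apply: measurable_rV_cons2.
      by apply: measurable_funM => //; exact: measurable_coord.
    apply: measurable_rVD; first exact: (measurableT_comp mrd (@measurable_tail n)).
    by apply: measurable_rVZ; exact: measurable_coord.
  rewrite -[RHS](integral_block_upper (F := F) t a0 mrd rd)//; last exact: ltW.
  congr (_ * _)%E.
  have ms : measurable_fun setT (dotv s) by exact: measurable_dotvl.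
  pose Sh (z : V n.+1) : V n.+1 :=
    rV_cons ((rV_uncons z).1 * a ord0 ord0 : R, row_dot b (rV_uncons z).2 + (rV_uncons z).1 *: t).
  transitivity (\int[mu n.+1]_x F (Sh x))%E => //.
  rewrite -[RHS](integral_block_lower (F := F \o Sh) (phi := id) (c := 1) one1 ms _ idP)//.
  - by rewrite normr1 mulr1 mul1e.
  - exact: (measurableT_comp mF msh).
  - by move=> x; exact: F0.
- move=> x Ax; have [|c yc cb] := bspan (y x); first by exists x.
  (* The coefficient of [a] that restores the head of [x] once the other coefficients are [c]. *)
  pose k := (x ord0 ord0 - dotv c t) / a ord0 ord0.
  exists (rV_cons (k : R, c)).
    rewrite rcE !rV_consK /=; apply/rowP => i; have [j ->|->] := unliftP ord0 i.
      by rewrite rV_consS -yc mxE [X in _ = _ + X]mxE yE /k; field.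
    by rewrite rV_cons0 mulr1 /k; field.
  move=> i; have [j ->|->] := unliftP ord0 i.
    rewrite rV_consS /=; apply: le_trans (cb j) _; rewrite lerDr.
    by rewrite addr_ge0// !mulr_ge0// auerbach_const_ge0.
  rewrite rV_cons0 /= /k normrM normfV ler_pdivrMr ?normr_gt0//.
  have : `|dotv c t| <= n%:R * auerbach_const n * (2 * `|a ord0 ord0|).
    apply: (le_trans (ler_norm_sum _ _ _)).
    apply: (@le_trans _ _ (\sum_(i < n) auerbach_const n * (2 * `|a ord0 ord0|))).
      apply: ler_sum => j _; rewrite normrM; apply: ler_pM => //.
      by rewrite tE; apply: Aa2; have [] := hxs j.
    by rewrite sumr_const card_ord -[X in X <= _]mulr_natl mulrA lexx.
  move=> h1; have h2 := Aa2 _ Ax; have h3 := ler_normB (x ord0 ord0) (dotv c t).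
  have h4 : 0 <= auerbach_const n * `|a ord0 ord0| by rewrite mulr_ge0 ?auerbach_const_ge0.
  nra.
Qed.

End auerbach.

(** * Polar sets and the volume product *)

Section polar.
Context (R : realType) (n : nat).
Local Notation V := 'rV[R]_n.
Local Notation mu := (lebesgue_rV R n).
Implicit Types (K : set V) (x y z w v : V).

Definition support_fun K x : \bar R := ereal_sup [set (dotv w x)%:E | w in K].

Lemma continuous_dotvl w : continuous (dotv w : V -> R).
Proof.
move=> x; apply: (@cvg_big R 'I_n (@GRing.add R) 0 xpredT _ V (nbhs x) (index_enum 'I_n)
  (fun i (y : V) => w ord0 i * y ord0 i)).
  by move=> p; exact: add_continuous.
move=> i _.
have h : {for x, continuous (fun y : V => y ord0 i : R)} by exact: coord_continuous.
exact: continuousM (cvg_cst (w ord0 i)) h.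
Qed.

Lemma measurable_support_fun K : measurable_fun setT (support_fun K).
Proof.
apply: (measurability _ (ErealGenOInfty.measurableE R)).
move=> /= _ [_ [a ->]] <-; apply: measurableI => //; apply: open_measurable_rV.
rewrite preimage_itvoy.
rewrite (_ : [set x | _] = \bigcup_(w in K) (dotv w @^-1` [set t | a < t])).
  apply: bigcup_open => w Kw; apply: open_comp; last exact: open_gt.
  by move=> x _; exact: continuous_dotvl.
apply/seteqP; split => x /=.
  by move=> /ereal_sup_gt[_ [w Kw <-]]; rewrite lte_fin => h; exists w.
move=> [w Kw /= h]; apply: (@lt_le_trans _ _ (dotv w x)%:E); first by rewrite lte_fin.
by apply: ereal_sup_ubound; exists w.
Qed.

(* [expR (- (2 pi b_z x))] on the domain of the support function, where
   [b_z x = sup (w - z) . x] over [w] in [K]. *)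
Definition qkern K z x : R :=
  if (support_fun K x < +oo)%E then expR (- (2 * pi * (fine (support_fun K x) - dotv z x))) else 0.

Definition qdens K z : \bar R := (\int[mu]_x (qkern K z x)%:E)%E.

(** The indicator of the symmetrization of K - z. Its integral becomes, after a dilation, the
    overlap measure of the Hankel estimate. *)
Definition symm_ind K z v : R := \1_K (z + v) * \1_K (z - v).

Lemma qkern_ge0 K z x : 0 <= qkern K z x.
Proof. by rewrite /qkern; case: ifP => // _; exact: expR_ge0. Qed.

Lemma measurable_qkern2 K : measurable_fun setT (fun p : V * V => qkern K p.1 p.2).
Proof.
have ms := measurable_support_fun K.
apply: measurable_fun_ifT.
- apply: (measurableT_comp (f := fun x : \bar R => (x < +oo)%E)); last exact: (measurableT_comp ms measurable_snd).
  by apply: measurable_fun_lte => //; exact: measurable_cst.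
- apply: (measurableT_comp (@measurable_expR R)); apply: measurable_funN; apply: measurable_funM => //; apply: measurable_funB.
    by apply: (measurableT_comp (fine_measurable _)) => //; exact: (measurableT_comp ms measurable_snd).
  exact: measurable_dotv.
- exact: measurable_cst.
Qed.

Lemma measurable_qkern K z : measurable_fun setT (qkern K z).
Proof. exact: (measurableT_comp (measurable_qkern2 K) (pair1_measurable z)). Qed.

(** The polar of K - z, which is the sublevel set b_z <= 1; for z in [K] the integrand of [qdens] is
    at least exp (- 2 pi) on it. *)
Definition polar_set K z := [set x | forall w, K w -> dotv (w - z) x <= 1].

Lemma qkern_polar K z x : K z -> polar_set K z x -> expR (- (2 * pi)) <= qkern K z x.
Proof.
move=> Kz Ax.
have su : (support_fun K x <= (1 + dotv z x)%:E)%E.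
  apply: ge_ereal_sup => _ [w Kw <-]; rewrite lee_fin.
  by have := Ax w Kw; rewrite dotvDl dotvNl; lra.
have sl : ((dotv z x)%:E <= support_fun K x)%E by apply: ereal_sup_ubound; exists z.
rewrite /qkern (le_lt_trans su) ?ltry// ler_expR lerN2 ler_piMr ?mulr_ge0 ?pi_ge0// lerBlDr -lee_fin fineK//.
rewrite fin_numE; apply/andP; split.
  by rewrite gt_eqF// (lt_le_trans _ sl)// ltNyr.
by rewrite lt_eqF// (le_lt_trans su)// ltry.
Qed.

Lemma measurable_symm_ind K z : open K -> measurable_fun setT (symm_ind K z).
Proof.
move=> oK; have mK := open_measurable_rV oK.
apply: measurable_funM.
  rewrite (_ : (fun v => _) = \1_K \o (fun v => v + z)); last by apply/funext => v/=; rewrite addrC.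
  by apply: measurableT_comp; [exact: measurable_indic|exact: measurable_rV_shift].
rewrite (_ : (fun v => _) = \1_K \o (fun v => (-1) *: v + z)); last by apply/funext => v/=; rewrite scaleN1r addrC.
apply: measurableT_comp; first exact: measurable_indic.
exact: (measurableT_comp (measurable_rV_shift z) (measurable_rV_scale (-1))).
Qed.

Lemma polar_set_bounded K z : open K -> K z ->
  exists M, forall x i, polar_set K z x -> `|x ord0 i| <= M.
Proof.
move=> oK Kz; have [r r0 hr] := rV_nbhs_ball oK Kz.
exists (2 / r) => x i Ax.
have h (s : R) : `|s| < r -> s * x ord0 i <= 1.
  move=> sr; have Kw : K (z + s *: delta_mx ord0 i).
    apply: hr => j; rewrite !mxE eqxx/=; case: eqP => _; last by rewrite mulr0 normr0.
    by rewrite mulr1.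
  by have := Ax _ Kw; rewrite addrC addKr dotvZl dotvC dotv_delta.
have h1 : (r / 2) * x ord0 i <= 1 by apply: h; rewrite ger0_norm; lra.
have h2 : (- (r / 2)) * x ord0 i <= 1 by apply: h; rewrite normrN ger0_norm; lra.
rewrite ler_norml -mulNr; apply/andP; split; [rewrite ler_pdivrMr//|rewrite ler_pdivlMr//]; nra.
Qed.

Lemma polar_set_sep K z v : open K -> rVconvex K -> K z -> ~ K (z + v) ->
  exists2 x, polar_set K z x & dotv v x = 1.
Proof.
move=> oK cK Kz nK; have [x hx] := open_convex_separation oK cK Kz nK.
have b0 : 0 < dotv v x by have := hx _ Kz; rewrite dotvDl; lra.
exists ((dotv v x)^-1 *: x); last by rewrite dotvZr mulVf// gt_eqF.
move=> w /hx; rewrite dotvZr ler_pdivrMl// mulr1 !dotvDl dotvNl; lra.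
Qed.

(** The absence of lines enters here: if the polar set were orthogonal to [u], no point z + t u
    could be separated from [K], and the whole line would lie in [K]. *)
Lemma polar_set_spans K z (u : V) : open K -> rVconvex K -> ~ contains_affine_line K -> K z ->
  u != 0 -> exists2 x, polar_set K z x & dotv u x != 0.
Proof.
move=> oK cK nl Kz u0; apply: contrapT => h.
apply: nl; exists z, u; split => // t; apply: contrapT => nKt.
have [x Ax] := polar_set_sep oK cK Kz nKt.
rewrite dotvZl => h1; apply: h; exists x => //; apply/eqP => h2.
by move: h1; rewrite h2 mulr0 => /eqP; rewrite eq_sym oner_eq0.
Qed.

(** If the products of v with a near-Auerbach basis of the polar set are at most this width, then |v
    . x| < 1 for every polar x, which keeps z + v and z - v in [K]. In [mahler_const] the factor
    n^-1 is the side of a cube of coefficients whose combinations remain polar. *)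
Definition mahler_width : R := (2 * (n%:R * auerbach_const R n + 1))^-1.
Definition mahler_const : R := expR (- (2 * pi)) * (n%:R^-1 * (2 * mahler_width)) ^+ n.

Lemma mahler_width_gt0 : 0 < mahler_width.
Proof.
rewrite invr_gt0 mulr_gt0//; have := auerbach_const_ge0 R n => h.
have : 0 <= n%:R * auerbach_const R n by apply: mulr_ge0.
lra.
Qed.

Lemma mahler_const_gt0 : 0 < mahler_const.
Proof.
rewrite mulr_gt0 ?expR_gt0//; have := mahler_width_gt0 => h.
rewrite /mahler_const; case: n => [|m]; first by rewrite expr0.
by rewrite exprn_gt0// mulr_gt0// mulr_gt0.
Qed.

Definition cube_ind (a b : R) x : R := \prod_i \1_(`[a, b]%classic : set R) (x ord0 i).

Lemma integral_cube (a b : R) : a <= b ->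
  (\int[mu]_x (cube_ind a b x)%:E = ((b - a) ^+ n)%:E)%E.
Proof.
move=> ab.
rewrite (integral_prod (f := fun=> \1_(`[a, b]%classic : set R)))//.
rewrite (eq_bigr (fun=> (b - a)%:E)); last first.
  move=> i _; transitivity (@lebesgue_measure R `[a, b]%classic).
    by rewrite integral_indic// setIT.
  rewrite lebesgue_measure_itv/= lte_fin.
  case: ltP => [//|ba]; by rewrite (_ : b = a) ?subrr//; apply/le_anti/andP.
by rewrite prodEFin prodr_const card_ord.
Qed.

(** A near-Auerbach basis of the polar set bounds both factors. Combinations with coefficients in
    [0, 1/n] are polar, which makes [qdens] at least d times a constant; vectors with small products
    with the basis belong to the symmetrization, whose measure is at least d^-1 times a constant.
    The factor [d] cancels. *)
Lemma mahler_lower_bound K z : open K -> rVconvex K -> ~ contains_affine_line K -> K z ->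
  (mahler_const%:E <= qdens K z * \int[mu]_v (symm_ind K z v)%:E)%E.
Proof.
move=> oK cK nl Kz.
have [M AM] := polar_set_bounded oK Kz.
have [a [d [Aa d0 [mrc rc] [mrd rd] span]]] :=
  near_auerbach_basis AM (fun u => @polar_set_spans K z u oK cK nl Kz).
have mcube (l r : R) : measurable_fun setT (fun x : V => (cube_ind l r x)%:E).
  apply/measurable_EFinP; apply: (measurable_prod_coord (f := fun=> \1_(`[l, r]%classic : set R))) => i.
  exact: measurable_indic.
have cube0 (l r : R) (x : V) : (0 <= (cube_ind l r x)%:E)%E.
  by rewrite lee_fin prodr_ge0.
have cube_out (l r : R) (x : V) i : ~ (l <= x ord0 i <= r) -> cube_ind l r x = 0.
  move=> h; apply/eqP/prodf_eq0; exists i => //=.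
  by rewrite indicE memNset//= in_itv.
have cube_le1 (l r : R) (x : V) : cube_ind l r x <= 1.
  by apply: numdomain.Num.Theory.prodr_ile1 => i _; rewrite indicE; case: (_ \in _); rewrite ?ler01 lexx.
have hq : ((d * (expR (- (2 * pi)) * n%:R^-1 ^+ n))%:E <= qdens K z)%E.
  have mq : measurable_fun setT (fun x => (qkern K z x)%:E).
    by apply/measurable_EFinP; exact: measurable_qkern.
  rewrite /qdens -rc//; last by move=> x; rewrite lee_fin qkern_ge0.
  rewrite EFinM lee_wpmul2l ?lee_fin ?(ltW d0)//.
  rewrite EFinM -[n%:R^-1]subr0 -integral_cube ?invr_ge0//.
  rewrite -(@ge0_integralZl _ _ R mu setT measurableT _ (mcube 0 n%:R^-1)); last 2 first.
  - by move=> x _; exact: cube0.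
  - by rewrite lee_fin expR_ge0.
  apply: ge0_le_integral => //.
  - by move=> x _; apply: mule_ge0 => //; rewrite lee_fin expR_ge0.
  - by apply: emeasurable_funM => //; exact: measurable_cst.
  - exact: (measurableT_comp mq mrc).
  move=> c _; rewrite -EFinM lee_fin.
  have [cc|/existsNP[i /cube_out ->]] := pselect (forall i, 0 <= c ord0 i <= n%:R^-1); last first.
    by rewrite mulr0 qkern_ge0.
  apply: (@le_trans _ _ (expR (- (2 * pi)))).
    by rewrite ler_piMr ?expR_ge0.
  apply: qkern_polar => // w Kw; rewrite /row_comb.
  have dotv_sum (s : seq 'I_n) u (f : 'I_n -> V) : dotv u (\sum_(i <- s) f i) = \sum_(i <- s) dotv u (f i).
    elim: s => [|i s IH]; first by rewrite !big_nil dotv0r.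
    by rewrite !big_cons dotvDr IH.
  rewrite dotv_sum; apply: (@le_trans _ _ (\sum_(i < n) n%:R^-1)).
    apply: ler_sum => i _; rewrite dotvZr; have /andP[c0 c1] := cc i.
    apply: le_trans c1; rewrite ler_piMr//; exact: Aa.
  rewrite sumr_const card_ord -[X in X <= _]mulr_natr.
  by case: (n) => [|m]; rewrite ?mulr0// mulVf// pnatr_eq0.
have hw : (((2 * mahler_width) ^+ n)%:E <= d%:E * \int[mu]_v (symm_ind K z v)%:E)%E.
  have := mahler_width_gt0 => w0.
  have -> : 2 * mahler_width = mahler_width - (- mahler_width) by lra.
  rewrite -integral_cube; last by lra.
  rewrite -rd// lee_wpmul2l ?lee_fin ?(ltW d0)//.
  apply: ge0_le_integral => //.
  - exact: (measurableT_comp (mcube _ _) mrd).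
  - by apply/measurable_EFinP; exact: measurable_symm_ind.
  move=> v _; rewrite lee_fin.
  have [cc|/existsNP[i /cube_out ->]] := pselect (forall i, - mahler_width <= row_dot a v ord0 i <= mahler_width); last first.
    by rewrite /symm_ind mulr_ge0.
  suff h (s : R) : `|s| = 1 -> K (z + s *: v).
    have h1 : K (z + v) by have := h 1; rewrite scale1r normr1; exact.
    have h2 : K (z - v) by have := h (-1); rewrite scaleN1r normrN1; exact.
    by rewrite /symm_ind !indicE !mem_set// mulr1.
  (* A polar vector separating z + s v from [K] has product 1 with s v, although it is a combination
     of the [a i] with coefficients at most [auerbach_const]. *)
  move=> s1; apply: contrapT => nK.
  have [x /span[c -> cb]] := polar_set_sep oK cK Kz nK.
  have dotv_sum (t : seq 'I_n) u (f : 'I_n -> V) : dotv u (\sum_(i <- t) f i) = \sum_(i <- t) dotv u (f i).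
    elim: t => [|i t IH]; first by rewrite !big_nil dotv0r.
    by rewrite !big_cons dotvDr IH.
  rewrite dotvZl /row_comb dotv_sum => h.
  have : `|s * \sum_i dotv v (c ord0 i *: a i)| <= n%:R * (auerbach_const R n * mahler_width).
    rewrite normrM s1 mul1r; apply: (le_trans (ler_norm_sum _ _ _)).
    rewrite -[X in X%:R * _](card_ord n) mulr_natl -sumr_const; apply: ler_sum => i _.
    rewrite dotvZr normrM ler_pM// ler_norml.
    by have := cc i; rewrite mxE.
  rewrite h normr1 leNgt => /negP; apply.
  rewrite mulrA /mahler_width ltr_pdivrMr; have := auerbach_const_ge0 R n => c0.
  - have : 0 <= n%:R * auerbach_const R n by apply: mulr_ge0.
    lra.
  - rewrite mulr_gt0//; have : 0 <= n%:R * auerbach_const R n by apply: mulr_ge0.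
    lra.
have w0 : (0 <= \int[mu]_v (symm_ind K z v)%:E)%E.
  by apply: integral_ge0 => v _; rewrite lee_fin mulr_ge0.
apply: le_trans (lee_wpmul2r w0 hq).
rewrite (mulrC d) (EFinM (_ * _)%R d) -muleA /mahler_const exprMn mulrA (EFinM (expR _ * _)%R) lee_wpmul2l//.
Qed.

End polar.

(** * Carleman's inequality *)

Arguments Normc.normc : simpl never.
Arguments cI : simpl never.

(** * Gamma integrals with a complex parameter *)

Section gamma_integral.
Context (R : realType).
Local Notation leb := (@lebesgue_measure R).
Local Notation Rpos := (`[0%R, +oo[%classic : set R).

(** The m-th power of x <= exp x at x = c s / m. *)
Lemma exprn_le_expR (m : nat) (c s : R) : 0 < c -> 0 <= s ->
  s ^+ m <= (m%:R / c) ^+ m * expR (c * s).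
Proof.
move=> c0 s0; case: m => [|m]; first by rewrite !expr0 mul1r -expR0 ler_expR mulr_ge0// ltW.
have m0 : 0 < m.+1%:R / c :> R by rewrite divr_gt0.
have -> : expR (c * s) = expR (c * s / m.+1%:R) ^+ m.+1.
  by rewrite -expRM_natl; congr expR; rewrite [RHS]mulrC divfK// pnatr_eq0.
rewrite -exprMn; apply: lerXn2r.
- by rewrite nnegrE.
- by rewrite nnegrE mulr_ge0 ?expR_ge0// ltW.
- rewrite -ler_pdivrMl// invf_div; apply: le_trans (expR_ge1Dx _).
  by rewrite mulrAC lerDr.
Qed.

Lemma integrable_expRNabs (c : R) : 0 < c -> leb.-integrable setT (fun s => (expR (- (c * `|s|)))%:E).
Proof.
move=> c0.
have mE : measurable_fun setT (fun s : R => (expR (- `|s|))%:E).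
  by apply/measurable_EFinP; apply: continuous_measurable_fun; exact: continuous_expRNabs.
have mM : measurable_fun setT (fun s : R => (expR (- (c * `|s|)))%:E).
  apply/measurable_EFinP; apply: (measurableT_comp (@measurable_expR R)); apply: measurable_funN.
  by apply: measurable_funM => //; exact: normr_measurable.
apply/integrableP; split => //.
have := @leb_affine R c 0 (fun s => (expR (- `|s|))%:E) (lt0r_neq0 c0) mE (fun x => expR_ge0 _).
rewrite integral_expRNabs; under eq_integral do rewrite addr0 normrM (ger0_norm (ltW c0)).
under [in X in _ -> X]eq_integral do rewrite abse_EFin (ger0_norm (expR_ge0 _)).
rewrite (ger0_norm (ltW c0)).
set I := (\int[_]_x _)%E; have : (0 <= I)%E by apply: integral_ge0 => x _; rewrite lee_fin expR_ge0.
by case: I => // [r|] _; rewrite ?ltry// gt0_muley// ?lte_fin.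
Qed.

(** Integration by parts is carried out on real and imaginary parts. This lemma and the next
    recombine the two real equations into sigma I_0 = 1 and sigma I_(m+1) = (m + 1) I_m, where sigma
    = al + i be. *)
Lemma cgam_base (al be a b : R) : 0 * a + (- al * a + - be * b) = - 1 ->
  0 * a + (- al * b + be * a) = - 0 -> (a -i* b) * (al +i* be) ^+ 1 = 0`!%:R.
Proof.
move=> h1 h2.
by rewrite expr1 fact0; apply: complex_ext; rewrite ?cReM ?cImM/=; lra.
Qed.

Lemma cgam_step (al be : R) (m : nat) (a b a' b' : R) :
  m%:R * a + (- al * a' + - be * b') = - 0 ->
  m%:R * b + (- al * b' + be * a') = - 0 ->
  (a' -i* b') * (al +i* be) = m%:R * (a -i* b).
Proof.
rewrite -(rmorph_nat (real_complex R)); move: (m%:R : R) => k h1 h2.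
by apply: complex_ext; rewrite ?cReM ?cImM/=; lra.
Qed.

Variables (al be : R).
Hypothesis al0 : 0 < al.

Let gc m (s : R) := s ^+ m * (expR (- (al * s)) * cos (be * s)).
Let gs m (s : R) := s ^+ m * (expR (- (al * s)) * sin (be * s)).

Let is_derive_e (s : R) : is_derive s (1 : R) (fun s => expR (- (al * s))) (- al * expR (- (al * s))).
Proof.
have h : is_derive s (1 : R) (fun s => - (al * s)) (- al).
  by have := is_deriveN (is_deriveZ al (is_derive_id s (1 : R))); rewrite /GRing.scale/= mulr1.
have := @is_derive1_comp R (@expR R) (fun s => - (al * s)) s _ _ (is_derive_expR _) h.
by rewrite mulrC.
Qed.

Let is_derive_b (s : R) : is_derive s (1 : R) (fun s => be * s) be.
Proof. by have := is_deriveZ be (is_derive_id s (1 : R)); rewrite /GRing.scale/= mulr1. Qed.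

Let is_derive_c (s : R) : is_derive s (1 : R) (fun s => expR (- (al * s)) * cos (be * s))
  (- al * (expR (- (al * s)) * cos (be * s)) - be * (expR (- (al * s)) * sin (be * s))).
Proof.
have h := is_deriveM (is_derive_e s) (is_derive1_comp (is_derive_cos (be * s)) (is_derive_b s)).
by apply: (is_derive_eq h); rewrite /GRing.scale/=; ring.
Qed.

Let is_derive_s (s : R) : is_derive s (1 : R) (fun s => expR (- (al * s)) * sin (be * s))
  (- al * (expR (- (al * s)) * sin (be * s)) + be * (expR (- (al * s)) * cos (be * s))).
Proof.
have h := is_deriveM (is_derive_e s) (is_derive1_comp (is_derive_sin (be * s)) (is_derive_b s)).
by apply: (is_derive_eq h); rewrite /GRing.scale/=; ring.
Qed.

Let is_derive_gc0 s : is_derive s (1 : R) (gc 0) (- al * gc 0 s - be * gs 0 s).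
Proof.
rewrite /gc /gs (_ : (fun s => _) = (fun s => expR (- (al * s)) * cos (be * s))).
  by apply: (is_derive_eq (is_derive_c s)); rewrite !expr0 !mul1r.
by apply/funext => t; rewrite expr0 mul1r.
Qed.

Let is_derive_gs0 s : is_derive s (1 : R) (gs 0) (- al * gs 0 s + be * gc 0 s).
Proof.
rewrite /gc /gs (_ : (fun s => _) = (fun s => expR (- (al * s)) * sin (be * s))).
  by apply: (is_derive_eq (is_derive_s s)); rewrite !expr0 !mul1r.
by apply/funext => t; rewrite expr0 mul1r.
Qed.

Let is_derive_X m (s : R) : is_derive s (1 : R) (fun s => s ^+ m.+1) (m.+1%:R * s ^+ m).
Proof.
have h := is_deriveX m.+1 (is_derive_id s (1 : R)).
rewrite exprfctE in h.
by apply: (is_derive_eq h); rewrite /GRing.scale/= mulr1.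
Qed.

Let is_derive_gc m s : is_derive s (1 : R) (gc m.+1)
  (m.+1%:R * gc m s - al * gc m.+1 s - be * gs m.+1 s).
Proof.
have h := is_deriveM (is_derive_X m s) (is_derive_c s).
by apply: (is_derive_eq h); rewrite /gc /gs /GRing.scale/=; ring.
Qed.

Let is_derive_gs m s : is_derive s (1 : R) (gs m.+1)
  (m.+1%:R * gs m s - al * gs m.+1 s + be * gc m.+1 s).
Proof.
have h := is_deriveM (is_derive_X m s) (is_derive_s s).
by apply: (is_derive_eq h); rewrite /gc /gs /GRing.scale/=; ring.
Qed.

Let cont_gc m : continuous (gc m).
Proof.
move=> s; case: m => [|m]; [exact: (is_derive_cvg (is_derive_gc0 s))|exact: (is_derive_cvg (is_derive_gc m s))].
Qed.

Let cont_gs m : continuous (gs m).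
Proof.
move=> s; case: m => [|m]; [exact: (is_derive_cvg (is_derive_gs0 s))|exact: (is_derive_cvg (is_derive_gs m s))].
Qed.

(** Half of the decay rate absorbs the power of s; the other half is kept for integrability and for
    the limit at infinity. *)
Let bound m (t : R) (s : R) : 0 <= s -> `|t| <= 1 ->
  `|s ^+ m * (expR (- (al * s)) * t)| <= (m%:R / (al / 2)) ^+ m * expR (- (al / 2 * `|s|)).
Proof.
move=> s0 t1; rewrite !normrM (ger0_norm (expR_ge0 _)) ger0_norm ?exprn_ge0// (ger0_norm s0).
have a2 : 0 < al / 2 by rewrite divr_gt0.
apply: (@le_trans _ _ (s ^+ m * expR (- (al * s)))).
  by rewrite ler_wpM2l ?exprn_ge0// ler_piMr ?expR_ge0.
have -> : expR (- (al / 2 * s)) = expR (al / 2 * s) * expR (- (al * s)).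
  by rewrite -expRD; congr expR; field.
by rewrite mulrA ler_wpM2r ?expR_ge0// exprn_le_expR.
Qed.

Let integrable_g (f : R -> R) m : continuous f ->
  (forall s, 0 <= s -> `|f s| <= (m%:R / (al / 2)) ^+ m * expR (- (al / 2 * `|s|))) ->
  leb.-integrable Rpos (EFin \o f).
Proof.
move=> cf bf; have a2 : 0 < al / 2 by rewrite divr_gt0.
apply: (@le_integrable _ _ R leb Rpos _ _ (fun s => ((m%:R / (al / 2)) ^+ m)%:E * (expR (- (al / 2 * `|s|)))%:E)%E) => //.
- by apply/measurable_EFinP; apply: measurable_funTS; exact: continuous_measurable_fun.
- move=> s; rewrite /= in_itv/= andbT => s0; rewrite lee_fin (le_trans (bf s s0))//.
  by rewrite ler_norm.
- apply: (integrableS measurableT) => //.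
  by apply: integrableZl => //; exact: integrable_expRNabs.
Qed.

Lemma integrable_gamma_cos m : leb.-integrable Rpos (EFin \o gc m).
Proof. by apply: (@integrable_g _ m) => // s s0; apply: bound => //; exact: cos_max. Qed.

Lemma integrable_gamma_sin m : leb.-integrable Rpos (EFin \o gs m).
Proof. by apply: (@integrable_g _ m) => // s s0; apply: bound => //; exact: sin_max. Qed.

Let cvg_g (f : R -> R) m :
  (forall s, 0 <= s -> `|f s| <= (m%:R / (al / 2)) ^+ m * expR (- (al / 2 * `|s|))) ->
  f s @[s --> +oo] --> (0 : R).
Proof.
move=> bf; have a2 : 0 < al / 2 by rewrite divr_gt0.
set C := _ ^+ m in bf.
have C0 : 0 <= C by rewrite exprn_ge0// divr_ge0// ltW.
apply/cvgr0Pnorm_le => e e0; exists ((C + 1) / (al / 2 * e)); split; first exact: num_real.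
move=> s /= hs; have ae : 0 < al / 2 * e by rewrite mulr_gt0.
have s0 : 0 < s by apply: lt_trans hs; rewrite divr_gt0//; lra.
apply: (le_trans (bf s (ltW s0))); rewrite (gtr0_norm s0).
have as0 : 0 < al / 2 * s by rewrite mulr_gt0.
have : expR (- (al / 2 * s)) <= (al / 2 * s)^-1.
  rewrite expRN lef_pV2 ?posrE ?expR_gt0//.
  by have := expR_ge1Dx (al / 2 * s); lra.
move=> /(ler_wpM2l C0) /le_trans; apply.
rewrite ler_pdivrMr//; move: hs; rewrite ltr_pdivrMr//; nra.
Qed.

(** The integral of s^m exp (- sigma s) over the half-line, with sigma = al + i be. *)
Definition cgam m : R[i] := (\int[leb]_(s in Rpos) gc m s) -i* (\int[leb]_(s in Rpos) gs m s).

Lemma cgam_closed m : cgam m * (al +i* be) ^+ m.+1 = m`!%:R.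
Proof.
have cvgc k := cvg_g (fun s s0 => bound k s0 (cos_max (be * s))).
have cvgs k := cvg_g (fun s s0 => bound k s0 (sin_max (be * s))).
have iZ (c : R) (f : R -> R) : leb.-integrable Rpos (EFin \o f) ->
    leb.-integrable Rpos (EFin \o (fun s => c * f s)).
  by move=> fi; rewrite (_ : _ \o _ = (fun s => c%:E * (EFin \o f) s)%E)//; exact: integrableZl.
have iD (f g : R -> R) : leb.-integrable Rpos (EFin \o f) -> leb.-integrable Rpos (EFin \o g) ->
    leb.-integrable Rpos (EFin \o (fun s => f s + g s)).
  by move=> fi gi; rewrite (_ : _ \o _ = (fun s => (EFin \o f) s + (EFin \o g) s)%E)//; exact: integrableD.
have cZ (c : R) (f : R -> R) : continuous f -> continuous (fun s => c * f s).
  by move=> cf x; apply: cvgM; [exact: cvg_cst|exact: cf].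
have FTC (F f g : R -> R) (b c : R) (d : R) (e : R -> R) : continuous f -> continuous g -> continuous e ->
    leb.-integrable Rpos (EFin \o f) -> leb.-integrable Rpos (EFin \o g) -> leb.-integrable Rpos (EFin \o e) ->
    (forall s, is_derive s (1 : R) F (d * e s + (b * f s + c * g s))) -> F s @[s --> +oo] --> (0 : R) ->
    d * (\int[leb]_(s in Rpos) e s) + (b * (\int[leb]_(s in Rpos) f s) + c * (\int[leb]_(s in Rpos) g s)) = - F 0.
  move=> cf cg ce fi gi ei dF F0.
  rewrite -!RintegralZl// -RintegralD//; [|exact: iZ|exact: iZ].
  rewrite -RintegralD//; [|exact: iZ|by apply: iD; exact: iZ].
  rewrite /Rintegral (FTC2y_integrable dF)//.
    move=> x; apply: cvgD; first exact: (cZ d e ce).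
    by apply: cvgD; [exact: (cZ b f cf)|exact: (cZ c g cg)].
  exact: (iD (fun s => d * e s) (fun s => b * f s + c * g s) (iZ d e ei)
    (iD (fun s => b * f s) (fun s => c * g s) (iZ b f fi) (iZ c g gi))).
have ci := integrable_gamma_cos; have si := integrable_gamma_sin.
elim: m => [|m IH].
  have h1 : 0 * (\int[leb]_(s in Rpos) gc 0 s) +
     (- al * (\int[leb]_(s in Rpos) gc 0 s) + - be * (\int[leb]_(s in Rpos) gs 0 s)) = - gc 0 0.
    apply: FTC => //; last exact: cvgc.
    by move=> s; apply: (is_derive_eq (is_derive_gc0 s)); ring.
  have h2 : 0 * (\int[leb]_(s in Rpos) gc 0 s) +
     (- al * (\int[leb]_(s in Rpos) gs 0 s) + be * (\int[leb]_(s in Rpos) gc 0 s)) = - gs 0 0.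
    apply: FTC => //; last exact: cvgs.
    by move=> s; apply: (is_derive_eq (is_derive_gs0 s)); ring.
  have g0 : gc 0 0 = 1 by rewrite /gc !mulr0 oppr0 expr0 expR0 cos0 !mul1r.
  have g1 : gs 0 0 = 0 by rewrite /gs !mulr0 sin0 !mulr0.
  by rewrite g0 in h1; rewrite g1 in h2; exact: cgam_base.
have h1 : m.+1%:R * (\int[leb]_(s in Rpos) gc m s) +
     (- al * (\int[leb]_(s in Rpos) gc m.+1 s) + - be * (\int[leb]_(s in Rpos) gs m.+1 s)) = - gc m.+1 0.
  apply: FTC => //; last exact: cvgc.
  by move=> s; apply: (is_derive_eq (is_derive_gc m s)); ring.
have h2 : m.+1%:R * (\int[leb]_(s in Rpos) gs m s) +
     (- al * (\int[leb]_(s in Rpos) gs m.+1 s) + be * (\int[leb]_(s in Rpos) gc m.+1 s)) = - gs m.+1 0.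
  apply: FTC => //; last exact: cvgs.
  by move=> s; apply: (is_derive_eq (is_derive_gs m s)); ring.
have g0 : gc m.+1 0 = 0 by rewrite /gc exprS !mul0r.
have g1 : gs m.+1 0 = 0 by rewrite /gs exprS !mul0r.
rewrite g0 in h1; rewrite g1 in h2.
by rewrite factS natrM -IH exprS mulrA (cgam_step h1 h2) [RHS]mulrA.
Qed.

End gamma_integral.

Section homogeneous.
Context (R : realType) (n : nat).
Local Notation V := 'rV[R]_n.

(** This is chi exp (- sigma) with sigma = al + i be. When [chi] is constant and sigma linear along
    rays, radial integration produces gamma integrals. *)
Definition phase_fun (chi al be : V -> R) (x : V) : R[i] :=
  (chi x * expR (- al x))%:C * expi (- be x).
Definition homog1 (f : V -> R) := forall (s : R) x, 0 < s -> f (s *: x) = s * f x.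
Definition homog0 (f : V -> R) := forall (s : R) x, 0 < s -> f (s *: x) = f x.

End homogeneous.

(** * Integration along rays *)

Section polar_coordinates.
Context (R : realType).
Local Notation leb := (@lebesgue_measure R).
Local Notation Rpos := (`[0%R, +oo[%classic : set R).
Local Notation Opos := (`]0%R, +oo[%classic : set R).

Definition gam_dens (al : R) (m : nat) (s : R) : R :=
  if 0 < s then s ^+ m * expR (- (al * s)) else 0.

Lemma Rintegral_Opos (f : R -> R) : measurable_fun setT f ->
  \int[leb]_s (if 0 < s then f s else 0) = \int[leb]_(s in Rpos) f s.
Proof.
move=> mf; rewrite /Rintegral -integral_itv_obnd_cbnd; last by apply/measurable_EFinP; exact: measurable_funTS.
rewrite [in RHS]integral_mkcond; congr fine; apply: eq_integral => s _.
by rewrite /patch mem_setE in_itv/= andbT; case: ifP.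
Qed.

Lemma integrable_Opos (f : R -> R) : leb.-integrable Rpos (EFin \o f) ->
  leb.-integrable setT (EFin \o (fun s => if 0 < s then f s else 0)).
Proof.
move=> fi; have h : leb.-integrable Opos (EFin \o f).
  by apply: integrableS fi => // x /=; rewrite !in_itv/= !andbT => /ltW.
rewrite (_ : EFin \o _ = (EFin \o f) \_ Opos).
  by apply/(integrable_mkcond _ _).1 => //.
by apply/funext => s; rewrite /patch mem_setE in_itv/= andbT; case: ifP.
Qed.

Lemma cintble_gam_dens (al be : R) m : 0 < al ->
  cintble leb (fun s => (gam_dens al m s)%:C * expi (- (be * s))).
Proof.
move=> al0; split.
  have := integrable_Opos (integrable_gamma_cos be al0 m).
  congr (integrable _ _ _); apply/funext => s /=; rewrite /= mul0r subr0 cosN /gam_dens.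
  by case: ifP; rewrite ?mul0r// mulrA.
have := integrable_Opos (integrable_gamma_sin be al0 m).
move=> /integrableN; congr (integrable _ _ _); apply/funext => s /=; rewrite /= mul0r addr0 sinN /gam_dens.
by case: ifP; rewrite ?mul0r ?oppr0// mulrN mulrA.
Qed.

Lemma cgamE (al be : R) m : 0 < al ->
  cI leb (fun s => (gam_dens al m s)%:C * expi (- (be * s))) = cgam al be m.
Proof.
move=> al0; have mE : measurable_fun setT (fun s : R => expR (- (al * s))).
  by apply: (measurableT_comp (@measurable_expR R)); apply: measurable_funN; exact: measurable_funM.
apply: complex_ext.
  rewrite /cI /cgam [LHS]/= [RHS]/= -Rintegral_Opos.
    apply: eq_Rintegral => s _; rewrite mul0r subr0 cosN /gam_dens.
    by case: ifP; rewrite ?mul0r// mulrA.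
  apply: measurable_funM; first exact: measurable_funX.
  apply: measurable_funM => //; apply: (measurableT_comp (f := @cos R)).
    by apply: continuous_measurable_fun; exact: continuous_cos.
  exact: measurable_funM.
rewrite /cI /cgam [LHS]/= [RHS]/= -Rintegral_Opos; last first.
  apply: measurable_funM; first exact: measurable_funX.
  apply: measurable_funM => //; apply: (measurableT_comp (f := @sin R)).
    by apply: continuous_measurable_fun; exact: continuous_sin.
  exact: measurable_funM.
rewrite -mulN1r -RintegralZl//; last first.
  exact: integrable_Opos (integrable_gamma_sin be al0 m).
apply: eq_Rintegral => s _; rewrite mul0r addr0 sinN /gam_dens.
by case: ifP => _; [ring|rewrite mul0r mulr0].
Qed.

Lemma measurable_ge0_inv d (T : measurableType d) (f : T -> R) : (forall x, 0 <= f x) ->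
  measurable_fun setT f -> measurable_fun setT (fun x => (f x)^-1).
Proof.
move=> f0 mf; rewrite (_ : (fun x => _) = (fun x => f x `^ (-1))).
  exact: (measurableT_comp (measurable_powR (-1)) mf).
by apply/funext => x; rewrite powR_inv1.
Qed.

(** Its integral over s is pi / 2 for every w > 0. Inserting it and substituting x = s y separates
    radius from direction without a surface measure. *)
Definition pol_dens (w s : R) : R := if 0 < s then w / (w ^+ 2 + s ^+ 2) else 0.

Lemma measurable_pol_dens d (T : measurableType d) (f g : T -> R) :
  measurable_fun setT f -> measurable_fun setT g ->
  measurable_fun setT (fun x => pol_dens (f x) (g x)).
Proof.
move=> mf mg; rewrite /pol_dens; apply: measurable_fun_ifT.
- by apply: measurable_fun_ltr => //.
- apply: measurable_funM => //; apply: measurable_ge0_inv; last first.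
    by apply: measurable_funD; exact: measurable_funX.
  by move=> x; rewrite addr_ge0// sqr_ge0.
- exact: measurable_cst.
Qed.

Lemma pol_dens_ge0 w s : 0 <= w -> 0 <= pol_dens w s.
Proof.
by move=> w0; rewrite /pol_dens; case: ifP => // s0; rewrite divr_ge0// addr_ge0// sqr_ge0.
Qed.

Lemma integral_pol_dens w : 0 < w -> (\int[leb]_s (pol_dens w s)%:E = (pi / 2)%:E)%E.
Proof.
move=> w0.
have mP (v : R) : measurable_fun setT (fun s => (pol_dens v s)%:E).
  by apply/measurable_EFinP; exact: measurable_pol_dens.
have <- : (\int[leb]_s (pol_dens 1 s)%:E = (pi / 2)%:E)%E.
  have c0 (x : R) : 0 <= (1 + x ^+ 2)^-1 by rewrite invr_ge0 addr_ge0// sqr_ge0.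
  have cc : continuous (fun x : R => (1 + x ^+ 2)^-1).
    move=> x; apply: cvgV; first by rewrite gt_eqF// ltr_wpDr// sqr_ge0.
    apply: cvgD; first exact: cvg_cst.
    exact: exprn_continuous.
  have h := integral_cauchy R.
  rewrite ge0_symfun_integralT// in h; last by move=> x /=; rewrite sqrrN.
  rewrite -set_itvcy -integral_itv_obnd_cbnd in h; last first.
    apply/measurable_EFinP; apply: measurable_funTS; exact: continuous_measurable_fun.
  have e : (\int[leb]_s (pol_dens 1 s)%:E = \int[leb]_(x in Opos) ((1 + x ^+ 2)^-1)%:E)%E.
    rewrite [RHS]integral_mkcond; apply: eq_integral => s _.
    rewrite /patch mem_setE in_itv/= andbT /pol_dens expr1n mul1r.
    by case: ifP.
  rewrite e; move: h; set I := (\int[_]_(_ in _) _)%E; have : (0 <= I)%E.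
    by apply: integral_ge0 => x _; rewrite lee_fin.
  case: I => [r r0|_|//]; last by rewrite mulry gtr0_sg// mul1e.
  by rewrite -EFinM => -[<-]; congr EFin; field.
rewrite -[RHS](leb_affine 0 (invr_neq0 (lt0r_neq0 w0)))//; last first.
  by move=> x; rewrite lee_fin pol_dens_ge0.
rewrite -ge0_integralZl//.
- apply: eq_integral => s _; rewrite -EFinM addr0 /pol_dens; congr EFin.
  rewrite pmulr_rgt0 ?invr_gt0//; case: ifP => s0; last by rewrite mulr0.
  rewrite gtr0_norm ?invr_gt0//; field.
  by rewrite lt0r_neq0//= lt0r_neq0// ltr_pwDl// ?exprn_gt0// sqr_ge0.
- apply: (measurableT_comp (mP 1)); apply: measurable_funD => //; exact: measurable_funM.
- by move=> x _; rewrite lee_fin pol_dens_ge0.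
Qed.

Variable m : nat.
Local Notation V := 'rV[R]_m.+1.
Local Notation mu := (lebesgue_rV R m.+1).
Implicit Types chi w al be : V -> R.

(** The exponents are known to be positive away from the origin only. The origin is null because it
    lies in a degenerate cube. *)
Lemma rV_neq0_ae : \forall x \ae mu, x != 0.
Proof.
have m0 : measurable [set (0 : V)].
  by apply: closed_measurable_rV; apply: accessible_closed_set1; exact: hausdorff_accessible.
exists [set (0 : V)]; split => //; last by move=> x /= /negP; rewrite negbK => /eqP.
apply/eqP; rewrite eq_le measure_ge0 andbT.
have -> : 0%E = (\int[mu]_x (cube_ind 0 0 x)%:E)%E by rewrite integral_cube// subrr expr0n.
rewrite -(setIT [set 0]) -integral_indic//.
apply: ge0_le_integral => //.
- by apply/measurable_EFinP; exact: measurable_indic.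
- apply/measurable_EFinP; apply: (measurable_prod_coord (f := fun=> \1_(`[0, 0]%classic : set R))) => i.
  exact: measurable_indic.
move=> x _; rewrite lee_fin indicE; case: (boolP (x \in _)) => [|_]; last by rewrite prodr_ge0.
rewrite inE/= => ->; rewrite /cube_ind big1// => i _.
by rewrite mxE indicE mem_set//= in_itv/= lexx.
Qed.

Lemma eq_cI_ae (f g : V -> R[i]) : cmeas f -> cmeas g ->
  (\forall x \ae mu, f x = g x) -> cI mu f = cI mu g.
Proof.
move=> [f1 f2] [g1 g2] fg; rewrite /cI; congr (_ +i* _); congr fine.
- apply: ae_eq_integral => //; try exact/measurable_EFinP.
  by apply: filterS fg => x /= ->.
- apply: ae_eq_integral => //; try exact/measurable_EFinP.
  by apply: filterS fg => x /= ->.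
Qed.

(** The factor [pol_dens (w x) s] is inserted, x = s y is substituted for each s, and the integral
    over s is taken first: homogeneity leaves w / (w^2 + 1) times the gamma integral of order [m],
    the ambient dimension being m + 1. *)
Lemma cI_phase_fun chi w al be :
  measurable_fun setT chi -> measurable_fun setT w -> measurable_fun setT al -> measurable_fun setT be ->
  homog0 chi -> homog1 w -> homog1 al -> homog1 be ->
  (forall x, 0 <= chi x) -> (forall x, x != 0 -> chi x != 0 -> 0 < w x /\ 0 < al x) ->
  (forall x, 0 <= w x) ->
  cintble mu (phase_fun chi al be) ->
  cintble mu (fun y => (w y / (w y ^+ 2 + 1) * chi y)%:C * cgam (al y) (be y) m) /\
  (pi / 2)%:C * cI mu (phase_fun chi al be) =
  cI mu (fun y => (w y / (w y ^+ 2 + 1) * chi y)%:C * cgam (al y) (be y) m).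
Proof.
move=> mchi mw mal mbe hchi hw hal hbe chi0 pos w0 iE.
have w00 : w 0 = 0 by have := hw 2 0 (ltr0Sn _ _); rewrite scaler0; lra.
have mE := cintble_meas iE.
pose E := phase_fun chi al be.
pose f (p : measurableTypeR R * V) := (pol_dens (w p.2) p.1)%:C * E p.2.
pose g (p : measurableTypeR R * V) := (w p.2 / (w p.2 ^+ 2 + 1) * chi p.2)%:C *
  ((gam_dens (al p.2) m p.1)%:C * expi (- (be p.2 * p.1))).
have mpol : measurable_fun setT (fun p : measurableTypeR R * V => pol_dens (w p.2) p.1).
  by apply: measurable_pol_dens; [exact: (measurableT_comp mw measurable_snd)|exact: measurable_fst].
have mf : cmeas f.
  apply: cmeasM; first exact: cmeas_real.
  by have [m1 m2] := mE; split; [exact: (measurableT_comp m1 measurable_snd)|exact: (measurableT_comp m2 measurable_snd)].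
have mg : cmeas g.
  have ms : measurable_fun setT (fun p : measurableTypeR R * V => p.1) := measurable_fst.
  have mw2 : measurable_fun setT (fun p : measurableTypeR R * V => w p.2) := measurableT_comp mw measurable_snd.
  have mal2 : measurable_fun setT (fun p : measurableTypeR R * V => al p.2) := measurableT_comp mal measurable_snd.
  have mbe2 : measurable_fun setT (fun p : measurableTypeR R * V => be p.2) := measurableT_comp mbe measurable_snd.
  have mchi2 : measurable_fun setT (fun p : measurableTypeR R * V => chi p.2) := measurableT_comp mchi measurable_snd.
  apply: cmeasM.
    apply: cmeas_real; apply: (measurable_funM _ mchi2).
    apply: (measurable_funM mw2); apply: measurable_ge0_inv.
      by move=> p; rewrite addr_ge0// sqr_ge0.
    exact: (measurable_funD (measurable_funX 2 mw2) (measurable_cst _)).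
  apply: cmeasM.
    apply: cmeas_real; apply: measurable_fun_ifT.
    - exact: (measurable_fun_ltr (measurable_cst _) ms).
    - apply: (measurable_funM (measurable_funX m ms)).
      apply: (measurableT_comp (@measurable_expR R)); apply: measurable_funN.
      exact: (measurable_funM mal2 ms).
    - exact: measurable_cst.
  by apply: cmeas_expi; apply: measurable_funN; exact: (measurable_funM mbe2 ms).
(* the substitution x = s y *)
have fg s y : 0 < s -> (s ^+ m.+1)%:C * f (s, s *: y) = g (s, y).
  move=> s0; rewrite /f /g /E /phase_fun /pol_dens /gam_dens /= s0 hw// hchi// hal// hbe//.
  rewrite !mulrA -!rmorphM/= (mulrC s (be y)) (mulrC s (al y)); congr (_%:C * _).
  rewrite exprMn -[X in _ / (_ + X)]mulr1 -mulrDr invfM exprSr.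
  have d0 : w y ^+ 2 + 1 != 0 by rewrite lt0r_neq0// ltr_wpDl// sqr_ge0.
  have s1 : s != 0 by rewrite lt0r_neq0.
  by move: (w y ^+ 2 + 1) d0 => D d0; field; rewrite d0 s1.
have enf := emeas_normc mf; have eng := emeas_normc mg.
have nf_ge0 p : (0 <= (normc (f p))%:E)%E by rewrite lee_fin normc_ge0.
have ng_ge0 p : (0 <= (normc (g p))%:E)%E by rewrite lee_fin normc_ge0.
have npol x : (\int[leb]_s (pol_dens (w x) s)%:E <= (pi / 2)%:E)%E.
  have [wx|wx|wx] := ltgtP 0 (w x); first by rewrite integral_pol_dens.
    by have := w0 x; rewrite leNgt wx.
  rewrite -wx; under eq_integral do rewrite /pol_dens mul0r if_same.
  by rewrite integral0 lee_fin divr_ge0// pi_ge0.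
have nfE s x : normc (f (s, x)) = pol_dens (w x) s * normc (E x).
  by rewrite normcMl normc_real ger0_norm// pol_dens_ge0.
have nf0 : (\int[leb \x mu]_p (normc (f p))%:E < +oo)%E.
  rewrite (fubini_tonelli2 (m1 := leb) (m2 := mu) _ enf nf_ge0) /fubini_G.
  apply: (@le_lt_trans _ _ (\int[mu]_x ((pi / 2)%:E * (normc (E x))%:E))%E); last first.
    rewrite ge0_integralZl//.
    - by rewrite lte_mul_pinfty ?lee_fin ?divr_ge0 ?pi_ge0//; exact: cintble_fin.
    - exact: emeas_normc.
    - by move=> x _; rewrite lee_fin normc_ge0.
    - by rewrite lee_fin divr_ge0// pi_ge0.
  apply: ge0_le_integral => //.
  - by move=> x _; apply: integral_ge0.
  - exact: (measurable_fun_fubini_tonelli_G (m1 := leb) _ enf nf_ge0).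
  - by apply: measurable_funeM; exact: emeas_normc.
  - move=> x _; under eq_integral do rewrite nfE EFinM.
    rewrite ge0_integralZr//.
    + by rewrite lee_wpmul2r// lee_fin normc_ge0.
    + by apply/measurable_EFinP; exact: measurable_pol_dens.
    + by move=> s _; rewrite lee_fin pol_dens_ge0.
    + by rewrite lee_fin normc_ge0.
have if_ : cintble (leb \x mu)%E f by exact: cintble_lty.
have neg s y : s <= 0 -> f (s, y) = 0 /\ g (s, y) = 0.
  move=> s0; rewrite /f /g /pol_dens /gam_dens /= ltNge s0/=.
  by rewrite rmorph0 !mul0r mulr0.
(* The substitution preserves the L^1 norm of each slice, so integrability passes from [f] to
   [g]. *)
have eI (s : R) : (\int[mu]_y (normc (g (s, y)))%:E = \int[mu]_y (normc (f (s, y)))%:E)%E.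
  have [s0|s0] := leP s 0.
    by apply: eq_integral => y _; have [-> ->] := neg s y s0.
  have mfs : measurable_fun setT (fun y => (normc (f (s, y)))%:E).
    exact: (measurableT_comp enf (pair1_measurable s)).
  rewrite -(integral_scale (lt0r_neq0 s0) mfs); last by move=> y; exact: nf_ge0.
  have mfss : measurable_fun setT (fun y : V => (normc (f (s, s *: y)))%:E).
    exact: (measurableT_comp mfs (measurable_rV_scale s)).
  rewrite -(@ge0_integralZl _ _ R mu setT measurableT _ mfss).
  - by apply: eq_integral => y _; rewrite -fg// normcMl normc_real EFinM normrX.
  - by move=> y _; exact: nf_ge0.
  - by rewrite lee_fin exprn_ge0.
have ig : cintble (leb \x mu)%E g.
  apply: cintble_lty => //; rewrite (fubini_tonelli1 (m1 := leb) (m2 := mu) _ eng ng_ge0) /fubini_F.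
  move: nf0; rewrite (fubini_tonelli1 (m1 := leb) (m2 := mu) _ enf nf_ge0) /fubini_F.
  by under [in X in _ -> X]eq_integral do rewrite eI.
have [f1 f2 f3] := cI_fubini if_; have [g1 g2 g3] := cI_fubini ig.
have gE y : cI leb (fun s => g (s, y)) = (w y / (w y ^+ 2 + 1) * chi y)%:C * cgam (al y) (be y) m.
  have [cy|cy] := eqVneq (w y / (w y ^+ 2 + 1) * chi y) 0.
    rewrite cy rmorph0 mul0r (@eq_cI _ _ _ leb _ (fun=> (0 : R)%:C)).
      by rewrite cI_real /Rintegral integral0.
    by move=> s; rewrite /g /= cy rmorph0 mul0r.
  have y0 : y != 0.
    by apply: contraNneq cy => ->; rewrite w00 !mul0r.
  have cy0 : chi y != 0 by apply: contraNneq cy => ->; rewrite mulr0.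
  have [wy aly] := pos _ y0 cy0.
  by rewrite /g /= cIZ ?cgamE//; exact: cintble_gam_dens.
split.
  by rewrite -(funext gE).
transitivity (cI mu (fun y => cI leb (fun s => g (s, y)))); last exact: eq_cI.
rewrite -g3.
transitivity (cI leb (fun s => cI mu (fun y => f (s, y)))); last first.
  apply: eq_cI => s; have [s0|s0] := leP s 0.
    by apply: eq_cI => y; have [-> ->] := neg s y s0.
  have fsi : cintble mu (fun y => f (s, y)).
    apply: (cintbleMb (b := s^-1) iE).
      by apply: cmeas_real; exact: (measurable_pol_dens mw (measurable_cst s)).
    move=> x; rewrite normc_real ger0_norm ?pol_dens_ge0// /pol_dens s0.
    rewrite ler_pdivrMr; last by rewrite ltr_wpDl ?exprn_gt0// sqr_ge0.
    by move: (w x) (w0 x) => t t0; change (t <= s^-1 * (t ^+ 2 + s ^+ 2)); rewrite ler_pdivlMl//; nra.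
  rewrite -(cI_scale (lt0r_neq0 s0) fsi).2 gtr0_norm// -cIZ; last exact: (cI_scale (lt0r_neq0 s0) fsi).1.
  by apply: eq_cI => y; rewrite -fg.
rewrite f3 -(cIZ _ iE); apply: eq_cI_ae.
- exact: cintble_meas (cintbleZ _ iE).
- exact: cintble_meas f2.
apply: filterS rV_neq0_ae => x x0.
have [cx|cx] := eqVneq (chi x) 0.
  rewrite /phase_fun cx mul0r rmorph0 mul0r mulr0.
  rewrite (@eq_cI _ _ _ leb _ (fun=> (0 : R)%:C)).
    by rewrite cI_real /Rintegral integral0.
  by move=> s; rewrite /f /E /phase_fun /= cx mul0r rmorph0 mul0r mulr0.
have [wx _] := pos _ x0 cx.
have ip : cintble leb (fun s => (pol_dens (w x) s)%:C).
  apply: cintble_lty; first by apply: cmeas_real; exact: measurable_pol_dens.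
  under eq_integral do rewrite normc_real ger0_norm ?pol_dens_ge0//.
  by rewrite integral_pol_dens// ltry.
transitivity (cI leb (fun s => E x * (pol_dens (w x) s)%:C)); last by apply: eq_cI => s; rewrite mulrC.
by rewrite cIZ// cI_real /Rintegral integral_pol_dens// mulrC.
Qed.

(* Rotating the exponent [sigma = al - i be] to [i sigma]: in polar coordinates
   both integrals are multiples of [sigma ^- n]. *)
Lemma cI_phase_rot_pos chi al be :
  measurable_fun setT chi -> measurable_fun setT al -> measurable_fun setT be ->
  homog0 chi -> homog1 al -> homog1 be ->
  (forall x, 0 <= chi x) -> (forall x, x != 0 -> chi x != 0 -> 0 < al x /\ 0 < be x) ->
  (forall x, 0 <= al x) ->
  cintble mu (phase_fun chi al (fun x => - be x)) -> cintble mu (phase_fun chi be al) ->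
  cI mu (phase_fun chi al (fun x => - be x)) = 'i%C ^+ m.+1 * cI mu (phase_fun chi be al).
Proof.
move=> mchi mal mbe hchi hal hbe chi0 pos al0 i1 i2.
have hNbe : homog1 (fun x => - be x) by move=> s x s0; rewrite hbe// mulrN.
(* Both integrals are computed with the same weight [al], so that the results can be compared
   pointwise. *)
have [|_ e1] := cI_phase_fun mchi mal mal (measurable_funN mbe) hchi hal hal hNbe chi0 _ al0 i1.
  by move=> x x0 cx; have [] := pos _ x0 cx.
have [|j2 e2] := cI_phase_fun mchi mal mbe mal hchi hal hbe hal chi0 _ al0 i2.
  by move=> x x0 cx; have [] := pos _ x0 cx.
have pi2 : (pi / 2 : R)%:C != 0 by rewrite fmorph_eq0 lt0r_neq0// divr_gt0// pi_gt0.
apply: (mulfI pi2); rewrite e1 mulrCA e2 -(cIZ _ j2); apply: eq_cI => x.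
rewrite mulrCA; have [->|cx] := eqVneq (al x / (al x ^+ 2 + 1) * chi x) 0.
  by rewrite rmorph0 !mul0r.
congr (_ * _).
have x0 : x != 0.
  have a0 : al 0 = 0 by have := hal 2 0 (ltr0Sn _ _); rewrite scaler0; lra.
  by apply: contraNneq cx => ->; rewrite a0 !mul0r.
have cx0 : chi x != 0 by apply: contraNneq cx => ->; rewrite mulr0.
have [ax bx] := pos _ x0 cx0.
have s0 : (al x +i* - be x) ^+ m.+1 != 0.
  by rewrite expf_neq0// eq_complex/= negb_and lt0r_neq0.
apply: (mulIf s0); rewrite cgam_closed// mulrAC -exprMn.
have -> : 'i%C * (al x +i* - be x) = be x +i* al x.
  by apply: complex_ext; rewrite ?cReM ?cImM/=; ring.
by rewrite [RHS]mulrC cgam_closed.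
Qed.

End polar_coordinates.

(** In dimension 0 there are no rays, and both exponents vanish at the only point. *)
Lemma cI_phase_rot (R : realType) (n : nat) (chi al be : 'rV[R]_n -> R) :
  measurable_fun setT chi -> measurable_fun setT al -> measurable_fun setT be ->
  homog0 chi -> homog1 al -> homog1 be ->
  (forall x, 0 <= chi x) -> (forall x, x != 0 -> chi x != 0 -> 0 < al x /\ 0 < be x) ->
  (forall x, 0 <= al x) ->
  cintble (lebesgue_rV R n) (phase_fun chi al (fun x => - be x)) ->
  cintble (lebesgue_rV R n) (phase_fun chi be al) ->
  cI (lebesgue_rV R n) (phase_fun chi al (fun x => - be x)) =
  'i%C ^+ n * cI (lebesgue_rV R n) (phase_fun chi be al).
Proof.
case: n chi al be => [|m] chi al be; last exact: cI_phase_rot_pos.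
move=> _ _ _ _ hal hbe _ _ _ _ _.
have z (f : 'rV[R]_0 -> R) x : homog1 f -> f x = 0.
  by move=> hf; have := hf 2 0 (ltr0Sn _ _); rewrite scaler0 (row0_eq x 0); lra.
rewrite expr0 mul1r; apply: eq_cI => x.
by rewrite /phase_fun !(z _ _ hal, z _ _ hbe) !oppr0.
Qed.

(** * The kernel of the support function *)

Section carleman.
Context (R : realType) (n : nat).
Local Notation V := 'rV[R]_n.
Local Notation mu := (lebesgue_rV R n).
Implicit Types (K S : set V) (x y z w v : V) (h : V -> R[i]).

Definition dom_ind K x : R := if (support_fun K x < +oo)%E then 1 else 0.
(** The function b_z, extended by 0 outside the domain of the support function, which keeps it
    real-valued and 1-homogeneous everywhere. *)
Definition excess K z x : R := dom_ind K x * (fine (support_fun K x) - dotv z x).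

Lemma dom_ind_ge0 K x : 0 <= dom_ind K x.
Proof. by rewrite /dom_ind; case: ifP. Qed.

Lemma dom_ind_le1 K x : dom_ind K x <= 1.
Proof. by rewrite /dom_ind; case: ifP. Qed.

Lemma support_fun_fin K z x : K z -> dom_ind K x != 0 -> support_fun K x = (fine (support_fun K x))%:E.
Proof.
rewrite /dom_ind; case: ifP => [lty Kz _|]; last by rewrite eqxx.
rewrite fineK// fin_numE; apply/andP; split; last by rewrite lt_eqF.
rewrite gt_eqF//; apply: (@lt_le_trans _ _ (dotv z x)%:E); first by rewrite ltNyr.
by apply: ereal_sup_ubound; exists z.
Qed.

Lemma support_funZ K (s : R) x : 0 < s -> support_fun K (s *: x) = (s%:E * support_fun K x)%E.
Proof.
have le (t : R) y : 0 < t -> (support_fun K (t *: y) <= t%:E * support_fun K y)%E.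
  move=> t0; apply: ge_ereal_sup => _ [w Kw <-].
  rewrite dotvZr EFinM; apply: lee_wpmul2l; first by rewrite lee_fin ltW.
  by apply: ereal_sup_ubound; exists w.
move=> s0; apply/le_anti; rewrite le//=.
have si : 0 < s^-1 by rewrite invr_gt0.
have := le _ (s *: x) si; rewrite scalerA mulVf ?lt0r_neq0// scale1r => h.
have := lee_wpmul2l (ltW s0 : (0 <= s%:E)%E) h.
by rewrite muleA -EFinM divff ?lt0r_neq0// mul1e.
Qed.

Lemma homog0_dom_ind K : homog0 (dom_ind K).
Proof.
move=> s x s0; rewrite /dom_ind support_funZ//; congr (if _ then _ else _).
case: (support_fun K x) => [r| |]; first by rewrite -EFinM !ltry.
  by rewrite gt0_muley ?lte_fin// ltxx.
by rewrite gt0_muleNy ?lte_fin.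
Qed.

Lemma homog1_excess K z : homog1 (excess K z).
Proof.
move=> s x s0; rewrite /excess homog0_dom_ind// support_funZ// dotvZr.
have [->|d0] := eqVneq (dom_ind K x) 0; first by rewrite !mul0r mulr0.
have -> : fine (s%:E * support_fun K x)%E = s * fine (support_fun K x).
  move: d0; rewrite /dom_ind; case: (support_fun K x) => [r| |]//=.
    by rewrite eqxx.
  by rewrite gt0_muleNy ?lte_fin//= mulr0.
by ring.
Qed.

(** The supremum is tested at z + (r / 2) sgn x, the half keeping the point inside the open cube.
    This linear growth is the source of the integrable majorants. *)
Lemma excess_ge K z (r : R) x : 0 < r -> (forall y, (forall i, `|y ord0 i| < r) -> K (z + y)) ->
  dom_ind K x != 0 -> r / 2 * (\sum_i `|x ord0 i|) <= excess K z x.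
Proof.
move=> r0 Kr d0.
have Kz : K z by have := Kr 0; rewrite addr0; apply => i; rewrite mxE normr0.
have -> : excess K z x = fine (support_fun K x) - dotv z x.
  by move: d0; rewrite /excess /dom_ind; case: ifP; rewrite ?mul1r// eqxx.
rewrite lerBrDl -lee_fin -(support_fun_fin Kz d0).
apply: ereal_sup_ubound; exists (z + (r / 2) *: \row_i Num.sg (x ord0 i)).
  apply: Kr => i; rewrite !mxE normrM ger0_norm; last by lra.
  apply: (@le_lt_trans _ _ (r / 2 * 1)); last by lra.
  by rewrite ler_wpM2l; [|lra|rewrite normr_sg; case: (_ != 0)].
rewrite dotvDl dotvZl; congr (_ + _ * _)%:E.
by apply: eq_bigr => i _; rewrite mxE normrEsg.
Qed.

Lemma excess_ge0 K z x : open K -> K z -> 0 <= excess K z x.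
Proof.
move=> oK Kz; have [d0|d0] := eqVneq (dom_ind K x) 0; first by rewrite /excess d0 mul0r.
have [r r0 Kr] := rV_nbhs_ball oK Kz.
apply: le_trans (excess_ge r0 Kr d0); rewrite mulr_ge0//; first by lra.
exact: sumr_ge0.
Qed.

Lemma excess_gt0 K z x : open K -> K z -> x != 0 -> dom_ind K x != 0 -> 0 < excess K z x.
Proof.
move=> oK Kz x0 d0; have [r r0 Kr] := rV_nbhs_ball oK Kz.
apply: lt_le_trans (excess_ge r0 Kr d0); rewrite mulr_gt0//; first by lra.
rewrite lt_neqAle sumr_ge0// andbT eq_sym; apply: contra x0.
rewrite psumr_eq0// => /allP h; apply/eqP/rowP => i; rewrite mxE.
by have := h i (mem_index_enum i); rewrite normr_eq0 => /eqP.
Qed.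

Lemma measurable_dom_ind K : measurable_fun setT (dom_ind K).
Proof.
have ms := measurable_support_fun K.
apply: measurable_fun_ifT => //.
apply: (measurableT_comp (f := fun x : \bar R => (x < +oo)%E)); last exact: ms.
by apply: measurable_fun_lte => //; exact: measurable_cst.
Qed.

Lemma measurable_excess K z : measurable_fun setT (excess K z).
Proof.
apply: measurable_funM; first exact: measurable_dom_ind.
apply: measurable_funB; last exact: measurable_dotvl.
by apply: (measurableT_comp (fine_measurable _)) => //; exact: measurable_support_fun.
Qed.

Lemma qkernE K z x : qkern K z x = dom_ind K x * expR (- (2 * pi * excess K z x)).
Proof. by rewrite /qkern /excess /dom_ind; case: ifP; rewrite ?mul0r// !mul1r. Qed.

Lemma integrable_gam_scale (c : R) : 0 < c -> mu.-integrable setT (fun x => (gam (c *: x))%:E).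
Proof.
by move=> c0; have [[]] := cI_scale (lt0r_neq0 c0) (cintble_gam R n).
Qed.

Lemma expR_excess_le K z (c r : R) x : 0 < c -> 0 < r ->
  (forall y, (forall i, `|y ord0 i| < r) -> K (z + y)) ->
  dom_ind K x * expR (- (c * excess K z x)) <= gam ((c * (r / 2)) *: x).
Proof.
move=> c0 r0 Kr; have [->|d0] := eqVneq (dom_ind K x) 0; first by rewrite mul0r ltW// gam_gt0.
apply: (@le_trans _ _ (expR (- (c * excess K z x)))).
  by rewrite ler_piMl ?expR_ge0// dom_ind_le1.
have -> : gam ((c * (r / 2)) *: x) = expR (- (c * (r / 2) * \sum_i `|x ord0 i|)).
  rewrite /gam mulr_sumr -sumrN expR_sum; apply: eq_bigr => i _.
  by rewrite mxE normrM gtr0_norm// mulr_gt0//; lra.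
by rewrite ler_expR lerN2 -mulrA ler_pM2l// excess_ge.
Qed.

(** Compactness makes the radius uniform, hence the majorant of [qkern K z] the same for all z of
    [S]. *)
Lemma compact_uniform_ball S K : open K -> compact S -> S `<=` K ->
  exists2 r : R, 0 < r & forall z, S z -> forall x, (forall i, `|x ord0 i| < r) -> K (z + x).
Proof.
move=> oK cS SK.
have /compact_near_coveringP := cS.
move=> /(_ R (0^'+) (fun r z => forall x, (forall i, `|x ord0 i| < r) -> K (z + x)) _) h.
have {}h : \forall r \near 0^'+, S `<=` (fun z => forall x : V, (forall i, `|x ord0 i| < r) -> K (z + x)).
  apply: h => z Sz; have [r r0 Kr] := rV_nbhs_ball oK (SK _ Sz).
  exists (ball z (r / 2), [set e : R | e < r / 2]).
    split; first by apply: nbhsx_ballx; rewrite divr_gt0.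
    by apply: nbhs_right_lt; rewrite divr_gt0.
  move=> [z' e] /= [[_ zz'] er] x xe.
  have -> : z' + x = z + (z' - z + x) by rewrite addrA (addrC z) subrK.
  apply: Kr => i; rewrite !mxE.
  have h1 : `|z ord0 i - z' ord0 i| < r / 2 := zz' ord0 i.
  have h2 := xe i; rewrite distrC in h1.
  have := ler_normD (z' ord0 i - z ord0 i) (x ord0 i); lra.
have [e e0 he] : exists2 e : R, 0 < e & S `<=` (fun z => forall x : V, (forall i, `|x ord0 i| < e) -> K (z + x)).
  near (0 : R)^'+ => e.
  exists e; first by near: e; exact: nbhs_right_gt.
  by near: e.
by exists e.
Unshelve. all: by end_near. Qed.

Lemma measurable_qdens K : measurable_fun setT (qdens K).
Proof.
apply: (measurable_fun_fubini_tonelli_F (m2 := mu) (fun p : V * V => (qkern K p.1 p.2)%:E)).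
  by apply/measurable_EFinP; exact: measurable_qkern2.
by move=> p; rewrite lee_fin qkern_ge0.
Qed.

(** The unimodular kernel exp (2 pi i s_K), restricted to the domain of s_K and damped by exp (- e
    b_z0), which makes it integrable and keeps its modulus at most 1. *)
Definition cker K z0 (e : R) x : R[i] :=
  phase_fun (dom_ind K) (fun x => e * excess K z0 x) (fun x => - (2 * pi * fine (support_fun K x))) x.

Lemma normc_phase_fun (chi al be : V -> R) x : 0 <= chi x -> normc (phase_fun chi al be x) = chi x * expR (- al x).
Proof. by move=> c0; rewrite normcMl normc_expi mulr1 normc_real ger0_norm// mulr_ge0 ?expR_ge0. Qed.

Lemma cmeas_phase_fun (chi al be : V -> R) : measurable_fun setT chi -> measurable_fun setT al ->
  measurable_fun setT be -> cmeas (phase_fun chi al be).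
Proof.
move=> mc ma mb; apply: cmeasM.
  apply: cmeas_real; apply: measurable_funM => //.
  by apply: (measurableT_comp (@measurable_expR R)); exact: measurable_funN.
by apply: cmeas_expi; exact: measurable_funN.
Qed.

Lemma cintble_phase_excess K z (c : R) be : open K -> K z -> 0 < c -> measurable_fun setT be ->
  cintble mu (phase_fun (dom_ind K) (fun x => c * excess K z x) be).
Proof.
move=> oK Kz c0 mb; have [r r0 Kr] := rV_nbhs_ball oK Kz.
have me : measurable_fun setT (fun x => c * excess K z x).
  by apply: measurable_funM => //; exact: measurable_excess.
have cr : 0 < c * (r / 2) by rewrite mulr_gt0// divr_gt0.
apply: (le_cintble _ (integrable_gam_scale cr)).
  exact: cmeas_phase_fun (measurable_dom_ind K) me mb.
by move=> x; rewrite lee_fin normc_phase_fun ?dom_ind_ge0// expR_excess_le.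
Qed.

(** The Fourier kernel at z turns the phase s_K into b_z, so the integrand is exp (- sigma) with
    sigma = e b_z0 - 2 pi i b_z. After rotation the phase has become the decay and the damping a
    phase that disappears as e -> 0. *)
Lemma fourier_cker K z0 z e : open K -> K z0 -> K z -> 0 < e ->
  fourier (cker K z0 e) z = 'i%C ^+ n *
    cI mu (phase_fun (dom_ind K) (fun x => 2 * pi * excess K z x) (fun x => e * excess K z0 x)).
Proof.
move=> oK Kz0 Kz e0.
have p0 : 0 < 2 * pi :> R by rewrite mulr_gt0 ?pi_gt0.
have mb : measurable_fun setT (fun x => 2 * pi * excess K z x).
  by apply: measurable_funM => //; exact: measurable_excess.
have ma : measurable_fun setT (fun x => e * excess K z0 x).
  by apply: measurable_funM => //; exact: measurable_excess.
have hom (c : R) y : homog1 (fun x => c * excess K y x).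
  by move=> s x s0; rewrite homog1_excess// mulrCA.
rewrite -(cI_phase_rot (measurable_dom_ind K) ma mb (@homog0_dom_ind K) (hom _ _) (hom _ _)).
- rewrite fourierE; apply: eq_cI => x; rewrite /cker /phase_fun -mulrA -expiD.
  have [->|d0] := eqVneq (dom_ind K x) 0; first by rewrite mul0r rmorph0 !mul0r.
  have E : excess K z x = fine (support_fun K x) - dotv z x.
    by move: d0; rewrite /excess /dom_ind; case: ifP; rewrite ?mul1r// eqxx.
  by congr (_ * expi _); rewrite E; ring.
- exact: dom_ind_ge0.
- by move=> x x0 d0; split; apply: mulr_gt0 => //; exact: excess_gt0.
- by move=> x; apply: mulr_ge0; [exact: ltW|exact: excess_ge0].
- exact: cintble_phase_excess (measurable_funN mb).
- exact: cintble_phase_excess ma.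
Qed.

Lemma cker_le1 K z0 e x : open K -> K z0 -> 0 < e -> normc (cker K z0 e x) <= 1.
Proof.
move=> oK Kz0 e0; rewrite normc_phase_fun ?dom_ind_ge0//.
apply: (@le_trans _ _ (1 * 1)); last by rewrite mulr1.
apply: ler_pM; rewrite ?dom_ind_ge0 ?expR_ge0 ?dom_ind_le1//.
rewrite -expR0 ler_expR oppr_le0; apply: mulr_ge0; [exact: ltW|exact: excess_ge0].
Qed.

Lemma cintble_cker K z0 e : open K -> K z0 -> 0 < e -> cintble mu (cker K z0 e).
Proof.
move=> oK Kz0 e0; apply: cintble_phase_excess => //.
apply: measurable_funN; apply: measurable_funM => //.
by apply: (measurableT_comp (fine_measurable _)) => //; exact: measurable_support_fun.
Qed.

Lemma qdens_fin K z : open K -> K z -> mu.-integrable setT (fun x => (qkern K z x)%:E).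
Proof.
move=> oK Kz; have p0 : 0 < 2 * pi :> R by rewrite mulr_gt0 ?pi_gt0.
have := cintble_phase_excess oK Kz p0 (measurable_cst (0 : R)).
move=> /cintbleP[_]; congr (integrable _ _ _); apply/funext => x.
by rewrite normc_phase_fun ?dom_ind_ge0// qkernE.
Qed.

Lemma cvg_expi (c : R) : (fun k => normc (expi (- (k.+1%:R^-1 * c)) - 1)) @ \oo --> (0 : R).
Proof.
have h : (fun k => - (k.+1%:R^-1 * c)) @ \oo --> (0 : R).
  by rewrite -oppr0; apply: cvgN; exact: cvg_invnM.
apply: (squeeze0 (v := fun k => `|cos (- (k.+1%:R^-1 * c)) - 1| + `|sin (- (k.+1%:R^-1 * c))|)).
- by move=> k; exact: normc_ge0.
- move=> k; apply: le_trans (normc_le_ReIm _) _.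
  by rewrite /expi /= subr0.
- have hc : cos (- (k.+1%:R^-1 * c)) @[k --> \oo] --> (1 : R).
    by have := cvg_comp _ _ h (@continuous_cos R 0); rewrite cos0.
  have hs : sin (- (k.+1%:R^-1 * c)) @[k --> \oo] --> (0 : R).
    by have := cvg_comp _ _ h (@continuous_sin R 0); rewrite sin0.
  rewrite -[X in _ --> X]addr0; apply: cvgD.
    rewrite -(normr0 R); apply: cvg_norm; rewrite -(subrr 1); apply: cvgB => //; exact: cvg_cst.
  by rewrite -(normr0 R); exact: cvg_norm.
Qed.

Lemma normc_le_dist (a b : R[i]) : normc a <= normc b + normc (b - a).
Proof.
have e : a = b + - (b - a) by rewrite opprB addrCA subrr addr0.
by rewrite {1}e -(normcNl (b - a)); exact: ler_normcD.
Qed.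

(** [normc_cI_fourier] is applied to the damped kernel, and e -> 0. The limit is dominated because
    the points of [S] have cubes of one common size inside [K]. *)
Theorem carleman K S h : open K -> compact S -> S `<=` K -> (forall z, h z != 0 -> S z) ->
  cintble mu h -> cintble mu (fourier h) -> (forall z, h z = fourier (fourier h) (- z)) ->
  (exists M, forall z, normc (h z) <= M) ->
  (\int[mu]_z ((normc (h z) ^+ 2)%:E * qdens K z) <=
   (\int[mu]_x (normc (fourier h x))%:E) * (\int[mu]_x (normc (fourier h x))%:E))%E.
Proof.
move=> oK cS SK hS hi Hi inv bh; have [M hM] := bh.
have I0 : (0 <= \int[mu]_x (normc (fourier h x))%:E)%E.
  by apply: integral_ge0 => x _; rewrite lee_fin normc_ge0.
have [h0|/existsNP[z0 /eqP hz0]] := pselect (forall z, h z = 0).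
  rewrite (@eq_integral _ _ _ mu setT (cst 0%E)); first by rewrite integral0 mule_ge0.
  by move=> z _; rewrite h0 Normc.normc0 expr0n/= mul0e.
have Kz0 := SK _ (hS _ hz0).
have [r r0 Kr] := compact_uniform_ball oK cS SK.
have p0 : 0 < 2 * pi :> R by rewrite mulr_gt0 ?pi_gt0.
have pr0 : 0 < 2 * pi * (r / 2) by rewrite mulr_gt0// divr_gt0.
have mh := cintble_meas hi.
pose e (k : nat) : R := k.+1%:R^-1.
have e0 k : 0 < e k by rewrite invr_gt0.
(* [Q k] is the transform of the kernel with damping 1 / (k + 1), freed from the factor i^n; [Q0] is
   its limit. *)
pose Q k z := cI mu (phase_fun (dom_ind K) (fun x => 2 * pi * excess K z x) (fun x => e k * excess K z0 x)).
pose Q0 z := (\int[mu]_x (qkern K z x))%:C.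
have ma k : measurable_fun setT (fun x => e k * excess K z0 x).
  by apply: measurable_funM => //; exact: measurable_excess.
pose G := fine (\int[mu]_x (gam ((2 * pi * (r / 2)) *: x))%:E)%E.
have GE : (\int[mu]_x (gam ((2 * pi * (r / 2)) *: x))%:E)%E = G%:E.
  by rewrite fineK//; exact: (integrable_fin_num _ (integrable_gam_scale pr0)).
have inorm : normc ('i%C ^+ n : R[i]) = 1.
  have -> : 'i%C = expi (pi / 2) :> R[i] by rewrite /expi cos_pihalf sin_pihalf.
  by elim: (n) => [|k IH]; rewrite ?expr0 ?Normc.normc1// exprS normcMl IH normc_expi mulr1.
have in0 : 'i%C ^+ n != 0 :> R[i] by rewrite -normc_eq0 inorm oner_eq0.
have hQ k z : h z * conjc (h z) * fourier (cker K z0 (e k)) z = 'i%C ^+ n * (h z * conjc (h z) * Q k z).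
  have [->|hz] := eqVneq (h z) 0; first by rewrite !mul0r mulr0.
  rewrite (fourier_cker oK Kz0 (SK _ (hS _ hz)) (e0 k)) -/(Q k z); exact: mulrCA.
have hQi k : cintble mu (fun z => h z * conjc (h z) * fourier (cker K z0 (e k)) z).
  under eq_fun do rewrite -mulrA mulrC.
  apply: (cintbleMb (b := M * fine (\int[mu]_y (normc (cker K z0 (e k) y))%:E)%E) hi).
    apply: cmeasM; first exact: cmeasJ.
    exact/cmeas_fourier/cintble_cker.
  move=> z; rewrite normcMl normc_conj; apply: ler_pM; rewrite ?normc_ge0//.
  rewrite -lee_fin fineK; first exact/normc_fourier/cintble_cker.
  rewrite ge0_fin_numE; first exact/cintble_fin/cintble_cker.
  by apply: integral_ge0 => y _; rewrite lee_fin normc_ge0.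
have Qi k : cintble mu (fun z => h z * conjc (h z) * Q k z).
  have := cintbleZ ('i%C ^+ n)^-1 (hQi k); congr (cintble _ _); apply/funext => z.
  by rewrite hQ mulrA mulVf// mul1r.
pose I := fine (\int[mu]_x (normc (fourier h x))%:E)%E.
have IE : (\int[mu]_x (normc (fourier h x))%:E)%E = I%:E.
  by rewrite fineK// ge0_fin_numE//; exact: cintble_fin.
have bQ k : normc (cI mu (fun z => h z * conjc (h z) * Q k z)) <= I * I.
  have := normc_cI_fourier hi Hi inv bh (cintble_cker oK Kz0 (e0 k)) (fun x => cker_le1 x oK Kz0 (e0 k)).
  rewrite IE -EFinM lee_fin; under eq_cI do rewrite hQ.
  by rewrite (cIZ _ (Qi k)) normcMl inorm mul1r.
have Gb z x : S z -> qkern K z x <= gam ((2 * pi * (r / 2)) *: x).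
  by move=> Sz; rewrite qkernE expR_excess_le//; exact: Kr.
have cvgQ z : S z -> (fun k => normc (Q k z - Q0 z)) @ \oo --> (0 : R).
  move=> Sz; rewrite /Q0 -cI_real.
  apply: (@cI_cvg _ _ _ mu _ (fun x => (qkern K z x)%:C) (fun x => (gam ((2 * pi * (r / 2)) *: x))%:E)).
  - move=> k; apply: cmeas_phase_fun (measurable_dom_ind K) _ (ma k).
    by apply: measurable_funM => //; exact: measurable_excess.
  - by apply: cmeas_real; exact: measurable_qkern.
  - move=> x; rewrite -(mulr0 (qkern K z x)).
    under eq_fun do rewrite /phase_fun -qkernE -[X in _ - X]mulr1 -mulrBr normcMl normc_real ger0_norm ?qkern_ge0//.
    by apply: cvgM; [exact: cvg_cst|exact: cvg_expi].
  - exact: integrable_gam_scale.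
  - by move=> k x; rewrite lee_fin normc_phase_fun ?dom_ind_ge0// -qkernE Gb.
have Q0b z : S z -> normc (Q0 z) <= G.
  move=> Sz; rewrite normc_real ger0_norm; last by apply: Rintegral_ge0 => x _; exact: qkern_ge0.
  rewrite -lee_fin -GE EFin_Rintegral; last exact/qdens_fin/SK.
  apply: ge0_le_integral => //.
  - by move=> x _; rewrite lee_fin qkern_ge0.
  - by apply/measurable_EFinP; exact: measurable_qkern.
  - exact: measurable_int (integrable_gam_scale pr0).
  - by move=> x _; rewrite lee_fin Gb.
have Qb k z : S z -> normc (Q k z) <= G.
  move=> Sz; rewrite -lee_fin -GE.
  have Kz := SK _ Sz.
  apply: le_trans (normc_cI (cintble_phase_excess oK Kz p0 (ma k))) _.
  apply: ge0_le_integral => //.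
  - by move=> x _; rewrite lee_fin normc_ge0.
  - exact: emeas_normc (cintble_meas (cintble_phase_excess oK Kz p0 (ma k))).
  - exact: measurable_int (integrable_gam_scale pr0).
  - by move=> x _; rewrite lee_fin normc_phase_fun ?dom_ind_ge0// -qkernE Gb.
have mQ0 : cmeas (fun z => h z * conjc (h z) * Q0 z).
  apply: cmeasM; first by apply: cmeasM => //; exact: cmeasJ.
  apply: cmeas_real; apply: (measurableT_comp (fine_measurable _)) => //.
  exact: measurable_qdens.
have bi : mu.-integrable setT (fun z => ((M * G) * normc (h z))%:E).
  by under eq_fun do rewrite EFinM; apply: integrableZl => //; have /cintbleP[] := hi.
have bound (q : V -> R[i]) : (forall z, S z -> normc (q z) <= G) ->
    forall z, normc (h z * conjc (h z) * q z) <= M * G * normc (h z).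
  move=> qG z; have [->|hz] := eqVneq (h z) 0.
    by rewrite !mul0r Normc.normc0 mulr0.
  rewrite !normcMl normc_conj (mulrAC M); apply: ler_pM; rewrite ?mulr_ge0 ?normc_ge0//.
    by rewrite ler_wpM2r ?normc_ge0.
  exact/qG/hS.
have cvg0 : (fun k => normc (cI mu (fun z => h z * conjc (h z) * Q k z) -
    cI mu (fun z => h z * conjc (h z) * Q0 z))) @ \oo --> (0 : R).
  apply: (@cI_cvg _ _ _ mu _ _ (fun z => ((M * G) * normc (h z))%:E)) => //.
  - by move=> k; exact: cintble_meas (Qi k).
  - move=> z; have [->|hz] := eqVneq (h z) 0.
      by under eq_fun do rewrite !mul0r subrr Normc.normc0; exact: cvg_cst.
    rewrite -(mulr0 (normc (h z * conjc (h z)))).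
    under eq_fun do rewrite -mulrBr normcMl.
    by apply: cvgM; [exact: cvg_cst|exact/cvgQ/hS].
  - by move=> k z; rewrite lee_fin; apply: bound => {}z; exact: Qb.
have final : normc (cI mu (fun z => h z * conjc (h z) * Q0 z)) <= I * I.
  have h1 : (fun k => I * I + normc (cI mu (fun z => h z * conjc (h z) * Q k z) -
      cI mu (fun z => h z * conjc (h z) * Q0 z))) @ \oo --> (I * I).
    by rewrite -[X in _ --> X]addr0; apply: cvgD => //; exact: cvg_cst.
  apply: (cvgr_to_ge h1); apply: nearW => k.
  apply: (le_trans (normc_le_dist _ (cI mu (fun z => h z * conjc (h z) * Q k z)))).
  by apply: lerD; [exact: bQ|exact: lexx].
have Q0E z : h z * conjc (h z) * Q0 z = (normc (h z) ^+ 2 * (\int[mu]_x (qkern K z x)))%:C.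
  by rewrite mulJc -rmorphM.
have Q0i : cintble mu (fun z => h z * conjc (h z) * Q0 z).
  by apply: (le_cintble mQ0 bi) => z; rewrite lee_fin; exact: bound.
rewrite IE -EFinM; apply: le_trans (_ : ((I * I)%:E <= _)%E) => //.
rewrite -lee_fin in final; apply: le_trans final.
under [in leRHS]eq_cI do rewrite Q0E.
rewrite cI_real normc_real ger0_norm; last first.
  by apply: Rintegral_ge0 => z _; rewrite mulr_ge0 ?sqr_ge0//; apply: Rintegral_ge0 => x _; exact: qkern_ge0.
rewrite EFin_Rintegral; last first.
  by have [+ _] := Q0i; congr (integrable _ _ _); apply/funext => z; rewrite Q0E.
rewrite le_eqVlt; apply/orP; left; apply/eqP; apply: eq_integral => z _.
have [->|hz] := eqVneq (h z) 0; first by rewrite Normc.normc0 expr0n/= mul0e mul0r.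
by rewrite [RHS]EFinM EFin_Rintegral//; exact/qdens_fin/SK/hS.
Qed.

End carleman.

(** * Test functions and mollification *)

Section compact_support.
Context (R : realType) (n : nat).
Local Notation V := 'rV[R]_n.
Local Notation mu := (lebesgue_rV R n).
Implicit Types (f g : V -> R) (h : V -> R[i]) (x y z a : V).

Definition box (L : R) : set V := [set x | forall i, `|x ord0 i| <= L].

Lemma compact_box L : compact (box L).
Proof.
have -> : box L = [set v : V | forall i : 'I_n, (`[- L, L]%classic : set R) (v ord0 i)].
  by apply/seteqP; split => x hx i; have := hx i; rewrite /= in_itv/= ler_norml.
apply: (@rV_compact R n (fun=> (`[- L, L]%classic : set R))) => i; exact: segment_compact.
Qed.

Lemma compact_eventually I (F : set_system I) (P : I -> V -> Prop) (K : set V) : Filter F -> compact K ->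
  (forall x, K x -> \forall x' \near x & i \near F, P i x') ->
  \forall i \near F, forall x, K x -> P i x.
Proof. by move=> FF /compact_near_coveringP cK h; apply: cK. Qed.

Lemma continuous_ball f x (e : R) : {for x, continuous f} -> 0 < e ->
  exists2 d, 0 < d & forall y, (forall i, `|y ord0 i| < d) -> `|f (x + y) - f x| < e.
Proof.
move=> cf e0; have /cvgrPdist_lt /(_ e e0) /nbhs_ballP[d /= d0 hd] := cf.
exists d => // y hy; rewrite distrC; apply: hd; split => // i j /=; rewrite ord1 !mxE/=.
by rewrite /ball/= opprD addrA subrr sub0r normrN.
Qed.

Lemma cvg_ball f x (l : R) : (forall e : R, 0 < e ->
    exists2 d, 0 < d & forall y, (forall i, `|y ord0 i| < d) -> `|f (x + y) - l| < e) ->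
  f @ x --> l.
Proof.
move=> h; apply: (@cvgrPdist_lt R R V (nbhs x) (nbhs_filter x) f l).2 => e e0.
have [d d0 hd] := h e e0; apply/nbhs_ballP; exists d => //= y [_ xy].
have -> : y = x + (y - x) by rewrite addrC subrK.
by rewrite distrC; apply: hd => i; rewrite !mxE distrC; exact: xy ord0 i.
Qed.

Definition box_supp (T : nmodType) (f : V -> T) (L : R) := forall x, ~ box L x -> f x = 0.

Lemma notin_box L x : ~ box L x -> exists i, L < `|x ord0 i|.
Proof. by move=> /existsNP[i /negP]; rewrite -ltNge => h; exists i. Qed.

Lemma unif_continuous f L (e : R) : continuous f -> box_supp f L -> 0 < e ->
  exists2 d, 0 < d & forall x y, (forall i, `|y ord0 i| < d) -> `|f (x + y) - f x| < e.
Proof.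
move=> cf sf e0.
have h : \forall d \near 0^'+, forall x, box L x ->
    forall y, (forall i, `|y ord0 i| < d) -> `|f (x + y) - f x| < e.
  apply: compact_eventually (@compact_box L) _ => x _.
  have e2 : 0 < e / 2 by rewrite divr_gt0.
  have [d d0 hd] := continuous_ball (cf x) e2.
  exists (ball x (d / 2), [set t : R | t < d / 2]).
    split; first by apply: nbhsx_ballx; rewrite divr_gt0.
    by apply: nbhs_right_lt; rewrite divr_gt0.
  move=> [x' t] /= [[_ xx'] td] y yt.
  have h1 i : `|x' ord0 i - x ord0 i| < d / 2 by rewrite distrC; exact: xx' ord0 i.
  have k1 : `|f x' - f x| < e / 2.
    have -> : x' = x + (x' - x) by rewrite addrC subrK.
    by apply: hd => i; rewrite !mxE; have := h1 i; lra.
  have k2 : `|f (x' + y) - f x| < e / 2.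
    have -> : x' + y = x + (x' - x + y) by rewrite addrA (addrC x) subrK.
    apply: hd => i; rewrite !mxE; have := h1 i; have := yt i.
    by have := ler_normD (x' ord0 i - x ord0 i) (y ord0 i); lra.
  have := ler_normB (f (x' + y) - f x) (f x' - f x).
  by rewrite opprB addrA subrK; lra.
have [d d0 hd] : exists2 d : R, 0 < d & forall x, box L x ->
    forall y, (forall i, `|y ord0 i| < d) -> `|f (x + y) - f x| < e.
  near (0 : R)^'+ => d; exists d; first by near: d; exact: nbhs_right_gt.
  by near: d.
exists d => // x y yd.
have [bx|bx] := pselect (box L x); first exact: hd.
have [bxy|bxy] := pselect (box L (x + y)); last by rewrite !sf// subrr normr0.
have := hd _ bxy (- y); rewrite addrK distrC; apply => i.
by rewrite mxE normrN.
Unshelve. all: by end_near. Qed.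

Lemma bounded_box_supp f L : continuous f -> box_supp f L -> exists M, forall x, `|f x| <= M.
Proof.
move=> cf sf.
have h : \forall M \near +oo, forall x, box L x -> `|f x| <= M.
  apply: compact_eventually (@compact_box L) _ => x _.
  have [d d0 hd] := continuous_ball (cf x) ltr01.
  exists (ball x d, [set M : R | `|f x| + 1 <= M]).
    by split; [exact: nbhsx_ballx|exact: nbhs_pinfty_ge].
  move=> [x' t] /= [[_ xx'] td].
  have h1 : `|f x' - f x| < 1.
    have -> : x' = x + (x' - x) by rewrite addrC subrK.
    by apply: hd => i; rewrite !mxE distrC; exact: xx' ord0 i.
  have := ler_normD (f x' - f x) (f x); rewrite subrK; lra.
have [M M0 hM] : exists2 M : R, 0 <= M & forall x, box L x -> `|f x| <= M.
  near +oo_R => M; exists M; first by near: M; exact: nbhs_pinfty_ge.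
  by near: M.
exists M => x; have [bx|bx] := pselect (box L x); first exact: hM.
by rewrite sf// normr0.
Unshelve. all: by end_near. Qed.

Lemma integrable_cube (a b : R) : a <= b -> mu.-integrable setT (fun x => (cube_ind a b x)%:E).
Proof.
move=> ab; apply/integrableP; split.
  apply/measurable_EFinP; apply: (measurable_prod_coord (f := fun=> \1_(`[a, b]%classic : set R))) => i.
  exact: measurable_indic.
under eq_integral do rewrite abse_EFin ger0_norm ?prodr_ge0//.
by rewrite integral_cube// ltry.
Qed.

Lemma cube_ind_ge0 (a b : R) x : 0 <= cube_ind a b x.
Proof. exact: prodr_ge0. Qed.

Lemma cube_ind_box L x : box L x -> cube_ind (- L) L x = 1.
Proof.
by move=> bx; rewrite /cube_ind big1// => i _; rewrite indicE mem_set//= in_itv/= -ler_norml.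
Qed.

Lemma cintble_box h (M L : R) : cmeas h -> (forall x, normc (h x) <= M) -> 0 <= L -> box_supp h L ->
  cintble mu h.
Proof.
move=> mh hM L0 sh.
have i : mu.-integrable setT (fun x => M%:E * (cube_ind (- L) L x)%:E)%E.
  by apply: integrableZl => //; apply: integrable_cube; lra.
apply: (le_cintble mh i) => x; rewrite -EFinM lee_fin.
have [bx|bx] := pselect (box L x); first by rewrite cube_ind_box// mulr1.
rewrite sh// Normc.normc0 mulr_ge0 ?cube_ind_ge0//.
exact: le_trans (normc_ge0 _) (hM x).
Qed.

End compact_support.

(** * Smooth functions of bounded support and their transforms *)

Section smooth_theory.
Context (R : realType) (n : nat).
Local Notation V := 'rV[R]_n.
Local Notation mu := (lebesgue_rV R n).
Local Notation dl i := (delta_mx ord0 i : V).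
Implicit Types (f g : V -> R) (h : V -> R[i]) (x y z a : V) (s : seq 'I_n).

Lemma partial_cat s (t : seq 'I_n) f : partial (s ++ t) f = partial s (partial t f).
Proof. by rewrite /partial foldr_cat. Qed.

Lemma smooth_partial s f : smooth f -> smooth (partial s f).
Proof. by move=> sf t; rewrite -partial_cat; exact: sf. Qed.

Lemma smooth_continuous f : smooth f -> continuous f.
Proof. by move=> /(_ [::])[]. Qed.

Lemma partial_shift s f a : partial s (fun x => f (x + a)) = fun x => partial s f (x + a).
Proof.
elim: s => //= i s ->; apply/funext => x; rewrite /derive; congr (lim _).
by apply: congr2 => //; apply/funext => c /=; rewrite addrA.
Qed.

Lemma smooth_shift f a : smooth f -> smooth (fun x => f (x + a)).
Proof.
move=> sf s; rewrite partial_shift; have [c d] := sf s; split.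
  move=> x; apply: cvg_ball => e e0; have [d0 d00 hd0] := continuous_ball (c (x + a)) e0.
  by exists d0 => // y hy; rewrite (addrAC x); exact: hd0.
move=> x i; have := d (x + a) i; rewrite /derivable.
congr (cvg _); apply: congr2 => //; apply/funext => e /=; by rewrite addrA.
Qed.

Lemma smooth_lin (c : R) f g : smooth f -> smooth g ->
  (forall s, partial s (fun x => c * f x + g x) = fun x => c * partial s f x + partial s g x) /\
  smooth (fun x => c * f x + g x).
Proof.
move=> sf sg.
have E s : partial s (fun x => c * f x + g x) = fun x => c * partial s f x + partial s g x.
  elim: s => //= i s ->; apply/funext => x.
  have df := (sf s).2 x i; have dg := (sg s).2 x i.
  have dz : derivable (c *: partial s f) x (dl i) by exact: derivableZ.
  exact: etrans (deriveD dz dg) (congr1 (fun e => e + _) (deriveZ c df)).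
split => // s; rewrite E; split.
  move=> x; have h1 : {for x, continuous (fun x => c * partial s f x)}.
    exact: continuousM (cvg_cst c) ((sf s).1 x).
  exact: continuousD h1 ((sg s).1 x).
move=> x i; have df := (sf s).2 x i; have dg := (sg s).2 x i.
have dz : derivable (c *: partial s f) x (dl i) by exact: derivableZ.
exact: derivableD dz dg.
Qed.

Lemma smooth0 : (forall s, partial s (fun _ : V => 0 : R) = fun=> 0) /\ smooth (fun _ : V => 0 : R).
Proof.
have E s : partial s (fun _ : V => 0 : R) = fun=> 0.
  by elim: s => //= i s ->; apply/funext => x; rewrite derive_cst.
split; first exact: E.
by move=> s; rewrite E; split; [exact: cst_continuous|move=> x i; exact: derivable_cst].
Qed.

Lemma nbhs_notin_box (L : R) x : ~ box L x -> \forall y \near x, ~ box L y.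
Proof.
move=> /notin_box[i xi].
have xi0 : 0 < `|x ord0 i| - L by rewrite subr_gt0.
apply/nbhs_ballP; exists (`|x ord0 i| - L) => //= y [_ xy] /(_ i).
have h : `|x ord0 i - y ord0 i| < `|x ord0 i| - L := xy ord0 i.
have := ler_normD (x ord0 i - y ord0 i) (y ord0 i); rewrite subrK; lra.
Qed.

Lemma box_supp_partial f L s : box_supp f L -> box_supp (partial s f) L.
Proof.
move=> sf; elim: s => //= i s IH x bx.
rewrite (@near_eq_derive _ _ _ _ (fun=> 0)) ?derive_cst//.
by apply: filterS (nbhs_notin_box bx) => y; exact: IH.
Qed.

Lemma is_derive_line f x i : (forall y, derivable f y (dl i)) ->
  forall t : R, is_derive t (1 : R) (fun t => f (x + t *: dl i)) ('D_(dl i) f (x + t *: dl i)).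
Proof.
move=> df t.
have E : (fun e : R => e^-1 *: (((fun t => f (x + t *: dl i)) \o shift t) (e *: (1 : R)) - f (x + t *: dl i))) =
   (fun e : R => e^-1 *: ((f \o shift (x + t *: dl i)) (e *: dl i) - f (x + t *: dl i))).
  apply/funext => e /=; congr (_ *: (f _ - _)).
  by rewrite (_ : e%:A = e) ?scalerDl 1?addrCA//; exact: mulr1.
by apply: DeriveDef; [rewrite /derivable E; exact: df|rewrite /derive E].
Qed.

Lemma partial_lipschitz f i (M t : R) x : (forall y, derivable f y (dl i)) ->
  (forall y, `|'D_(dl i) f y| <= M) -> 0 <= t -> `|f (x + t *: dl i) - f x| <= M * t.
Proof.
move=> df dM t0.
have [||c _] := @MVT_segment R (fun t => f (x + t *: dl i)) (fun t => 'D_(dl i) f (x + t *: dl i)) 0 t t0.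
- by move=> u _; exact: is_derive_line.
- apply: continuous_subspaceT => u; exact: is_derive_cvg (is_derive_line x df u).
rewrite scale0r addr0 subr0 => ->; rewrite normrM (ger0_norm t0) ler_wpM2r//.
Qed.

Lemma cvg_harmonic_dnbhs : (fun k : nat => k.+1%:R^-1 : R) @ \oo --> (0 : R)^'.
Proof.
move=> P hP; have hP' : nbhs (0 : R) (fun e : R => e != 0 -> P e) := hP.
have h : \forall k \near \oo, (k.+1%:R^-1 != 0 :> R -> P k.+1%:R^-1) := cvg_harmonic hP'.
by apply: filterS h => k; apply; rewrite invr_eq0 pnatr_eq0.
Qed.

Lemma cvg_diff_quot f x i : derivable f x (dl i) ->
  (fun k => k.+1%:R * (f (x + k.+1%:R^-1 *: dl i) - f x)) @ \oo --> 'D_(dl i) f x.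
Proof.
move=> df; have := cvg_comp _ _ cvg_harmonic_dnbhs df.
rewrite /derive; apply: cvg_trans; apply: near_eq_cvg; apply: nearW => k /=.
by rewrite invrK (addrC x).
Qed.

Definition csmooth h := smooth (fun x => Re (h x)) /\ smooth (fun x => Im (h x)).

Lemma cpartial_cat s (t : seq 'I_n) h : cpartial (s ++ t) h = cpartial s (cpartial t h).
Proof. by apply/funext => x; rewrite /cpartial !partial_cat. Qed.

Lemma csmooth_cpartial s h : csmooth h -> csmooth (cpartial s h).
Proof. by move=> [h1 h2]; split; exact: smooth_partial. Qed.

Lemma cpartial_nil h : cpartial [::] h = h.
Proof. by apply/funext => x; rewrite /cpartial /=; case: (h x). Qed.

Lemma cmeas_csmooth h : csmooth h -> cmeas h.
Proof.
by move=> [/smooth_continuous h1 /smooth_continuous h2]; split; exact: continuous_measurable_rV.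
Qed.

Lemma box_supp_Re h L : box_supp h L -> box_supp (fun x => Re (h x)) L.
Proof. by move=> hL x bx; rewrite hL. Qed.

Lemma box_supp_Im h L : box_supp h L -> box_supp (fun x => Im (h x)) L.
Proof. by move=> hL x bx; rewrite hL. Qed.

Lemma box_supp_cpartial s h L : box_supp h L -> box_supp (cpartial s h) L.
Proof.
move=> hL x bx; rewrite /cpartial (box_supp_partial s (box_supp_Re hL))//.
by rewrite (box_supp_partial s (box_supp_Im hL)).
Qed.

Lemma bounded_csmooth h L : csmooth h -> box_supp h L -> exists M, forall x, normc (h x) <= M.
Proof.
move=> [/smooth_continuous h1 /smooth_continuous h2] hL.
have [M1 b1] := bounded_box_supp h1 (box_supp_Re hL).
have [M2 b2] := bounded_box_supp h2 (box_supp_Im hL).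
by exists (M1 + M2) => x; apply: le_trans (normc_le_ReIm _) _; exact: lerD.
Qed.

Lemma cintble_csmooth h L : 0 <= L -> csmooth h -> box_supp h L -> cintble mu h.
Proof.
move=> L0 sh hL; have [M hM] := bounded_csmooth sh hL.
exact: cintble_box (cmeas_csmooth sh) hM L0 hL.
Qed.

Lemma unif_csmooth h L (e : R) : csmooth h -> box_supp h L -> 0 < e ->
  exists2 d, 0 < d & forall x y, (forall i, `|y ord0 i| < d) -> normc (h (x + y) - h x) < e.
Proof.
move=> [/smooth_continuous h1 /smooth_continuous h2] hL e0.
have e2 : 0 < e / 2 by rewrite divr_gt0.
have [d1 d10 u1] := unif_continuous h1 (box_supp_Re hL) e2.
have [d2 d20 u2] := unif_continuous h2 (box_supp_Im hL) e2.
exists (Num.min d1 d2); first by rewrite lt_min d10.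
move=> x y yd; apply: le_lt_trans (normc_le_ReIm _) _.
rewrite cReD cImD cReN cImN.
have k1 : `|Re (h (x + y)) - Re (h x)| < e / 2 by apply: u1 => i; have := yd i; rewrite lt_min => /andP[].
have k2 : `|Im (h (x + y)) - Im (h x)| < e / 2 by apply: u2 => i; have := yd i; rewrite lt_min => /andP[].
lra.
Qed.

Lemma ccont_csmooth h L : csmooth h -> box_supp h L -> ccont h.
Proof.
move=> sh hL x; apply: cvg_ball => e e0; have [d d0 hd] := unif_csmooth sh hL e0.
by exists d => // y yd; rewrite subr0 ger0_norm ?normc_ge0//; exact: hd.
Qed.

Definition dquot i h (k : nat) x : R[i] := (k.+1%:R)%:C * (h (x + k.+1%:R^-1 *: dl i) - h x).

Lemma cvg_dquot i h x : csmooth h -> (fun k => normc (dquot i h k x - cpartial [:: i] h x)) @ \oo --> (0 : R).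
Proof.
move=> [h1 h2].
have c1 := cvg_diff_quot ((h1 [::]).2 x i); have c2 := cvg_diff_quot ((h2 [::]).2 x i).
apply: (squeeze0 (v := fun k => `|Re (dquot i h k x - cpartial [:: i] h x)| + `|Im (dquot i h k x - cpartial [:: i] h x)|)).
- by move=> k; exact: normc_ge0.
- by move=> k; exact: normc_le_ReIm.
- rewrite -[X in _ --> X]addr0; apply: cvgD.
    under eq_fun do rewrite cReD cReN /dquot cReM cReD cReN /= mul0r subr0.
    rewrite -(normr0 R); apply: cvg_norm; rewrite -(subrr ('D_(dl i) (fun x => Re (h x)) x)).
    by apply: cvgB => //; exact: cvg_cst.
  under eq_fun do rewrite cImD cImN /dquot cImM cImD cImN /= mul0r addr0.
  rewrite -(normr0 R); apply: cvg_norm; rewrite -(subrr ('D_(dl i) (fun x => Im (h x)) x)).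
  by apply: cvgB => //; exact: cvg_cst.
Qed.

Lemma normc_dquot i h L : csmooth h -> box_supp h L -> exists M, forall k x, normc (dquot i h k x) <= M.
Proof.
move=> [h1 h2] hL.
have [M1 b1] := bounded_box_supp ((h1 [:: i]).1) (box_supp_partial [:: i] (box_supp_Re hL)).
have [M2 b2] := bounded_box_supp ((h2 [:: i]).1) (box_supp_partial [:: i] (box_supp_Im hL)).
exists (M1 + M2) => k x; have ik0 : 0 <= k.+1%:R^-1 :> R by rewrite invr_ge0.
rewrite normcMl normc_real ger0_norm// -ler_pdivlMl// mulrC.
apply: le_trans (normc_le_ReIm _) _; rewrite cReD cReN cImD cImN mulrDl; apply: lerD.
  exact: (@partial_lipschitz (fun x => Re (h x)) i M1 _ x (fun y => (h1 [::]).2 y i) b1 ik0).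
exact: (@partial_lipschitz (fun x => Im (h x)) i M2 _ x (fun y => (h2 [::]).2 y i) b2 ik0).
Qed.

Lemma cmeas_dquot i h k : cmeas h -> cmeas (dquot i h k).
Proof.
move=> mh; have [m1 m2] := mh; apply: cmeasM; first exact: cmeas_cst.
apply: cmeasD; first by split; [apply: (measurableT_comp m1)|apply: (measurableT_comp m2)]; exact: measurable_rV_shift.
have -> : (fun x => - h x) = (fun x => -1 * h x) by apply/funext => x; rewrite mulN1r.
by apply: cmeasM => //; exact: cmeas_cst.
Qed.

(** Differentiation under the integral sign: the mean value theorem bounds the difference quotients
    uniformly. The map [phi] allows the argument x - z of a convolution. *)
Lemma cI_dquot_cvg (i : 'I_n) h L (phi : V -> V) (g : V -> R[i]) : csmooth h -> box_supp h L ->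
  measurable_fun setT phi -> cintble mu g ->
  (fun k => normc (cI mu (fun z => dquot i h k (phi z) * g z) -
    cI mu (fun z => cpartial [:: i] h (phi z) * g z))) @ \oo --> (0 : R).
Proof.
move=> sh hL mphi gi; have [M hM] := normc_dquot i sh hL.
have mg := cintble_meas gi.
have mcomp (f : V -> R[i]) : cmeas f -> cmeas (fun z => f (phi z)).
  by move=> [m1 m2]; split; [exact: (measurableT_comp m1 mphi)|exact: (measurableT_comp m2 mphi)].
apply: (@cI_cvg _ _ _ mu _ _ (fun z => (M%:E * (normc (g z))%:E)%E)).
- by move=> k; apply: cmeasM => //; apply/mcomp/cmeas_dquot/cmeas_csmooth.
- by apply: cmeasM => //; apply/mcomp/cmeas_csmooth/csmooth_cpartial.
- move=> z; rewrite -[X in _ --> X](mul0r (normc (g z))).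
  under eq_fun do rewrite -mulrBl normcMl.
  by apply: cvgMl; exact: cvg_dquot.
- by apply: integrableZl => //; have /cintbleP[] := gi.
- by move=> k z; rewrite -EFinM lee_fin normcMl ler_wpM2r ?normc_ge0.
Qed.

(* Integration by parts: shift the difference quotient from one factor to the other. *)
Lemma cI_parts (i : 'I_n) h r L L' x : 0 <= L -> csmooth h -> box_supp h L ->
  0 <= L' -> csmooth r -> box_supp r L' ->
  cI mu (fun z => cpartial [:: i] h z * r (x - z)) = cI mu (fun z => h z * cpartial [:: i] r (x - z)).
Proof.
move=> L0 sh hL L0' sr rL.
have hi := cintble_csmooth L0 sh hL; have ri := cintble_csmooth L0' sr rL.
have [M hM] := bounded_csmooth sh hL; have [M' rM] := bounded_csmooth sr rL.
have mx : measurable_fun setT (fun z : V => x - z).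
  rewrite (_ : (fun z => _) = (fun z => z + x) \o (fun z => (-1) *: z)).
    by apply: measurableT_comp; [exact: measurable_rV_shift|exact: measurable_rV_scale].
  by apply/funext => z /=; rewrite scaleN1r addrC.
have rxi : cintble mu (fun z => r (x - z)).
  have := cI_opp (cI_shift x ri).1 => -[+ _].
  by under eq_fun do rewrite addrC.
have c1 := cI_dquot_cvg i sh hL (@measurable_id _ _ setT) rxi.
have c2 := cI_dquot_cvg i sr rL mx hi.
have e k : cI mu (fun z => dquot i h k z * r (x - z)) = cI mu (fun z => dquot i r k (x - z) * h z).
  pose v : V := k.+1%:R^-1 *: dl i.
  have i1 : cintble mu (fun z => h (z + v) * r (x - z)).
    apply: (cintbleMb (b := M) rxi) => //.
    have [m1 m2] := cintble_meas hi.
    by split; [apply: (measurableT_comp m1)|apply: (measurableT_comp m2)]; exact: measurable_rV_shift.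
  have i2 : cintble mu (fun z => h z * r (x - z)) by exact: (cintbleMb (b := M) rxi (cintble_meas hi)).
  have i3 : cintble mu (fun z => h z * r (x - z + v)).
    have := (cI_shift (- v) i1).1; congr (cintble _ _); apply/funext => z.
    by rewrite subrK opprB (addrC v) addrA.
  have s1 : cI mu (fun z => h (z + v) * r (x - z)) = cI mu (fun z => h z * r (x - z + v)).
    rewrite -(cI_shift (- v) i1).2; apply: eq_cI => z.
    by rewrite subrK opprB (addrC v) addrA.
  have E1 : (fun z => dquot i h k z * r (x - z)) =
      (fun z => (k.+1%:R)%:C * (h (z + v) * r (x - z) + -1 * (h z * r (x - z)))).
    by apply/funext => z; rewrite /dquot; ring.
  have E2 : (fun z => dquot i r k (x - z) * h z) =
      (fun z => (k.+1%:R)%:C * (h z * r (x - z + v) + -1 * (h z * r (x - z)))).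
    by apply/funext => z; rewrite /dquot; ring.
  rewrite E1 E2 !cIZ ?cID ?s1//; try exact: cintbleZ.
  - by apply: cintbleD => //; exact: cintbleZ.
  - by apply: cintbleD => //; exact: cintbleZ.
apply: (normc_cvg_unique (u := fun k => cI mu (fun z => dquot i h k z * r (x - z)))); first exact: c1.
have e0 : cI mu (fun z => h z * cpartial [:: i] r (x - z)) = cI mu (fun z => cpartial [:: i] r (x - z) * h z).
  by apply: eq_cI => z; rewrite mulrC.
by rewrite e0; under eq_fun do rewrite e.
Qed.

Lemma expi_dquot (c : R) :
  (fun k => normc ((k.+1%:R)%:C * (expi (k.+1%:R^-1 * c) - 1) - 'i%C * c%:C)) @ \oo --> (0 : R).
Proof.
have dc : is_derive (0 : R) (1 : R) (fun t => cos (t * c)) 0.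
  have h : is_derive (0 : R) (1 : R) (fun t => t * c) c.
    have := is_deriveZ c (is_derive_id (0 : R) (1 : R)).
    rewrite /GRing.scale/= mulr1; congr (is_derive _ _ _ _).
    by apply/funext => u; rewrite mulrC.
  have := @is_derive1_comp R (@cos R) (fun t => t * c) 0 _ _ (is_derive_cos _) h.
  by rewrite mul0r sin0 oppr0 mul0r.
have ds : is_derive (0 : R) (1 : R) (fun t => sin (t * c)) c.
  have h : is_derive (0 : R) (1 : R) (fun t => t * c) c.
    have := is_deriveZ c (is_derive_id (0 : R) (1 : R)).
    rewrite /GRing.scale/= mulr1; congr (is_derive _ _ _ _).
    by apply/funext => u; rewrite mulrC.
  have := @is_derive1_comp R (@sin R) (fun t => t * c) 0 _ _ (is_derive_sin _) h.
  by rewrite mul0r cos0 mul1r.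
have lim (f : R -> R) l : is_derive (0 : R) (1 : R) f l ->
    (fun k => k.+1%:R * (f k.+1%:R^-1 - f 0)) @ \oo --> l.
  move=> [df <-]; have := cvg_comp _ _ cvg_harmonic_dnbhs df.
  rewrite /derive; apply: cvg_trans; apply: near_eq_cvg; apply: nearW => k /=.
  by rewrite invrK addr0 (_ : k.+1%:R^-1%:A = k.+1%:R^-1 :> R)//; exact: mulr1.
have hc := lim _ _ dc; have hs := lim _ _ ds.
rewrite /= mul0r cos0 in hc; rewrite /= mul0r sin0 in hs.
pose u k : R[i] := (k.+1%:R)%:C * (expi (k.+1%:R^-1 * c) - 1) - 'i%C * c%:C.
apply: (squeeze0 (v := fun k => `|Re (u k)| + `|Im (u k)|)).
- by move=> k; exact: normc_ge0.
- by move=> k; exact: normc_le_ReIm.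
have eR k : Re (u k) = k.+1%:R * (cos (k.+1%:R^-1 * c) - 1).
  by rewrite cReD cReN !cReM cReD cReN cImD cImN /=; ring.
have eI k : Im (u k) = k.+1%:R * (sin (k.+1%:R^-1 * c) - 0) - c.
  by rewrite cImD cImN !cImM cReD cReN cImD cImN /=; ring.
rewrite -[X in _ --> X]addr0; apply: cvgD.
  by rewrite -(normr0 R); apply: cvg_norm; under eq_fun do rewrite eR.
have h3 : (fun k => k.+1%:R * (sin (k.+1%:R^-1 * c) - 0) - c) @ \oo --> (0 : R).
  by rewrite -[X in _ --> X](subrr c); apply: cvgB => //; exact: cvg_cst.
by rewrite -(normr0 R); apply: cvg_norm; under eq_fun do rewrite eI.
Qed.

(** A translation of [h] multiplies the transform by a phase, so a difference quotient of [h]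
    becomes a difference quotient of that phase. *)
Lemma fourier_partial (i : 'I_n) h L x : 0 <= L -> csmooth h -> box_supp h L ->
  fourier (cpartial [:: i] h) x = 'i%C * (2 * pi * x ord0 i)%:C * fourier h x.
Proof.
move=> L0 sh hL.
have hi := cintble_csmooth L0 sh hL; have [M hM] := bounded_csmooth sh hL.
have mh := cintble_meas hi.
(* The kernel is cut off to be integrable. The steps of the difference quotients are at most 1, so
   the cube of half-side L + 1 contains their supports. *)
pose g z : R[i] := kern x z * (cube_ind (- (L + 1)) (L + 1) z)%:C.
have gi : cintble mu g.
  apply: (cintbleMb (b := 1) (f := fun z => (cube_ind (- (L + 1)) (L + 1) z)%:C) _ (cmeas_kern x)).
    by split; [apply: integrable_cube; lra|exact: integrable0].
  by move=> z; rewrite normc_kern.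
have dg (k : nat) z : dquot i h k z * g z = dquot i h k z * kern x z.
  have [bz|bz] := pselect (box (L + 1) z); first by rewrite /g cube_ind_box// mulr1.
  rewrite /dquot !hL ?subrr ?mulr0 ?mul0r//.
    by move=> bz'; apply: bz => j; rewrite (le_trans (bz' j))// lerDl.
  have [j zj] := notin_box bz; move=> /(_ j); rewrite !mxE eqxx/= => h1.
  have h2 : `|k.+1%:R^-1 * (j == i)%:R| <= 1 :> R.
    rewrite normrM -[leRHS]mulr1; apply: ler_pM => //.
      by rewrite normfV ger0_norm// invf_le1// ler1n.
    by case: (_ == _); rewrite ?normr1 ?normr0.
  have := ler_normB (z ord0 j + k.+1%:R^-1 * (j == i)%:R) (k.+1%:R^-1 * (j == i)%:R).
  by rewrite addrK; lra.
have cg z : cpartial [:: i] h z * g z = cpartial [:: i] h z * kern x z.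
  have [bz|bz] := pselect (box (L + 1) z); first by rewrite /g cube_ind_box// mulr1.
  rewrite (box_supp_cpartial [:: i] hL) ?mul0r//.
  by move=> bz'; apply: bz => j; rewrite (le_trans (bz' j))// lerDl.
have c1 := cI_dquot_cvg i sh hL (@measurable_id _ _ setT) gi.
have hki := cintble_kern x hi.
have e k : cI mu (fun z => dquot i h k z * g z) =
    (k.+1%:R)%:C * (expi (k.+1%:R^-1 * (2 * pi * x ord0 i)) - 1) * fourier h x.
  pose v : V := k.+1%:R^-1 *: dl i.
  have vE : expi (k.+1%:R^-1 * (2 * pi * x ord0 i)) = kern x (- v).
    by rewrite /kern dotvNr dotvZr dotv_delta; congr expi; ring.
  have i1 : cintble mu (fun z => h (z + v) * kern x z).
    under eq_fun do rewrite mulrC.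
    apply: (cintbleMb (b := 1) (cI_shift v hi).1 (cmeas_kern x)) => z.
    by rewrite normc_kern.
  have s1 : cI mu (fun z => h (z + v) * kern x z) = kern x (- v) * fourier h x.
    rewrite -(cI_shift (- v) i1).2 fourierE -(cIZ _ hki); apply: eq_cI => z.
    by rewrite subrK (kernC x) kernDl !(kernC _ x); ring.
  rewrite vE (eq_cI _ (dg k)).
  have E1 : (fun z => dquot i h k z * kern x z) =
      (fun z => (k.+1%:R)%:C * (h (z + v) * kern x z + -1 * (h z * kern x z))).
    by apply/funext => z; rewrite /dquot; ring.
  have i2 := cintbleZ (-1) hki.
  rewrite E1 (cIZ _ (cintbleD i1 i2)) (cID i1 i2) (cIZ _ hki) s1 -fourierE.
  ring.
apply: (normc_cvg_unique (u := fun k => cI mu (fun z => dquot i h k z * g z))).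
  rewrite fourierE (_ : (fun y => _) = (fun z => cpartial [:: i] h z * g z)) //.
  by apply/funext => z; rewrite cg.
rewrite -[X in _ --> X](mul0r (normc (fourier h x))).
under eq_fun do rewrite e -mulrBl normcMl.
by apply: cvgMl; exact: expi_dquot.
Qed.

Lemma csmooth_lin (c : R) h (k : V -> R[i]) : csmooth h -> csmooth k ->
  (forall s, cpartial s (fun x => c%:C * h x + k x) = fun x => c%:C * cpartial s h x + cpartial s k x) /\
  csmooth (fun x => c%:C * h x + k x).
Proof.
move=> [h1 h2] [k1 k2].
have [e1 s1] := smooth_lin c h1 k1; have [e2 s2] := smooth_lin c h2 k2.
have eR : (fun x => Re (c%:C * h x + k x)) = fun x => c * Re (h x) + Re (k x).
  by apply/funext => x; rewrite cReD cReM/= mul0r subr0.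
have eI : (fun x => Im (c%:C * h x + k x)) = fun x => c * Im (h x) + Im (k x).
  by apply/funext => x; rewrite cImD cImM/= mul0r addr0.
split; last by rewrite /csmooth eR eI.
move=> s; apply/funext => x; rewrite /cpartial eR eI e1 e2.
by apply: complex_ext; rewrite ?cReD ?cImD ?cReM ?cImM/=; ring.
Qed.

(** Applying 1 - d_i^2 in every coordinate multiplies the transform by the product of the 1 + (2 pi
    x_i)^2, that is 2^n / [khat x], and the result is still the transform of an integrable function,
    hence bounded. *)
Lemma fourier_decay h L : 0 <= L -> csmooth h -> box_supp h L ->
  exists C, forall x, normc (fourier h x) <= C * khat x.
Proof.
move=> L0 sh hL.
have H s : exists k, [/\ csmooth k, box_supp k L &
    forall x, fourier k x = (\prod_(i <- s) (1 + (2 * pi * x ord0 i) ^+ 2))%:C * fourier h x].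
  elim: s => [|i s [k [sk kL kE]]].
    by exists h; split => // x; rewrite big_nil mul1r.
  pose k2 := cpartial [:: i] (cpartial [:: i] k).
  have sk1 : csmooth (cpartial [:: i] k) by exact: csmooth_cpartial.
  have sk2 : csmooth k2 by exact: csmooth_cpartial.
  have kL1 : box_supp (cpartial [:: i] k) L by exact: box_supp_cpartial.
  have kL2 : box_supp k2 L by exact: box_supp_cpartial.
  exists (fun x => (-1)%:C * k2 x + k x); split.
  - exact: (csmooth_lin (-1) sk2 sk).2.
  - by move=> x bx; rewrite kL2// kL// mulr0 addr0.
  - move=> x; have ki := cintble_kern x (cintble_csmooth L0 sk kL).
    have k2i := cintble_kern x (cintble_csmooth L0 sk2 kL2).
    transitivity ((-1)%:C * fourier k2 x + fourier k x).
      rewrite !fourierE -(cIZ _ k2i) -cID//; last exact: cintbleZ.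
      by apply: eq_cI => z; rewrite mulrDl mulrA.
    rewrite /k2 (fourier_partial i x L0 sk1 kL1) (fourier_partial i x L0 sk kL) big_cons kE.
    have hC (a b : R) : ((1 + a ^+ 2) * b)%:C = (1 + a%:C ^+ 2) * b%:C :> R[i].
      by rewrite rmorphM rmorphD rmorph1 rmorphXn.
    rewrite hC rmorphN1.
    have i2 : 'i%C * 'i%C = -1 :> R[i] by apply: complex_ext; rewrite ?cReM ?cImM/=; ring.
    have -> (a b c : R[i]) : -1 * ('i%C * a * ('i%C * a * (b * c))) + b * c = (1 - ('i%C * 'i%C) * a ^+ 2) * b * c.
      by ring.
    by rewrite i2 mulN1r opprK.
have [k [sk kL kE]] := H (index_enum 'I_n).
have ki := cintble_csmooth L0 sk kL.
pose C := fine (\int[mu]_y (normc (k y))%:E)%E.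
exists (C / 2 ^+ n) => x.
have p1 i : 0 < 1 + (2 * pi * x ord0 i) ^+ 2 by rewrite ltr_wpDr// sqr_ge0.
have P0 : 0 < \prod_i (1 + (2 * pi * x ord0 i) ^+ 2) by apply: prodr_gt0.
have khE : khat x = 2 ^+ n / \prod_i (1 + (2 * pi * x ord0 i) ^+ 2).
  by rewrite /khat big_split/= prodr_const card_ord prodfV.
have h2 : 2 ^+ n != 0 :> R by rewrite expf_neq0// pnatr_eq0.
rewrite khE mulrA divfK// ler_pdivlMr// mulrC.
have : normc (fourier k x) <= C.
  rewrite -lee_fin fineK; first exact: normc_fourier.
  rewrite ge0_fin_numE; first exact: cintble_fin.
  by apply: integral_ge0 => y _; rewrite lee_fin normc_ge0.
by rewrite kE normcMl normc_real gtr0_norm.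
Qed.

Lemma cintble_fourier_csmooth h L : 0 <= L -> csmooth h -> box_supp h L -> cintble mu (fourier h).
Proof.
move=> L0 sh hL; have [C hC] := fourier_decay L0 sh hL.
have i : mu.-integrable setT (fun x => C%:E * (khat x)%:E)%E.
  by apply: integrableZl => //; exact: integrable_khat.
apply: (le_cintble _ i); first exact/cmeas_fourier/(cintble_csmooth L0 sh hL).
by move=> x; rewrite -EFinM lee_fin.
Qed.

Lemma inversion_csmooth h L : 0 <= L -> csmooth h -> box_supp h L ->
  forall z, h z = fourier (fourier h) (- z).
Proof.
move=> L0 sh hL z; have [M hM] := bounded_csmooth sh hL.
rewrite (fourier_inversion (cintble_csmooth L0 sh hL) (ccont_csmooth sh hL) hM)//.
exact: cintble_fourier_csmooth L0 sh hL.
Qed.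

End smooth_theory.

(** * Construction of bumps *)

Section bump1.
Context (R : realType).
Local Notation leb := (@lebesgue_measure R).
Implicit Types (p q : {poly R}) (t : R).

(** The functions p(1/t) exp (- 1/t), flat at 0, are stable under differentiation; the polynomial
    records the derivative, so a single computation gives smoothness of every order. *)
Definition flat p t : R := if 0 < t then p.[t^-1] * expR (- t^-1) else 0.

Definition flat_deriv p : {poly R} := 'X^2 * (p - p^`()).

Lemma poly_expRN_bounded p : exists C, forall u, 0 <= u -> `|p.[u]| * expR (- u) <= C.
Proof.
elim/poly_ind: p => [|p c [C hC]].
  by exists 0 => u _; rewrite horner0 normr0 mul0r.
have [D hD] : exists D, forall u, 0 <= u -> `|(p * 'X).[u]| * expR (- u) <= D.
  pose m := size p.
  have bp u : 0 <= u -> `|p.[u]| <= (\sum_(i < m) `|p`_i|) * (1 + u) ^+ m.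
    move=> u0; rewrite horner_coef mulr_suml; apply: (le_trans (ler_norm_sum _ _ _)).
    apply: ler_sum => i _; rewrite normrM ler_wpM2l// normrX ger0_norm//.
    apply: (@le_trans _ _ ((1 + u) ^+ i)); first by apply: lerXn2r; rewrite ?nnegrE ?addr_ge0// lerDr.
    by rewrite ler_weXn2l// ?lerDl// ltnW.
  exists ((\sum_(i < m) `|p`_i|) * (m.+1%:R ^+ m.+1 * expR 1)) => u u0.
  rewrite hornerM hornerX normrM (ger0_norm u0) -mulrA.
  apply: (@le_trans _ _ ((\sum_(i < m) `|p`_i|) * (1 + u) ^+ m * (u * expR (- u)))).
    by rewrite ler_wpM2r ?bp// mulr_ge0 ?expR_ge0.
  rewrite -mulrA ler_wpM2l ?sumr_ge0// mulrA.
  apply: (@le_trans _ _ ((1 + u) ^+ m.+1 * expR (- u))).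
    by rewrite ler_wpM2r ?expR_ge0// exprSr ler_wpM2l ?exprn_ge0 ?addr_ge0// lerDr.
  have := exprn_le_expR m.+1 ltr01 (addr_ge0 ler01 u0); rewrite divr1 mul1r => h.
  apply: le_trans (ler_wpM2r (expR_ge0 _) h) _.
  by rewrite -mulrA -expRD addrK.
exists (D + `|c|) => u u0; rewrite hornerD hornerC.
apply: (@le_trans _ _ ((`|(p * 'X).[u]| + `|c|) * expR (- u))).
  by rewrite ler_wpM2r ?expR_ge0// ler_normD.
rewrite mulrDl; apply: lerD; first exact: hD.
by rewrite ler_piMr// -expR0 ler_expR oppr_le0.
Qed.

Lemma flat0 p t : t <= 0 -> flat p t = 0.
Proof. by move=> t0; rewrite /flat ltNge t0. Qed.

Lemma is_derive_flat p t : is_derive t (1 : R) (flat p) (flat (flat_deriv p) t).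
Proof.
have [t0|t0|->] := ltgtP t 0.
- rewrite (flat0 _ (ltW t0)).
  have E : \forall s \near t, flat p s = (fun=> 0) s.
    near=> s; rewrite flat0//; apply: ltW; near: s; exact: lt_nbhsl.
  have E' : \forall s \near t, (fun=> 0) s = flat p s by apply: filterS E => s ->.
  apply: DeriveDef; first exact: (near_eq_derivable E' (derivable_cst _ _ _)).
  by rewrite (near_eq_derive _ E) derive_cst.
- pose F s := p.[s^-1] * expR (- s^-1).
  have dF : is_derive t (1 : R) F (flat (flat_deriv p) t).
    have h1 : is_derive t (1 : R) (fun s => s^-1) (- t ^- 2).
      have := is_deriveV (lt0r_neq0 t0) (is_derive_id t (1 : R)).
      by rewrite /GRing.scale/= mulr1.
    have h2 := @is_derive1_comp R (fun u => p.[u]) (fun s => s^-1) t _ _ (is_derive_poly p _) h1.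
    have h3 := @is_derive1_comp R (@expR R) (fun s => - s^-1) t _ _ (is_derive_expR _) (is_deriveN h1).
    have h4 := is_deriveM h2 h3.
    apply: (is_derive_eq h4); rewrite /flat t0 /flat_deriv /GRing.scale/= hornerM hornerXn hornerD hornerN.
    by rewrite exprVn; ring.
  have E : \forall s \near t, F s = flat p s.
    by near=> s; rewrite /flat ifT//; near: s; exact: lt_nbhsr.
  have E' : \forall s \near t, flat p s = F s by apply: filterS E => s ->.
  have [d1 d2] := dF.
  apply: DeriveDef; first exact: (near_eq_derivable E d1).
  by rewrite (near_eq_derive _ E').
- rewrite (flat0 _ (lexx 0)).
  (* At 0 the difference quotient with step h > 0 is h times the value at 1/h of u^2 p(u) exp (- u),
     which is bounded. *)
  have [C hC] := poly_expRN_bounded ('X^2 * p).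
  have C0 : 0 <= C by apply: le_trans (hC 0 (lexx _)); rewrite mulr_ge0 ?expR_ge0.
  have lim : (fun h : R => h^-1 *: ((flat p \o shift 0) (h *: (1 : R)) - flat p 0)) @ 0^' --> (0 : R).
    apply/cvgr0Pnorm_le => e e0; near=> h.
    rewrite /= addr0 (_ : h%:A = h); last exact: mulr1.
    rewrite (flat0 _ (lexx 0)) subr0 /flat; case: ifP => h0; last by rewrite scaler0 normr0 ltW.
    rewrite /GRing.scale/=.
    have -> : h^-1 * (p.[h^-1] * expR (- h^-1)) = h * (('X^2 * p).[h^-1] * expR (- h^-1)).
      by rewrite hornerM hornerXn; field; rewrite lt0r_neq0.
    rewrite normrM (gtr0_norm h0) normrM (ger0_norm (expR_ge0 _)).
    apply: (@le_trans _ _ (h * C)).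
      by rewrite ler_wpM2l ?(ltW h0)// hC// invr_ge0 ltW.
    apply: (@le_trans _ _ (e / (C + 1) * C)).
      rewrite ler_wpM2r//; apply: (le_trans (ler_norm h)); apply: ltW.
      near: h; apply: dnbhs0_lt; rewrite divr_gt0//; lra.
    by rewrite mulrAC ler_pdivrMr; nra.
  by apply: DeriveDef; [apply: cvgP lim|exact: (cvg_lim _ lim)].
Unshelve. all: by end_near. Qed.

End bump1.

Lemma flat1_lb (R : realType) (e t : R) : 0 < e -> - (e / 2) <= t <= e / 2 ->
  expR (- (2 / e)) <= flat 1 (e + t) /\ expR (- (2 / e)) <= flat 1 (e - t).
Proof.
move=> e0 /andP[t1 t2].
have k (u : R) : e / 2 <= u -> expR (- (2 / e)) <= flat 1 u.
  move=> ue; have u0 : 0 < u by lra.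
  rewrite /flat u0 hornerC mul1r ler_expR lerN2 -[2 / e]invf_div lef_pV2 ?posrE//.
  by rewrite divr_gt0.
by split; apply: k; lra.
Qed.

Section bump_family.
Context (R : realType) (e : R).
Local Notation leb := (@lebesgue_measure R).
Implicit Types (p q : {poly R}) (t : R) (l : seq ({poly R} * {poly R})).

(** A list of pairs of polynomials stands for a sum of products supported in [-e, e]; the product
    rule acts on the list. *)
Definition bumpl l t : R := \sum_(pq <- l) flat pq.1 (e + t) * flat pq.2 (e - t).

Definition bumpl_deriv l : seq ({poly R} * {poly R}) :=
  flatten [seq [:: (flat_deriv pq.1, pq.2); (pq.1, - flat_deriv pq.2)] | pq <- l].

Lemma flatN p t : flat (- p) t = - flat p t.
Proof. by rewrite /flat; case: ifP => _; rewrite ?oppr0// hornerN mulNr. Qed.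

Lemma is_derive_bumpl l t : is_derive t (1 : R) (bumpl l) (bumpl (bumpl_deriv l) t).
Proof.
elim: l => [|[p q] l IH].
  rewrite /bumpl_deriv/= /bumpl big_nil (_ : (fun t => _) = fun=> 0); first exact: is_derive_cst.
  by apply/funext => s; rewrite big_nil.
have h1 : is_derive t (1 : R) (fun t => flat p (e + t)) (flat (flat_deriv p) (e + t)).
  have h : is_derive t (1 : R) (fun t => e + t) (0 + 1) by apply: is_deriveD.
  have := @is_derive1_comp R (flat p) (fun t => e + t) t _ _ (is_derive_flat _ _) h.
  by rewrite add0r mulr1.
have h2 : is_derive t (1 : R) (fun t => flat q (e - t)) (- flat (flat_deriv q) (e - t)).
  have h : is_derive t (1 : R) (fun t => e - t) (0 - 1) by apply: is_deriveB.
  have := @is_derive1_comp R (flat q) (fun t => e - t) t _ _ (is_derive_flat _ _) h.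
  by rewrite sub0r mulrN1.
have h3 := is_deriveD (is_deriveM h1 h2) IH.
rewrite (_ : bumpl ((p, q) :: l) = (fun t => flat p (e + t)) * (fun t => flat q (e - t)) + bumpl l).
  apply: (is_derive_eq h3); rewrite /bumpl_deriv/= /bumpl !big_cons/= flatN /GRing.scale/=.
  by rewrite addrA; congr (_ + _); ring.
by apply/funext => s; rewrite /bumpl big_cons.
Qed.

Lemma bumpl_supp l t : e <= `|t| -> bumpl l t = 0.
Proof.
rewrite ler_normr => /orP[et|et]; apply: big1 => pq _.
  by rewrite (@flat0 _ pq.2) ?mulr0//; lra.
by rewrite (@flat0 _ pq.1) ?mul0r//; lra.
Qed.

Lemma continuous_bumpl l : continuous (bumpl l).
Proof. by move=> t; exact: is_derive_cvg (is_derive_bumpl l t). Qed.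

Hypothesis e0 : 0 < e.

Definition bump_mass : R := fine (\int[leb]_t (bumpl [:: (1, 1)] t)%:E)%E.

Let bumplE t : bumpl [:: (1, 1)] t = flat 1 (e + t) * flat 1 (e - t).
Proof. by rewrite /bumpl big_seq1. Qed.

Let flat1_ge0 t : 0 <= flat 1 t.
Proof. by rewrite /flat; case: ifP => // _; rewrite hornerC mul1r expR_ge0. Qed.

Let flat1_le1 t : flat 1 t <= 1.
Proof.
rewrite /flat; case: ifP => // t0; rewrite hornerC mul1r -expR0 ler_expR oppr_le0 invr_ge0.
exact: ltW.
Qed.

Let measurable_bumpl l : measurable_fun setT (bumpl l).
Proof. by apply: continuous_measurable_fun; exact: continuous_bumpl. Qed.

(** For positivity: on [-e/2, e/2] both factors are at least exp (- 2/e), so the mass is at least e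
    exp (- 4/e). *)
Lemma bump_massE : ((\int[leb]_t (bumpl [:: (1, 1)] t)%:E)%E = bump_mass%:E) /\ 0 < bump_mass.
Proof.
have ge0 t : 0 <= bumpl [:: (1, 1)] t by rewrite bumplE mulr_ge0.
have int_itv (a b : R) : a <= b -> (\int[leb]_t (\1_(`[a, b]%classic : set R) t)%:E = (b - a)%:E)%E.
  move=> ab; transitivity (@lebesgue_measure R `[a, b]%classic).
    by rewrite integral_indic// setIT.
  rewrite lebesgue_measure_itv/= lte_fin.
  by case: ltP => [//|ba]; rewrite (_ : b = a) ?subrr//; apply/le_anti/andP.
have fin : (\int[leb]_t (bumpl [:: (1, 1)] t)%:E < +oo)%E.
  apply: (@le_lt_trans _ _ (\int[leb]_t (\1_(`[- e, e]%classic : set R) t)%:E)%E); last first.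
    have ee : - e <= e by rewrite (@le_trans _ _ 0) ?oppr_le0 ?ltW.
    by rewrite (int_itv _ _ ee) ltry.
  apply: ge0_le_integral => //.
  - by move=> t _; rewrite lee_fin.
  - by apply/measurable_EFinP; exact: measurable_bumpl.
  - by apply/measurable_EFinP; exact: measurable_indic.
  move=> t _; rewrite lee_fin; have [te|te] := leP e `|t|; first by rewrite bumpl_supp.
  rewrite indicE mem_set/=; last by rewrite /= in_itv/= -ler_norml ltW.
  by rewrite bumplE mulr_ile1.
have pos : ((expR (- (4 / e)) * e)%:E <= \int[leb]_t (bumpl [:: (1, 1)] t)%:E)%E.
  have -> : (expR (- (4 / e)) * e)%:E = ((expR (- (4 / e)))%:E * \int[leb]_t (\1_(`[- (e / 2), e / 2]%classic : set R) t)%:E)%E.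
    have e2 : 0 <= e / 2 by rewrite divr_ge0 ?ltW.
    have ee : - (e / 2) <= e / 2 by rewrite (@le_trans _ _ 0) ?oppr_le0.
    by rewrite (int_itv _ _ ee) -EFinM opprK -splitr.
  have mi : measurable_fun [set: measurableTypeR R] (EFin \o (\1_(`[- (e / 2), e / 2]%classic) : R -> R)).
    by apply/measurable_EFinP; exact: measurable_indic.
  rewrite -(@ge0_integralZl _ _ R leb setT measurableT _ mi).
  - apply: ge0_le_integral => //.
    + by move=> t _; rewrite -EFinM lee_fin mulr_ge0// expR_ge0.
    + exact: measurable_funeM.
    + by apply/measurable_EFinP; exact: measurable_bumpl.
    move=> t _; rewrite -EFinM lee_fin indicE.
    have [te|te] := pselect (- (e / 2) <= t <= e / 2); last by rewrite memNset ?mulr0//= in_itv/=.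
    have tm : (t \in `[- (e / 2), e / 2]%classic) = true by rewrite mem_setE/= in_itv/=.
    rewrite tm mulr1.
    have /andP[t1 t2] := te.
    have -> : expR (- (4 / e)) = expR (- (2 / e)) * expR (- (2 / e)).
      by rewrite -expRD; congr expR; field; rewrite lt0r_neq0.
    by rewrite bumplE; apply: ler_pM; rewrite ?expR_ge0//; have [k1 k2] := flat1_lb e0 te.
  - by move=> t _; rewrite lee_fin.
  - by rewrite lee_fin expR_ge0.
have mE : (\int[leb]_t (bumpl [:: (1, 1)] t)%:E)%E = bump_mass%:E.
  by rewrite fineK// ge0_fin_numE//; apply: integral_ge0 => t _; rewrite lee_fin.
split => //; move: pos; rewrite mE lee_fin; apply: lt_le_trans.
by rewrite mulr_gt0// expR_gt0.
Qed.

(** The k-th derivative of the normalized bump; the inverse of the mass enters as a constant first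
    polynomial. *)
Definition bfam (k : nat) : R -> R := bumpl (iter k bumpl_deriv [:: ((bump_mass^-1)%:P, 1)]).

Lemma is_derive_bfam k t : is_derive t (1 : R) (bfam k) (bfam k.+1 t).
Proof. exact: is_derive_bumpl. Qed.

Lemma continuous_bfam k : continuous (bfam k).
Proof. exact: continuous_bumpl. Qed.

Lemma bfam_supp k t : e <= `|t| -> bfam k t = 0.
Proof. exact: bumpl_supp. Qed.

Let bfam0E t : bfam 0 t = bump_mass^-1 * bumpl [:: (1, 1)] t.
Proof.
rewrite bumplE /bfam/= /bumpl big_seq1/= mulrA; congr (_ * _).
by rewrite /flat; case: ifP => _; rewrite ?mulr0// !hornerC mul1r.
Qed.

Lemma bfam_ge0 t : 0 <= bfam 0 t.
Proof. by rewrite bfam0E mulr_ge0 ?invr_ge0 ?(ltW bump_massE.2)// bumplE mulr_ge0. Qed.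

Lemma integral_bfam : (\int[leb]_t (bfam 0 t)%:E = 1)%E.
Proof.
have [mE m0] := bump_massE.
under eq_integral do rewrite bfam0E EFinM.
rewrite ge0_integralZl//.
- by rewrite mE -EFinM mulVf// lt0r_neq0.
- by apply/measurable_EFinP; exact: measurable_bumpl.
- by move=> t _; rewrite lee_fin bumplE mulr_ge0.
- by rewrite lee_fin invr_ge0 ltW.
Qed.

End bump_family.

Section bumpf.
Context (R : realType) (n : nat) (e : R).
Hypothesis e0 : 0 < e.
Local Notation V := 'rV[R]_n.
Local Notation mu := (lebesgue_rV R n).
Local Notation dl i := (delta_mx ord0 i : V).
Implicit Types (x y z : V) (s : seq 'I_n) (k : 'I_n -> nat).

(** [k] is a multi-index: coordinate i carries the derivative of order [k i], and a partial
    derivative raises one entry. *)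
Definition bumpk k x : R := \prod_i bfam e (k i) (x ord0 i).

Lemma is_derive_bumpk k i x :
  is_derive x (dl i) (bumpk k) (bumpk (fun j => (j == i) + k j)%N x).
Proof.
pose C := \prod_(j | j != i) bfam e (k j) (x ord0 j).
have fE (t : R) : bumpk k (t *: dl i + x) = C * bfam e (k i) (t + x ord0 i).
  rewrite /bumpk (bigD1 i)//= mulrC !mxE !eqxx mulr1; congr (_ * _).
  by apply: eq_bigr => j ji; rewrite !mxE (negbTE ji) andbF mulr0 add0r.
have E : (fun t : R => t^-1 *: ((bumpk k \o shift x) (t *: dl i) - bumpk k x)) =
   (fun t : R => t^-1 *: (((fun u => C * bfam e (k i) u) \o shift (x ord0 i)) (t *: (1 : R)) - C * bfam e (k i) (x ord0 i))).
  apply/funext => t /=; congr (_ *: (_ - _)).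
    by rewrite fE (_ : t%:A = t)//; exact: mulr1.
  by have := fE 0; rewrite scale0r !add0r.
have [d1 d2] := is_deriveZ C (is_derive_bfam e (k i) (x ord0 i)).
apply: DeriveDef; first by rewrite /derivable E; exact: d1.
rewrite /derive E; apply: etrans d2 _.
rewrite /bumpk [RHS](bigD1 i)//= eqxx/= mulrC; congr (_ * _).
by apply: eq_bigr => j ji; rewrite (negbTE ji).
Qed.

Lemma continuous_bumpk k : continuous (bumpk k).
Proof.
move=> x; apply: (@cvg_big R 'I_n (@GRing.mul R) 1 xpredT _ V (nbhs x) (index_enum 'I_n)
  (fun i (y : V) => bfam e (k i) (y ord0 i))).
  by move=> p; exact: mul_continuous.
move=> i _.
have h : {for x, continuous (fun y : V => y ord0 i : R)} by exact: coord_continuous.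
exact: (cvg_comp _ _ h (@continuous_bfam R e (k i) (x ord0 i))).
Qed.

Lemma partial_bumpk s k : partial s (bumpk k) = bumpk (fun j => count_mem j s + k j)%N.
Proof.
elim: s => [|i s IH]; first by congr bumpk; apply/funext => j.
rewrite /= IH; apply/funext => x.
have [_ ->] := is_derive_bumpk (fun j => count_mem j s + k j)%N i x.
by congr (bumpk _ x); apply/funext => j; rewrite eq_sym addnA.
Qed.

Lemma smooth_bumpk k : smooth (bumpk k).
Proof.
move=> s; rewrite partial_bumpk; split; first exact: continuous_bumpk.
by move=> x i; have [] := is_derive_bumpk (fun j => count_mem j s + k j)%N i x.
Qed.

Definition bumpf x : R := bumpk (fun=> 0%N) x.
Definition cbump x : R[i] := (bumpf x)%:C.

Lemma bumpf_ge0 x : 0 <= bumpf x.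
Proof. by apply: prodr_ge0 => i _; exact: bfam_ge0. Qed.

Lemma integral_bumpf : (\int[mu]_x (bumpf x)%:E = 1)%E.
Proof.
rewrite (integral_prod (f := fun=> bfam e 0)).
- by rewrite big1// => i _; exact: integral_bfam.
- by move=> i; apply: continuous_measurable_fun; exact: continuous_bfam.
- by move=> i x; exact: bfam_ge0.
Qed.

Lemma bumpk_supp k x i : e <= `|x ord0 i| -> bumpk k x = 0.
Proof. by move=> h; apply/eqP/prodf_eq0; exists i => //; rewrite bfam_supp. Qed.

Lemma csmooth_cbump : csmooth cbump.
Proof. by split; [exact: smooth_bumpk|exact: (smooth0 R n).2]. Qed.

Lemma cpartial_cbump s : cpartial s cbump = fun x => (bumpk (fun j => count_mem j s) x)%:C.
Proof.
apply/funext => x; rewrite /cpartial (smooth0 R n).1.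
rewrite (_ : (fun y => Re (cbump y)) = bumpk (fun=> 0%N))// partial_bumpk.
by congr (bumpk _ x +i* _); apply/funext => j; rewrite addn0.
Qed.

Lemma box_supp_cbump : box_supp cbump e.
Proof.
by move=> x /notin_box[i /ltW h]; rewrite /cbump /bumpf (bumpk_supp _ h).
Qed.

(** A derivative of the bump depends only on how often each coordinate occurs. This undoes the
    reversal caused by repeated integration by parts. *)
Lemma cpartial_cbump_rev s : cpartial (rev s) cbump = cpartial s cbump.
Proof.
rewrite !cpartial_cbump; apply/funext => x; congr ((bumpk _ x)%:C).
by apply/funext => j; rewrite count_rev.
Qed.

End bumpf.

Section parts.
Context (R : realType) (n : nat).
Local Notation V := 'rV[R]_n.
Local Notation mu := (lebesgue_rV R n).

Lemma cI_parts_seq (s : seq 'I_n) (h r : V -> R[i]) (L L' : R) x :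
  0 <= L -> csmooth h -> box_supp h L -> 0 <= L' -> csmooth r -> box_supp r L' ->
  cI mu (fun z => cpartial s h z * r (x - z)) = cI mu (fun z => h z * cpartial (rev s) r (x - z)).
Proof.
move=> L0 sh hL L0'; elim: s r => [|i s IH] r sr rL; first by rewrite !cpartial_nil.
have -> : cpartial (i :: s) h = cpartial [:: i] (cpartial s h) by rewrite -cpartial_cat.
rewrite (cI_parts i x L0 (csmooth_cpartial s sh) (box_supp_cpartial s hL) L0' sr rL).
rewrite (IH _ (csmooth_cpartial [:: i] sr) (box_supp_cpartial [:: i] rL)).
by rewrite -cpartial_cat rev_cons cats1.
Qed.

End parts.

(** * Test functions and translated bumps *)

Section test_functions.
Context (R : realType) (n : nat).
Local Notation V := 'rV[R]_n.
Local Notation mu := (lebesgue_rV R n).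
Implicit Types (W S C : set V) (h g : V -> R[i]) (x y z : V).

Lemma csmooth_linC (a : R[i]) h g : csmooth h -> csmooth g ->
  (forall s, cpartial s (fun x => a * h x + g x) = fun x => a * cpartial s h x + cpartial s g x) /\
  csmooth (fun x => a * h x + g x).
Proof.
move=> [h1 h2] [g1 g2].
have [e1 s1] := smooth_lin (- Im a) h2 g1; have [e1' s1'] := smooth_lin (Re a) h1 s1.
have [e2 s2] := smooth_lin (Im a) h1 g2; have [e2' s2'] := smooth_lin (Re a) h2 s2.
have eR : (fun x => Re (a * h x + g x)) = fun x => Re a * Re (h x) + (- Im a * Im (h x) + Re (g x)).
  by apply/funext => x; rewrite cReD cReM; ring.
have eI : (fun x => Im (a * h x + g x)) = fun x => Re a * Im (h x) + (Im a * Re (h x) + Im (g x)).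
  by apply/funext => x; rewrite cImD cImM; ring.
split; last by rewrite /csmooth eR eI.
move=> s; apply/funext => x; rewrite /cpartial eR eI e1' e2' e1 e2.
by apply: complex_ext; rewrite ?cReD ?cImD ?cReM ?cImM/=; ring.
Qed.

Lemma csmooth0 : (forall s, cpartial s (fun _ : V => 0 : R[i]) = fun=> 0) /\ csmooth (fun _ : V => 0 : R[i]).
Proof.
have [z1 z2] := @smooth0 R n.
by split => // s; rewrite /cpartial z1.
Qed.

Lemma csmooth_sum (I : Type) (s : seq I) (a : I -> R[i]) (H : I -> V -> R[i]) :
  (forall i, csmooth (H i)) ->
  (forall t, cpartial t (fun x => \sum_(i <- s) a i * H i x) = fun x => \sum_(i <- s) a i * cpartial t (H i) x) /\
  csmooth (fun x => \sum_(i <- s) a i * H i x).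
Proof.
move=> sH; elim: s => [|i s [IH1 IH2]].
  rewrite (_ : (fun x => _) = fun=> 0); last by apply/funext => x; rewrite big_nil.
  have [z1 z2] := csmooth0; split => // t; rewrite z1; apply/funext => x; by rewrite big_nil.
rewrite (_ : (fun x => \sum_(_ <- _ :: _) _) = fun x => a i * H i x + \sum_(i <- s) a i * H i x); last first.
  by apply/funext => x; rewrite big_cons.
have [l1 l2] := csmooth_linC (a i) (sH i) IH2.
split => // t; rewrite l1 IH1; apply/funext => x; by rewrite big_cons.
Qed.

Lemma csmooth_shift h a : csmooth h -> csmooth (fun x => h (x + a)).
Proof. by move=> [h1 h2]; split; [exact: (smooth_shift a h1)|exact: (smooth_shift a h2)]. Qed.

Lemma cpartial_shift s h a : cpartial s (fun x => h (x + a)) = fun x => cpartial s h (x + a).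
Proof.
by apply/funext => x; rewrite /cpartial (partial_shift s (fun x => Re (h x))) (partial_shift s (fun x => Im (h x))).
Qed.

Lemma nbhs_cube x (d : R) : 0 < d -> nbhs x [set y : V | forall i, `|y ord0 i - x ord0 i| < d].
Proof.
move=> d0; apply/nbhs_ballP; exists d => // y [_ xy] i; rewrite distrC; exact: xy ord0 i.
Qed.

Lemma hausdorff_rV : hausdorff_space V.
Proof.
move=> p q pq; apply/rowP => i; apply/eqP; rewrite -subr_eq0 -normr_le0.
apply/ler_addgt0Pr => e e0; rewrite add0r.
have e2 : 0 < e / 2 by exact: divr_gt0.
have [y [yp yq]] := pq _ _ (nbhs_cube p e2) (nbhs_cube q e2).
rewrite -(subrKA (y ord0 i)) (le_trans (ler_normD _ _))// [leRHS]splitr lerD//.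
  by rewrite distrC ltW.
by rewrite ltW.
Qed.

Lemma compact_box_bound S : compact S -> exists2 L : R, 0 <= L & S `<=` box L.
Proof.
move=> cS.
have : \forall k \near \oo, forall x, S x -> box (k%:R : R) x.
  apply: (@compact_eventually R n nat (nbhs \oo) (fun k => box (k%:R : R)) S _ cS) => x _.
  pose b := 1 + \sum_i `|x ord0 i|.
  exists ([set y : V | forall i, `|y ord0 i - x ord0 i| < 1], [set k : nat | b <= k%:R]) => /=.
    by split; [exact: nbhs_cube|exact: nbhs_infty_ger].
  move=> [y k]/= [yx bk] i; apply: le_trans bk.
  rewrite -(subrK (x ord0 i) (y ord0 i)) (le_trans (ler_normD _ _))// lerD//; first exact/ltW/yx.
  by rewrite (bigD1 i)//= lerDl sumr_ge0.
case=> N _ /(_ N (leqnn N)) hN; exists N%:R => //; exact: hN.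
Qed.

Lemma csupport_in h x : h x != 0 -> csupport h x.
Proof. by move=> hx; apply: subset_closure. Qed.

Lemma notin_csupport h x : ~ csupport h x -> h x = 0.
Proof. by move=> nx; apply/eqP/negPn/negP => /csupport_in. Qed.

Lemma test_csmooth W h : test_function W h -> csmooth h /\ exists2 L, 0 <= L & box_supp h L.
Proof.
move=> [h1 h2 cS _]; split => //; have [L L0 SL] := compact_box_bound cS.
by exists L => // x nx; apply: notin_csupport => /SL.
Qed.

Lemma csupport_sub h C : compact C -> (forall x, h x != 0 -> C x) -> csupport h `<=` C.
Proof.
move=> cC hC; apply: (@subset_trans _ (closure C)); first exact: closure_subset.
by rewrite -(iffLR (closure_id C))//; apply: compact_closed => //; exact: hausdorff_rV.
Qed.

Lemma test_intro W h C : csmooth h -> compact C -> C `<=` W -> (forall x, h x != 0 -> C x) ->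
  test_function W h.
Proof.
move=> [h1 h2] cC CW hC; have sC := csupport_sub cC hC.
split => //; last exact: subset_trans CW.
by apply: subclosed_compact cC sC; exact: closed_closure.
Qed.

Definition addbox S (e : R) : set V := [set x | exists2 y, S y & forall i, `|x ord0 i - y ord0 i| <= e].

Lemma compact_addbox S e : compact S -> compact (addbox S e).
Proof.
move=> cS.
have -> : addbox S e = (fun p : V * V => p.1 + p.2) @` (S `*` box e).
  apply/seteqP; split => [x [y Sy xy]|_ [[y b] [/= Sy be] <-]].
    by exists (y, x - y) => /=; [split => // i; rewrite !mxE; exact: xy|rewrite addrC subrK].
  by exists y => // i; rewrite mxE addrC addrK; exact: be.
apply: continuous_compact; last by apply: compact_setX => //; exact: compact_box.
apply: continuous_subspaceT => p; apply/cvg_ballP => e' e0.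
have e2 : 0 < e' / 2 by exact: divr_gt0.
exists ([set y : V | forall i, `|y ord0 i - p.1 ord0 i| < e' / 2], [set y : V | forall i, `|y ord0 i - p.2 ord0 i| < e' / 2]) => /=.
  by split; exact: nbhs_cube.
move=> q [/= h1 h2]; split => // i j; rewrite ord1 /ball/= !mxE opprD addrACA.
by rewrite (le_lt_trans (ler_normD _ _))// [ltRHS]splitr ltrD// distrC.
Qed.

Lemma addboxS S e x : 0 <= e -> S x -> addbox S e x.
Proof. by move=> e0 Sx; exists x => // i; rewrite subrr normr0. Qed.

Definition tbump (e : R) z : V -> R[i] := fun x => cbump e (x - z).

Lemma csmooth_tbump e z : 0 < e -> csmooth (tbump e z).
Proof. by move=> e0; apply: csmooth_shift; exact: csmooth_cbump. Qed.

Lemma cpartial_tbump s e z : cpartial s (tbump e z) = fun x => cpartial s (@cbump R n e) (x - z).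
Proof. exact: cpartial_shift. Qed.

Lemma tbump_supp e z x : 0 < e -> tbump e z x != 0 -> addbox [set z] e x.
Proof.
move=> e0 hx; exists z => // i.
have hb := @box_supp_cbump R n e.
have [//|he] := pselect (`|x ord0 i - z ord0 i| <= e).
case/negP: hx; apply/eqP; apply: hb => hb; apply: he; have := hb i; by rewrite !mxE.
Qed.

Lemma test_tbump W e z : 0 < e -> addbox [set z] e `<=` W -> test_function W (tbump e z).
Proof.
move=> e0 zW; apply: (@test_intro _ _ (addbox [set z] e)) => //.
- exact: csmooth_tbump.
- by apply: compact_addbox; exact: compact_set1.
- by move=> x; exact: tbump_supp.
Qed.

(** The induction peels off the innermost derivative, the last of the list, because the remaining
    ones then apply to a function of the same kind. *)
Lemma unif_csmooth_Ck h L (k : nat) (e : R) : csmooth h -> box_supp h L -> 0 < e ->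
  exists2 d, 0 < d & forall s, (size s <= k)%N -> forall x y, (forall i, `|y ord0 i| < d) ->
    normc (cpartial s h (x + y) - cpartial s h x) < e.
Proof.
move=> sh hL e0; elim: k => [|k IH] in h sh hL *.
  have [d d0 hd] := unif_csmooth sh hL e0; exists d => // s.
  by rewrite leqn0 size_eq0 => /eqP ->; rewrite cpartial_nil.
have [d0 d00 hd0] := unif_csmooth sh hL e0.
have hi (i : 'I_n) : \forall d \near (0 : R)^'+, forall s, (size s <= k)%N -> forall x y, (forall j, `|y ord0 j| < d) ->
    normc (cpartial s (cpartial [:: i] h) (x + y) - cpartial s (cpartial [:: i] h) x) < e.
  have [d dp hd] := IH _ (csmooth_cpartial [:: i] sh) (box_supp_cpartial [:: i] hL).
  near=> d'; move=> s sk x y yd; apply: hd => // j; apply: lt_trans (yd j) _.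
  by near: d'; exact: nbhs_right_lt.
have hall : \forall d \near (0 : R)^'+, d < d0 /\ 0 < d /\ forall i s, (size s <= k)%N -> forall x y, (forall j, `|y ord0 j| < d) ->
    normc (cpartial s (cpartial [:: i] h) (x + y) - cpartial s (cpartial [:: i] h) x) < e.
  apply: filterI; first exact: nbhs_right_lt.
  apply: filterI; first exact: nbhs_right_gt.
  exact: (filter_forall _ hi).
have [d [dd [dp hd]]] := filter_ex hall.
exists d => // s; elim/last_ind: s => [_ x y yd|s i _].
  by rewrite cpartial_nil; apply: hd0 => i; exact: lt_trans (yd i) dd.
rewrite size_rcons => sk x y yd; rewrite -cats1 cpartial_cat; exact: hd.
Unshelve. all: by end_near.
Qed.

Lemma Ck_norm_le h (k : nat) (b : R) : (forall s, (size s <= k)%N -> forall x, normc (cpartial s h x) <= b) ->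
  (Ck_norm k h <= b%:E)%E.
Proof. by move=> hb; apply: ge_ereal_sup => _ [s [x [sk ->]]]; rewrite lee_fin; exact: hb. Qed.

End test_functions.

(** * Linearity and continuity of distributions *)

Section distribution_linear.
Context (R : realType) (n : nat).
Local Notation V := 'rV[R]_n.
Implicit Types (W C : set V) (h g : V -> R[i]).

Lemma test_lin W (a : R[i]) h g : test_function W h -> test_function W g ->
  test_function W (fun x => a * h x + g x).
Proof.
move=> th tg; have [sh _] := test_csmooth th; have [sg _] := test_csmooth tg.
case: th => _ _ ch hW; case: tg => _ _ cg gW.
apply: (@test_intro _ _ _ _ (csupport h `|` csupport g)).
- exact: (csmooth_linC a sh sg).2.
- exact: compactU.
- by move=> x [/hW|/gW].
- move=> x hx; have [h0|h0] := eqVneq (h x) 0; last by left; exact: csupport_in.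
  by right; apply: csupport_in; move: hx; rewrite h0 mulr0 add0r.
Qed.

Lemma test0 W : test_function W (fun _ : V => 0 : R[i]).
Proof.
apply: (@test_intro _ _ _ _ set0) => //; first exact: (csmooth0 R n).2.
- exact: compact0.
- by move=> x; rewrite eqxx.
Qed.

Lemma dist0 W u : distribution_on W u -> u (fun _ : V => 0 : R[i]) = 0.
Proof.
move=> [ul _]; have := ul 1 _ _ (test0 W) (test0 W).
rewrite (_ : (fun x => _) = fun=> 0); last by apply/funext => x; rewrite mul1r addr0.
by rewrite mul1r => /eqP; rewrite -subr_eq0 opprD addrA subrr add0r oppr_eq0 => /eqP.
Qed.

Lemma dist_sum W u (I : Type) (s : seq I) (a : I -> R[i]) (H : I -> V -> R[i]) :
  distribution_on W u -> (forall i, test_function W (H i)) ->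
  test_function W (fun x => \sum_(i <- s) a i * H i x) /\
  u (fun x => \sum_(i <- s) a i * H i x) = \sum_(i <- s) a i * u (H i).
Proof.
move=> du tH; elim: s => [|i s [IH1 IH2]].
  rewrite (_ : (fun x => _) = fun=> 0); last by apply/funext => x; rewrite big_nil.
  by rewrite big_nil; split; [exact: test0|exact: dist0 du].
rewrite (_ : (fun x => \sum_(_ <- _ :: _) _) = fun x => a i * H i x + \sum_(i <- s) a i * H i x); last first.
  by apply/funext => x; rewrite big_cons.
split; first exact: test_lin.
by rewrite du.1// IH2 big_cons.
Qed.

Lemma dist_sub W u h g : distribution_on W u -> test_function W h -> test_function W g ->
  test_function W (fun x => h x - g x) /\ u (fun x => h x - g x) = u h - u g.
Proof.
move=> du th tg.
have -> : (fun x => h x - g x) = fun x => (-1) * g x + h x by apply/funext => x; rewrite mulN1r addrC.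
by split; [exact: test_lin|rewrite du.1// mulN1r addrC].
Qed.

Lemma dist_bound W u C : distribution_on W u -> compact C -> C `<=` W -> exists (c : R) (k : nat), 0 <= c /\
  forall h (b : R), test_function W h -> (forall x, h x != 0 -> C x) ->
    (forall s, (size s <= k)%N -> forall x, normc (cpartial s h x) <= b) -> normc (u h) <= c * b.
Proof.
move=> [_ ub] cC CW; have [c [k hck]] := ub C cC CW.
exists (Num.max c 0), k; split; first by rewrite le_max lexx orbT.
move=> h b th hC hb.
have b0 : 0 <= b by have := hb [::] isT 0; apply: le_trans; exact: normc_ge0.
have := hck h th (csupport_sub cC hC).
rewrite -lee_fin => /le_trans; apply; rewrite EFinM.
have C0 : (0 <= Ck_norm k h)%E.
  apply: (@le_trans _ _ (normc (cpartial [::] h 0))%:E); first by rewrite lee_fin normc_ge0.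
  by apply: ereal_sup_ubound; exists [::], 0.
apply: (@le_trans _ _ ((Num.max c 0)%:E * Ck_norm k h)%E).
  by apply: lee_wpmul2r => //; rewrite lee_fin le_max lexx.
apply: lee_wpmul2l; first by rewrite lee_fin le_max lexx orbT.
exact: Ck_norm_le.
Qed.

End distribution_linear.

(** * Mollification of a distribution *)

Section mollification.
Context (R : realType) (n : nat).
Local Notation V := 'rV[R]_n.
Local Notation mu := (lebesgue_rV R n).
Implicit Types (W S C : set V) (h g : V -> R[i]) (x y z : V).

Lemma rV_open (A : set V) :
  (forall z, A z -> exists2 d : R, 0 < d & forall y, (forall i, `|y ord0 i| < d) -> A (z + y)) -> open A.
Proof.
move=> hA; rewrite openE => z /hA[d d0 hd]; apply: filterS (nbhs_cube z d0) => y yd.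
by rewrite -(subrKC z y); apply: hd => i; rewrite !mxE.
Qed.

(** Made for mollified distributions, which are continuous on the inset and set to 0 outside, where
    they may jump. *)
Lemma measurable_open_cont (A : set V) (g : V -> R) : open A -> (forall x, ~ A x -> g x = 0) ->
  (forall z, A z -> forall e : R, 0 < e -> exists2 d : R, 0 < d & forall y, (forall i, `|y ord0 i| < d) ->
    `|g (z + y) - g z| < e) -> measurable_fun setT g.
Proof.
move=> oA g0 gc; apply: (measurability _ (RGenOpens.measurableE R)) => _ [_ [a [b ->] <-]].
rewrite setTI.
have -> : g @^-1` `]a, b[ = (A `&` g @^-1` `]a, b[) `|` (~` A `&` [set x | `]a, b[%classic (0 : R)]).
  apply/seteqP; split => x /=.
    by move=> hx; have [Ax|nAx] := pselect (A x); [left|right; split => //; rewrite -(g0 _ nAx)].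
  by case => -[// nAx]; rewrite g0.
apply: measurableU; last first.
  apply: measurableI; first by apply: measurableC; exact: open_measurable_rV.
  have [h0|h0] := pselect (`]a, b[%classic (0 : R)).
    by rewrite (_ : [set _ | _] = setT)//; apply/seteqP; split.
  by rewrite (_ : [set _ | _] = set0)//; apply/seteqP; split.
apply: open_measurable_rV; apply: rV_open => z [Az]; rewrite /= in_itv/= => /andP[az zb].
have [d1 d10 hd1] := rV_nbhs_ball oA Az.
have e0 : 0 < Num.min (g z - a) (b - g z) by rewrite lt_min !subr_gt0 az.
have [d2 d20 hd2] := gc z Az _ e0.
exists (Num.min d1 d2); first by rewrite lt_min d10.
move=> y yd; have y1 i : `|y ord0 i| < d1 by have := yd i; rewrite lt_min => /andP[].
have y2 i : `|y ord0 i| < d2 by have := yd i; rewrite lt_min => /andP[].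
split; first exact: hd1.
have := hd2 y y2; rewrite lt_min => /andP[]; rewrite !ltr_norml => /andP[p1 p2] /andP[p3 p4].
by rewrite in_itv/=; apply/andP; split; lra.
Qed.

Lemma bounded_csmooth_Ck h L (k : nat) : csmooth h -> box_supp h L ->
  exists2 M : R, 0 <= M & forall s, (size s <= k)%N -> forall x, normc (cpartial s h x) <= M.
Proof.
move=> sh hL; elim: k => [|k IH] in h sh hL *.
  have [M hM] := bounded_csmooth sh hL; exists M; first exact: le_trans (normc_ge0 _) (hM 0).
  by move=> s; rewrite leqn0 size_eq0 => /eqP ->; rewrite cpartial_nil.
have [M0 hM0] := bounded_csmooth sh hL.
have [M hM] : {M : 'I_n -> R & forall i, 0 <= M i /\ forall s, (size s <= k)%N ->
    forall x, normc (cpartial s (cpartial [:: i] h) x) <= M i}.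
  apply: (@choice _ _ (fun i M => 0 <= M /\ forall s, (size s <= k)%N ->
    forall x, normc (cpartial s (cpartial [:: i] h) x) <= M)) => i.
  by have [M M00 hM] := IH _ (csmooth_cpartial [:: i] sh) (box_supp_cpartial [:: i] hL); exists M.
have M00 : 0 <= M0 by exact: le_trans (normc_ge0 _) (hM0 0).
have S0 : 0 <= \sum_i M i by apply: sumr_ge0 => i _; exact: (hM i).1.
exists (M0 + \sum_i M i); first exact: addr_ge0.
move=> s; elim/last_ind: s => [_ x|s i _].
  by rewrite cpartial_nil (le_trans (hM0 x))// lerDl.
rewrite size_rcons => sk x; rewrite -cats1 cpartial_cat (le_trans ((hM i).2 s sk x))//.
rewrite (bigD1 i)//= addrCA lerDl addr_ge0//; apply: sumr_ge0 => j _; exact: (hM j).1.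
Qed.

Definition cube_nbhd (d : R) z : set V := ([set y : V | forall i, `|y ord0 i - z ord0 i| < d])°.

(** Measurable weights suffice, so indicators are combined successively: each point takes what its
    cube covers and leaves the rest to the others. *)
Lemma partition_list (l : seq V) (d : R) : exists chi : nat -> V -> R,
  [/\ forall j, measurable_fun setT (chi j), forall j x, 0 <= chi j x <= 1,
      forall j x, chi j x != 0 -> cube_nbhd d (nth 0 l j) x &
      forall x, (exists2 z, z \in l & cube_nbhd d z x) -> \sum_(j < size l) chi j x = 1].
Proof.
elim: l => [|z l [chi [c1 c2 c3 c4]]].
  exists (fun _ _ => 0); split => //; first by move=> *; rewrite lexx ler01.
  - by move=> j x; rewrite eqxx.
  - by move=> x [].
pose b : V -> R := \1_(cube_nbhd d z).
have mb : measurable_fun setT b.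
  by apply: measurable_indic; apply: open_measurable_rV; exact: open_interior.
have b01 x : 0 <= b x <= 1 by rewrite /b indicE; case: (_ \in _); rewrite ?lexx ?ler01.
exists (fun j => if j is j'.+1 then (fun x => (1 - b x) * chi j' x) else b); split.
- by case=> // j; apply: measurable_funM => //; exact: measurable_funB.
- case=> [//|j] x; have /andP[b0 b1] := b01 x; have /andP[k0 k1] := c2 j x.
  by rewrite mulr_ge0 ?subr_ge0//= mulr_ile1 ?subr_ge0// lerBlDr lerDl.
- case=> [|j] x /=; last by rewrite mulf_eq0 negb_or => /andP[_]; exact: c3.
  rewrite /b indicE; have [zx|zx] := pselect (cube_nbhd d z x); first by [].
  by rewrite memNset// eqxx.
move=> x hx; rewrite big_ord_recl/= -mulr_sumr.
have [zx|zx] := pselect (cube_nbhd d z x).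
  by rewrite /b indicE mem_set// subrr mul0r addr0.
rewrite /b indicE memNset// add0r subr0 mul1r; apply: c4.
by case: hx => w; rewrite inE => /orP[/eqP -> //|wl wx]; exists w.
Qed.

(** Nodes and coefficients are chosen before [F]. One Riemann sum thus serves both the mollified
    distribution and all derivatives of the mollified test function. *)
Lemma riemann_approx S h (d : R) : compact S -> cintble mu h -> (forall z, h z != 0 -> S z) -> 0 < d ->
  exists (m : nat) (p : 'I_m -> V) (c : 'I_m -> R[i]), (forall j, S (p j)) /\
    forall (F : V -> R[i]) (o : R), cintble mu (fun z => h z * F z) ->
      (forall z w, S z -> S w -> (forall i, `|z ord0 i - w ord0 i| < d) -> normc (F z - F w) <= o) ->
      ((normc (cI mu (fun z => h z * F z) - \sum_j c j * F (p j)))%:E <=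
        o%:E * \int[mu]_z (normc (h z))%:E)%E.
Proof.
move=> cS hi hS d0.
move: cS; rewrite compact_cover => /(_ V S (cube_nbhd d)) [].
- by move=> z _; exact: open_interior.
- by move=> z Sz; exists z => //; exact: nbhs_cube.
move=> D DS cov; pose l : seq V := finmap.enum_fset D.
have [chi [c1 c2 c3 c4]] := partition_list l d.
have chi1 z : S z -> \sum_(j < size l) chi j z = 1.
  by move=> /cov[w /= wD wz]; apply: c4; exists w.
have lS (j : 'I_(size l)) : S (nth 0 l j).
  by have := DS (nth 0 l j); rewrite inE; apply; exact: mem_nth.
have chiC j x : normc (chi j x)%:C <= 1.
  by have /andP[k0 k1] := c2 j x; rewrite normc_real ger0_norm.
have mchi j : cmeas (fun x => (chi j x)%:C) by exact: cmeas_real.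
have ihc j : cintble mu (fun x => (chi j x)%:C * h x) by exact: (cintbleMb hi (mchi j) (chiC j)).
exists (size l), (fun j => nth 0 l j), (fun j => cI mu (fun x => (chi j x)%:C * h x)); split => //.
move=> F o hF Fo.
pose G (j : 'I_(size l)) z := F (nth 0 l j) * ((chi j z)%:C * h z).
have iG j : cintble mu (G j) by exact: cintbleZ.
have [iS eS] := cI_sum (index_enum _) iG.
have -> : cI mu (fun z => h z * F z) - \sum_(j < size l) cI mu (fun x => (chi j x)%:C * h x) * F (nth 0 l j) =
    cI mu (fun z => h z * F z + (-1) * \sum_j G j z).
  rewrite (cID hF (cintbleZ (-1) iS)) (cIZ _ iS) eS mulN1r; congr (_ - _).
  by apply: eq_bigr => j _; rewrite (cIZ _ (ihc j)) mulrC.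
apply: (le_trans (normc_cI (cintbleD hF (cintbleZ (-1) iS)))).
have mn : measurable_fun setT (fun z => (normc (h z))%:E) by apply: emeas_normc; exact: (cintble_meas hi).
have [/existsP[j _]|/existsPn l0] := boolP [exists j : 'I_(size l), true]; last first.
  have h0 z : h z = 0.
    apply/eqP/negPn/negP => /hS /chi1; rewrite big1 => [/eqP|j _].
      by rewrite eq_sym oner_eq0.
    by have := l0 j.
  rewrite integral0_eq => [|z _]; last first.
    by rewrite h0 mul0r big1 ?mulr0 ?addr0 ?Normc.normc0// => j _; rewrite /G h0 !mulr0.
  by rewrite integral0_eq ?mule0// => z _; rewrite h0 Normc.normc0.
have o0 : 0 <= o by apply: le_trans (Fo _ _ (lS j) (lS j) _); rewrite ?normc_ge0// => i; rewrite subrr normr0.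
rewrite -(@ge0_integralZl _ _ R mu setT measurableT _ mn) => [|z _|]; last 2 first.
- by rewrite lee_fin normc_ge0.
- by rewrite lee_fin.
apply: ge0_le_integral => //.
- by move=> z _; rewrite lee_fin normc_ge0.
- by apply: emeas_normc; apply: cintble_meas; exact: (cintbleD hF (cintbleZ (-1) iS)).
- exact: measurable_funeM.
move=> z _; rewrite -EFinM lee_fin.
have [hz|hz] := eqVneq (h z) 0.
  rewrite hz mul0r Normc.normc0 mulr0 add0r big1 ?mulr0 ?Normc.normc0// => i _; by rewrite /G hz !mulr0.
have Sz := hS _ hz.
have -> : h z * F z + -1 * \sum_j0 G j0 z = \sum_(i < size l) (chi i z)%:C * h z * (F z - F (nth 0 l i)).
  under [RHS]eq_bigr do rewrite mulrBr.
  rewrite sumrB mulN1r -mulr_suml -mulr_suml; congr (_ - _).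
    rewrite -(raddf_sum (real_complex R)) chi1// /= mul1r//.
  by apply: eq_bigr => i _; rewrite /G mulrC.
apply: (le_trans (normc_sum _ _ _)).
apply: (@le_trans _ _ (\sum_(i < size l) chi i z * (o * normc (h z)))); last first.
  by rewrite -mulr_suml chi1// mul1r.
apply: ler_sum => i _; rewrite !normcMl normc_real; have /andP[k0 k1] := c2 i z.
rewrite ger0_norm// -mulrA.
have [->|ci] := eqVneq (chi i z) 0; first by rewrite !mul0r.
rewrite ler_wpM2l// mulrC ler_wpM2r ?normc_ge0//.
apply: Fo => // k; have := c3 _ _ ci; move=> /interior_subset; exact.
Qed.

Lemma int_tbump (e : R) x : 0 < e ->
  [/\ cintble mu (fun z => cbump e (x - z)), cI mu (fun z => cbump e (x - z) : R[i]) = 1 &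
    (\int[mu]_z (bumpf e (x - z))%:E = 1)%E].
Proof.
move=> e0.
have i0 := cintble_csmooth (ltW e0) (@csmooth_cbump R n e) (@box_supp_cbump R n e).
have [i1 e1] := cI_shift x i0; have [i2 e2] := cI_opp i1.
have mb : measurable_fun setT (fun y : V => (bumpf e y)%:E).
  by apply/measurable_EFinP; exact: (cintble_meas i0).1.
rewrite (_ : (fun z => cbump e _) = fun z => cbump e (- z + x)); last by apply/funext => z; rewrite addrC.
split; first exact: i2.
- transitivity (cI mu (@cbump R n e)); first exact: (etrans e2 e1).
  rewrite (cI_real mu (@bumpf R n e)) -[RHS]/(1%:C); congr (_%:C).
  by rewrite /Rintegral integral_bumpf.
- under eq_integral do rewrite addrC.
  have mbx : measurable_fun setT (fun y : V => (bumpf e (y + x))%:E).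
    by apply: (measurableT_comp mb); exact: measurable_rV_shift.
  have b0 (z : V) : (0 <= (bumpf e z)%:E)%E by rewrite lee_fin; exact: bumpf_ge0.
  rewrite (integral_rVN mbx (fun z => b0 _)).
  by apply: etrans (integral_shift x mb b0) _; exact: integral_bumpf.
Qed.

(** The strict inequality makes the set open and leaves room for the closed support of a bump of
    radius [e]. *)
Definition inset W (e : R) : set V :=
  [set z | exists2 r : R, e < r & forall y, (forall i, `|y ord0 i| < r) -> W (z + y)].

(** The regularization of [u] at scale [e]; outside the inset, where a translated bump might leave
    [W], the value is 0. *)
Definition mollify W (u : (V -> R[i]) -> R[i]) (e : R) z : R[i] :=
  if `[< inset W e z >] then u (tbump e z) else 0.

Lemma mollifyE W u e z : inset W e z -> mollify W u e z = u (tbump e z).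
Proof. by move=> hz; rewrite /mollify; case: asboolP. Qed.

Lemma inset_addbox W e z : inset W e z -> addbox [set z] e `<=` W.
Proof.
move=> [r er hr] x [_ -> xz]; rewrite -(subrKC z x); apply: hr => i; rewrite !mxE.
exact: le_lt_trans (xz i) er.
Qed.

Lemma open_inset W e : open (inset W e).
Proof.
apply: rV_open => z [r er hr]; exists ((r - e) / 2); first by rewrite divr_gt0 ?subr_gt0.
move=> y yd; exists ((r + e) / 2); first by lra.
move=> w wd; rewrite -addrA; apply: hr => i; rewrite mxE.
have := yd i; have := wd i; have := ler_normD (y ord0 i) (w ord0 i); lra.
Qed.

Lemma tbump_diff_le (k : nat) (e d o : R) (z w : V) : 0 < e ->
  (forall s, (size s <= k)%N -> forall x y, (forall i, `|y ord0 i| < d) ->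
    normc (cpartial s (@cbump R n e) (x + y) - cpartial s (@cbump R n e) x) < o) ->
  (forall i, `|z ord0 i - w ord0 i| < d) -> forall s, (size s <= k)%N -> forall x,
  normc (cpartial s (@cbump R n e) (x - z) - cpartial s (@cbump R n e) (x - w)) <= o.
Proof.
move=> e0 hd zw s sk x; apply/ltW; have -> : x - z = (x - w) + (w - z) by rewrite addrA subrK.
by apply: hd => // i; rewrite !mxE distrC.
Qed.

Lemma dist_tbump_diff W u C (c o e : R) (k : nat) (z w : V) : distribution_on W u -> C `<=` W -> 0 < e ->
  (forall h (b : R), test_function W h -> (forall x, h x != 0 -> C x) ->
    (forall s, (size s <= k)%N -> forall x, normc (cpartial s h x) <= b) -> normc (u h) <= c * b) ->
  addbox [set z] e `<=` C -> addbox [set w] e `<=` C ->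
  (forall s, (size s <= k)%N -> forall x,
    normc (cpartial s (@cbump R n e) (x - z) - cpartial s (@cbump R n e) (x - w)) <= o) ->
  normc (u (tbump e z) - u (tbump e w)) <= c * o.
Proof.
move=> du CW e0 hc zC wC ho.
have tz := test_tbump e0 (subset_trans zC CW); have tw := test_tbump e0 (subset_trans wC CW).
have [tzw <-] := dist_sub du tz tw.
apply: hc => //.
  move=> x; have [z0|z0] := eqVneq (tbump e z x) 0; last by move=> _; apply: zC; exact: tbump_supp z0.
  by rewrite z0 sub0r oppr_eq0 => w0; apply: wC; exact: tbump_supp w0.
move=> s sk x.
have -> : (fun x => tbump e z x - tbump e w x) = fun x => (-1) * tbump e w x + tbump e z x.
  by apply/funext => v; rewrite mulN1r addrC.
rewrite (csmooth_linC (-1) (csmooth_tbump w e0) (csmooth_tbump z e0)).1 !cpartial_tbump mulN1r addrC.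
exact: ho.
Qed.

Lemma dist_tbump_unif W u C (e eta : R) : distribution_on W u -> compact C -> C `<=` W -> 0 < e -> 0 < eta ->
  exists2 d : R, 0 < d & forall z w, addbox [set z] e `<=` C -> addbox [set w] e `<=` C ->
    (forall i, `|z ord0 i - w ord0 i| < d) -> normc (u (tbump e z) - u (tbump e w)) <= eta.
Proof.
move=> du cC CW e0 eta0.
have [c [k [c0 hc]]] := dist_bound du cC CW.
have ec : 0 < eta / (c + 1) by rewrite divr_gt0// ltr_wpDl.
have [d d0 hd] := unif_csmooth_Ck k (@csmooth_cbump R n e) (@box_supp_cbump R n e) ec.
exists d => // z w zC wC zw.
apply: (@le_trans _ _ (c * (eta / (c + 1)))); last first.
  by rewrite mulrA ler_pdivrMr ?ltr_wpDl// mulrC ler_pM2l// lerDl.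
by apply: (dist_tbump_diff du CW e0 hc zC wC); exact: tbump_diff_le zw.
Qed.

Lemma cmeas_mollify W u e : distribution_on W u -> 0 < e -> cmeas (mollify W u e).
Proof.
move=> du e0.
have key z : inset W e z -> forall eta : R, 0 < eta -> exists2 d : R, 0 < d &
    forall y, (forall i, `|y ord0 i| < d) -> normc (mollify W u e (z + y) - mollify W u e z) <= eta.
  move=> hz eta eta0; have [r er hr] := hz.
  pose C := addbox [set z] ((r + e) / 2).
  have cC : compact C by apply: compact_addbox; exact: compact_set1.
  have CW : C `<=` W.
    move=> x [_ -> xz]; rewrite -(subrKC z x); apply: hr => i; rewrite !mxE.
    by apply: le_lt_trans (xz i) _; lra.
  have [d d0 hd] := dist_tbump_unif du cC CW e0 eta0.
  have [d' d'0 hd'] := rV_nbhs_ball (@open_inset W e) hz.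
  exists (Num.min d (Num.min d' ((r - e) / 2))); first by rewrite !lt_min d0 d'0 divr_gt0 ?subr_gt0.
  move=> y yd; rewrite !mollifyE//; last first.
    by apply: hd' => i; have := yd i; rewrite !lt_min => /andP[_ /andP[]].
  apply: hd => [x [_ -> xz]|x [_ -> xz]|i].
  - exists z => // i; have := xz i; have := yd i; rewrite !lt_min mxE => /andP[_ /andP[_ yi]] xi.
    have := ler_normD (x ord0 i - (z ord0 i + y ord0 i)) (y ord0 i).
    have -> : x ord0 i - (z ord0 i + y ord0 i) + y ord0 i = x ord0 i - z ord0 i by ring.
    lra.
  - by exists z => // i; apply: le_trans (xz i) _; lra.
  - by rewrite mxE addrAC subrr add0r; have := yd i; rewrite !lt_min => /andP[].
have m0 z : ~ inset W e z -> mollify W u e z = 0 by move=> nz; rewrite /mollify; case: asboolP.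
split; apply: (measurable_open_cont (@open_inset W e)) => [z /m0 ->//|z hz eta eta0];
  have [d d0 hd] := key z hz _ (divr_gt0 eta0 (@ltr0Sn R 1)); exists d => // y /hd h;
  apply: (@le_lt_trans _ _ (normc (mollify W u e (z + y) - mollify W u e z)));
  rewrite ?(le_lt_trans h) ?ltr_pdivrMr ?ltr_pMr ?ltr1n//.
- by rewrite (le_trans _ (ler_Re_normc _))// cReD cReN.
- by rewrite (le_trans _ (ler_Im_normc _))// cImD cImN.
Qed.

(** A finite sum of translated bumps is compared in two ways. Under [u] it becomes a Riemann sum of
    the integral of [h] against the mollified [u]; in C^k it is close to the mollification of [h],
    hence to [h]. Continuity of [u] on a fixed compact neighbourhood of the support joins the
    two. *)
Theorem mollify_cvg W u h (eta : R) : open W -> distribution_on W u -> test_function W h -> 0 < eta ->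
  exists2 e1 : R, 0 < e1 & forall e, 0 < e -> e < e1 ->
    cintble mu (fun z => h z * mollify W u e z) /\
    normc (u h - cI mu (fun z => h z * mollify W u e z)) <= eta.
Proof.
move=> oW du th eta0; have [_ _ cS SW] := th; set S := csupport h in cS SW.
have hS z : h z != 0 -> S z by exact: csupport_in.
have [sh [L L0 hL]] := test_csmooth th.
have hi := cintble_csmooth L0 sh hL.
have [r r0 hr] := compact_uniform_ball oW cS SW.
pose e0 := r / 2; have e00 : 0 < e0 by exact: divr_gt0.
pose C := addbox S e0; have cC : compact C by exact: compact_addbox.
have CW : C `<=` W.
  move=> x [y Sy xy]; rewrite -(subrKC y x); apply: hr => // i; rewrite !mxE.
  by apply: le_lt_trans (xy i) _; rewrite /e0; lra.
have [c [k [c0 hc]]] := dist_bound du cC CW.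
pose M := fine (\int[mu]_z (normc (h z))%:E)%E.
have ME : (\int[mu]_z (normc (h z))%:E = M%:E)%E.
  by rewrite fineK// ge0_fin_numE ?cintble_fin//; apply: integral_ge0 => z _; rewrite lee_fin normc_ge0.
have M0 : 0 <= M by rewrite -lee_fin -ME; apply: integral_ge0 => z _; rewrite lee_fin normc_ge0.
(* The error is c eta1, from mollifying [h], plus twice c o M, from the Riemann sums; eta1 and o are
   chosen to make these terms at most eta / 2 and eta / 4. *)
pose eta1 := eta / (2 * (c + 1)); have eta10 : 0 < eta1 by rewrite divr_gt0// mulr_gt0// ltr_wpDl.
have [d1 d10 hd1] := unif_csmooth_Ck k sh hL eta10.
exists (Num.min e0 d1); first by rewrite lt_min e00.
move=> e ep; rewrite lt_min => /andP[ee0 ed1].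
have zin z : S z -> inset W e z.
  by move=> Sz; exists r; [rewrite /e0 in ee0; lra|exact: hr].
have zC z : S z -> addbox [set z] e `<=` C.
  by move=> Sz x [_ -> xz]; exists z => // i; rewrite (le_trans (xz i))// ltW.
pose o := eta / (4 * (c + 1) * (M + 1)).
have oc : 0 < 4 * (c + 1) * (M + 1) by rewrite !mulr_gt0// ltr_wpDl.
have o0 : 0 < o by rewrite divr_gt0.
have bs := @csmooth_cbump R n e; have bb := @box_supp_cbump R n e.
have [d2 d20 hd2] := unif_csmooth_Ck k bs bb o0.
have [m [p [cf [pS happ]]]] := riemann_approx cS hi hS d20.
have Phi_diff z w : S z -> S w -> (forall i, `|z ord0 i - w ord0 i| < d2) ->
    normc (mollify W u e z - mollify W u e w) <= c * o.
  move=> Sz Sw zw; rewrite !mollifyE; [|exact: zin..].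
  by apply: (dist_tbump_diff du CW ep hc (zC z Sz) (zC w Sw)); exact: tbump_diff_le zw.
have [B B0 hB] := bounded_csmooth_Ck k bs bb.
have mPhi := cmeas_mollify du ep.
have hPhi : cintble mu (fun z => h z * mollify W u e z).
  have [mh nh] := (cintbleP mu h).1 hi.
  apply: (le_cintble (g := fun z => ((c * B)%:E * (normc (h z))%:E)%E)).
  - exact: cmeasM.
  - exact: integrableZl.
  move=> z; rewrite -EFinM lee_fin normcMl mulrC.
  have [->|hz] := eqVneq (h z) 0; first by rewrite Normc.normc0 !mulr0.
  have Sz := hS _ hz; rewrite ler_wpM2r ?normc_ge0// mollifyE; last exact: zin.
  apply: hc => [|x|s sk x].
  - by apply: test_tbump => //; apply: subset_trans CW; exact: zC.
  - by move/(tbump_supp ep); exact: zC.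
  - by rewrite cpartial_tbump; exact: hB.
split=> //.
have part1 : normc (cI mu (fun z => h z * mollify W u e z) - \sum_j cf j * u (tbump e (p j))) <= c * o * M.
  have := happ _ _ hPhi Phi_diff; rewrite ME -EFinM lee_fin.
  rewrite (_ : \sum_j cf j * mollify W u e (p j) = \sum_j cf j * u (tbump e (p j)))//.
  by apply: eq_bigr => j _; rewrite mollifyE//; exact: zin.
have part2 s x : (size s <= k)%N ->
    normc (cI mu (fun z => h z * cpartial s (@cbump R n e) (x - z)) -
      \sum_j cf j * cpartial s (tbump e (p j)) x) <= o * M.
  move=> sk; have mphi : measurable_fun setT (fun z : V => x - z).
    apply: measurable_rVD; first exact: measurable_cst.
    exact: measurable_rVN.
  have [m1 m2] := cmeas_csmooth (csmooth_cpartial s bs).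
  have mF : cmeas (fun z => cpartial s (@cbump R n e) (x - z)).
    by split; [exact: (measurableT_comp m1 mphi)|exact: (measurableT_comp m2 mphi)].
  have hF : cintble mu (fun z => h z * cpartial s (@cbump R n e) (x - z)).
    rewrite (_ : (fun z => _) = fun z => cpartial s (@cbump R n e) (x - z) * h z); last first.
      by apply/funext => z; rewrite mulrC.
    by apply: (cintbleMb (b := B) hi mF) => z; exact: hB.
  have := happ _ o hF; rewrite ME -EFinM lee_fin.
  rewrite (_ : \sum_j cf j * cpartial s (@cbump R n e) (x - p j) = \sum_j cf j * cpartial s (tbump e (p j)) x).
    by apply => z w _ _ zw; exact: (tbump_diff_le ep hd2 zw sk).
  by apply: eq_bigr => j _; rewrite cpartial_tbump.
have part3 s x : (size s <= k)%N ->
    normc (cpartial s h x - cI mu (fun z => h z * cpartial s (@cbump R n e) (x - z))) <= eta1.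
  (* The derivative is moved from the bump to [h], whose derivatives have a modulus of continuity
     independent of [e]. *)
  move=> sk; have -> : cI mu (fun z => h z * cpartial s (@cbump R n e) (x - z)) =
      cI mu (fun z => cpartial s h z * cbump e (x - z)).
    by rewrite (cI_parts_seq s x L0 sh hL (ltW ep) bs bb) cpartial_cbump_rev.
  have [i1 I1 I2] := int_tbump x ep.
  have sd := csmooth_cpartial s sh; have [D hD] := bounded_csmooth sd (box_supp_cpartial s hL).
  have i2 := cintbleMb i1 (cmeas_csmooth sd) hD.
  set a := cpartial s h x.
  have -> : a - cI mu (fun z => cpartial s h z * cbump e (x - z)) =
      cI mu (fun z => a * cbump e (x - z) + (-1) * (cpartial s h z * cbump e (x - z))).
    by rewrite (cID (cintbleZ a i1) (cintbleZ (-1) i2)) (cIZ a i1) (cIZ (-1) i2) I1 mulr1 mulN1r.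
  have i3 := cintbleD (cintbleZ a i1) (cintbleZ (-1) i2).
  have mb : measurable_fun setT (fun z : V => (bumpf e (x - z))%:E).
    by apply/measurable_EFinP; exact: (cintble_meas i1).1.
  rewrite -lee_fin (le_trans (normc_cI i3))// -[X in (_ <= X)%E]mule1 -I2.
  rewrite -(@ge0_integralZl _ _ R mu setT measurableT _ mb) => [|z _|]; last 2 first.
  - by rewrite lee_fin bumpf_ge0.
  - by rewrite lee_fin ltW.
  apply: ge0_le_integral => //.
  - by move=> z _; rewrite lee_fin normc_ge0.
  - by apply: emeas_normc; exact: (cintble_meas i3).
  - exact: measurable_funeM.
  move=> z _; rewrite -EFinM lee_fin mulN1r -mulrBl normcMl normc_real ger0_norm ?bumpf_ge0//.
  have [b0|b0] := eqVneq (bumpf e (x - z)) 0; first by rewrite b0 !mulr0.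
  rewrite ler_wpM2r ?bumpf_ge0// -normcNl opprB ltW//.
  have -> : a = cpartial s h (z + (x - z)) by rewrite subrKC.
  rewrite -normcNl opprB; apply: hd1 => // i.
  have cb : cbump e (x - z) != 0 by rewrite -normc_eq0 normc_real normr_eq0.
  have [y -> xy] := tbump_supp (z := z) (x := x) ep cb.
  by rewrite !mxE; apply: le_lt_trans (xy i) _.
have tb j : test_function W (tbump e (p j)).
  by apply: test_tbump => //; apply: subset_trans CW; exact: zC.
have [tsum us] := dist_sum (index_enum 'I_m) cf du tb.
have [tA uA] := dist_sub du th tsum.
have part4 : normc (u h - \sum_j cf j * u (tbump e (p j))) <= c * (eta1 + o * M).
  rewrite -us -uA; apply: hc => //.
    move=> x; have [h0|h0] := eqVneq (h x) 0; last first.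
      by move=> _; apply: addboxS; [exact: ltW|exact: hS].
    rewrite h0 sub0r oppr_eq0 => h1.
    have : exists j, tbump e (p j) x != 0.
      apply: contrapT => /forallNP hn; case/negP: h1; rewrite big1// => j _.
      by have /negP/negPn/eqP -> := hn j; rewrite mulr0.
    by case=> j /(tbump_supp ep); apply: zC.
  move=> s sk x.
  have [q1 q2] := csmooth_sum (index_enum 'I_m) cf (fun j => csmooth_tbump (p j) ep).
  have -> : (fun x => h x - \sum_j cf j * tbump e (p j) x) = fun x => (-1) * (\sum_j cf j * tbump e (p j) x) + h x.
    by apply/funext => v; rewrite mulN1r addrC.
  rewrite (csmooth_linC (-1) q2 sh).1 q1 mulN1r addrC.
  set a := cpartial s h x; set b := \sum_j _.
  pose v := cI mu (fun z => h z * cpartial s (@cbump R n e) (x - z)).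
  have -> : a - b = (a - v) + (v - b) by rewrite addrA subrK.
  by rewrite (le_trans (ler_normcD _ _))// lerD//; [exact: part3|exact: part2].
set a := u h in part4 *; set b := \sum_j _ in part4 part1; set v := cI mu _ in part1 *.
have -> : a - v = (a - b) - (v - b) by rewrite opprB addrA subrK.
rewrite (le_trans (ler_normcD _ _))// normcNl (le_trans (lerD part4 part1))//.
have e1 : c * eta1 <= eta / 2.
  rewrite /eta1 mulrA ler_pdivrMr ?mulr_gt0 ?ltr_wpDl//.
  have -> : eta / 2 * (2 * (c + 1)) = c * eta + eta by field.
  by rewrite lerDl ltW.
have e2 : c * o * M <= eta / 4.
  rewrite /o (_ : _ * _ * M = (c * M * eta) / (4 * (c + 1) * (M + 1))); last by ring.
  rewrite ler_pdivrMr//.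
  have -> : eta / 4 * (4 * (c + 1) * (M + 1)) = eta * ((c + 1) * (M + 1)) by field.
  rewrite mulrC ler_wpM2l ?(ltW eta0)//.
  by apply: ler_pM => //; rewrite lerDl.
have -> : c * (eta1 + o * M) = c * eta1 + c * o * M by ring.
lra.
Qed.

End mollification.

(** The limit is named explicitly: u k - 2 C 2^-k increases, u k + 2 C 2^-k decreases, and the
    supremum of the former lies between the two. *)
Lemma geom_cauchy (R : realType) (u : nat -> R) (C : R) : 0 <= C ->
  (forall k, `|u k.+1 - u k| <= C * 2^-1 ^+ k) ->
  forall k, `|u k - sup (range (fun k => u k - 2 * C * 2^-1 ^+ k))| <= 2 * C * 2^-1 ^+ k.
Proof.
move=> C0 hu k; set a := fun k => u k - _; pose b k := u k + 2 * C * 2^-1 ^+ k.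
have ha : nondecreasing_seq a.
  apply/nondecreasing_seqP => j; rewrite /a exprSr; have := hu j; rewrite ler_norml => /andP[]; lra.
have hb : nonincreasing_seq b.
  apply/nonincreasing_seqP => j; rewrite /b exprSr; have := hu j; rewrite ler_norml => /andP[]; lra.
have ab j : a j <= b j.
  have : 0 <= C * 2^-1 ^+ j by rewrite mulr_ge0 ?exprn_ge0.
  rewrite /a /b; lra.
have abk j i : a j <= b i.
  apply: (le_trans (ha _ _ (leq_maxl j i))); apply: le_trans (ab _) _; exact: hb (leq_maxr _ _).
have l1 : a k <= sup (range a).
  by apply: ub_le_sup; [exists (b 0) => _ [j _ <-]; exact: abk|exists k].
have l2 : sup (range a) <= b k.
  by apply: ge_sup; [exists (a 0), 0|move=> _ [j _ <-]; exact: abk].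
rewrite ler_norml /a /b in l1 l2 *; apply/andP; split; lra.
Qed.

Lemma sum_geom_le (R : realType) (m : nat) : \sum_(0 <= k < m) (4^-1 ^+ k : R) <= 2.
Proof.
suff -> : \sum_(0 <= k < m) (4^-1 ^+ k : R) = (4 - 4 * 4^-1 ^+ m) / 3.
  have : 0 <= (4^-1 : R) ^+ m by exact: exprn_ge0.
  lra.
elim: m => [|m IH]; first by rewrite big_geq// expr0; field.
by rewrite big_nat_recr//= IH exprSr; field.
Qed.

Lemma cvg_geom4 {R : realType} (b : R) : (fun k : nat => b * 4^-1 ^+ k) @ \oo --> (0 : R).
Proof.
rewrite -[X in _ --> X](mulr0 b); apply: cvgMr; apply: cvg_expr.
by rewrite ger0_norm//; lra.
Qed.

(** * Square-integrable functions *)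

Section riesz_fischer.
Context d (T : measurableType d) (R : realType) (mu : {measure set T -> \bar R}).
Implicit Types f g : T -> R[i].

(** The squared increments are summed with weights 4^k. The sum [S] has integral at most that of the
    series of (4/16)^k, and where it is finite the k-th increment is at most 2^-k times the root of
    [S]; this gives the limit almost everywhere and its rate. *)
Theorem riesz_fischer (F : nat -> T -> R[i]) : (forall k, cmeas (F k)) ->
  (forall k, (N2 mu (fun x => (F k.+1 x - F k x)%R) <= (16^-1 ^+ k)%:E)%E) ->
  exists f, [/\ cmeas f, forall k, (N2 mu (fun x => (F k x - f x)%R) <= (32 * 4^-1 ^+ k)%:E)%E &
    \forall x \ae mu, (fun k => normc (F k x - f x)) @ \oo --> (0 : R)].
Proof.
move=> mF hF.
pose D k x := ((4 ^+ k * normc (F k.+1 x - F k x) ^+ 2)%:E : \bar R).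
have mD k : measurable_fun setT (D k).
  have mk : measurable_fun setT (fun x => (normc (F k.+1 x - F k x) ^+ 2)%:E).
    apply: cmeas_sqr; have -> : (fun x => F k.+1 x - F k x) = fun x => F k.+1 x + (-1) * F k x.
      by apply/funext => x; rewrite mulN1r.
    by apply: cmeasD => //; apply: cmeasM => //; exact: cmeas_cst.
  rewrite (_ : D k = fun x => ((4 ^+ k)%:E * (normc (F k.+1 x - F k x)%R ^+ 2)%:E)%E).
    exact: measurable_funeM.
  by apply/funext => x; rewrite /D EFinM.
have D0 k x : (0 <= D k x)%E by rewrite lee_fin mulr_ge0 ?sqr_ge0 ?exprn_ge0.
pose S x := (\sum_(k <oo) D k x)%E.
have mS : measurable_fun setT S by apply: ge0_emeasurable_sum => // k x _ _; exact: D0.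
have S0 x : (0 <= S x)%E by apply: nneseries_ge0 => k _ _; exact: D0.
have IS : (\int[mu]_x S x <= 2%:E)%E.
  rewrite integral_nneseries//.
  apply: lime_le; first by apply: is_cvg_nneseries => k _ _; apply: integral_ge0 => x _; exact: D0.
  apply: nearW => m; rewrite (@le_trans _ _ (\sum_(0 <= k < m) (4^-1 ^+ k)%:E)%E)//; last first.
    by rewrite sumEFin lee_fin sum_geom_le.
  apply: lee_sum => k _.
  rewrite (eq_integral (fun x => ((4 ^+ k)%:E * (normc (F k.+1 x - F k x)%R ^+ 2)%:E)%E)); last first.
    by move=> x _; rewrite /D EFinM.
  have mk : measurable_fun setT (fun x => (normc (F k.+1 x - F k x) ^+ 2)%:E).
    have := measurable_funeM (((4 ^+ k)^-1)%:E) (mD k); congr measurable_fun; apply/funext => x.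
    by rewrite /D -EFinM mulrA mulVf ?mul1r// expf_neq0.
  rewrite (@ge0_integralZl _ _ R mu setT measurableT _ mk) => [|x _|]; last 2 first.
  - by rewrite lee_fin sqr_ge0.
  - by rewrite lee_fin exprn_ge0.
  have h4 : (0 <= (4 ^+ k : R)%:E)%E by rewrite lee_fin exprn_ge0.
  apply: (le_trans (lee_wpmul2l h4 (hF k))); rewrite -EFinM lee_fin.
  by rewrite -exprMn (_ : 4 * 16^-1 = 4^-1 :> R)//; field.
have le_DS k x : (D k x <= S x)%E.
  apply: (@le_trans _ _ (\sum_(0 <= i < k.+1) D i x)%E); last exact: nneseries_lim_ge.
  by rewrite big_nat_recr//= leeDr// sume_ge0.
pose C x := Num.sqrt (fine (S x)).
have dC k x : (S x < +oo)%E -> normc (F k.+1 x - F k x) <= C x * 2^-1 ^+ k.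
  move=> Sx; have Sf : S x = (C x ^+ 2)%:E.
    by rewrite sqr_sqrtr ?fine_ge0// fineK// ge0_fin_numE.
  have C0 : 0 <= C x by exact: sqrtr_ge0.
  have p2 : 0 < (2 : R) ^+ k by exact: exprn_gt0.
  have := le_DS k x; rewrite Sf lee_fin => h; rewrite exprVn ler_pdivlMr//.
  rewrite -(ler_pXn2r (n:=2)) ?nnegrE//; last by apply: mulr_ge0; [exact: normc_ge0|exact: ltW].
  apply: le_trans h; rewrite exprMn mulrC -exprM mulnC exprM.
  by rewrite (_ : (2 : R) ^+ 2 = 4)//; ring.
pose lim0 (u : nat -> R) (c : R) := sup (range (fun k => u k - 2 * c * 2^-1 ^+ k)).
pose f x := if `[< (S x < +oo)%E >] then
  (lim0 (fun k => Re (F k x)) (C x)) +i* (lim0 (fun k => Im (F k x)) (C x)) else 0.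
have fF k x : (S x < +oo)%E -> normc (F k x - f x) <= 4 * C x * 2^-1 ^+ k.
  move=> Sx; apply: (le_trans (normc_le_ReIm _)); rewrite /f; case: asboolP => // _.
  have C0 : 0 <= C x by exact: sqrtr_ge0.
  have h1 : `|Re (F k x) - lim0 (fun k => Re (F k x)) (C x)| <= 2 * C x * 2^-1 ^+ k.
    apply: (geom_cauchy (u := fun k => Re (F k x)) C0) => j.
    by apply: le_trans (dC j x Sx); rewrite -cReN -cReD; exact: ler_Re_normc.
  have h2 : `|Im (F k x) - lim0 (fun k => Im (F k x)) (C x)| <= 2 * C x * 2^-1 ^+ k.
    apply: (geom_cauchy (u := fun k => Im (F k x)) C0) => j.
    by apply: le_trans (dC j x Sx); rewrite -cImN -cImD; exact: ler_Im_normc.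
  rewrite cReD cReN cImD cImN /=; lra.
have fcvg x : (S x < +oo)%E -> (fun k => normc (F k x - f x)) @ \oo --> (0 : R).
  move=> Sx; apply: squeeze0 (fun k => 4 * C x * 2^-1 ^+ k) _ _ _ => [k|k|]; first exact: normc_ge0.
  - exact: fF.
  - rewrite -[X in _ --> X](mulr0 (4 * C x)); apply: cvgMr; apply: cvg_expr.
    by rewrite ger0_norm//; lra.
have mG : measurable [set x | (S x < +oo)%E].
  by rewrite -[X in measurable X]setTI; apply: emeasurable_fun_infty_o.
have mf : cmeas f.
  pose iG : T -> R := \1_[set x | (S x < +oo)%E].
  have miG : measurable_fun setT iG by exact: measurable_indic.
  have cvgG x : (fun k => normc ((iG x)%:C * F k x - f x)) @ \oo --> (0 : R).
    have [Sx|Sx] := pselect (S x < +oo)%E.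
      by rewrite /iG indicE mem_set//; under eq_fun do rewrite mul1r; exact: fcvg.
    rewrite /iG indicE memNset// /f; case: asboolP => // _.
    by under eq_fun do rewrite mul0r subrr Normc.normc0; exact: cvg_cst.
  have cvg_part (p : R[i] -> R) (x : T) : (forall z w, `|p z - p w| <= normc (z - w)) ->
      (fun k => p ((iG x)%:C * F k x)) @ \oo --> p (f x).
    move=> hp; apply/subr_cvg0.
    have h : (fun k => `|p ((iG x)%:C * F k x) - p (f x)|) @ \oo --> (0 : R).
      by apply: squeeze0 (cvgG x) => k.
    exact/norm_cvg0P.
  have mGF k : cmeas (fun x => (iG x)%:C * F k x) by apply: cmeasM => //; exact: cmeas_real.
  split.
  - apply: (measurable_fun_cvg (h := fun k x => Re ((iG x)%:C * F k x))) => [k|x _]; first by have [] := mGF k.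
    by apply: cvg_part => z w; rewrite -cReN -cReD; exact: ler_Re_normc.
  - apply: (measurable_fun_cvg (h := fun k x => Im ((iG x)%:C * F k x))) => [k|x _]; first by have [] := mGF k.
    by apply: cvg_part => z w; rewrite -cImN -cImD; exact: ler_Im_normc.
exists f; split => //.
(* Pointwise, |F k - f|^2 <= 16 S 4^-k; since [S] has integral at most 2, the constant is 32. *)
- move=> k; apply: (@le_trans _ _ (\int[mu]_x ((16 * 4^-1 ^+ k)%:E * S x))%E).
    apply: ge0_le_integral => //.
    + by move=> x _; rewrite lee_fin sqr_ge0.
    + apply: cmeas_sqr; have -> : (fun x => F k x - f x) = fun x => F k x + (-1) * f x.
        by apply/funext => x; rewrite mulN1r.
      by apply: cmeasD => //; apply: cmeasM => //; exact: cmeas_cst.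
    + exact: measurable_funeM.
    move=> x _; have [Sx|] := ltP (S x) +oo%E; last first.
      by rewrite leye_eq => /eqP ->; rewrite gt0_muley ?leey// lte_fin mulr_gt0// exprn_gt0.
    have Sf : S x = (C x ^+ 2)%:E by rewrite sqr_sqrtr ?fine_ge0// fineK// ge0_fin_numE.
    rewrite Sf -EFinM lee_fin.
    have -> : 16 * 4^-1 ^+ k * C x ^+ 2 = (4 * C x * 2^-1 ^+ k) ^+ 2.
      have -> : (4^-1 : R) = 2^-1 ^+ 2 by field.
      by rewrite -exprM mulnC exprM; ring.
    by rewrite ler_pXn2r// ?nnegrE ?normc_ge0// ?fF// !mulr_ge0 ?sqrtr_ge0 ?exprn_ge0.
  rewrite (@ge0_integralZl _ _ R mu setT measurableT _ mS)//.
  have h4 : (0 <= (16 * 4^-1 ^+ k : R)%:E)%E by rewrite lee_fin mulr_ge0 ?exprn_ge0.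
  by apply: (le_trans (lee_wpmul2l h4 IS)); rewrite -EFinM lee_fin; lra.
have iS : mu.-integrable setT S.
  apply/integrableP; split => //; under eq_integral do rewrite gee0_abs//.
  by apply: le_lt_trans IS _; rewrite ltry.
have := integrable_ae measurableT iS; apply: filterS => x /(_ I) Sx; apply: fcvg.
by rewrite -ge0_fin_numE.
Qed.

End riesz_fischer.

Lemma sum_cauchy_schwarz (R : realType) (I : Type) (s : seq I) (a b : I -> R) :
  (forall i, 0 <= a i) -> (forall i, 0 <= b i) ->
  (\sum_(i <- s) a i * b i) ^+ 2 <= (\sum_(i <- s) a i ^+ 2) * (\sum_(i <- s) b i ^+ 2).
Proof.
move=> a0 b0; elim: s => [|i s]; first by rewrite !big_nil expr0n mul0r.
rewrite !big_cons; set S := \sum_(j <- s) _ * _; set A := \sum_(j <- s) _ ^+ 2.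
set B := \sum_(j <- s) b _ ^+ 2 => IH.
have S0 : 0 <= S by apply: sumr_ge0 => j _; exact: mulr_ge0.
have A0 : 0 <= A by apply: sumr_ge0 => j _; exact: sqr_ge0.
have B0 : 0 <= B by apply: sumr_ge0 => j _; exact: sqr_ge0.
have x0 := a0 i; have y0 := b0 i; set x := a i in x0 *; set y := b i in y0 *.
suff : 2 * (x * y * S) <= x ^+ 2 * B + y ^+ 2 * A by rewrite !expr2 in IH *; nra.
have p0 : 0 <= x ^+ 2 * B + y ^+ 2 * A by rewrite addr_ge0// mulr_ge0// sqr_ge0.
rewrite -(ler_pXn2r (n:=2)) ?nnegrE ?mulr_ge0//.
apply: (@le_trans _ _ (4 * ((x * y) ^+ 2 * (A * B)))).
  have -> : (2 * (x * y * S)) ^+ 2 = 4 * ((x * y) ^+ 2 * S ^+ 2) by ring.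
  by rewrite ler_wpM2l// ler_wpM2l ?sqr_ge0.
rewrite -subr_ge0 (_ : _ - _ = (x ^+ 2 * B - y ^+ 2 * A) ^+ 2) ?sqr_ge0//; ring.
Qed.

Section square_integrable.
Context d (T : measurableType d) (R : realType) (mu : {measure set T -> \bar R}).
Implicit Types f g h : T -> R[i].

Definition sqint f := cmeas f /\ (N2 mu f < +oo)%E.
(** The squared norm as a real number. An infinite one reads as 0, so statements about it carry
    [sqint]. *)
Definition nrm2 f : R := fine (N2 mu f).
Definition cdot f g : R[i] := cI mu (fun x => f x * conjc (g x)).

Lemma nrm2E f : sqint f -> N2 mu f = (nrm2 f)%:E.
Proof. by move=> [_ fo]; rewrite fineK// ge0_fin_numE// N2_ge0. Qed.

Lemma nrm2_ge0 f : 0 <= nrm2 f.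
Proof. by rewrite fine_ge0// N2_ge0. Qed.

Lemma N2_conj f : N2 mu (fun x => conjc (f x)) = N2 mu f.
Proof. by apply: eq_integral => x _; rewrite normc_conj. Qed.

Lemma sqint_lin (a : R[i]) f g : sqint f -> sqint g -> sqint (fun x => a * f x + g x).
Proof.
move=> [mf fo] [mg go]; have maf : cmeas (fun x => a * f x) by apply: cmeasM => //; exact: cmeas_cst.
split; first exact: cmeasD.
apply: le_lt_trans (N2D mu maf mg) _; rewrite N2Z//.
by rewrite lte_add_pinfty// lte_mul_pinfty// ?lee_fin ?N2_ge0 ?sqr_ge0 ?mule_ge0 ?lte_mul_pinfty ?lee_fin ?sqr_ge0 ?N2_ge0.
Qed.

Lemma sqint0 : sqint (fun=> 0).
Proof.
split; first exact: cmeas_cst.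
by rewrite /N2 (eq_integral (fun=> 0%E)) ?integral0// => x _; rewrite Normc.normc0 expr0n.
Qed.

Lemma sqintZ (a : R[i]) f : sqint f -> sqint (fun x => a * f x).
Proof.
by move=> sf; have := sqint_lin a sf sqint0; congr sqint; apply/funext => x; rewrite addr0.
Qed.

Lemma sqintD f g : sqint f -> sqint g -> sqint (fun x => f x + g x).
Proof.
by move=> sf sg; have := sqint_lin 1 sf sg; congr sqint; apply/funext => x; rewrite mul1r.
Qed.

Lemma sqintB f g : sqint f -> sqint g -> sqint (fun x => f x - g x).
Proof.
by move=> sf sg; have := sqint_lin (-1) sg sf; congr sqint; apply/funext => x; rewrite mulN1r addrC.
Qed.

Lemma sqint_sum (I : Type) (s : seq I) (a : I -> R[i]) (h : I -> T -> R[i]) :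
  (forall i, sqint (h i)) -> sqint (fun x => \sum_(i <- s) a i * h i x).
Proof.
move=> sh; elim: s => [|i s IH].
  by rewrite (_ : (fun x => _) = fun=> 0); [exact: sqint0|apply/funext => x; rewrite big_nil].
rewrite (_ : (fun x => _) = fun x => a i * h i x + \sum_(j <- s) a j * h j x).
  exact: sqint_lin.
by apply/funext => x; rewrite big_cons.
Qed.

Lemma cintble_cdot f g : sqint f -> sqint g -> cintble mu (fun x => f x * conjc (g x)).
Proof. by move=> [mf fo] [mg go]; apply: cintbleM2 => //; [exact: cmeasJ|rewrite N2_conj]. Qed.

Lemma cdot_lin (a : R[i]) f g h : sqint f -> sqint g -> sqint h ->
  cdot (fun x => a * f x + g x) h = a * cdot f h + cdot g h.
Proof.
move=> sf sg sh; have i1 := cintble_cdot sf sh; have i2 := cintble_cdot sg sh.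
rewrite /cdot -(cIZ a i1) -(cID (cintbleZ a i1) i2); apply: eq_cI => x.
by rewrite mulrDl mulrA.
Qed.

Lemma cdotJ f g : sqint f -> sqint g -> cdot g f = conjc (cdot f g).
Proof.
move=> sf sg; rewrite /cdot -(cIJ (cintble_cdot sf sg)); apply: eq_cI => x.
by rewrite conjcM conjcK mulrC.
Qed.

Lemma cdot0l g : cdot (fun=> 0) g = 0.
Proof.
rewrite /cdot (eq_cI mu (g := fun=> (0 : R)%:C)) => [|x]; last by rewrite mul0r.
by rewrite cI_real /Rintegral integral0.
Qed.

Lemma cdotBl f g h : sqint f -> sqint g -> sqint h ->
  cdot (fun x => f x - g x) h = cdot f h - cdot g h.
Proof.
move=> sf sg sh; have := cdot_lin (-1) sg sf sh; rewrite mulN1r addrC => <-.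
by congr cdot; apply/funext => x; rewrite mulN1r addrC.
Qed.

Lemma cdot_suml (I : Type) (s : seq I) (a : I -> R[i]) (h : I -> T -> R[i]) g :
  (forall i, sqint (h i)) -> sqint g ->
  cdot (fun x => \sum_(i <- s) a i * h i x) g = \sum_(i <- s) a i * cdot (h i) g.
Proof.
move=> sh sg; elim: s => [|i s IH].
  by rewrite big_nil (_ : (fun x => _) = fun=> 0); [exact: cdot0l|apply/funext => x; rewrite big_nil].
rewrite big_cons -IH -(cdot_lin _ (sh i) (sqint_sum s a sh) sg); congr cdot.
by apply/funext => x; rewrite big_cons.
Qed.

Lemma cdotff f : sqint f -> cdot f f = (nrm2 f)%:C.
Proof.
move=> [mf fo]; rewrite /cdot (eq_cI mu (g := fun x => (normc (f x) ^+ 2)%:C)) => [|x]; last by rewrite mulJc.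
by rewrite cI_real.
Qed.

Lemma cdot_cs f g : sqint f -> sqint g -> normc (cdot f g) ^+ 2 <= nrm2 f * nrm2 g.
Proof.
move=> sf sg; apply: (normc_cI_sqr (f := f) (g := fun x => conjc (g x))).
- exact: sf.1.
- exact: cmeasJ sg.1.
- by rewrite nrm2E.
- by rewrite N2_conj nrm2E.
Qed.

Lemma nrm2D f g : sqint f -> sqint g -> nrm2 (fun x => f x + g x) <= 2 * nrm2 f + 2 * nrm2 g.
Proof.
move=> sf sg; have := N2D mu sf.1 sg.1.
by rewrite (nrm2E (sqintD sf sg)) (nrm2E sf) (nrm2E sg) -!EFinM -EFinD lee_fin.
Qed.

Lemma nrm2_sym f g : nrm2 (fun x => f x - g x) = nrm2 (fun x => g x - f x).
Proof.
congr fine; apply: eq_integral => x _; by rewrite -normcNl opprB.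
Qed.

Lemma nrm2_tri f g h : sqint f -> sqint g -> sqint h ->
  nrm2 (fun x => f x - h x) <= 2 * nrm2 (fun x => f x - g x) + 2 * nrm2 (fun x => g x - h x).
Proof.
move=> sf sg sh; have := nrm2D (sqintB sf sg) (sqintB sg sh); congr (_ <= _).
by congr nrm2; apply/funext => x; rewrite addrA subrK.
Qed.

Lemma eq_nrm2_ae f g : (\forall x \ae mu, f x = g x) -> cmeas f -> cmeas g -> N2 mu f = N2 mu g.
Proof.
move=> fg mf mg; apply: ge0_ae_eq_integral => //.
- exact: cmeas_sqr.
- exact: cmeas_sqr.
- by move=> x _; rewrite lee_fin sqr_ge0.
- by move=> x _; rewrite lee_fin sqr_ge0.
- by apply: filterS fg => x -> _.
Qed.

Lemma nrm2_sum_le (I : Type) (s : seq I) (a : I -> R[i]) (h : I -> T -> R[i]) :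
  (forall i, sqint (h i)) ->
  nrm2 (fun x => \sum_(i <- s) a i * h i x) <=
    (\sum_(i <- s) normc (a i) ^+ 2) * \sum_(i <- s) nrm2 (h i).
Proof.
move=> sh; rewrite -lee_fin -(nrm2E (sqint_sum s a sh)).
set A := \sum_(i <- s) normc (a i) ^+ 2.
have A0 : 0 <= A by apply: sumr_ge0 => i _; exact: sqr_ge0.
have mh i : measurable_fun setT (fun x => (normc (h i x) ^+ 2)%:E) by apply: cmeas_sqr; exact: (sh i).1.
have -> : ((A * \sum_(i <- s) nrm2 (h i))%:E = \int[mu]_x (A%:E * (\sum_(i <- s) (normc (h i x) ^+ 2)%:E)%E))%E.
  rewrite (@ge0_integralZl _ _ R mu setT measurableT _ (emeasurable_sum s mh))//; last first.
    by move=> x _; apply: sume_ge0 => i _; rewrite lee_fin sqr_ge0.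
  rewrite ge0_integral_sum//; last by move=> i x _; rewrite lee_fin sqr_ge0.
  by rewrite (eq_bigr (fun i => (nrm2 (h i))%:E)) => [|i _]; [rewrite sumEFin EFinM|rewrite -nrm2E].
apply: ge0_le_integral => //.
- by move=> x _; rewrite lee_fin sqr_ge0.
- by apply: cmeas_sqr; exact: (sqint_sum s a sh).1.
- by apply: measurable_funeM; exact: emeasurable_sum.
move=> x _; rewrite sumEFin -EFinM lee_fin.
apply: (@le_trans _ _ ((\sum_(i <- s) normc (a i) * normc (h i x)) ^+ 2)); last first.
  by apply: sum_cauchy_schwarz => i; exact: normc_ge0.
rewrite ler_pXn2r ?nnegrE ?normc_ge0//.
  by apply: (le_trans (normc_sum _ _ _)); apply: ler_sum => i _; rewrite normcMl.
by apply: sumr_ge0 => i _; rewrite mulr_ge0 ?normc_ge0.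
Qed.

End square_integrable.

Lemma sum_subseq (I : eqType) (V : zmodType) (J J' : seq I) (w : I -> V) : uniq J -> uniq J' ->
  {subset J <= J'} ->
  \sum_(i <- J') w i = \sum_(i <- J) w i + \sum_(i <- [seq i <- J' | i \notin J]) w i.
Proof.
move=> uJ uJ' JJ'; rewrite (bigID (mem J))/= -big_filter -[X in _ + X]big_filter; congr (_ + _).
apply: perm_big; apply: uniq_perm => //; first exact: filter_uniq.
by move=> i; rewrite mem_filter/=; apply: andb_idr; exact: JJ'.
Qed.

(** * Orthonormal expansions in a closed subspace *)

Section orthonormal_expansion.
Context d (T : measurableType d) (R : realType) (mu : {measure set T -> \bar R}).
Context (I : choiceType) (e : I -> T -> R[i]) (P : (T -> R[i]) -> Prop).
Implicit Types (f g : T -> R[i]) (J : seq I).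
Local Notation sqint := (sqint mu).
Local Notation nrm2 := (nrm2 mu).
Local Notation cdot := (cdot mu).

Hypothesis P_sqint : forall f, P f -> sqint f.
Hypothesis P0 : P (fun=> 0).
Hypothesis P_lin : forall (a : R[i]) f g, P f -> P g -> P (fun x => a * f x + g x).
(** Closedness is expressed with the geometric rates of [riesz_fischer]. *)
Hypothesis P_closed : forall F f, (forall k, P (F k)) ->
  (forall k, (N2 mu (fun x => (F k.+1 x - F k x)%R) <= (16^-1 ^+ k)%:E)%E) ->
  cmeas f -> (forall k, (N2 mu (fun x => (F k x - f x)%R) <= (32 * 4^-1 ^+ k)%:E)%E) -> P f.
Hypothesis P_e : forall i, P (e i).
Hypothesis e_orth : forall i j, cdot (e i) (e j) = (i == j)%:R.
Hypothesis e_max : forall f, P f -> (forall i, cdot f (e i) = 0) -> \forall x \ae mu, f x = 0.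

Let e_sqint i : sqint (e i). Proof. exact/P_sqint/P_e. Qed.

Lemma cdot_sum_e J (a : I -> R[i]) j : uniq J ->
  cdot (fun x => \sum_(i <- J) a i * e i x) (e j) = if j \in J then a j else 0.
Proof.
move=> uJ; rewrite cdot_suml//; under eq_bigr do rewrite e_orth.
case: ifPn => jJ.
  rewrite (bigD1_seq j)//= eqxx mulr1 big1 ?addr0// => i ij.
  by rewrite (negbTE ij) mulr0.
rewrite big_seq big1// => i iJ; case: eqP => [ij|_]; last by rewrite mulr0.
by rewrite -ij iJ in jJ.
Qed.

Lemma nrm2_sum_e J (a : I -> R[i]) : uniq J ->
  nrm2 (fun x => \sum_(i <- J) a i * e i x) = \sum_(i <- J) normc (a i) ^+ 2.
Proof.
move=> uJ; have sS := sqint_sum J a e_sqint.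
have : (nrm2 (fun x => \sum_(i <- J) a i * e i x))%:C = (\sum_(i <- J) normc (a i) ^+ 2)%:C.
  rewrite -(cdotff sS) (cdot_suml J a e_sqint sS) big_seq.
  rewrite (eq_bigr (fun i => (normc (a i) ^+ 2)%:C)) -?big_seq -?(raddf_sum (real_complex R))// => i iJ.
  by rewrite (cdotJ sS (e_sqint i)) cdot_sum_e// iJ mulJc.
by case.
Qed.

Definition oproj J f x : R[i] := \sum_(i <- J) cdot f (e i) * e i x.

Lemma P_sum J (a : I -> R[i]) : P (fun x => \sum_(i <- J) a i * e i x).
Proof.
elim: J => [|i J IH]; first by rewrite (_ : (fun x => _) = fun=> 0)//; apply/funext => x; rewrite big_nil.
rewrite (_ : (fun x => _) = fun x => a i * e i x + \sum_(j <- J) a j * e j x); first exact: P_lin.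
by apply/funext => x; rewrite big_cons.
Qed.

Lemma nrm2_oproj J f : uniq J -> sqint f ->
  nrm2 (fun x => f x - oproj J f x) = nrm2 f - \sum_(i <- J) normc (cdot f (e i)) ^+ 2.
Proof.
move=> uJ sf; have sp : sqint (oproj J f) by exact: sqint_sum.
have sd := sqintB sf sp.
have : (nrm2 (fun x => f x - oproj J f x))%:C = (nrm2 f - \sum_(i <- J) normc (cdot f (e i)) ^+ 2)%:C.
  rewrite -(cdotff sd) cdotBl//.
  have -> : cdot (oproj J f) (fun x => f x - oproj J f x) = 0.
    rewrite /oproj cdot_suml// big_seq big1// => i iJ.
    by rewrite (cdotJ sd (e_sqint i)) cdotBl// cdot_sum_e// iJ subrr conjc0 mulr0.
  rewrite subr0 (cdotJ sd sf) cdotBl// cdotff// /oproj cdot_suml//.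
  rewrite (eq_bigr (fun i => (normc (cdot f (e i)) ^+ 2)%:C)) => [|i _]; last first.
    by rewrite (cdotJ sf (e_sqint i)) mulJc.
  by rewrite -(raddf_sum (real_complex R)) -rmorphB conjc_real.
by case.
Qed.

Lemma bessel J f : uniq J -> sqint f -> \sum_(i <- J) normc (cdot f (e i)) ^+ 2 <= nrm2 f.
Proof. by move=> uJ sf; rewrite -subr_ge0 -nrm2_oproj// nrm2_ge0. Qed.

Lemma nrm2_oprojB J J' f : uniq J -> uniq J' -> {subset J <= J'} ->
  nrm2 (fun x => oproj J' f x - oproj J f x) =
    \sum_(i <- J') normc (cdot f (e i)) ^+ 2 - \sum_(i <- J) normc (cdot f (e i)) ^+ 2.
Proof.
move=> uJ uJ' JJ'; rewrite (sum_subseq _ uJ uJ' JJ') addrAC subrr add0r.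
rewrite -(nrm2_sum_e (fun i => cdot f (e i))) ?filter_uniq//; congr nrm2; apply/funext => x.
by rewrite /oproj (sum_subseq _ uJ uJ' JJ') addrAC subrr add0r.
Qed.

(** The index set may be uncountable, so finite sets are chosen whose energy approaches the
    supremum. Nested ones give Cauchy projections with a limit [g]. Every coefficient of f - g
    vanishes, because adding an index to the k-th set gains at most 16^-k; maximality of the system
    then gives f = g almost everywhere. *)
Theorem oproj_approx f (del : R) : P f -> 0 < del ->
  exists2 J, uniq J & forall J', uniq J' -> {subset J <= J'} ->
    nrm2 (fun x => f x - oproj J' f x) <= del.
Proof.
move=> Pf del0; have sf := P_sqint Pf.
pose c i := cdot f (e i); pose En J : R := \sum_(i <- J) normc (c i) ^+ 2.
pose X : set R := [set En J | J in [set J | uniq J]].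
have hX : has_sup X.
  split; first by exists (En [::]), [::].
  by exists (nrm2 f) => _ [J uJ <-]; exact: bessel.
have En_le J : uniq J -> En J <= sup X by move=> uJ; apply: sup_upper_bound => //; exists J.
have pick (k : nat) : {J | uniq J & sup X - 16^-1 ^+ k < En J}.
  apply: cid2; have h : 0 < (16^-1 : R) ^+ k by exact: exprn_gt0.
  by have [_ [J uJ <-] hJ] := sup_adherent h hX; exists J.
pose K := fix K (k : nat) : seq I := if k is k'.+1 then undup (K k' ++ s2val (pick k)) else s2val (pick 0).
have uK k : uniq (K k) by case: k => [|k]; [exact: s2valP (pick 0)|exact: undup_uniq].
have KS k : {subset K k <= K k.+1} by move=> i iK; rewrite /= mem_undup mem_cat iK.
have En_mono J J' : uniq J -> uniq J' -> {subset J <= J'} -> En J <= En J'.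
  by move=> uJ uJ' JJ'; rewrite -subr_ge0 -nrm2_oprojB ?nrm2_ge0.
have EK k : sup X - 16^-1 ^+ k < En (K k).
  case: k => [|k]; first exact: s2valP' (pick 0).
  apply: lt_le_trans (s2valP' (pick k.+1)) _; apply: En_mono; rewrite ?undup_uniq//.
    exact: s2valP (pick k.+1).
  by move=> i ip; rewrite mem_undup mem_cat ip orbT.
pose p k := oproj (K k) f.
have Pp k : P (p k) by exact: P_sum.
have sp k : sqint (p k) by exact: P_sqint.
have pB k : (N2 mu (fun x => (p k.+1 x - p k x)%R) <= (16^-1 ^+ k)%:E)%E.
  rewrite (nrm2E (sqintB (sp k.+1) (sp k))) lee_fin nrm2_oprojB//.
  have := EK k; have := En_le _ (uK k.+1); rewrite /En; lra.
have [g [mg pg _]] := riesz_fischer (fun k => (sp k).1) pB.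
have Pg := P_closed Pp pB mg pg; have sg := P_sqint Pg.
have pg2 k : nrm2 (fun x => p k x - g x) <= 32 * 4^-1 ^+ k.
  by rewrite -lee_fin -(nrm2E (sqintB (sp k) sg)).
have cfg i : cdot (fun x => f x - g x) (e i) = 0.
  (* 66 is twice 1, for an index outside the k-th set, plus twice 32, from the rate of
     [riesz_fischer]. *)
  have key k : normc (cdot (fun x => f x - g x) (e i)) ^+ 2 <= 66 * 4^-1 ^+ k.
    have -> : cdot (fun x => f x - g x) (e i) = cdot (fun x => f x - p k x) (e i) + cdot (fun x => p k x - g x) (e i).
      by rewrite !cdotBl// addrA subrK.
    apply: (le_trans (normc_sqrD _ _)).
    have h1 : normc (cdot (fun x => f x - p k x) (e i)) ^+ 2 <= 4^-1 ^+ k.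
      apply: (@le_trans _ _ (16^-1 ^+ k)); last first.
        by apply: lerXn2r; rewrite ?nnegrE//; lra.
      rewrite cdotBl// /p /oproj cdot_sum_e//; case: ifPn => iK.
        by rewrite subrr Normc.normc0 expr0n exprn_ge0.
      rewrite subr0; have := EK k; have := En_le (i :: K k); rewrite /= iK uK => /(_ isT).
      rewrite /En big_cons; lra.
    have h2 : normc (cdot (fun x => p k x - g x) (e i)) ^+ 2 <= 32 * 4^-1 ^+ k.
      apply: (le_trans (cdot_cs (sqintB (sp k) sg) (e_sqint i))); apply: le_trans (pg2 k).
      have : (nrm2 (e i))%:C = 1 :> R[i] by rewrite -cdotff// e_orth eqxx.
      by case=> ->; rewrite mulr1.
    lra.
  apply/eqP; rewrite -normc_eq0 -sqrf_eq0; apply/eqP/le_anti; rewrite sqr_ge0 andbT.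
  by apply: (cvgr_to_ge (cvg_geom4 (66 : R))); apply: nearW.
have fg0 : nrm2 (fun x => f x - g x) = 0.
  have Pfg : P (fun x => f x - g x).
    have := P_lin (-1) Pg Pf; congr P; apply/funext => x; by rewrite mulN1r addrC.
  have ae0 := e_max Pfg cfg.
  have m0 : cmeas (fun _ : T => 0 : R[i]) by exact: cmeas_cst.
  have := @eq_nrm2_ae _ T R mu (fun x => f x - g x) (fun=> 0) ae0 (sqintB sf sg).1 m0.
  rewrite /nrm2 => ->; by rewrite /N2 (eq_integral (fun=> 0%E)) ?integral0// => x _; rewrite Normc.normc0 expr0n.
have fp k : nrm2 (fun x => f x - p k x) <= 64 * 4^-1 ^+ k.
  apply: (le_trans (nrm2_tri sf sg (sp k))); rewrite fg0 nrm2_sym; have := pg2 k; lra.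
have [k hk] : exists k : nat, 64 * 4^-1 ^+ k <= del.
  have /cvgrPdist_le /(_ del del0) [N _ /(_ N (leqnn N))] := cvg_geom4 (64 : R).
  rewrite sub0r normrN => h; exists N; apply: le_trans h; exact: ler_norm.
exists (K k) => // J' uJ' KJ'; apply: le_trans hk; apply: le_trans (fp k).
by rewrite !nrm2_oproj// lerD2l lerN2; exact: En_mono.
Qed.

End orthonormal_expansion.

(** * Hilbert-Schmidt Hankel operators *)

Section fourierL2_theory.
Context (R : realType) (n : nat).
Local Notation V := 'rV[R]_n.
Local Notation mu := (lebesgue_rV R n).
Implicit Types (U : set V) (f g : V -> R[i]).

Lemma sqint_fourier f : cintble mu f -> sqint mu f -> sqint mu (fourier f).
Proof.
by move=> fi [mf fo]; split; [exact: cmeas_fourier|exact: le_lt_trans (N2_fourier fi) fo].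
Qed.

Lemma nrm2_fourier f : cintble mu f -> sqint mu f -> nrm2 mu (fourier f) <= nrm2 mu f.
Proof.
by move=> fi sf; rewrite -lee_fin -(nrm2E sf) -(nrm2E (sqint_fourier fi sf)); exact: N2_fourier.
Qed.

Lemma fourier_lin (a : R[i]) f g : cintble mu f -> cintble mu g ->
  fourier (fun x => a * f x + g x) = fun x => a * fourier f x + fourier g x.
Proof.
move=> fi gi; apply/funext => x; rewrite !fourierE.
have i1 := cintble_kern x fi; have i2 := cintble_kern x gi.
rewrite -(cIZ a i1) -(cID (cintbleZ a i1) i2); apply: eq_cI => y.
by rewrite mulrDl mulrA.
Qed.

Definition fourier_approx f g (F : V -> R[i]) (del : R) :=
  [/\ cintble mu F, sqint mu F, nrm2 mu (fun x => F x - f x) <= del &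
    nrm2 mu (fun x => fourier F x - g x) <= del].

(** Approximating sequences are traded for one approximant at each accuracy, with both errors
    measured by real squared norms. *)
Lemma fourierL2P f g : fourierL2 f g <->
  [/\ sqint mu f, sqint mu g & forall del : R, 0 < del -> exists F, fourier_approx f g F del].
Proof.
split=> [[/Lp2P sf /Lp2P sg [F [F12 Ff Fg]]]|[sf sg hF]].
  split => // del del0.
  have small (G : nat -> V -> R[i]) : N2 mu (G k) @[k --> \oo] --> 0%E ->
      \forall k \near \oo, nrm2 mu (G k) <= del.
    move=> /fine_cvgP[_ /cvgrPdist_le /(_ del del0)]; apply: filterS => k /=.
    by rewrite sub0r normrN ger0_norm ?fine_ge0 ?N2_ge0.
  have h : \forall k \near \oo, nrm2 mu (F k \- f) <= del /\ nrm2 mu (fourier (F k) \- g) <= del.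
    by apply: filterI; apply: small; exact: cLnorm2_cvg0.
  have [k [k1 k2]] := filter_ex h.
  by have [/Lp1P F1 /Lp2P F2] := F12 k; exists (F k).
have hk (k : nat) : {F | fourier_approx f g F (k.+1%:R^-1)} by apply: cid; apply: hF.
pose F k := sval (hk k); have FP k : fourier_approx f g (F k) (k.+1%:R^-1) := svalP (hk k).
have tends (G : nat -> V -> R[i]) : (forall k, sqint mu (G k)) -> (forall k, nrm2 mu (G k) <= k.+1%:R^-1) ->
    N2 mu (G k) @[k --> \oo] --> 0%E.
  move=> sG hG; under eq_fun do rewrite nrm2E//.
  apply: (@cvg_EFin _ _ _ _ _ 0) => //; first by apply: nearW.
  apply: squeeze0 hG _ => [k|]; first exact: nrm2_ge0.
  by have := @cvg_invnM R 1; under eq_fun do rewrite mulr1.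
split; [exact/Lp2P|exact/Lp2P|exists F; split].
- by move=> k; have [f1 f2 _ _] := FP k; split; [exact/Lp1P|exact/Lp2P].
- apply: N2_cvg0; apply: tends => k; have [f1 f2 f3 f4] := FP k => //; exact: sqintB.
- apply: N2_cvg0; apply: tends => k; have [f1 f2 f3 f4] := FP k => //.
  by apply: sqintB => //; exact: sqint_fourier.
Qed.

Lemma nrm2_lin_le (a : R[i]) f g : sqint mu f -> sqint mu g ->
  nrm2 mu (fun x => a * f x + g x) <= 2 * normc a ^+ 2 * nrm2 mu f + 2 * nrm2 mu g.
Proof.
move=> sf sg; apply: (le_trans (nrm2D (sqintZ a sf) sg)).
by rewrite lerD2r -mulrA ler_wpM2l// -lee_fin -nrm2E ?N2Z ?nrm2E ?EFinM//; [exact: sf.1|exact: sqintZ].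
Qed.

Lemma fourierL2_lin (a : R[i]) f g f' g' : fourierL2 f g -> fourierL2 f' g' ->
  fourierL2 (fun x => a * f x + f' x) (fun x => a * g x + g' x).
Proof.
move=> /fourierL2P[sf sg h] /fourierL2P[sf' sg' h']; apply/fourierL2P.
split; [exact: sqint_lin|exact: sqint_lin|move=> del del0].
have q0 : 0 < 2 * normc a ^+ 2 + 2 by have := sqr_ge0 (normc a); lra.
have d0 : 0 < del / (2 * normc a ^+ 2 + 2) by exact: divr_gt0.
have [F [F1 F2 F3 F4]] := h _ d0; have [G [G1 G2 G3 G4]] := h' _ d0.
exists (fun x => a * F x + G x); split.
- by apply: cintbleD => //; exact: cintbleZ.
- exact: sqint_lin.
- have -> : (fun x => a * F x + G x - (a * f x + f' x)) = fun x => a * (F x - f x) + (G x - f' x).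
    by apply/funext => x; ring.
  apply: (le_trans (nrm2_lin_le a (sqintB F2 sf) (sqintB G2 sf'))).
  rewrite (_ : del = 2 * normc a ^+ 2 * (del / (2 * normc a ^+ 2 + 2)) + 2 * (del / (2 * normc a ^+ 2 + 2))); last first.
    by field; rewrite gt_eqF.
  by apply: lerD; rewrite ler_wpM2l// mulr_ge0 ?sqr_ge0.
- rewrite fourier_lin//.
  have -> : (fun x => a * fourier F x + fourier G x - (a * g x + g' x)) =
      fun x => a * (fourier F x - g x) + (fourier G x - g' x) by apply/funext => x; ring.
  have s1 := sqint_fourier F1 F2; have s2 := sqint_fourier G1 G2.
  apply: (le_trans (nrm2_lin_le a (sqintB s1 sg) (sqintB s2 sg'))).
  rewrite (_ : del = 2 * normc a ^+ 2 * (del / (2 * normc a ^+ 2 + 2)) + 2 * (del / (2 * normc a ^+ 2 + 2))); last first.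
    by field; rewrite gt_eqF.
  by apply: lerD; rewrite ler_wpM2l// mulr_ge0 ?sqr_ge0.
Qed.

(* The constant 4 is an artefact of using [nrm2D] for the triangle inequality. *)
Lemma fourierL2_le f g : fourierL2 f g -> nrm2 mu g <= 4 * nrm2 mu f.
Proof.
move=> /fourierL2P[sf sg h]; apply/ler_addgt0Pr => del del0.
have [F [F1 F2 F3 F4]] := h _ (divr_gt0 del0 (ltr0Sn R 5)).
have s1 := sqint_fourier F1 F2.
have := nrm2_tri sg s1 (sqint0 mu); have := nrm2_tri F2 sf (sqint0 mu).
have -> : (fun x => g x - 0) = g by apply/funext => x; rewrite subr0.
have -> : (fun x => F x - 0) = F by apply/funext => x; rewrite subr0.
have -> : (fun x => f x - 0) = f by apply/funext => x; rewrite subr0.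
have -> : (fun x => fourier F x - 0) = fourier F by apply/funext => x; rewrite subr0.
rewrite (nrm2_sym mu g) => h1 h2; have := nrm2_fourier F1 F2; lra.
Qed.

Lemma fourierL2_0 : fourierL2 (fun _ : V => 0) (fun _ : V => 0).
Proof.
apply/fourierL2P; have s0 := sqint0 mu.
have i0 : cintble mu (fun _ : V => 0) by apply/Lp1P; split; [exact: s0.1|rewrite cLnorm1 integral0_eq// => x _; rewrite Normc.normc0].
have n0 : nrm2 mu (fun _ : V => 0) = 0.
  by rewrite /nrm2 /N2 integral0_eq// => x _; rewrite Normc.normc0 expr0n.
split => // del del0; exists (fun=> 0); split => //.
  by rewrite (_ : (fun x => _) = fun=> 0) ?n0 ?ltW//; apply/funext => x; rewrite subrr.
rewrite (_ : (fun x => _) = fun=> 0) ?n0 ?ltW//; apply/funext => x; rewrite subr0 fourierE.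
rewrite (eq_cI mu (g := fun=> (0 : R)%:C)) => [|y]; last by rewrite mul0r.
by rewrite cI_real /Rintegral integral0.
Qed.

Lemma PW_sqint U f : PW U f -> sqint mu f.
Proof. by case=> g /fourierL2P[]. Qed.

Lemma PW0 U : PW U (fun=> 0).
Proof. by exists (fun=> 0); [exact: fourierL2_0|apply: nearW]. Qed.

Lemma PW_lin U (a : R[i]) f g : PW U f -> PW U g -> PW U (fun x => a * f x + g x).
Proof.
move=> [f' ff' f0] [g' gg' g0]; exists (fun x => a * f' x + g' x); first exact: fourierL2_lin.
by apply: filterS2 f0 g0 => x h1 h2 Ux; rewrite h1// h2// mulr0 addr0.
Qed.

(** The transforms are Cauchy as well, so they converge to a representative of the transform of [f];
    convergence almost everywhere preserves the vanishing outside [U]. *)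
Lemma PW_closed U (F : nat -> V -> R[i]) f : (forall k, PW U (F k)) ->
  (forall k, (N2 mu (fun x => (F k.+1 x - F k x)%R) <= (16^-1 ^+ k)%:E)%E) ->
  cmeas f -> (forall k, (N2 mu (fun x => (F k x - f x)%R) <= (32 * 4^-1 ^+ k)%:E)%E) -> PW U f.
Proof.
move=> PF hF mf Ff.
have hk k : {g | fourierL2 (F k) g & \forall x \ae mu, ~ U x -> g x = 0} by exact: (cid2 (PF k)).
pose g k := s2val (hk k); have Fg k : fourierL2 (F k) (g k) := s2valP (hk k).
have g0 k : \forall x \ae mu, ~ U x -> g k x = 0 := s2valP' (hk k).
have sF k : sqint mu (F k) by exact: PW_sqint (PF k).
have sg k : sqint mu (g k) by have /fourierL2P[] := Fg k.
(* Halving the transforms compensates the factor 4 of [fourierL2_le], so that the increments meet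
   the rate 16^-k of [riesz_fischer]; [g'] undoes the halving. *)
pose a : R[i] := (2^-1)%:C.
pose G k x := a * g k x; have sG k : sqint mu (G k) by exact: sqintZ.
have N2a (h : V -> R[i]) : cmeas h -> N2 mu (fun x => a * h x) = ((4^-1)%:E * N2 mu h)%E.
  move=> mh; rewrite N2Z// normc_real ger0_norm//; congr (_%:E * _)%E; by field.
have hG k : (N2 mu (fun x => (G k.+1 x - G k x)%R) <= (16^-1 ^+ k)%:E)%E.
  have -> : (fun x => G k.+1 x - G k x) = fun x => a * (g k.+1 x - g k x).
    by apply/funext => x; rewrite mulrBr.
  have sB := sqintB (sg k.+1) (sg k); have sFB := sqintB (sF k.+1) (sF k).
  rewrite (N2a _ sB.1) (nrm2E sB) -EFinM lee_fin.
  have := fourierL2_le (fourierL2_lin (-1) (Fg k) (Fg k.+1)).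
  have -> : (fun x => -1 * F k x + F k.+1 x) = fun x => F k.+1 x - F k x.
    by apply/funext => x; rewrite mulN1r addrC.
  have -> : (fun x => -1 * g k x + g k.+1 x) = fun x => g k.+1 x - g k x.
    by apply/funext => x; rewrite mulN1r addrC.
  have := hF k; rewrite (nrm2E sFB) lee_fin; lra.
have [G' [mG' GG' aeG]] := riesz_fischer (fun k => (sG k).1) hG.
have sG' : sqint mu G'.
  split => //; have sd : sqint mu (fun x => G 0 x - G' x).
    split; last by apply: le_lt_trans (GG' 0%N) _; rewrite ltry.
    have -> : (fun x => G 0 x - G' x) = fun x => G 0 x + (-1) * G' x by apply/funext => x; rewrite mulN1r.
    by apply: cmeasD; [exact: (sG 0%N).1|apply: cmeasM => //; exact: cmeas_cst].
  by have [_] := sqintB (sG 0%N) sd; congr (_ < _)%E; congr N2; apply/funext => x; rewrite opprB addrC subrK.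
have sf : sqint mu f.
  split => //; have sd : sqint mu (fun x => F 0 x - f x).
    split; last by apply: le_lt_trans (Ff 0%N) _; rewrite ltry.
    have -> : (fun x => F 0 x - f x) = fun x => F 0 x + (-1) * f x by apply/funext => x; rewrite mulN1r.
    by apply: cmeasD; [exact: (sF 0%N).1|apply: cmeasM => //; exact: cmeas_cst].
  by have [_] := sqintB (sF 0%N) sd; congr (_ < _)%E; congr N2; apply/funext => x; rewrite opprB addrC subrK.
have a2 : (2%:C : R[i]) * a = 1 by rewrite /a -rmorphM/= mulfV.
pose g' x := (2%:C : R[i]) * G' x; have sg' : sqint mu g' by exact: sqintZ.
exists g'.
  apply/fourierL2P; split => // del del0.
  (* The error on the transform is at most twice del / 4 plus twice 128 4^-k, and 512 4^-k <= del
     makes this at most [del]. *)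
  have [k hk'] : exists k : nat, 512 * 4^-1 ^+ k <= del.
    have /cvgrPdist_le /(_ del del0) [N _ /(_ N (leqnn N))] := cvg_geom4 (512 : R).
    rewrite sub0r normrN => h; exists N; apply: le_trans h; exact: ler_norm.
  have /fourierL2P[_ _ hd] := Fg k; have d4 : 0 < del / 4 by exact: divr_gt0.
  have [F' [F1 F2 F3 F4]] := hd _ d4; exists F'; split => //.
    apply: (le_trans (nrm2_tri F2 (sF k) sf)).
    have := Ff k; rewrite (nrm2E (sqintB (sF k) sf)) lee_fin.
    have : 0 <= (4^-1 : R) ^+ k by exact: exprn_ge0.
    lra.
  apply: (le_trans (nrm2_tri (sqint_fourier F1 F2) (sg k) sg')).
  have : nrm2 mu (fun x => g k x - g' x) <= 128 * 4^-1 ^+ k.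
    rewrite -lee_fin -(nrm2E (sqintB (sg k) sg')).
    have -> : (fun x => g k x - g' x) = fun x => (2%:C : R[i]) * (G k x - G' x).
      by apply/funext => x; rewrite /g' mulrBr /G mulrA a2 mul1r.
    rewrite N2Z; last exact: (sqintB (sG k) sG').1.
    rewrite normc_real ger0_norm// (nrm2E (sqintB (sG k) sG')) -EFinM lee_fin.
    have := GG' k; rewrite (nrm2E (sqintB (sG k) sG')) lee_fin.
    have -> : (2 : R) ^+ 2 = 4 by ring.
    lra.
  lra.
have gall := ae_foralln g0.
apply: filterS2 aeG gall => x cx gx Ux.
have cG : (fun k => normc (G k x - 0)) @ \oo --> (0 : R).
  by under eq_fun do rewrite /G gx// mulr0 subrr Normc.normc0; exact: cvg_cst.
by rewrite /g' (normc_cvg_unique cx cG) mulr0.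
Qed.

End fourierL2_theory.

(** * Finite-rank approximation of Hilbert-Schmidt operators *)

Section hilbert_schmidt_operator.
Context (R : realType) (n : nat).
Local Notation V := 'rV[R]_n.
Local Notation mu := (lebesgue_rV R n).
Context (U : set V) (H : (V -> R[i]) -> V -> R[i]) (I : choiceType) (e : I -> V -> R[i]).
Hypothesis bH : bounded_PW_operator U H.
Hypothesis onb : PW_orthonormal_basis U e.
Hypothesis HS : (\esum_(i in [set: I]) (cLnorm 2%:E (H (e i)) ^+ 2) < +oo)%E.
Implicit Types (f g : V -> R[i]) (J A : seq I).

Lemma HS_e i : PW U (e i). Proof. by case: onb. Qed.

Lemma HS_He i : sqint mu (H (e i)).
Proof. by apply: (PW_sqint (U := U)); case: bH => -[h _ _] _; exact/h/HS_e. Qed.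

Lemma HS_orth i j : cdot mu (e i) (e j) = (i == j)%:R.
Proof. by case: onb => _ + _; apply. Qed.

Lemma HS_sum_le J : uniq J -> ((\sum_(i <- J) nrm2 mu (H (e i)))%:E <= \esum_(i in [set: I]) (cLnorm 2%:E (H (e i)) ^+ 2)%E)%E.
Proof.
move=> uJ; rewrite -sumEFin (eq_bigr (fun i => (cLnorm 2%:E (H (e i)) ^+ 2)%E)) => [|i _]; last first.
  by rewrite cLnorm2 -(nrm2E (HS_He i)).
apply: ereal_sup_ubound; exists [set` J]; first by split => //; exact: finite_seq.
by rewrite -fsbig_seq.
Qed.

Lemma H_bound : exists2 c : R, 0 <= c & forall f, PW U f -> nrm2 mu (H f) <= c * nrm2 mu f.
Proof.
have [[hP _ _] [c hc]] := bH; exists (c ^+ 2); first exact: sqr_ge0.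
move=> f Pf; have sf := PW_sqint Pf; have sH := PW_sqint (hP f Pf).
have fin g : sqint mu g -> exists2 r : R, 0 <= r & cLnorm 2%:E g = r%:E /\ nrm2 mu g = r ^+ 2.
  move=> sg; have /cLnorm2_lty go := sg.2; have g0 := cLnorm_ge0 2%:E g.
  have E : cLnorm 2%:E g = (fine (cLnorm 2%:E g))%:E by rewrite fineK// ge0_fin_numE.
  exists (fine (cLnorm 2%:E g)); first exact: fine_ge0.
  by split => //; rewrite /nrm2 -cLnorm2 E -EFin_expe.
have [r r0 [rE ->]] := fin f sf; have [s s0 [sE ->]] := fin _ sH.
have := hc f Pf; rewrite rE sE -EFinM lee_fin => h.
by rewrite -exprMn ler_pXn2r// nnegrE// (le_trans s0).
Qed.

Lemma H_lin (a : R[i]) f g : PW U f -> PW U g ->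
  \forall x \ae mu, H (fun y => a * f y + g y) x = a * H f x + H g x.
Proof. by case: bH => -[_ _ h] _; exact: h. Qed.

Lemma H_sum J (a : I -> R[i]) :
  \forall x \ae mu, H (fun y => \sum_(i <- J) a i * e i y) x = \sum_(i <- J) a i * H (e i) x.
Proof.
elim: J => [|i J IH].
  have -> : (fun y => \sum_(i <- [::]) a i * e i y) = fun y => (-1) * 0 + 0 :> R[i].
    by apply/funext => y; rewrite big_nil mulr0 addr0.
  apply: filterS (H_lin (-1) (PW0 U) (PW0 U)) => x ->; rewrite big_nil.
  by rewrite mulN1r addNr.
have -> : (fun y => \sum_(i <- i :: J) a i * e i y) = fun y => a i * e i y + \sum_(j <- J) a j * e j y.
  by apply/funext => y; rewrite big_cons.
have PS : PW U (fun x => \sum_(j <- J) a j * e j x).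
  exact: (P_sum (P := PW U) (PW0 U) (@PW_lin _ _ U) HS_e).
by apply: filterS2 (H_lin (a i) (HS_e i) PS) IH => x -> ->; rewrite big_cons.
Qed.

(** The squared Hilbert-Schmidt norm, as a real supremum over finite families. *)
Definition HS_total : R := sup [set \sum_(i <- J) nrm2 mu (H (e i)) | J in [set J | uniq J]].

Lemma HS_has_sup : has_sup [set \sum_(i <- J) nrm2 mu (H (e i)) | J in [set J | uniq J]].
Proof.
split; first by exists (\sum_(i <- [::]) nrm2 mu (H (e i))), [::].
exists (fine (\esum_(i in [set: I]) (cLnorm 2%:E (H (e i)) ^+ 2)%E)) => _ [J uJ <-].
rewrite -lee_fin fineK ?HS_sum_le// ge0_fin_numE//; apply: esum_ge0 => i _.
by rewrite cLnorm2 N2_ge0.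
Qed.

Lemma HS_total_ub J : uniq J -> \sum_(i <- J) nrm2 mu (H (e i)) <= HS_total.
Proof. by move=> uJ; apply: sup_upper_bound; [exact: HS_has_sup|exists J]. Qed.

(** Outside [A], Cauchy-Schwarz separates the coefficients of [f], controlled by Bessel, from the
    images of the basis, controlled by the tail of the Hilbert-Schmidt sum. The error depends on [f]
    through its norm only, hence is uniform over the wave packets. *)
Lemma HS_approx f A : PW U f -> uniq A ->
  nrm2 mu (fun x => H f x - \sum_(i <- A) cdot mu f (e i) * H (e i) x) <=
  2 * nrm2 mu f * (HS_total - \sum_(i <- A) nrm2 mu (H (e i))).
Proof.
move=> Pf uA; have [c c0 hc] := H_bound.
have [[hP _ _] _] := bH; have sHf := PW_sqint (hP f Pf); have sf := PW_sqint Pf.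
pose S J x := \sum_(i <- J) cdot mu f (e i) * H (e i) x.
have sS J : sqint mu (S J) by exact: (sqint_sum J _ HS_He).
apply/ler_addgt0Pr => del del0.
have d0 : 0 < del / (2 * (c + 1)) by rewrite divr_gt0// mulr_gt0// ltr_wpDl.
have [J uJ hJ] := oproj_approx (@PW_sqint _ _ U) (PW0 U) (@PW_lin _ _ U) (@PW_closed _ _ U) HS_e HS_orth
  (fun f Pf h => let: And3 _ _ hm := onb in hm f Pf h) Pf d0.
pose J' := undup (A ++ J).
have uJ' : uniq J' by exact: undup_uniq.
have JJ' : {subset J <= J'} by move=> i iJ; rewrite mem_undup mem_cat iJ orbT.
have AJ' : {subset A <= J'} by move=> i iJ; rewrite mem_undup mem_cat iJ.
have Pp : PW U (oproj mu e J' f) by exact: (P_sum (P := PW U) (PW0 U) (@PW_lin _ _ U) HS_e).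
have h1 : nrm2 mu (fun x => H f x - S J' x) <= c * (del / (2 * (c + 1))).
  have Pd : PW U (fun x => (-1) * oproj mu e J' f x + f x) by exact: PW_lin.
  have E : (fun x => (-1) * oproj mu e J' f x + f x) = fun x => f x - oproj mu e J' f x.
    by apply/funext => x; rewrite mulN1r addrC.
  have ae1 : \forall x \ae mu, H f x - S J' x = H (fun x => (-1) * oproj mu e J' f x + f x) x.
    apply: filterS2 (H_lin (-1) Pp Pf) (H_sum J' (fun i => cdot mu f (e i))) => x -> h2.
    by rewrite /S -h2 mulN1r addrC.
  rewrite {1}/nrm2 (eq_nrm2_ae ae1 (sqintB sHf (sS J')).1 (PW_sqint (hP _ Pd)).1).
  apply: (le_trans (hc _ Pd)); rewrite E ler_wpM2l//; exact: hJ.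
have h2 : nrm2 mu (fun x => S J' x - S A x) <= nrm2 mu f * (HS_total - \sum_(i <- A) nrm2 mu (H (e i))).
  have -> : (fun x => S J' x - S A x) = fun x => \sum_(i <- [seq i <- J' | i \notin A]) cdot mu f (e i) * H (e i) x.
    by apply/funext => x; rewrite /S (sum_subseq _ uA uJ' AJ') addrAC subrr add0r.
  apply: (le_trans (nrm2_sum_le _ _ HS_He)); apply: ler_pM.
  - by apply: sumr_ge0 => i _; exact: sqr_ge0.
  - by apply: sumr_ge0 => i _; exact: nrm2_ge0.
  - by apply: (bessel (@PW_sqint _ _ U) HS_e HS_orth) => //; exact: filter_uniq.
  - by rewrite lerBrDl -(sum_subseq _ uA uJ' AJ'); exact: HS_total_ub.
have h3 := nrm2_tri sHf (sS J') (sS A).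
have h4 : c * (del / (2 * (c + 1))) <= del / 2.
  rewrite mulrA ler_pdivrMr ?mulr_gt0 ?ltr_wpDl//.
  by rewrite (_ : del / 2 * (2 * (c + 1)) = c * del + del) ?lerDl ?ltW//; field.
rewrite -/(S A); lra.
Qed.

Lemma HS_near_sup (k : nat) : exists2 A, uniq A & HS_total - \sum_(i <- A) nrm2 mu (H (e i)) <= k.+1%:R^-1.
Proof.
have h : 0 < k.+1%:R^-1 :> R by [].
have [_ [A uA <-] hA] := sup_adherent h HS_has_sup; exists A => //.
have hA' : HS_total - k.+1%:R^-1 < \sum_(i <- A) nrm2 mu (H (e i)) := hA.
by rewrite lerBlDr -lerBlDl ltW.
Qed.

End hilbert_schmidt_operator.

(** * Wave packets *)

Section packets.
Context (R : realType) (n : nat) (r : R).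
Hypothesis r0 : 0 < r.
Local Notation V := 'rV[R]_n.
Local Notation mu := (lebesgue_rV R n).
Implicit Types (f g : V -> R[i]) (x y t : V).

Lemma sqint_bounded f (M : R) : cintble mu f -> (forall x, normc (f x) <= M) -> sqint mu f.
Proof.
move=> fi fM; have [mf nf] := (cintbleP mu f).1 fi; split => //.
have M0 : 0 <= M by apply: le_trans (normc_ge0 _) (fM 0).
apply: (@le_lt_trans _ _ (\int[mu]_x (M%:E * (normc (f x))%:E))%E).
  apply: ge0_le_integral => //.
  - by move=> x _; rewrite lee_fin sqr_ge0.
  - exact: cmeas_sqr.
  - by apply: measurable_funeM; exact: emeas_normc.
  - by move=> x _; rewrite -EFinM lee_fin expr2 ler_wpM2r// normc_ge0.
rewrite (@ge0_integralZl _ _ R mu setT measurableT _ (emeas_normc mf)) => [|x _|]; last 2 first.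
- by rewrite lee_fin normc_ge0.
- by rewrite lee_fin.
by rewrite lte_mul_pinfty// cintble_fin.
Qed.

Lemma eq_N2 f g : (forall x, normc (f x) = normc (g x)) -> N2 mu f = N2 mu g.
Proof. by move=> fg; apply: eq_integral => x _; rewrite fg. Qed.

Lemma tbump_box y : exists2 L, 0 <= L & box_supp (tbump r y) L.
Proof. by have [_] := test_csmooth (@test_tbump R n setT r y r0 (fun _ _ => I)). Qed.

Lemma cintble_tbump y : cintble mu (tbump r y).
Proof. by have [L L0 hL] := tbump_box y; exact: (cintble_csmooth L0 (csmooth_tbump y r0) hL). Qed.

Lemma kernDr x y t : kern x (y + t) = kern x y * kern x t.
Proof. by rewrite /kern dotvDr mulrDr opprD expiD. Qed.

Lemma fourier_tbump y x : fourier (tbump r y) x = kern x y * fourier (@cbump R n r) x.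
Proof.
have ci := cintble_csmooth (ltW r0) (@csmooth_cbump R n r) (@box_supp_cbump R n r).
have ck : cintble mu (fun z => cbump r z * kern x (z + y)).
  have := cintbleZ (kern x y) (cintble_kern x ci); congr cintble; apply/funext => z.
  by rewrite kernDr; ring.
have [_ E] := cI_shift (- y) ck.
rewrite !fourierE; transitivity (cI mu (fun z => cbump r z * kern x (z + y))).
  by rewrite -E; apply: eq_cI => z; rewrite subrK.
rewrite -(cIZ _ (cintble_kern x ci)); apply: eq_cI => z.
by rewrite kernDr; ring.
Qed.

Lemma normc_fourier_cbump x : normc (fourier (@cbump R n r) x) <= 1.
Proof.
have ci := cintble_csmooth (ltW r0) (@csmooth_cbump R n r) (@box_supp_cbump R n r).
rewrite -lee_fin (le_trans (normc_fourier x ci))//.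
rewrite (eq_integral (fun x => (bumpf r x)%:E)) ?integral_bumpf// => z _.
by rewrite normc_real ger0_norm// bumpf_ge0.
Qed.

(** The inverse transform of the bump at y. A Hankel operator sends it to a function whose transform
    at x is the symbol tested on the bump at x + y. Packets differ by a character, so they share
    modulus and norm. *)
Definition packet y : V -> R[i] := fun t => fourier (tbump r y) (- t).

Lemma normc_packet y t : normc (packet y t) = normc (fourier (@cbump R n r) (- t)).
Proof. by rewrite /packet fourier_tbump normcMl normc_kern mul1r. Qed.

Lemma cintble_packet y : cintble mu (packet y).
Proof.
have [L L0 hL] := tbump_box y.
exact: (cI_opp (cintble_fourier_csmooth L0 (csmooth_tbump y r0) hL)).1.
Qed.

Lemma sqint_packet y : sqint mu (packet y).
Proof.
apply: (sqint_bounded (cintble_packet y) (M := 1)) => t.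
by rewrite normc_packet normc_fourier_cbump.
Qed.

Lemma nrm2_packet y z : nrm2 mu (packet y) = nrm2 mu (packet z).
Proof.
have E : N2 mu (packet y) = N2 mu (packet z).
  apply: (@eq_N2 (packet y) (packet z)) => t.
  transitivity (normc (fourier (@cbump R n r) (- t))); first exact (normc_packet y t).
  symmetry; exact (normc_packet z t).
exact: (congr1 fine E).
Qed.

Lemma fourierL2_packet y : fourierL2 (packet y) (tbump r y).
Proof.
have [L L0 hL] := tbump_box y; have sh := csmooth_tbump y r0.
have ti := cintble_tbump y; have [M hM] := bounded_csmooth sh hL.
have st := sqint_bounded ti hM.
have E : fourier (packet y) = tbump r y.
  apply/funext => x; rewrite (inversion_csmooth L0 sh hL x) !fourierE.
  have i1 := cintble_kern (- x) (cintble_fourier_csmooth L0 sh hL).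
  have [_ <-] := cI_opp i1; apply: eq_cI => t.
  by rewrite /packet kernNl kernNr conjcK.
apply/fourierL2P; split => //; first exact: sqint_packet.
move=> del del0; exists (packet y).
have n0 (g : V -> R[i]) : nrm2 mu (fun x => g x - g x) = 0.
  by rewrite /nrm2 /N2 integral0_eq// => x _; rewrite subrr Normc.normc0 expr0n.
by split; rewrite ?E ?n0 ?ltW//; [exact: cintble_packet|exact: sqint_packet].
Qed.

Lemma PW_packet (U : set V) y : inset U r y -> PW U (packet y).
Proof.
move=> yU; exists (tbump r y); first exact: fourierL2_packet.
apply: nearW => x nUx; apply/eqP/negPn/negP => /(tbump_supp r0) hx; apply: nUx.
exact: inset_addbox hx.
Qed.

Definition packet_weight f t : R[i] := fourier (@cbump R n r) (- t) * conjc (f t).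

Lemma cintble_packet_weight f : sqint mu f -> cintble mu (packet_weight f).
Proof.
move=> sf; have E : packet_weight f = fun t => packet 0 t * conjc (f t).
  apply/funext => t; rewrite /packet /packet_weight fourier_tbump.
  by rewrite /kern dotv0r mulr0 oppr0 expi0 mul1r.
by rewrite E; exact: (cintble_cdot (sqint_packet 0) sf).
Qed.

(** As a function of y the coefficient is a Fourier transform, which lets Plancherel integrate it in
    y; [packet_weight f] is conj f times a factor of modulus at most 1. *)
Lemma cdot_packet f y : cdot mu (packet y) f = fourier (packet_weight f) (- y).
Proof.
rewrite fourierE; apply: eq_cI => t; rewrite /packet /packet_weight fourier_tbump.
have -> : kern (- t) y = kern (- y) t by rewrite /kern !dotvNl dotvC.
by rewrite -mulrA mulrC.
Qed.

Lemma cmeas_cdot_packet f : sqint mu f -> cmeas (fun y => cdot mu (packet y) f).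
Proof.
move=> sf; have := cmeas_fourier (cintble_packet_weight sf).
rewrite (_ : (fun y => _) = fun y => fourier (packet_weight f) (- y)); last first.
  by apply/funext => y; rewrite cdot_packet.
move=> [m1 m2]; have mo := @measurable_rVN R n.
by split; [exact: (measurableT_comp m1 mo)|exact: (measurableT_comp m2 mo)].
Qed.

(** The sum is, for every y, the product of the packet with one function, the combination of the
    [e i] with coefficients conj (a i). Its squared norm is the right-hand side, and Plancherel
    bounds the integral over y. *)
Lemma packet_sum_le (I : choiceType) (e : I -> V -> R[i]) (A : seq I) (a : I -> R[i]) :
  (forall i, sqint mu (e i)) -> (forall i j, cdot mu (e i) (e j) = (i == j)%:R) -> uniq A ->
  (N2 mu (fun y => (\sum_(i <- A) cdot mu (packet y) (e i) * a i)%R) <=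
    (\sum_(i <- A) normc (a i) ^+ 2)%:E)%E.
Proof.
move=> se oe uA.
pose F t := \sum_(i <- A) conjc (a i) * e i t.
have sF : sqint mu F by exact: sqint_sum.
have wi := cintble_packet_weight sF.
have E y : \sum_(i <- A) cdot mu (packet y) (e i) * a i = fourier (packet_weight F) (- y).
  rewrite -cdot_packet (cdotJ sF (sqint_packet y)) /F cdot_suml//; last exact: sqint_packet.
  rewrite rmorph_sum; apply: eq_bigr => i _.
  rewrite (cdotJ (se i) (sqint_packet y)) -[RHS]/(conjc (conjc (a i) * cdot mu (e i) (packet y))).
  by rewrite conjcM conjcK mulrC.
rewrite (_ : N2 mu _ = N2 mu (fourier (packet_weight F))); last first.
  rewrite /N2 -[RHS](integral_rVN (cmeas_sqr (cmeas_fourier wi))); last first.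
    by move=> y; rewrite lee_fin sqr_ge0.
  by apply: eq_integral => y _; rewrite E.
apply: (le_trans (N2_fourier wi)).
have <- : nrm2 mu F = \sum_(i <- A) normc (a i) ^+ 2.
  rewrite /F (nrm2_sum_e (P := fun f => sqint mu f))//.
  by apply: eq_bigr => i _; rewrite normc_conj.
rewrite -nrm2E//; apply: ge0_le_integral => //.
- by move=> y _; rewrite lee_fin sqr_ge0.
- by apply: cmeas_sqr; exact: (cintble_meas wi).
- by apply: cmeas_sqr; exact: sF.1.
move=> t _; rewrite lee_fin ler_pXn2r// ?nnegrE ?normc_ge0//.
by rewrite /packet_weight normcMl normc_conj ler_piMl ?normc_ge0// normc_fourier_cbump.
Qed.

End packets.

Section liminf.
Context (R : realType).

(** Removes an error of order 1 / (k + 1) pointwise, before Fatou's lemma is applied. *)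
Lemma le_limn_einf (q : \bar R) (a : nat -> \bar R) (c : R) :
  (forall k, (q <= a k + (c * k.+1%:R^-1)%:E)%E) -> (q <= limn_einf a)%E.
Proof.
move=> qa; apply/lee_addgt0Pr => e e0.
have [N hN] : exists N : nat, forall k, (N <= k)%N -> c * k.+1%:R^-1 <= e.
  have /cvgrPdist_le /(_ e e0) [N _ hN] := cvg_invnM c; exists N => k Nk.
  have := hN k Nk; rewrite sub0r normrN mulrC; apply: le_trans; exact: ler_norm.
rewrite -leeBlDr//; apply: (@le_trans _ _ (einfs a N)).
  apply: le_ereal_inf_tmp => _ [k Nk <-]; rewrite leeBlDr//; apply: (le_trans (qa k)).
  by rewrite leeD2l// lee_fin hN.
rewrite limn_einf_lim; apply: lime_ge; first exact: is_cvg_einfs.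
by exists N => // k Nk; exact: nondecreasing_einfs.
Qed.

End liminf.

(** * Dilates and insets of a convex set *)

Section dilation.
Context (R : realType) (n : nat).
Local Notation V := 'rV[R]_n.
Implicit Types (U K : set V) (x y z : V).

Lemma dilate2P U z : dilate2 U z <-> U (2^-1 *: z).
Proof.
split=> [[x Ux <-]|Uz]; first by rewrite scalerA mulVf// scale1r.
by exists (2^-1 *: z) => //; rewrite scalerA mulfV// scale1r.
Qed.

Lemma dilate2_add U x y : rVconvex U -> U x -> U y -> dilate2 U (x + y).
Proof.
move=> cU Ux Uy; apply/dilate2P; rewrite scalerDr.
have := cU x y 2^-1 Ux Uy; rewrite (_ : 1 - 2^-1 = 2^-1 :> R); last by field.
by apply; lra.
Qed.

Lemma open_dilate2 U : open U -> open (dilate2 U).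
Proof.
move=> oU; apply: rV_open => z /dilate2P Uz; have [d d0 hd] := rV_nbhs_ball oU Uz.
exists d => // y yd; apply/dilate2P; rewrite scalerDr; apply: hd => i.
rewrite mxE normrM ger0_norm//; apply: le_lt_trans (yd i).
by rewrite ler_piMl//; lra.
Qed.

Lemma rVconvex_dilate2 U : rVconvex U -> rVconvex (dilate2 U).
Proof.
move=> cU x y t /dilate2P Ux /dilate2P Uy t0 t1; apply/dilate2P.
have -> : 2^-1 *: (t *: x + (1 - t) *: y) = t *: (2^-1 *: x) + (1 - t) *: (2^-1 *: y).
  by rewrite scalerDr !scalerA mulrC [in X in _ + X]mulrC.
exact: cU.
Qed.

Lemma inset_sub U r : 0 < r -> inset U r `<=` U.
Proof.
move=> r0 z [r' rr' h]; rewrite -(addr0 z); apply: h => i; rewrite mxE normr0; exact: lt_trans rr'.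
Qed.

Lemma rVconvex_inset U r : rVconvex U -> rVconvex (inset U r).
Proof.
move=> cU x y t [r1 rr1 h1] [r2 rr2 h2] t0 t1.
exists (Num.min r1 r2); first by rewrite lt_min rr1.
move=> w wr; have -> : t *: x + (1 - t) *: y + w = t *: (x + w) + (1 - t) *: (y + w).
  by rewrite !scalerDr addrACA -scalerDl addrC (addrC t) subrK scale1r addrC.
by apply: cU => //; [apply: h1|apply: h2] => i; apply: lt_le_trans (wr i) _; rewrite ge_min lexx ?orbT.
Qed.

Lemma inset_add U r x y : rVconvex U -> U x -> inset U r y -> inset (dilate2 U) r (x + y).
Proof.
move=> cU Ux [r' rr' h]; exists r' => // w wr; rewrite -addrA; apply: dilate2_add => //; exact: h.
Qed.

Lemma noline_dilate2_inset U r : 0 < r -> ~ contains_affine_line U ->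
  ~ contains_affine_line (dilate2 (inset U r)).
Proof.
move=> r0 nl [p [v [v0 h]]]; apply: nl; exists (2^-1 *: p), v; split => // t.
have /dilate2P := h (2 * t); rewrite scalerDr scalerA mulrA mulVf// mul1r.
exact: inset_sub.
Qed.

(** The substitution y = (z + v) / 2 turns z + v and z - v in 2 K into y and z - y in [K]: the
    symmetrization of the Mahler type bound becomes the overlap that Fubini produces from a Hankel
    kernel. *)
Lemma integral_symm_ind K z : open K ->
  (\int[lebesgue_rV R n]_v (symm_ind (dilate2 K) z v)%:E =
    (2 ^+ n)%:E * \int[lebesgue_rV R n]_y (\1_K y * \1_K (z - y))%:E)%E.
Proof.
move=> oK; set mu := lebesgue_rV R n.
pose F (y : V) : \bar R := (\1_K y * \1_K (z - y))%:E.
have mK : measurable_fun setT (\1_K : V -> R) by apply: measurable_indic; exact: open_measurable_rV.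
have mF : measurable_fun setT F.
  apply/measurable_EFinP; apply: measurable_funM => //; apply: (measurableT_comp mK).
  apply: measurable_rVD; first exact: measurable_cst.
  exact: measurable_rVN.
have F0 y : (0 <= F y)%E by rewrite lee_fin mulr_ge0.
have mFs : measurable_fun setT (fun v : V => F (2^-1 *: v)).
  by apply: (measurableT_comp mF); exact: measurable_rV_scale.
have -> : (\int[mu]_v (symm_ind (dilate2 K) z v)%:E = \int[mu]_v F (2^-1 *: (v + z)))%E.
  apply: eq_integral => v _; rewrite /F /symm_ind; congr (_ * _)%:E.
    by rewrite !indicE addrC; congr (nat_of_bool _)%:R; apply/idP/idP; rewrite !inE => /dilate2P.
  have -> : z - 2^-1 *: (v + z) = 2^-1 *: (z - v).
    by apply/rowP => i; rewrite !mxE; field.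
  by rewrite !indicE; congr (nat_of_bool _)%:R; apply/idP/idP; rewrite !inE => /dilate2P.
rewrite (integral_shift z mFs (fun v => F0 _)).
have c0 : (2^-1 : R) != 0 by rewrite invr_eq0.
rewrite -(integral_scale c0 mF F0) muleA -EFinM -exprMn ger0_norm// mulfV// expr1n mul1e.
by [].
Qed.

End dilation.

Lemma slice_arith (R : realType) (N1 N2 B D k : R) : N1 <= 2 * N2 + 4 * B * D -> B * D <= B * k ->
  4 * N1 <= 8 * N2 + 16 * B * k.
Proof. by move=> h1 h2; lra. Qed.

(** * Bound of the symbol by the L^1 norm of the transform *)

Section hankel_bound.
Context (R : realType) (n : nat).
Local Notation V := 'rV[R]_n.
Local Notation mu := (lebesgue_rV R n).
Context (U : set V) (u : (V -> R[i]) -> R[i]) (H : (V -> R[i]) -> V -> R[i])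
  (I : choiceType) (e : I -> V -> R[i]).
Hypothesis oU : open U.
Hypothesis cU : rVconvex U.
Hypothesis du : distribution_on (dilate2 U) u.
Hypothesis hH : hankel_operator U u H.
Hypothesis bH : bounded_PW_operator U H.
Hypothesis onb : PW_orthonormal_basis U e.
Hypothesis HS : (\esum_(i in [set: I]) (cLnorm 2%:E (H (e i)) ^+ 2)%E < +oo)%E.
Let W := dilate2 U.
Let T := HS_total H e.
Implicit Types (r : R) (x y z : V).

(** For y in the inset, the squared L^2 norm over [U] of the transform of [H (packet r y)]. *)
Definition hankel_slice r y : \bar R :=
  (\int[mu]_x (\1_U x * normc (mollify W u r (x + y)) ^+ 2)%:E)%E.

Lemma measurable_hankel_kernel r : 0 < r ->
  measurable_fun setT (fun p : V * V => (\1_U p.2 * normc (mollify W u r (p.2 + p.1)) ^+ 2)%:E).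
Proof.
move=> r0; apply/measurable_EFinP; apply: measurable_funM.
  have mU : measurable_fun setT (\1_U : V -> R) by apply: measurable_indic; exact: open_measurable_rV.
  exact: (measurableT_comp mU measurable_snd).
have mm : measurable_fun setT (fun z => normc (mollify W u r z) ^+ 2).
  by apply: measurable_funX; apply: cmeas_normc; exact: cmeas_mollify.
apply: (measurableT_comp mm); apply: measurable_rVD; [exact: measurable_snd|exact: measurable_fst].
Qed.

Lemma hankel_kernel_ge0 r x y : (0 <= (\1_U x * normc (mollify W u r (x + y)) ^+ 2)%:E)%E.
Proof. by rewrite lee_fin mulr_ge0// sqr_ge0. Qed.

Lemma hankel_slice_le r y : 0 < r -> inset U r y -> (hankel_slice r y <= (4 * nrm2 mu (H (packet r y)))%:E)%E.
Proof.
move=> r0 yU; have ty := test_tbump r0 (inset_addbox yU).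
have [k Hk kE] := hH (fourierL2_packet r0 y) ty.
have /fourierL2P[_ sk _] := Hk.
apply: (@le_trans _ _ (N2 mu k)); last by rewrite (nrm2E sk) lee_fin; exact: fourierL2_le.
apply: ae_ge0_le_integral => //.
- by move=> x _; exact: hankel_kernel_ge0.
- have h := measurable_hankel_kernel r0.
  exact: (measurableT_comp h (measurable_pair1 y)).
- by move=> x _; rewrite lee_fin sqr_ge0.
- by apply: cmeas_sqr; exact: sk.1.
apply: filterS kE => x kx _; rewrite lee_fin indicE.
have [Ux|nUx] := pselect (U x); last by rewrite memNset// mul0r sqr_ge0.
rewrite mem_set// mul1r kx// mollifyE; last exact: inset_add.
rewrite (_ : (fun z => tbump r y (z - x)) = tbump r (x + y))//.
by apply/funext => z; rewrite /tbump opprD addrA.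
Qed.

Definition HS_partial (A : seq I) r y x : R[i] := \sum_(i <- A) cdot mu (packet r y) (e i) * H (e i) x.

Let sHe i : sqint mu (H (e i)). Proof. exact: (HS_He bH onb). Qed.
Let se i : sqint mu (e i). Proof. exact: (PW_sqint (HS_e onb i)). Qed.

Lemma sqint_HS_partial A r y : sqint mu (HS_partial A r y).
Proof. exact: sqint_sum. Qed.

Lemma nrm2_H_packet r y A : 0 < r -> inset U r y -> uniq A ->
  nrm2 mu (H (packet r y)) <= 2 * nrm2 mu (HS_partial A r y) +
    4 * nrm2 mu (packet r (0 : V)) * (T - \sum_(i <- A) nrm2 mu (H (e i))).
Proof.
move=> r0 yU uA; have Py := PW_packet r0 yU.
have sH : sqint mu (H (packet r y)) by case: bH => -[hP _ _] _; exact: (PW_sqint (hP _ Py)).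
have h := HS_approx bH onb HS Py uA; rewrite (nrm2_packet r0 y 0) in h.
have sS := sqint_HS_partial A r y.
have E : (fun x => HS_partial A r y x + (H (packet r y) x - HS_partial A r y x)) = H (packet r y).
  by apply/funext => x; rewrite addrC subrK.
have := nrm2D sS (sqintB sH sS); rewrite E.
have : nrm2 mu (fun x => H (packet r y) x - HS_partial A r y x) <= 2 * nrm2 mu (packet r (0 : V)) * (T - \sum_(i <- A) nrm2 mu (H (e i))) := h.
lra.
Qed.

Lemma cmeas_HS_partial A r : 0 < r -> cmeas (fun p : V * V => HS_partial A r p.1 p.2).
Proof.
move=> r0; apply: cmeas_sum => i; apply: cmeasM.
  have [m1 m2] := cmeas_cdot_packet r0 (se i).
  by split; [exact: (measurableT_comp m1 measurable_fst)|exact: (measurableT_comp m2 measurable_fst)].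
have [m1 m2] := (sHe i).1.
by split; [exact: (measurableT_comp m1 measurable_snd)|exact: (measurableT_comp m2 measurable_snd)].
Qed.

(** For fixed x the packet inequality applies with coefficients [H (e i) x]; integration in x leaves
    a partial Hilbert-Schmidt sum. *)
Lemma integral_HS_partial A r : 0 < r -> uniq A ->
  (\int[mu]_y N2 mu (HS_partial A r y) <= T%:E)%E.
Proof.
move=> r0 uA; have mS := cmeas_sqr (cmeas_HS_partial A r0).
rewrite (fubini_tonelli (m1 := mu) (m2 := mu) _ mS) => [|p]; last by rewrite lee_fin sqr_ge0.
apply: (@le_trans _ _ (\int[mu]_x (\sum_(i <- A) normc (H (e i) x) ^+ 2)%:E)%E).
  apply: ge0_le_integral => //.
  - by move=> x _; apply: integral_ge0 => y _; rewrite lee_fin sqr_ge0.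
  - by apply: (measurable_fun_fubini_tonelli_G (m1 := mu) _ mS) => p; rewrite lee_fin sqr_ge0.
  - apply/measurable_EFinP; apply: measurable_sum => i; apply: measurable_funX; apply: cmeas_normc; exact: (sHe i).1.
  - by move=> x _; exact: (packet_sum_le r0 (fun i => H (e i) x) se (HS_orth onb) uA).
under eq_integral do rewrite -sumEFin.
rewrite ge0_integral_sum//; last first.
- by move=> i x _; rewrite lee_fin sqr_ge0.
- by move=> i; apply: cmeas_sqr; exact: (sHe i).1.
rewrite (eq_bigr (fun i => (nrm2 mu (H (e i)))%:E)) => [|i _]; last by rewrite -(nrm2E (sHe i)).
by rewrite sumEFin lee_fin; exact: (HS_total_ub bH onb HS).
Qed.

(** Replacing H by a finite-rank operator leaves an error 16 B / (k + 1) that is uniform in y but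
    not integrable when the inset has infinite measure. It is removed pointwise through a lower
    limit, which Fatou's lemma exchanges with the integral. The factor 8 is 4 from [fourierL2_le]
    times 2 from [nrm2D]. *)
Theorem hankel_mollify_bound r : 0 < r ->
  (\int[mu]_y ((\1_(inset U r) y)%:E * hankel_slice r y) <= (8 * T)%:E)%E.
Proof.
move=> r0; have hA (k : nat) : {A | uniq A & T - \sum_(i <- A) nrm2 mu (H (e i)) <= k.+1%:R^-1}.
  by apply: cid2; exact: (HS_near_sup bH onb HS).
pose A k := s2val (hA k); have uA k : uniq (A k) := s2valP (hA k).
have TA k : T - \sum_(i <- A k) nrm2 mu (H (e i)) <= k.+1%:R^-1 := s2valP' (hA k).
pose B := nrm2 mu (packet r (0 : V)); have B0 : 0 <= B by exact: nrm2_ge0.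
pose q k y := (8%:E * N2 mu (HS_partial (A k) r y))%E.
have mN k : measurable_fun setT (fun y => N2 mu (HS_partial (A k) r y)).
  apply: (measurable_fun_fubini_tonelli_F (m2 := mu) _ (cmeas_sqr (cmeas_HS_partial (A k) r0))) => p.
  by rewrite lee_fin sqr_ge0.
have mq k : measurable_fun setT (q k) by apply: measurable_funeM.
have q0 k y : (0 <= q k y)%E by rewrite mule_ge0// N2_ge0.
apply: (@le_trans _ _ (\int[mu]_y limn_einf (q^~ y))%E).
  have msl : measurable_fun setT (hankel_slice r).
    apply: (measurable_fun_fubini_tonelli_F (m2 := mu) _ (measurable_hankel_kernel r0)) => p.
    exact: hankel_kernel_ge0.
  have s0 y : (0 <= hankel_slice r y)%E by apply: integral_ge0 => x _; exact: hankel_kernel_ge0.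
  apply: ge0_le_integral => //.
  - by move=> y _; rewrite mule_ge0// lee_fin.
  - apply: emeasurable_funM => //; apply/measurable_EFinP; apply: measurable_indic.
    by apply: open_measurable_rV; exact: open_inset.
  - rewrite (_ : (fun y => limn_einf _) = fun y => limn (einfs (q^~ y))); last first.
      by apply/funext => y; rewrite limn_einf_lim.
    apply: (emeasurable_fun_cvg (fun k y => einfs (q^~ y) k)) => [k|y _]; first exact: measurable_fun_einfs.
    exact: is_cvg_einfs.
  move=> y _; rewrite indicE; have [yU|nyU] := pselect (inset U r y); last first.
    rewrite memNset// mul0e; apply: (@le_limn_einf _ _ _ 0) => k; by rewrite mul0r adde0.
  rewrite mem_set// mul1e; apply: (@le_limn_einf _ _ _ (16 * B)) => k.
  apply: (le_trans (hankel_slice_le r0 yU)).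
  have sS := sqint_HS_partial (A k) r y.
  rewrite /q (nrm2E sS) -EFinM -EFinD lee_fin.
  have := nrm2_H_packet r0 yU (uA k); rewrite -/B => h.
  have h2 := ler_wpM2l B0 (TA k).
  exact: slice_arith h h2.
apply: (le_trans (fatou mu measurableT mq (fun k y _ => q0 k y))).
apply: limn_einf_le => k.
rewrite (@ge0_integralZl _ _ R mu setT measurableT _ (mN k)) => [|y _|]; last 2 first.
- exact: N2_ge0.
- by [].
rewrite EFinM lee_wpmul2l//; exact: integral_HS_partial.
Qed.

Hypothesis nlU : ~ contains_affine_line U.

(** With z = x + y, the double integral in x and y controls the squared regularized symbol against
    the overlap of the inset with its reflection z - y; the factor 2^n comes from the dilation. *)
Lemma mollify_symm_bound r : 0 < r ->
  (\int[mu]_z ((normc (mollify W u r z) ^+ 2)%:E * \int[mu]_v (symm_ind (dilate2 (inset U r)) z v)%:E)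
    <= (2 ^+ n * (8 * T))%:E)%E.
Proof.
move=> r0; set V0 := inset U r.
have mV : measurable_fun setT (\1_V0 : V -> R).
  by apply: measurable_indic; apply: open_measurable_rV; exact: open_inset.
have mP : measurable_fun setT (fun z => normc (mollify W u r z) ^+ 2).
  by apply: measurable_funX; apply: cmeas_normc; exact: cmeas_mollify.
have mo := @measurable_rVN R n.
pose G (p : V * V) : \bar R := (normc (mollify W u r p.1) ^+ 2 * (\1_V0 p.2 * \1_V0 (p.1 - p.2)))%:E.
have mG : measurable_fun setT G.
  apply/measurable_EFinP; apply: measurable_funM; first exact: (measurableT_comp mP measurable_fst).
  apply: measurable_funM; first exact: (measurableT_comp mV measurable_snd).
  apply: (measurableT_comp mV); apply: measurable_rVD; first exact: measurable_fst.
  exact: (measurableT_comp mo measurable_snd).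
have G0 p : (0 <= G p)%E by rewrite lee_fin; apply: mulr_ge0; [exact: sqr_ge0|exact: mulr_ge0].
have mz z : measurable_fun setT (fun y => (\1_V0 y * \1_V0 (z - y))%:E : \bar R).
  apply/measurable_EFinP; apply: measurable_funM => //; apply: (measurableT_comp mV).
  by apply: measurable_rVD => //; exact: measurable_cst.
have E1 : (\int[mu]_z ((normc (mollify W u r z) ^+ 2)%:E * \int[mu]_v (symm_ind (dilate2 V0) z v)%:E) =
    (2 ^+ n)%:E * \int[mu]_z \int[mu]_y G (z, y))%E.
  rewrite -(@ge0_integralZl _ _ R mu setT measurableT).
  - apply: eq_integral => z _; rewrite integral_symm_ind; last exact: open_inset.
    rewrite muleCA -(@ge0_integralZl _ _ R mu setT measurableT _ (mz z)) => [|y _|].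
    + by congr (_ * _)%E; apply: eq_integral => y _; rewrite /G/= EFinM.
    + by rewrite lee_fin mulr_ge0.
    + by rewrite lee_fin sqr_ge0.
  - exact: (measurable_fun_fubini_tonelli_F (m2 := mu) _ mG).
  - by move=> z _; apply: integral_ge0 => y _.
  - by rewrite lee_fin exprn_ge0.
rewrite E1 EFinM lee_wpmul2l ?lee_fin ?exprn_ge0//.
rewrite (fubini_tonelli (m1 := mu) (m2 := mu) _ mG G0).
have mG' := measurable_fun_fubini_tonelli_G (m1 := mu) _ mG G0.
have mK := measurable_hankel_kernel r0.
apply: le_trans (hankel_mollify_bound r0); apply: ge0_le_integral => //.
- by move=> y _; apply: integral_ge0.
- apply: emeasurable_funM; first exact/measurable_EFinP.
  by apply: (measurable_fun_fubini_tonelli_F (m2 := mu) _ mK) => p; exact: hankel_kernel_ge0.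
move=> y _.
have mGy : measurable_fun setT (fun z => G (z, y)) by exact: (measurableT_comp mG (measurable_pair2 y)).
rewrite -(integral_shift y mGy (fun z => G0 _)).
rewrite -(@ge0_integralZl _ _ R mu setT measurableT).
- apply: ge0_le_integral => //.
  + by apply: (measurableT_comp mGy); exact: measurable_rV_shift.
  + by apply: measurable_funeM; exact: (measurableT_comp mK (measurable_pair1 y)).
  move=> x _; rewrite /G/= addrK -EFinM lee_fin mulrCA ler_wpM2l//.
  rewrite mulrC ler_wpM2r ?sqr_ge0// !indicE.
  have [xV|nxV] := pselect (V0 x); last by rewrite (memNset nxV).
  by rewrite !mem_set//; exact: (inset_sub r0 xV).
- exact: (measurableT_comp mK (measurable_pair1 y)).
- by move=> x _; exact: hankel_kernel_ge0.
- by rewrite lee_fin.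
Qed.

Lemma csupport_dilate_inset h : test_function W h ->
  exists2 r1 : R, 0 < r1 & forall r, 0 < r -> r < r1 -> csupport h `<=` dilate2 (inset U r).
Proof.
move=> [_ _ cS SW]; have [d d0 hd] := compact_uniform_ball (open_dilate2 oU) cS SW.
exists (d / 2); first exact: divr_gt0.
move=> r r0 rd z Sz; apply/dilate2P; exists (d / 2) => // y yd.
have /dilate2P : W (z + 2 *: y).
  apply: hd => // i; rewrite mxE normrM ger0_norm//; have := yd i; rewrite ltr_pdivlMr//.
  by rewrite mulrC.
by rewrite scalerDr scalerA mulVf// scale1r.
Qed.

(** Cauchy-Schwarz with the root of q as weight, on the dilated inset: Carleman bounds the integral
    of |h|^2 q, and the Mahler type bound replaces q^-1 by a multiple of the overlap measure,
    against which the regularized symbol is already controlled. *)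
Lemma hankel_test_bound r h : 0 < r -> test_function W h -> csupport h `<=` dilate2 (inset U r) ->
  normc (cI mu (fun z => h z * mollify W u r z)) ^+ 2 <=
    fine (\int[mu]_x (normc (fourier h x))%:E) ^+ 2 * ((mahler_const R n)^-1 * (2 ^+ n * (8 * T))).
Proof.
move=> r0 th SK; set K := dilate2 (inset U r) in SK.
have [sh [L L0 hL]] := test_csmooth th; have [_ _ cS _] := th.
have oK : open K by apply: open_dilate2; exact: open_inset.
have cK : rVconvex K by apply: rVconvex_dilate2; exact: rVconvex_inset.
have nlK : ~ contains_affine_line K by exact: noline_dilate2_inset.
have hi := cintble_csmooth L0 sh hL; have fi := cintble_fourier_csmooth L0 sh hL.
have Fo := cintble_fin fi; set N1 := (\int[mu]_x _)%E in Fo *.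
have N10 : (0 <= N1)%E by apply: integral_ge0 => x _; rewrite lee_fin normc_ge0.
have N1E : N1 = (fine N1)%:E by rewrite fineK// ge0_fin_numE.
pose m := mahler_const R n; have m0 : 0 < m := mahler_const_gt0 R n.
pose kap z := fine (qdens K z).
have kapE z : K z -> qdens K z = (kap z)%:E.
  move=> Kz; rewrite /kap fineK// ge0_fin_numE; last by apply: integral_ge0 => x _; rewrite lee_fin qkern_ge0.
  have /integrableP[_] := qdens_fin oK Kz; apply: le_lt_trans; apply: ge0_le_integral => //.
  - by move=> x _; rewrite lee_fin qkern_ge0.
  - have /integrableP[mq _] := qdens_fin oK Kz; exact: mq.
  - have /integrableP[mq _] := qdens_fin oK Kz; exact: measurableT_comp.
  - by move=> x _; exact: lee_abs.
have mal z : K z -> (m%:E <= (kap z)%:E * \int[mu]_v (symm_ind K z v)%:E)%E.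
  by move=> Kz; rewrite -kapE//; exact: mahler_lower_bound.
have sy0 z : (0 <= \int[mu]_v (symm_ind K z v)%:E)%E.
  by apply: integral_ge0 => v _; rewrite lee_fin mulr_ge0.
have kap0 z : K z -> 0 < kap z.
  move=> Kz; rewrite lt_neqAle; apply/andP; split; last first.
    by rewrite fine_ge0//; apply: integral_ge0 => x _; rewrite lee_fin qkern_ge0.
  by apply/negP => /eqP k0; have := mal z Kz; rewrite -k0 mul0e lee_fin leNgt m0.
have mkap : measurable_fun setT kap by apply: (measurableT_comp _ (measurable_qdens K)) => //; exact: measurable_fine.
pose sq z := Num.sqrt (kap z).
have msq : measurable_fun setT sq.
  by apply: (measurableT_comp _ mkap); apply: continuous_measurable_fun; exact: sqrt_continuous.
have mK : measurable_fun setT (\1_K : V -> R) by apply: measurable_indic; exact: open_measurable_rV.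
have mPhi := cmeas_mollify (W := W) (u := u) du r0.
pose f z := h z * (sq z)%:C; pose g z := (\1_K z / sq z)%:C * mollify W u r z.
have mf : cmeas f by apply: cmeasM; [exact: cintble_meas hi|exact: cmeas_real].
have mg : cmeas g.
  apply: cmeasM => //; apply: cmeas_real; apply: measurable_funM => //.
  by apply: measurable_ge0_inv => // z; exact: sqrtr_ge0.
have -> : cI mu (fun z => h z * mollify W u r z) = cI mu (fun z => f z * g z).
  apply: eq_cI => z; rewrite /f /g; have [->|hz] := eqVneq (h z) 0; first by rewrite !mul0r.
  have Kz := SK _ (csupport_in hz).
  rewrite indicE mem_set// mul1r -mulrA; congr (_ * _); rewrite mulrA -rmorphM/= mulfV ?mul1r//.
  by rewrite gt_eqF// sqrtr_gt0 kap0.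
have b1 : (N2 mu f <= (fine N1 ^+ 2)%:E)%E.
  rewrite expr2 EFinM -N1E; apply: le_trans (carleman oK cS SK (@csupport_in _ _ h) hi fi (inversion_csmooth L0 sh hL) (bounded_csmooth sh hL)).
  apply: ge0_le_integral => //.
  - by move=> z _; rewrite lee_fin sqr_ge0.
  - exact: cmeas_sqr.
  - apply: emeasurable_funM; last exact: measurable_qdens.
    by apply: cmeas_sqr; exact: cintble_meas hi.
  move=> z _; rewrite /f; have [->|hz] := eqVneq (h z) 0; first by rewrite mul0r Normc.normc0 expr0n/= mul0e.
  have Kz := SK _ (csupport_in hz).
  rewrite kapE// -EFinM lee_fin normcMl normc_real exprMn real_normK ?num_real//.
  by rewrite sqr_sqrtr// ltW// kap0.
have b2 : (N2 mu g <= (m^-1 * (2 ^+ n * (8 * T)))%:E)%E.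
  have mi : (0 <= (m^-1)%:E)%E by rewrite lee_fin invr_ge0 ltW.
  have mS : measurable_fun setT (fun z => (normc (mollify W u r z) ^+ 2)%:E * \int[mu]_v (symm_ind K z v)%:E)%E.
    apply: emeasurable_funM; first exact: cmeas_sqr.
    apply: (measurable_fun_fubini_tonelli_F (m2 := mu) (fun p : V * V => (symm_ind K p.1 p.2)%:E)) => [|p].
      apply/measurable_EFinP; apply: measurable_funM; apply: (measurableT_comp mK).
        exact: measurable_rV_add.
      apply: measurable_rVD; first exact: measurable_fst.
      exact: (measurableT_comp (@measurable_rVN R n) measurable_snd).
    by rewrite lee_fin mulr_ge0.
  rewrite EFinM; apply: le_trans (lee_wpmul2l mi (mollify_symm_bound r0)).
  rewrite -(@ge0_integralZl _ _ R mu setT measurableT _ mS)//; last first.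
    by move=> z _; rewrite mule_ge0// lee_fin sqr_ge0.
  apply: ge0_le_integral => //.
  - by move=> z _; rewrite lee_fin sqr_ge0.
  - exact: cmeas_sqr.
  - exact: measurable_funeM.
  move=> z _; rewrite /g indicE; have [Kz|nKz] := pselect (K z); last first.
    by rewrite memNset// mul0r mul0r Normc.normc0 expr0n/= mule_ge0// mule_ge0// lee_fin sqr_ge0.
  rewrite mem_set// mul1r normcMl normc_real exprMn real_normK ?num_real//.
  rewrite exprVn sqr_sqrtr ?(ltW (kap0 z Kz))// muleCA mulrC EFinM.
  apply: lee_wpmul2l; first by rewrite lee_fin sqr_ge0.
  have k0 := kap0 z Kz.
  have ki : (0 <= (m^-1 * (kap z)^-1)%:E)%E by rewrite lee_fin mulr_ge0// invr_ge0 ltW.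
  have := lee_wpmul2l ki (mal z Kz); rewrite muleA -!EFinM.
  have -> : m^-1 * (kap z)^-1 * m = (kap z)^-1 by field; rewrite !gt_eqF.
  by have -> : m^-1 * (kap z)^-1 * kap z = m^-1 by field; rewrite !gt_eqF.
exact: normc_cI_sqr mf mg b1 b2.
Qed.

(** The bound on regularized symbols does not involve [r], so only the mollification error depends
    on it, and that error is made arbitrarily small. *)
Theorem hankel_symbol_bound : exists2 C : R, 0 <= C & forall h, test_function W h ->
  normc (u h) <= C * fine (\int[mu]_x (normc (fourier h x))%:E).
Proof.
have T0 : 0 <= T by have := HS_total_ub bH onb HS (isT : uniq [::]); rewrite big_nil.
pose B := (mahler_const R n)^-1 * (2 ^+ n * (8 * T)).
have B0 : 0 <= B by rewrite mulr_ge0 ?invr_ge0 ?(ltW (mahler_const_gt0 R n))// mulr_ge0 ?exprn_ge0 ?mulr_ge0.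
exists (Num.sqrt B); first exact: sqrtr_ge0.
move=> h th; set N1 := fine _.
have N10 : 0 <= N1 by rewrite fine_ge0//; apply: integral_ge0 => x _; rewrite lee_fin normc_ge0.
apply/ler_addgt0Pr => eta eta0.
have [e1 e10 he] := mollify_cvg (open_dilate2 oU) du th eta0.
have [r1 r10 hr] := csupport_dilate_inset th.
pose r := Num.min e1 r1 / 2.
have m0 : 0 < Num.min e1 r1 by rewrite lt_min e10.
have r0 : 0 < r by exact: divr_gt0.
have rm : r < Num.min e1 r1 by rewrite /r ltr_pdivrMr// ltr_pMr// ltr1n.
have [re rr] : r < e1 /\ r < r1 by move: rm; rewrite lt_min => /andP.
have [_ h1] := he r r0 re.
have h2 := hankel_test_bound r0 th (hr r r0 rr).
set v := cI mu _ in h1 h2.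
have h3 : normc v <= Num.sqrt B * N1.
  rewrite -(ler_pXn2r (n:=2)) ?nnegrE ?normc_ge0 ?mulr_ge0 ?sqrtr_ge0//.
  by apply: (le_trans h2); rewrite exprMn sqr_sqrtr// [leRHS]mulrC.
have -> : u h = v + (u h - v) by rewrite addrC subrK.
by rewrite (le_trans (ler_normcD _ _))// lerD.
Qed.

End hankel_bound.

(** * The dual of L^1 *)

Section L1_dual.
Context d (T : measurableType d) (R : realType) (mu : {sigma_finite_measure set T -> \bar R}).
Implicit Types (a b : T -> R) (A : set T).

Definition rintble a := mu.-integrable setT (EFin \o a).

Lemma rintble_meas a : rintble a -> measurable_fun setT a.
Proof. by move=> /measurable_int /measurable_EFinP. Qed.

Lemma rintble_lin (t : R) a b : rintble a -> rintble b -> rintble (fun x => t * a x + b x).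
Proof.
move=> ia ib; have := integrableD measurableT (integrableZl measurableT t ia) ib.
by apply: eq_integrable => // x _; rewrite /= EFinD EFinM.
Qed.

Lemma eq_RI a b : a =1 b -> \int[mu]_x a x = \int[mu]_x b x.
Proof. by move=> /funext ->. Qed.

Lemma rintble0 : rintble (fun=> 0).
Proof. exact: integrable0. Qed.

Lemma rintbleZ (t : R) a : rintble a -> rintble (fun x => t * a x).
Proof.
by move=> ia; have := rintble_lin t ia rintble0; congr rintble; apply/funext => x; rewrite addr0.
Qed.

Lemma rintbleN a : rintble a -> rintble (fun x => - a x).
Proof.
by move=> ia; have := rintbleZ (-1) ia; congr rintble; apply/funext => x; rewrite mulN1r.
Qed.

Lemma le_rintble a b : measurable_fun setT a -> rintble b -> (forall x, `|a x| <= b x) -> rintble a.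
Proof.
move=> ma ib ab; apply: (le_integrable measurableT _ _ ib); first exact/measurable_EFinP.
by move=> x _ /=; rewrite lee_fin (le_trans (ab x))// ler_norm.
Qed.

Lemma rintble_norm a : rintble a -> rintble (fun x => `|a x|).
Proof. by move=> /integrable_norm. Qed.

Definition L1_functional (G : (T -> R) -> R) (C : R) :=
  (forall (t : R) a b, rintble a -> rintble b -> G (fun x => t * a x + b x) = t * G a + G b) /\
  (forall a, rintble a -> `|G a| <= C * \int[mu]_x `|a x|).

Lemma L1_functional0 G C : L1_functional G C -> G (fun=> 0) = 0.
Proof.
move=> [Gl _]; have := Gl 1 _ _ rintble0 rintble0.
rewrite (_ : (fun x => _) = fun=> 0); last by apply/funext => x; rewrite mul1r addr0.
by rewrite mul1r => /eqP; rewrite -subr_eq0 opprD addrA subrr add0r oppr_eq0 => /eqP.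
Qed.

Lemma L1_functionalZ G C (t : R) a : L1_functional G C -> rintble a -> G (fun x => t * a x) = t * G a.
Proof.
move=> GC ia; have := GC.1 t _ _ ia rintble0; rewrite (L1_functional0 GC) addr0 => <-.
by congr G; apply/funext => x; rewrite addr0.
Qed.

Lemma L1_functional_sum G C (I : Type) (s : seq I) (h : I -> T -> R) : L1_functional G C ->
  (forall i, rintble (h i)) ->
  rintble (fun x => \sum_(i <- s) h i x) /\ G (fun x => \sum_(i <- s) h i x) = \sum_(i <- s) G (h i).
Proof.
move=> GC ih; elim: s => [|i s [IH1 IH2]].
  rewrite (_ : (fun x => _) = fun=> 0); last by apply/funext => x; rewrite big_nil.
  by rewrite big_nil; split; [exact: rintble0|exact: L1_functional0 GC].
rewrite (_ : (fun x => _) = fun x => 1 * h i x + \sum_(j <- s) h j x); last first.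
  by apply/funext => x; rewrite big_cons mul1r.
by split; [exact: rintble_lin|rewrite GC.1// IH2 big_cons mul1r].
Qed.

(** Dominated convergence for the functional. It yields both the sigma-additivity of the charge and
    the passage from simple functions to integrable ones. *)
Lemma L1_functional_cvg G C (a : nat -> T -> R) b g : L1_functional G C ->
  (forall k, measurable_fun setT (a k)) -> measurable_fun setT b -> rintble g ->
  (forall k x, `|a k x| <= g x) -> (forall x, (fun k => a k x) @ \oo --> b x) ->
  (fun k => G (a k)) @ \oo --> G b.
Proof.
move=> GC ma mb ig ag ab.
have bg x : `|b x| <= g x.
  have h : (fun k => `|a k x|) @ \oo --> `|b x| by apply: cvg_norm; exact: ab.
  by apply: (cvgr_to_le h); apply: nearW.
have ia k : rintble (a k) by exact: le_rintble (ma k) ig (ag k).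
have ib : rintble b by exact: le_rintble mb ig bg.
have idf k : rintble (fun x => (-1) * b x + a k x) by exact: rintble_lin.
have E k : G (a k) - G b = G (fun x => (-1) * b x + a k x) by rewrite GC.1// mulN1r addrC.
apply/subr_cvg0/norm_cvg0P; under eq_fun do rewrite E.
have C0 : 0 <= C * \int[mu]_x `|g x| by apply: le_trans (GC.2 _ ig).
apply: (squeeze0 (v := fun k => C * \int[mu]_x `|(-1) * b x + a k x|)) => [//|k|]; first exact: GC.2.
rewrite -[X in _ --> X](mulr0 C); apply: cvgMr.
have := @integral_normc_cvg0 _ T R mu (fun k x => ((-1) * b x + a k x)%:C) (fun x => (2 * g x)%:E).
move=> H; have /fine_cvg : (fun k => \int[mu]_x (normc (((-1) * b x + a k x)%:C : R[i]))%:E)%E @ \oo --> 0%E.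
  apply: H.
  - by move=> k; apply: cmeas_real; exact: rintble_meas (idf k).
  - move=> x; have h : (fun k => `|(-1) * b x + a k x|) @ \oo --> (0 : R).
      apply/norm_cvg0P; rewrite -[X in _ --> X](addNr (b x)).
      by apply: cvgD (ab x); rewrite mulN1r; exact: cvg_cst.
    by under eq_fun do rewrite normc_real.
  - have := integrableZl measurableT 2 ig; apply: eq_integrable => // x _; by rewrite /= EFinM.
  - move=> k x; rewrite normc_real lee_fin mulN1r (le_trans (ler_normD _ _))// normrN.
    by have := ag k x; have := bg x; lra.
rewrite (_ : (fun k => \int[mu]_x `|(-1) * b x + a k x|) =
  fine \o (fun k => \int[mu]_x (normc (((-1) * b x + a k x)%:C : R[i]))%:E)%E)//.
apply/funext => k /=; rewrite /Rintegral; congr fine; apply: eq_integral => x _.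
by rewrite normc_real.
Qed.

Context (w : T -> R).
Hypothesis w0 : forall x, 0 < w x.
Hypothesis iw : rintble w.

Lemma rintble_indic A a : measurable A -> rintble a -> rintble (fun x => \1_A x * a x).
Proof.
move=> mA ia; apply: le_rintble (rintble_norm ia) _.
  by apply: measurable_funM; [exact: measurable_indic|exact: rintble_meas].
by move=> x; rewrite normrM ler_piMl// ger0_norm// indicE; case: (_ \in _).
Qed.

(* Simple functions times [w] are dense in L^1. *)
Lemma L1_functional_eq0 G C : L1_functional G C ->
  (forall A, measurable A -> G (fun x => \1_A x * w x) = 0) -> forall a, rintble a -> G a = 0.
Proof.
move=> GC GA.
have pos a : rintble a -> (forall x, 0 <= a x) -> G a = 0.
  move=> ia a0; pose b x := (a x / w x)%:E.
  have mb : measurable_fun setT b.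
    apply/measurable_EFinP; apply: measurable_funM; first exact: rintble_meas.
    apply: measurable_ge0_inv; first by move=> x; exact: ltW.
    exact: rintble_meas.
  have b0 x : [set: T] x -> (0 <= b x)%E by move=> _; rewrite lee_fin divr_ge0// ltW.
  have [g [gm gb]] := approximation measurableT mb b0.
  have gle k x : g k x <= a x / w x.
    have /fine_cvg h := gb x I; apply: (cvgr_to_ge h); exists k => // j kj.
    by have /lefP/(_ x) := gm _ _ kj.
  have Gg k : G (fun x => g k x * w x) = 0.
    have E : (fun x => g k x * w x) = fun x => \sum_(y <- finmap.enum_fset (fset_set (range (g k)))) y * (\1_(g k @^-1` [set y]) x * w x).
      apply/funext => x; rewrite (fimfunE (g k) x) fsbig_finite//= mulr_suml.
      by apply: eq_bigr => y _; rewrite mulrA.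
    have iy (y : R) : rintble (fun x => \1_(g k @^-1` [set y]) x * w x) by exact: rintble_indic.
    have iy' (y : R) : rintble (fun x => y * (\1_(g k @^-1` [set y]) x * w x)).
      by have := rintble_lin y (iy y) rintble0; congr rintble; apply/funext => x; rewrite addr0.
    rewrite E (L1_functional_sum _ GC iy').2 big1// => y _.
    by rewrite (L1_functionalZ y GC (iy y)) GA ?mulr0.
  have cv : (fun k => G (fun x => g k x * w x)) @ \oo --> G a.
    apply: (L1_functional_cvg GC (g := a)) => //.
    - by move=> k; apply: measurable_funM => //; exact: rintble_meas.
    - exact: rintble_meas.
    - move=> k x; have gk : 0 <= g k x by [].
      rewrite ger0_norm ?mulr_ge0 ?(ltW (w0 x))//.
      by have := gle k x; rewrite ler_pdivlMr.
    - move=> x; have /fine_cvg h := gb x I.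
      rewrite -[X in _ --> X](divfK (lt0r_neq0 (w0 x)) (a x)).
      by apply: cvgMl; exact: h.
  by rewrite (funext Gg) in cv; apply: (cvg_unique _ cv) => //; exact: cvg_cst.
move=> a ia.
have ia1 : rintble (fun x => Num.max (a x) 0).
  apply: le_rintble (rintble_norm ia) _; first by apply: measurable_maxr => //; exact: rintble_meas.
  by move=> x; rewrite ger0_norm ?le_max ?lexx ?orbT// ge_max normr_ge0 ler_norm.
have ia2 : rintble (fun x => Num.max (- a x) 0).
  apply: le_rintble (rintble_norm ia) _.
    by apply: measurable_maxr => //; exact: rintble_meas (rintbleN ia).
  by move=> x; rewrite ger0_norm ?le_max ?lexx ?orbT// ge_max normr_ge0 -normrN ler_norm.
have -> : a = fun x => (-1) * Num.max (- a x) 0 + Num.max (a x) 0.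
  apply/funext => x; rewrite mulN1r; have [h|h] := leP 0 (a x).
    by rewrite (max_idPr _) ?oppr_le0// oppr0 add0r.
  by rewrite (max_idPl _) ?opprK ?addr0// oppr_ge0 ltW.
rewrite GC.1// !pos ?mulr0 ?addr0// => x; by rewrite le_max lexx orbT.
Qed.

Section density.
Context (G : (T -> R) -> R) (C : R).
Hypothesis GC : L1_functional G C.

(** Indicators of sets of infinite measure are not integrable; multiplied by the positive integrable
    weight [w] they are, so the charge is finite and Radon-Nikodym applies. The density of [G] is
    then phi / w. *)
Definition L1_charge A : \bar R := (G (fun x => \1_A x * w x))%:E.

Let L1_charge0 : L1_charge set0 = 0%E.
Proof.
rewrite /L1_charge (_ : (fun x => _) = fun=> 0) ?(L1_functional0 GC)//.
by apply/funext => x; rewrite indic0 mul0r.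
Qed.

Let L1_charge_fin A : measurable A -> L1_charge A \is a fin_num.
Proof. by []. Qed.

Let L1_charge_sigma : semi_sigma_additive L1_charge.
Proof.
move=> F mF tF mUF.
have iF k : rintble (fun x => \1_(F k) x * w x) by exact: rintble_indic.
have E k : (\sum_(0 <= i < k) L1_charge (F i))%E = (G (fun x => \sum_(0 <= i < k) \1_(F i) x * w x))%:E.
  by rewrite sumEFin (L1_functional_sum _ GC iF).2.
under eq_fun do rewrite E.
have ind01 A x : (\1_A x : R) <= 1 by rewrite indicE; case: (_ \in _).
have sumE k x : \sum_(0 <= i < k) \1_(F i) x * w x =
    (if `[< exists2 i, (i < k)%N & F i x >] then w x else 0).
  rewrite -mulr_suml; case: asboolP => [[i ik Fi]|nF]; last first.
    rewrite big_nat big1 ?mul0r// => i /andP[_ ik]; rewrite indicE memNset// => Fi; apply: nF; by exists i.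
  rewrite (bigD1_seq i) ?iota_uniq ?mem_index_iota//= indicE mem_set// big1 ?addr0 ?mul1r// => j ji.
  rewrite indicE memNset// => Fj; case/eqP: ji.
  by apply: (tF j i) => //; exists x.
apply: cvg_EFin; first exact: nearW.
apply: (L1_functional_cvg GC (g := w)) => //.
- by move=> k; exact: rintble_meas (L1_functional_sum _ GC iF).1.
- by apply: measurable_funM; [exact: measurable_indic|exact: rintble_meas].
- by move=> k x; rewrite sumE; case: asboolP => _; rewrite ?normr0 ?(ltW (w0 x))// ger0_norm// ltW.
- move=> x; apply: cvg_near_cst.
  have [[i _ Fi]|nF] := pselect ((\bigcup_i F i) x).
    exists i.+1 => // k /= ik; rewrite sumE; case: asboolP => [_|]; last by case; exists i.
    by rewrite indicE mem_set ?mul1r//; exists i.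
  exists 0%N => // k _ /=; rewrite sumE; case: asboolP => [[i ik Fi]|_]; first by case: nF; exists i.
  by rewrite indicE memNset// mul0r.
Qed.

HB.instance Definition _ := isCharge.Build _ _ _ L1_charge L1_charge0 L1_charge_fin L1_charge_sigma.

Lemma L1_charge_dominated : L1_charge `<< mu.
Proof.
apply/null_content_dominatesP => A mA A0; rewrite /L1_charge.
have h : \int[mu]_x `|\1_A x * w x| = 0.
  rewrite /Rintegral (_ : (\int[mu]_x _)%E = 0%E)//.
  rewrite (eq_integral (fun x => (\1_A x * w x)%:E)) => [|x _]; last first.
    by rewrite ger0_norm// mulr_ge0// ltW.
  have mAw : measurable_fun setT (fun x => (\1_A x * w x)%:E).
    by apply/measurable_EFinP; apply: rintble_meas; exact: rintble_indic.
  rewrite (ge0_ae_eq_integral (g := fun=> 0%E) measurableT mAw)//.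
  - by rewrite integral0.
  - by move=> x _; rewrite lee_fin mulr_ge0// ltW.
  exists A; split => // x /= /not_implyP[_ nx]; apply: contrapT => nAx; apply: nx.
  by rewrite indicE memNset// mul0r.
have := GC.2 _ (rintble_indic mA iw); rewrite h mulr0 normr_le0 => /eqP ->.
by [].
Qed.

Lemma L1_density : exists2 phi, rintble phi & forall A, measurable A ->
  G (fun x => \1_A x * w x) = \int[mu]_x (\1_A x * phi x).
Proof.
have dom := L1_charge_dominated.
pose phi := fine \o Radon_Nikodym L1_charge mu; have iphi : rintble phi.
  have := Radon_Nikodym_integrable dom; apply: eq_integrable => // x _ /=.
  by rewrite fineK// Radon_Nikodym_fin_num.
exists phi => // A mA; apply: EFin_inj; rewrite -[LHS]/(L1_charge A) (Radon_Nikodym_integral dom mA).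
rewrite EFin_Rintegral; last exact: rintble_indic.
rewrite [LHS]integral_mkcond; apply: eq_integral => x _; rewrite patchE indicE.
case: ifPn => xA; last by rewrite mul0r.
by rewrite mul1r /= fineK// Radon_Nikodym_fin_num.
Qed.

(** The hypothesis is tested on the set where the inequality fails, which is thereby null. *)
Lemma density_le (phi : T -> R) : rintble phi ->
  (forall A, measurable A -> \int[mu]_x (\1_A x * phi x) <= C * \int[mu]_x (\1_A x * w x)) ->
  \forall x \ae mu, phi x <= C * w x.
Proof.
move=> ip hp; pose d0 x := (- C) * w x + phi x.
have id0 : rintble d0 by exact: rintble_lin.
pose A := d0 @^-1` `]0, +oo[%classic.
have mA : measurable A.
  by rewrite -[A]setTI; apply: (rintble_meas id0) => //; exact: measurable_itv.
have ib : rintble (fun x => \1_A x * d0 x) by exact: rintble_indic.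
have b0 x : 0 <= \1_A x * d0 x.
  rewrite indicE; have [Ax|nAx] := pselect (A x); last by rewrite memNset// mul0r.
  by rewrite mem_set// mul1r ltW//; move: Ax; rewrite /A/= in_itv/= andbT.
have I0 : \int[mu]_x (\1_A x * d0 x) = 0.
  apply/le_anti; rewrite Rintegral_ge0// andbT.
  have -> : \int[mu]_x (\1_A x * d0 x) = \int[mu]_x (\1_A x * phi x) - C * \int[mu]_x (\1_A x * w x).
    rewrite -RintegralZl//; last exact: rintble_indic.
    have iCw : rintble (fun x => C * (\1_A x * w x)).
      have := rintble_lin C (rintble_indic mA iw) rintble0; congr rintble; apply/funext => x; by rewrite addr0.
    rewrite -RintegralB//; last exact: rintble_indic.
    by apply: eq_Rintegral => x _; rewrite /d0; ring.
  by rewrite subr_le0; exact: hp.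
have mb : measurable_fun setT (fun x => (\1_A x * d0 x)%:E) by apply/measurable_EFinP; exact: rintble_meas.
have E0 : (\int[mu]_x `|(\1_A x * d0 x)%:E| = 0)%E.
  under eq_integral do rewrite abse_EFin ger0_norm//.
  by rewrite -EFin_Rintegral// I0.
have [h _] := ae_eq_integral_abs mu measurableT mb.
apply: filterS (h E0) => x /(_ I) /= [] hx.
rewrite leNgt; apply/negP => lt; move: hx; rewrite indicE mem_set ?mul1r; last first.
  by rewrite /A/= in_itv/= andbT /d0; lra.
by rewrite /d0; lra.
Qed.

Theorem L1_dual : 0 <= C -> exists psi : T -> R, [/\ measurable_fun setT psi, forall x, `|psi x| <= C &
  forall a, rintble a -> G a = \int[mu]_x (psi x * a x)].
Proof.
move=> C0; have [phi ip hphi] := L1_density.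
have G_le A : measurable A -> `|\int[mu]_x (\1_A x * phi x)| <= C * \int[mu]_x (\1_A x * w x).
  move=> mA; rewrite -hphi//; have := GC.2 _ (rintble_indic mA iw).
  rewrite (eq_RI (b := fun x => \1_A x * w x)) => [//|x].
  by rewrite ger0_norm// mulr_ge0// ltW.
have ae1 : \forall x \ae mu, phi x <= C * w x.
  by apply: density_le => // A mA; apply: le_trans (ler_norm _) (G_le A mA).
have iphiN : rintble (fun x => - phi x).
  by have := rintble_lin (-1) ip rintble0; congr rintble; apply/funext => x; rewrite addr0 mulN1r.
have ae2 : \forall x \ae mu, - phi x <= C * w x.
  apply: density_le => // A mA; apply: le_trans (G_le A mA).
  rewrite (eq_RI (b := fun x => (-1) * (\1_A x * phi x))) => [|x]; last by ring.
  rewrite RintegralZl//; last exact: rintble_indic.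
  by rewrite mulN1r -normrN ler_norm.
(* Truncating phi / w to [-C, C] changes it on a null set only and makes the bound hold at every
   point. *)
pose psi x := Num.max (- C) (Num.min C (phi x / w x)).
have mpsi : measurable_fun setT psi.
  apply: measurable_maxr => //; apply: measurable_minr => //; apply: measurable_funM; first exact: rintble_meas.
  by apply: measurable_ge0_inv; [move=> x; exact: ltW|exact: rintble_meas].
have psiC x : `|psi x| <= C.
  by rewrite ler_norml /psi le_max lexx/= ge_max ge_min lexx/= andbT; lra.
have aepsi : \forall x \ae mu, psi x * w x = phi x.
  apply: filterS2 ae1 ae2 => x h1 h2; rewrite /psi (min_idPr _) ?ler_pdivrMr//.
  by rewrite (max_idPr _) ?divfK ?gt_eqF// ler_pdivlMr// mulNr lerNl.
have ipsi a : rintble a -> rintble (fun x => psi x * a x).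
  move=> ia; have ib : rintble (fun x => C * `|a x|).
    have := rintble_lin C (rintble_norm ia) rintble0; congr rintble; apply/funext => x; by rewrite addr0.
  apply: le_rintble ib _; first by apply: measurable_funM => //; exact: rintble_meas.
  by move=> x; rewrite normrM ler_wpM2r.
exists psi; split => // a ia; apply/eqP; rewrite -subr_eq0; apply/eqP.
(* The difference of the two functionals is again bounded on L^1 and vanishes on indicators times
   [w], hence everywhere. *)
pose K b := G b - \int[mu]_x (psi x * b x).
have KC : L1_functional K (C + C).
  split=> [t b c ib ic|b ib].
    rewrite /K GC.1// (eq_RI (b := fun x => t * (psi x * b x) + psi x * c x)) => [|x]; last by ring.
    have itb : rintble (fun x => t * (psi x * b x)).
      have := rintble_lin t (ipsi b ib) rintble0; congr rintble; apply/funext => x; by rewrite addr0.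
    by rewrite RintegralD ?RintegralZl//; [ring|exact: ipsi|exact: ipsi].
  rewrite /K mulrDl (le_trans (ler_normB _ _))// lerD ?GC.2//.
  rewrite (le_trans (le_normr_Rintegral measurableT (ipsi b ib)))//.
  rewrite -RintegralZl//; last exact: rintble_norm.
  apply: le_Rintegral => //; first exact: rintble_norm (ipsi b ib).
    have := rintble_lin C (rintble_norm ib) rintble0; congr rintble; apply/funext => x; by rewrite addr0.
  by move=> x _; rewrite normrM ler_wpM2r.
apply: (L1_functional_eq0 KC _ ia) => A mA; rewrite /K hphi//; apply/eqP; rewrite subr_eq0; apply/eqP.
apply: EFin_inj; rewrite !EFin_Rintegral; [|exact: (ipsi _ (rintble_indic mA iw))|exact: rintble_indic].
apply: ae_eq_integral => //.
- by apply/measurable_EFinP; apply: rintble_meas; exact: rintble_indic.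
- by apply/measurable_EFinP; apply: rintble_meas; exact: (ipsi _ (rintble_indic mA iw)).
by apply: filterS aepsi => x <- _; congr EFin; ring.
Qed.

End density.
End L1_dual.

Lemma fourier0 (R : realType) n : fourier (fun _ : 'rV[R]_n => 0) = fun=> 0.
Proof.
apply/funext => x; rewrite fourierE (eq_cI _ (g := fun=> (0 : R)%:C)) => [|y]; last by rewrite mul0r.
by rewrite cI_real /Rintegral integral0.
Qed.

Lemma complex_ReIm (R : realType) (c : R[i]) : 1%:C * (Re c)%:C + 'i%C * (Im c)%:C = c.
Proof. by case: c => p q; apply: complex_ext; rewrite ?cReD ?cImD ?cReM ?cImM/=; ring. Qed.

(** * From a bound on test functions to a bounded symbol *)

Section complex_L1_dual.
Context (R : realType) (n : nat).
Local Notation V := 'rV[R]_n.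
Local Notation mu := (lebesgue_rV R n).
Context (W : set V) (u : (V -> R[i]) -> R[i]) (C : R).
Hypothesis du : distribution_on W u.
Hypothesis C0 : 0 <= C.
Hypothesis uC : forall h, test_function W h ->
  normc (u h) <= C * fine (\int[mu]_x (normc (fourier h x))%:E).

(* C-valued functions as a real vector space. *)
Let E : lmodType R := ((V -> R^o) * (V -> R^o))%type.
Let toC (q : E) (x : V) : R[i] := (q.1 x) +i* (q.2 x).
Let N1 (h : V -> R[i]) : R := fine (\int[mu]_x (normc (h x))%:E).

Let toC_lin (t : R) (q q' : E) : toC (t *: q + q') = fun x => t%:C * toC q x + toC q' x.
Proof.
by apply/funext => x; apply: complex_ext; rewrite ?cReD ?cImD ?cReM ?cImM/= ?mul0r ?subr0 ?addr0.
Qed.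

Let toCD (q q' : E) : toC (q + q') = fun x => toC q x + toC q' x.
Proof. by rewrite -[q in LHS]scale1r toC_lin; apply/funext => x; rewrite mul1r. Qed.

Let toCZ (t : R) (q : E) : toC (t *: q) = fun x => t%:C * toC q x.
Proof. by rewrite -[_ *: _]addr0 toC_lin; apply/funext => x; rewrite -[RHS]addr0. Qed.

Lemma N1E h : cintble mu h -> (\int[mu]_x (normc (h x))%:E)%E = (N1 h)%:E.
Proof.
move=> hi; rewrite fineK// ge0_fin_numE ?cintble_fin//; apply: integral_ge0 => x _.
by rewrite lee_fin normc_ge0.
Qed.

Lemma N1D h k : cintble mu h -> cintble mu k -> N1 (fun x => h x + k x) <= N1 h + N1 k.
Proof.
move=> hi ki; have mh := emeas_normc (cintble_meas hi); have mk := emeas_normc (cintble_meas ki).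
rewrite -lee_fin EFinD -!N1E//; last exact: cintbleD.
rewrite -ge0_integralD//; [|by move=> x _; rewrite lee_fin normc_ge0..].
apply: ge0_le_integral => //.
- by move=> x _; rewrite lee_fin normc_ge0.
- by apply: emeas_normc; exact: (cintble_meas (cintbleD hi ki)).
- exact: emeasurable_funD.
- by move=> x _; rewrite -EFinD lee_fin ler_normcD.
Qed.

Lemma N1Z (t : R) h : cintble mu h -> N1 (fun x => t%:C * h x) = `|t| * N1 h.
Proof.
move=> hi; apply: EFin_inj; rewrite EFinM -!N1E//; last exact: cintbleZ.
rewrite -ge0_integralZl//; last 2 first.
- by apply: emeas_normc; exact: cintble_meas hi.
- by move=> x _; rewrite lee_fin normc_ge0.
by apply: eq_integral => x _; rewrite normcMl normc_real EFinM.
Qed.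

Lemma cintble_fourier_test h : test_function W h -> cintble mu h /\ cintble mu (fourier h) /\
  forall z, h z = fourier (fourier h) (- z).
Proof.
move=> th; have [sh [L L0 hL]] := test_csmooth th.
by split; [|split]; [exact: cintble_csmooth L0 sh hL|exact: cintble_fourier_csmooth L0 sh hL|exact: inversion_csmooth L0 sh hL].
Qed.

Let D : set E := [set q | cintble mu (toC q)].
Let F : set E := [set q | exists2 h, test_function W h & toC q = fourier h].
(** Inversion recovers a test function from its transform, which makes the real part of [u] a
    functional on transforms. *)
Let f (q : E) : R := Re (u (fun z => fourier (toC q) (- z))).
Let p (q : E) : R := C * N1 (toC q).

Let f_test q h : test_function W h -> toC q = fourier h -> f q = Re (u h).
Proof.
move=> th qh; have [_ [_ inv]] := cintble_fourier_test th.
by rewrite /f qh; congr (Re (u _)); apply/funext => z; rewrite -inv.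
Qed.

Let F_lin (t : R) q q' : F q -> F q' -> F (t *: q + q') /\ f (t *: q + q') = t * f q + f q'.
Proof.
move=> [h th qh] [k tk qk].
have [hi _] := cintble_fourier_test th; have [ki _] := cintble_fourier_test tk.
have E1 : toC (t *: q + q') = fourier (fun x => t%:C * h x + k x).
  by rewrite toC_lin qh qk fourier_lin.
have tl := test_lin t%:C th tk.
split; first by exists (fun x => t%:C * h x + k x).
rewrite (f_test tl E1) (f_test th qh) (f_test tk qk) du.1//.
by rewrite cReD cReM/= mul0r subr0.
Qed.

Lemma complex_hahn_banach : exists g : E -> R,
  [/\ forall q, F q -> g q = f q, forall q, D q -> g q <= p q &
      forall (t : R) x y, D x -> D y -> g (t *: x + y) = t * g x + g y].
Proof.
apply: (@hahn_banach R E D F p f).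
- have := cintbleZ 0 (@cintble_gam R n); congr cintble; apply/funext => x; rewrite mul0r.
  by apply: complex_ext.
- by move=> t x y Dx Dy; rewrite /D/= toC_lin; apply: cintbleD => //; exact: cintbleZ.
- by move=> x y Dx Dy; rewrite /p toCD -mulrDr ler_wpM2l//; exact: N1D.
- by move=> t x t0 Dx; rewrite /p toCZ N1Z// ger0_norm ?(ltW t0)// mulrCA.
- by move=> q [h th qh]; rewrite /D/= qh; have [_ []] := cintble_fourier_test th.
- have t0 : test_function W (fun _ : V => 0 : R[i]) by exact: test0.
  by exists (fun=> 0) => //; rewrite fourier0; apply/funext => x; apply: complex_ext.
- by move=> t x y Fx Fy; have [] := F_lin t Fx Fy.
- by move=> t x y Fx Fy; have [] := F_lin t Fx Fy.
- move=> q [h th qh]; rewrite (f_test th qh) /p qh.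
  apply: (le_trans _ (uC th)); apply: le_trans (ler_Re_normc _); exact: ler_norm.
Qed.

(** Restricting the real-linear extension to real and to purely imaginary functions gives two real
    functionals on L^1 and two densities bounded by [C], whence C + C. Complex linearity of [u] then
    carries the identity from real parts to imaginary parts. *)
Theorem bounded_symbol : exists psi : V -> R[i],
  [/\ cmeas psi, forall x, normc (psi x) <= C + C &
    forall h, test_function W h -> u h = cI mu (fun x => psi x * fourier h x)].
Proof.
have [g [gf gp gl]] := complex_hahn_banach.
pose i1 (a : V -> R) : E := (a, fun=> 0); pose i2 (a : V -> R) : E := (fun=> 0, a).
have i1E (a : V -> R) : toC (i1 a) = fun x => (a x)%:C by [].
have i2E (a : V -> R) : toC (i2 a) = fun x => 'i%C * (a x)%:C.
  by apply/funext => x; apply: complex_ext; rewrite ?cReM ?cImM/= ?mul0r ?mul1r ?mulr0 ?subr0 ?add0r.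
have rc (a : V -> R) : rintble mu a -> cintble mu (fun x => (a x)%:C).
  by move=> ia; split => //=; exact: rintble0.
have D1 (a : V -> R) : rintble mu a -> D (i1 a) by move=> ia; rewrite /D/= i1E; exact: rc.
have D2 (a : V -> R) : rintble mu a -> D (i2 a) by move=> ia; rewrite /D/= i2E; apply: cintbleZ; exact: rc.
have g_abs q : D q -> `|g q| <= p q.
  move=> Dq; rewrite ler_norml gp// andbT lerNl.
  have D00 : D 0 by have := D1 _ (rintble0 mu).
  have g0 : g 0 = 0.
    have := gl 1 0 0 D00 D00; rewrite scaler0 addr0 mul1r => /eqP.
    by rewrite -subr_eq0 opprD addrA subrr add0r oppr_eq0 => /eqP.
  have -> : - g q = g (- q) by have := gl (-1) q 0 Dq D00; rewrite scaleN1r addr0 g0 addr0 mulN1r.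
  have E1 : toC (- q) = fun x => (-1)%:C * toC q x by rewrite -scaleN1r toCZ.
  have Dn : D (- q) by rewrite /D/= E1; exact: cintbleZ.
  by apply: (le_trans (gp _ Dn)); rewrite /p E1 N1Z// normrN1 mul1r.
have N1real (a : V -> R) (c : R[i]) : normc c = 1 -> N1 (fun x => c * (a x)%:C) = \int[mu]_x `|a x|.
  move=> c1; rewrite /N1 /Rintegral; congr fine; apply: eq_integral => x _.
  by rewrite normcMl c1 mul1r normc_real.
have F1 : L1_functional mu (fun a => g (i1 a)) C.
  split=> [t a b ia ib|a ia].
    rewrite -gl; [|exact: D1|exact: D1]; congr g; congr pair; apply/funext => x.
    by rewrite -[RHS]/(t * 0 + 0) mulr0 addr0.
  apply: (le_trans (g_abs _ (D1 _ ia))); rewrite /p i1E.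
  have -> : (fun x => (a x)%:C) = fun x => 1 * (a x)%:C by apply/funext => x; rewrite mul1r.
  by rewrite N1real// (normc_real (1 : R)) normr1.
have F2 : L1_functional mu (fun a => g (i2 a)) C.
  split=> [t a b ia ib|a ia].
    rewrite -gl; [|exact: D2|exact: D2]; congr g; congr pair; apply/funext => x.
    by rewrite -[RHS]/(t * 0 + 0) mulr0 addr0.
  apply: (le_trans (g_abs _ (D2 _ ia))); rewrite /p i2E -(N1real a 'i%C)//.
  by rewrite -[LHS]/(Num.sqrt ((0 : R) ^+ 2 + 1 ^+ 2)) expr0n expr1n add0r sqrtr1.
have w0 := @gam_gt0 R n; have iw : rintble mu (@gam R n) by exact: integrable_gam.
have [psi1 [m1 b1 h1]] := L1_dual w0 iw F1 C0.
have [psi2 [m2 b2 h2]] := L1_dual w0 iw F2 C0.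
(* The sign makes Re (psi v) equal to psi1 Re v + psi2 Im v. *)
pose psi x : R[i] := (psi1 x) +i* (- psi2 x).
have mpsi : cmeas psi.
  split => //=; rewrite (_ : (fun x => - psi2 x) = fun x => (-1) * psi2 x).
    by apply: measurable_funM => //; exact: measurable_cst.
  by apply/funext => x; rewrite mulN1r.
have bpsi x : normc (psi x) <= C + C.
  by apply: (le_trans (normc_le_ReIm _)); rewrite lerD//= normrN.
have key h : test_function W h -> Re (u h) = Re (cI mu (fun x => psi x * fourier h x)).
  move=> th; have [hi [fi inv]] := cintble_fourier_test th.
  pose a x := Re (fourier h x); pose b x := Im (fourier h x).
  have ia : rintble mu a := fi.1; have ib : rintble mu b := fi.2.
  have qE : toC (1 *: i1 a + i2 b) = fourier h.
    rewrite toC_lin i1E i2E; apply/funext => x; exact: complex_ReIm.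
  have Fq : F (1 *: i1 a + i2 b) by exists h.
  rewrite -(f_test th qE) -gf// gl; [|exact: D1|exact: D2].
  have H1 : g (i1 a) = \int[mu]_x (psi1 x * a x) := h1 a ia.
  have H2 : g (i2 b) = \int[mu]_x (psi2 x * b x) := h2 b ib.
  rewrite mul1r H1 H2 -[RHS]/(\int[mu]_x Re (psi x * fourier h x)).
  have int_psi (q a' : V -> R) : measurable_fun setT q -> (forall x, `|q x| <= C) -> rintble mu a' ->
      rintble mu (fun x => q x * a' x).
    move=> mq bq ia'; apply: le_rintble (rintbleZ C (rintble_norm ia')) _.
      exact: measurable_funM mq (rintble_meas ia').
    by move=> x; rewrite normrM ler_wpM2r.
  rewrite -RintegralD//; [|exact: int_psi|exact: int_psi].
  by apply: eq_RI => x; rewrite cReM -[Re (psi x)]/(psi1 x) -[Im (psi x)]/(- psi2 x) mulNr opprK.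
exists psi; split => // h th; apply: complex_ext; first exact: key.
have [hi [fi _]] := cintble_fourier_test th.
have t0 := @test0 R n W.
(* The real part of the identity at - i h is its imaginary part at h; the summand 0 only gives the
   function the shape required by linearity. *)
have tih := test_lin (- 'i%C) th t0.
have z1 : u (fun x => - 'i%C * h x + 0) = - 'i%C * u h by rewrite du.1// (dist0 du) addr0.
have z2 : fourier (fun x => - 'i%C * h x + 0) = fun x => - 'i%C * fourier h x.
  have i0 : cintble mu (fun _ : V => 0) by apply/cintbleP; split; [exact: cmeas_cst|under eq_fun do rewrite Normc.normc0; exact: integrable0].
  by rewrite (fourier_lin (- 'i%C) hi i0) fourier0; apply/funext => x; rewrite addr0.
have := key _ tih; rewrite z1 z2.
have pfi : cintble mu (fun x => psi x * fourier h x) by exact: (cintbleMb fi mpsi bpsi).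
have -> : cI mu (fun x => psi x * (- 'i%C * fourier h x)) = - 'i%C * cI mu (fun x => psi x * fourier h x).
  by rewrite -(cIZ _ pfi); apply: eq_cI => x; rewrite mulrCA.
by rewrite !cReM/= oppr0 !mul0r !sub0r !mulN1r !opprK.
Qed.

End complex_L1_dual.

(** * Return to the Hankel operator *)

Section conclusion.
Context (R : realType) (n : nat).
Local Notation V := 'rV[R]_n.
Local Notation mu := (lebesgue_rV R n).
Implicit Types (U : set V) (h g : V -> R[i]) (x z : V).

Lemma Lp_pinfty h (M : R) : cmeas h -> (forall x, normc (h x) <= M) -> Lp +oo%E h.
Proof.
move=> mh hM; split => //; rewrite /cLnorm unlock; case: ifP => _; last exact: ltry.
apply: (@le_lt_trans _ _ M%:E); last exact: ltry.
apply/ess_supP; apply: nearW => x /=.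
by rewrite lee_fin ger0_norm ?normc_ge0.
Qed.

(** The support is translated by a point of [U], and U + U lies in 2 U by convexity. The identity of
    the two distributions thus applies to every pairing in the definition of the operator. *)
Lemma test_shift U g x : rVconvex U -> U x -> test_function U g ->
  test_function (dilate2 U) (fun z => g (z - x)).
Proof.
move=> cU Ux tg; have [sg _] := test_csmooth tg; have [_ _ cS SU] := tg.
pose K : set V := [set z | csupport g (z - x)].
apply: (@test_intro _ _ _ _ K).
- exact: csmooth_shift.
- have [L L0 SL] := compact_box_bound cS.
  apply: (@subclosed_compact _ _ (box (L + \sum_i `|x ord0 i|))).
  + rewrite -(setCK K); apply: open_closedC; apply: rV_open => z nz.
    have oS : open (~` csupport g) by apply: closed_openC; exact: closed_closure.
    have nz' : (~` csupport g) (z - x) := nz.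
    have [d d0 hd] := rV_nbhs_ball oS nz'; exists d; [exact: d0|move=> y yd].
    have h : (~` csupport g) (z - x + y) := hd y yd.
    by rewrite addrAC in h; exact: h.
  + exact: compact_box.
  + move=> z /SL zL i; have := zL i; rewrite !mxE => h.
    rewrite -(subrK (x ord0 i) (z ord0 i)) (le_trans (ler_normD _ _))// lerD//.
    by rewrite (bigD1 i)//= lerDl sumr_ge0.
- by move=> z /SU Uz; rewrite -(subrKC x z); exact: dilate2_add.
- by move=> z gz; exact: csupport_in.
Qed.

End conclusion.

Theorem theorem1p2 (R : realType) (n : nat) (Omega : set 'rV[R]_n)
    (phihat : ('rV[R]_n -> R[i]) -> R[i])
    (H : ('rV[R]_n -> R[i]) -> 'rV[R]_n -> R[i]) :
  open Omega ->
  convex_set (Omega : set (convex_lmodType 'rV[R]_n)) ->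
  ~ contains_affine_line Omega ->
  distribution_on (dilate2 Omega) phihat ->
  hankel_operator Omega phihat H ->
  hilbert_schmidt Omega H ->
  exists psi : 'rV[R]_n -> R[i],
    [/\ Lp +oo%E psi,
        hankel_operator Omega (fourier_distribution psi) H &
        forall h, test_function (dilate2 Omega) h ->
          phihat h = fourier_distribution psi h].
Proof.
move=> oU /convex_setP cU nlU du hH [bH [I [e [onb HS]]]].
have [C C0 uC] := hankel_symbol_bound oU cU du hH bH onb HS nlU.
have [psi [mpsi bpsi psiE]] := bounded_symbol du C0 uC.
have E h : test_function (dilate2 Omega) h -> phihat h = fourier_distribution psi h.
  by move=> th; rewrite psiE.
exists psi; split => //; first exact: Lp_pinfty mpsi bpsi.
move=> f g fg tg; have [k Hk kE] := hH f g fg tg.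
exists k => //; apply: filterS kE => x kx Ux; rewrite kx//; apply: E; exact: test_shift.
Qed.
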